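(* Let $M$ be a smooth manifold, $\{\cdot,\cdot\}$ a nondegenerate generalized Poisson bracket on $M$ with bundle map $J=\omega^{-1}:T^*M\to TM$ ($\omega$ a nondegenerate, not necessarily closed, two-form), $\Delta\subset TM$ a smooth vector subbundle, $\mathcal D$ the Dirac structure with fibers $\mathcal D(x)=\{(v,v^* )\in T_xM\times T_x^*M\mid v-J(x)v^*\in\Delta(x),\ v^*\in\Delta^\circ(x)\}$, and $H\in C^\infty(M)$. Let $G$ be a Lie group with Lie algebra $\mathfrak g$ acting properly on $M$ such that $H$ is $G$-invariant and, for all $\xi\in\mathfrak g$, $L_{\xi_M}J=0$ and $L_{\xi_M}Z$ is a local section of $\Delta$ whenever $Z$ is. Suppose the action admits an $Ad^*$-equivariant map $P:M\to\mathfrak g^*$ with $dP_\xi=\omega(\xi_M,\cdot)$ and $dP_\xi\in\Gamma(\Delta^\circ)$ for all $\xi\in\mathfrak g$. With $V(x)=\mathrm{span}\{\xi_M(x)\mid\xi\in\mathfrak g\}$, assume that $\Delta\cap V=0$, that $V+\Delta$ is a smooth vector subbundle of $TM$, and that the regular reduction conditions listed in the context hold on each $P^{-1}(0)\cap M_{(K)}$. Let $(M_0,\mathcal D_0,H_0)$, $\mathcal D_0=(\{\cdot,\cdot\}_0,\hat\Delta)$, be the singular reduced implicit Hamiltonian system on $M_0=P^{-1}(0)/G$, and for each conjugacy class $(K)$ of compact subgroups of $G$ let $((M_0)_{(K)},\mathcal D_{(K)},H_{(K)})$ be the regular reduced implicit Hamiltonian system on the piece $(M_0)_{(K)}=(P^{-1}(0)\cap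 M_{(K)})/G$. Then: (1) $((M_0)_{(K)},\mathcal D_{(K)},H_{(K)})$ is exactly the restriction of $(M_0,\mathcal D_0,H_0)$ to the piece $(M_0)_{(K)}$; that is, $\{f_0|_{(M_0)_{(K)}},h_0|_{(M_0)_{(K)}}\}_{(K)}=\{f_0,h_0\}_0|_{(M_0)_{(K)}}$ for all $f_0,h_0\in C^\infty(M_0)$, $(\hat\Delta)_{(K)}$ is the restriction of $\hat\Delta$ to $W^\infty((M_0)_{(K)})$, and $H_{(K)}=H_0|_{(M_0)_{(K)}}$. (2) Every solution $\gamma(t)$ of $(M_0,\mathcal D_0,H_0)$ with $\gamma(0)\in(M_0)_{(K)}$ preserves the piece $(M_0)_{(K)}$ (i.e. $\gamma(t)\in(M_0)_{(K)}$ for all $t$) and restricts to a solution $\bar\gamma(t)$ of $((M_0)_{(K)},\mathcal D_{(K)},H_{(K)})$.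
   Context: All objects are smooth. A generalized Poisson bracket is a skew-symmetric bilinear bracket on $C^\infty(M)$ satisfying the Leibniz rule (Jacobi not required). Here $\{f,h\}=\omega(X_f,X_h)$ with $df=\omega(X_f,\cdot)$, and $J$ satisfies $\langle df,J\,dh\rangle=\{f,h\}$. A Dirac structure on a manifold $M$ is a vector subbundle $\mathcal D\subset TM\oplus T^*M$ equal to its own orthogonal complement under the pairing $\langle\langle(v,v^* ),(w,w^* )\rangle\rangle=\langle v^*,w\rangle+\langle w^*,v\rangle$. On a manifold, a solution of an implicit Hamiltonian system $(M,\mathcal D,H)$ is a smooth curve $x(t)$ with $(\dot x(t),dH(x(t)))\in\mathcal D(x(t))$ for all $t$. $\Delta^\circ$ is the annihilator of $\Delta$; $\xi_M$ is the infinitesimal generator of $\xi$; $P_\xi(x)=\langle P(x),\xi\rangle$; $X[f]=\langle df,X\rangle$; $\mathfrak X_{loc},\Omega^1_{loc},\Gamma_{loc}$ denote local vector fields, one-forms, sections. Write $N=P^{-1}(0)$, $\pi:N\to M_0=N/G$. Singular reduced system: a continuous $f_0$ on $M_0$ (quotient topology) is in $C^\infty(M_0)$ if $f_0\circ\pi=f|_N$ for some $f\in C^\infty(M)^G$. $\{f_0,h_0\}_0\circ\pi=\{f,h\}|_N$ for such extensions $f,h$ of $f_0,h_0$. $H_0\circ\pi=H|_N$. Since $\Delta\cap V=0$ and $V+\Delta$ is a subbundle, $\Delta$ has local bases of sections $X_1,\dots,X_m$ with $[\xi_M,X_j]=0$ for all $\xi\in\mathfrak g$; these project to derivations $\hat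 X_j$ on $C^\infty(M_0)$ given by $\hat X_j[f_0](\pi(x))=X_j[f](x)$, $x\in N$ (in the domain of $X_j$), $f\in C^\infty(M)^G$ with $f_0\circ\pi=f|_N$. $\hat\Delta$ is the vector space of derivations on $C^\infty(M_0)$ locally spanned by $\hat X_1,\dots,\hat X_m$. For a derivation $\hat X$ and $p\in M_0$, $\hat X(p)$ is the functional $f_0\mapsto\hat X[f_0](p)$, and $\hat\Delta(p)=\{\hat Z(p)\mid\hat Z\in\hat\Delta\}$. A continuous curve $\gamma(t)$ in $M_0$ is smooth if $f_0\circ\gamma$ is smooth for all $f_0\in C^\infty(M_0)$; it is an integral curve of $\hat X$ if $\frac{d}{dt}f_0(\gamma(t))=\hat X[f_0](\gamma(t))$ for all $t$ and all $f_0\in C^\infty(M_0)$. A solution of $(M_0,\mathcal D_0,H_0)$ is a smooth curve $\gamma$ for which there is a derivation $\hat X$ on $C^\infty(M_0)$ such that $\gamma$ is an integral curve of $\hat X$ and, for all $t$, $\hat X(\gamma(t))-\{\cdot,H_0\}_0(\gamma(t))\in\hat\Delta(\gamma(t))$ and $\hat Z[H_0](\gamma(t))=0$ for all $\hat Z\in\hat\Delta$. Pieces: for a compact subgroup $K\subset G$, $M_{(K)}=\{x\in M\mid G_x\text{ is conjugate to }K\}$, $G_x$ the stabilizer of $x$. $N_{(K)}=P^{-1}(0)\cap M_{(K)}$ is a submanifold of $M$, and $(M_0)_{(K)}=N_{(K)}/G=\pi(N_{(K)})\subset M_0$ is a smooth manifold with projection $\pi_{(K)}:N_{(K)}\to(M_0)_{(K)}$.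 Regular reduction conditions, for each $N'=N_{(K)}$: (i) $\mathcal D(x)\cap(T_xN'\times T_x^*M)$ has constant dimension for $x\in N'$, so that the restricted Dirac structure $\mathcal D_{N'}$ with fibers $\{(v,v^*|_{T_xN'})\mid(v,v^* )\in\mathcal D(x),\ v\in T_xN'\}$ is defined; (ii) $\ker T\pi_{(K)}+\Delta_{N'}$ is a smooth subbundle of $TN'$, where $\Delta_{N'}(x)=\{X(x)\mid(X,0)\text{ a local section of }\mathcal D_{N'}\}$, and $\mathcal D_{N'}\cap E_{N'}$ is a smooth subbundle of $TN'\oplus T^*N'$, where $E_{N'}$ is the subbundle whose local sections are the $(X,\alpha)$ with $\alpha=\pi_{(K)}^*\hat\alpha$ for some local one-form $\hat\alpha$ on $(M_0)_{(K)}$. Regular reduced system on a piece: $W^\infty((M_0)_{(K)})$ is the set of continuous functions $\bar f_0$ on $(M_0)_{(K)}$ with $\bar f_0\circ\pi_{(K)}=f|_{N_{(K)}}$ for some $f\in C^\infty(M)^G$ (equivalently the restrictions to $(M_0)_{(K)}$ of functions in $C^\infty(M_0)$); it is dense in $C^\infty((M_0)_{(K)})$. $\{\bar f_0,\bar h_0\}_{(K)}\circ\pi_{(K)}=\{f,h\}|_{N_{(K)}}$ for such $f,h$; this extends to a generalized Poisson bracket on $C^\infty((M_0)_{(K)})$ with bundle map $J_{(K)}$, $\langle d\bar f_0,J_{(K)}d\bar h_0\rangle=\{\bar f_0,\bar h_0\}_{(K)}$. The vector fields $X_j$ above are tangent to $N_{(K)}$, and their restrictions project along $\pi_{(K)}$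 to local vector fields on $(M_0)_{(K)}$ spanning the distribution $(\hat\Delta)_{(K)}$. $\mathcal D_{(K)}$ is the Dirac structure on $(M_0)_{(K)}$ with local sections the $(\hat X,\hat\alpha)\in\mathfrak X_{loc}((M_0)_{(K)})\times\Omega^1_{loc}((M_0)_{(K)})$ such that $\hat X-J_{(K)}\hat\alpha\in\Gamma_{loc}((\hat\Delta)_{(K)})$ and $\hat\alpha\in\Gamma_{loc}(((\hat\Delta)_{(K)})^\circ)$. $H_{(K)}\circ\pi_{(K)}=H|_{N_{(K)}}$. Restriction of $\hat\Delta$: the statement that $(\hat\Delta)_{(K)}$ is the restriction of $\hat\Delta$ to $W^\infty((M_0)_{(K)})$ means that the derivations $\hat X_j$ spanning $\hat\Delta$ restrict to derivations $f_0|_{(M_0)_{(K)}}\mapsto\hat X_j[f_0]|_{(M_0)_{(K)}}$ of $W^\infty((M_0)_{(K)})$, and the corresponding vector fields on $(M_0)_{(K)}$ span $(\hat\Delta)_{(K)}$. *)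

(* Defs.v *)
From HB Require Import structures.
From mathcomp Require Import all_boot all_order all_algebra.
From mathcomp Require Import all_classical all_reals all_analysis.
Import Order.TTheory GRing.Theory Num.Theory.
Import numFieldNormedType.Exports.

Set Implicit Arguments.
Unset Strict Implicit.
Unset Printing Implicit Defensive.

Local Open Scope classical_set_scope.
Local Open Scope ring_scope.

Fixpoint Ck (R : realType) (n k : nat) (U : set 'rV[R]_n) (f : 'rV[R]_n -> R)
    : Prop :=
  (forall x, U x -> {for x, continuous f}) /\
  (if k is k'.+1 then
     forall i : 'I_n,
       (forall x, U x -> derivable f x (delta_mx 0 i)) /\
       Ck k' U (fun x => 'D_(delta_mx 0 i) f x)
   else True).

Definition Cinf (R : realType) (n : nat) (U : set 'rV[R]_n)
    (f : 'rV[R]_n -> R) : Prop := forall k, Ck k U f.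

Definition Cinf1 (R : realType) (I : set R) (f : R -> R) : Prop :=
  forall (k : nat) (t : R), I t -> derivable (derive1n k f) t 1.

Record chart (R : realType) (n : nat) (T : topologicalType) := Chart {
  cdom : set T;
  cmap : T -> 'rV[R]_n;
  cinv : 'rV[R]_n -> T;
  cdom_open : open cdom;
  cimg_open : open (cmap @` cdom);
  cmapK : forall x, cdom x -> cinv (cmap x) = x;
  cmap_cont : forall x, cdom x -> {for x, continuous cmap};
  cinv_cont : forall y, (cmap @` cdom) y -> {for y, continuous cinv} }.

Record manifold (R : realType) (n : nat) := Manifold {
  mtop :> topologicalType;
  atlas : set (chart R n mtop);
  atlas_cover : forall x : mtop, exists2 c, atlas c & cdom c x;
  atlas_compat : forall c d, atlas c -> atlas d -> forall i : 'I_n,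
    Cinf (cmap c @` (cdom c `&` cdom d))
         (fun y => (cmap d (cinv c y)) 0 i);
  mhausdorff : hausdorff_space mtop;
  msecond_countable : @second_countable mtop }.

(* A space carrying a sheaf of smooth functions.  All the spaces below
   (manifolds, their submanifolds, and the quotients of the latter) are
   described this way, so that tangent vectors, vector fields and forms are
   defined once.  Points live in a type [pt] and the underlying set of the
   space is [carrier]; an open set [U] of the space is represented by any
   [U : set pt], only [U `&` carrier] being relevant, and similarly for
   functions. *)
Record fspace (R : realType) := FSpace {
  pt : Type;
  carrier : set pt;
  fopen : set pt -> Prop;
  fsmooth : set pt -> (pt -> R) -> Prop }.

Definition mspace (R : realType) (n : nat) (M : manifold R n) : fspace R :=
  {| pt := M;
     carrier := setT;
     fopen := @open M;
     fsmooth := fun U f => forall c, atlas (m := M) c ->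
       Cinf (cmap c @` (cdom c `&` U)) (f \o cinv c) |}.

Definition mprod (R : realType) (n1 n2 : nat) (M1 : manifold R n1)
    (M2 : manifold R n2) : fspace R :=
  {| pt := (M1 * M2)%type;
     carrier := setT;
     fopen := @open (M1 * M2)%type;
     fsmooth := fun U f =>
       forall c1 c2, atlas (m := M1) c1 -> atlas (m := M2) c2 ->
       Cinf [set z : 'rV[R]_(n1 + n2) | exists p : M1 * M2,
               [/\ U p, cdom c1 p.1, cdom c2 p.2 &
                   z = row_mx (cmap c1 p.1) (cmap c2 p.2)]]
            (fun z => f (cinv c1 (lsubmx z), cinv c2 (rsubmx z))) |}.

(* An embedded submanifold [S] of [M]: relative topology, and the functions
   that extend locally to smooth functions on [M]. *)
Definition subspc (R : realType) (n : nat) (M : manifold R n) (S : set M)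
    : fspace R :=
  {| pt := M;
     carrier := S;
     fopen := fun U => exists2 O : set M, open O &
       forall x, S x -> (U x <-> O x);
     fsmooth := fun U f => forall x, S x -> U x ->
       exists (O : set M) (g : M -> R),
         [/\ open O, O x, fsmooth (f := mspace M) O g &
             forall y, S y -> U y -> O y -> f y = g y] |}.

Section FSpaceTheory.
Variable R : realType.
Implicit Types X Y : fspace R.

Definition smooth_map X Y (F : pt X -> pt Y) : Prop :=
  [/\ forall x, carrier x -> carrier (F x),
      forall V, fopen V -> fopen (F @^-1` V) &
      forall V (f : pt Y -> R), fopen V -> fsmooth V f ->
        fsmooth (F @^-1` V) (f \o F)].

Definition Csm X (f : pt X -> R) : Prop := fsmooth setT f.

Definition smooth_at X (x : pt X) (f : pt X -> R) : Prop :=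
  exists U, [/\ fopen U, U x & fsmooth U f].

Definition germ_eq X (x : pt X) (f g : pt X -> R) : Prop :=
  exists U, [/\ fopen U, U x & forall y, carrier y -> U y -> f y = g y].

Definition vec X := (pt X -> R) -> R^o.
Definition covec X := vec X -> R^o.

HB.instance Definition _ X := GRing.Lmodule.on (vec X).
HB.instance Definition _ X := GRing.Lmodule.on (covec X).

(* Derivations of the germs of smooth functions at [x].  The value 0 outside
   smooth germs makes equality of tangent vectors the equality of
   functionals; likewise for covectors outside the tangent space. *)
Definition tangent X (x : pt X) (v : vec X) : Prop :=
  [/\ forall (a : R) f g, smooth_at x f -> smooth_at x g ->
        v (fun y => a * f y + g y) = a * v f + v g,
      forall f g, smooth_at x f -> smooth_at x g ->
        v (fun y => f y * g y) = f x * v g + g x * v f,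
      forall f g, smooth_at x f -> germ_eq x f g -> v f = v g &
      forall f, ~ smooth_at x f -> v f = 0].

Definition cotangent X (x : pt X) (a : covec X) : Prop :=
  (forall (r : R) v w, tangent x v -> tangent x w ->
     a (r *: v + w) = r * a v + a w) /\
  (forall v, ~ tangent x v -> a v = 0).

Definition dform X (f : pt X -> R) (x : pt X) : covec X :=
  fun v => if `[< tangent x v >] then v f else 0.

Definition Tmap X Y (F : pt X -> pt Y) (x : pt X) (v : vec X) : vec Y :=
  fun f => if `[< smooth_at (F x) f >] then v (f \o F) else 0.

Definition Tmap_dual X Y (F : pt X -> pt Y) (x : pt X) (b : covec Y)
    : covec X :=
  fun v => if `[< tangent x v >] then b (Tmap F x v) else 0.

Definition vfield X (U : set (pt X)) (Z : pt X -> vec X) : Prop :=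
  (forall x, carrier x -> U x -> tangent x (Z x)) /\
  (forall V f, fopen V -> V `<=` U -> fsmooth V f ->
     fsmooth V (fun x => Z x f)).

Definition oneform X (U : set (pt X)) (a : pt X -> covec X) : Prop :=
  (forall x, carrier x -> U x -> cotangent x (a x)) /\
  (forall V Z, fopen V -> V `<=` U -> vfield V Z ->
     fsmooth V (fun x => a x (Z x))).

Definition twoform X (om : pt X -> vec X -> vec X -> R) : Prop :=
  [/\ forall x (r : R) u v w, carrier x ->
        tangent x u -> tangent x v -> tangent x w ->
        om x (r *: u + v) w = r * om x u w + om x v w,
      forall x v w, carrier x -> tangent x v -> tangent x w ->
        om x v w = - om x w v &
      forall V Z W, fopen V -> vfield V Z -> vfield V W ->
        fsmooth V (fun x => om x (Z x) (W x))].

Definition nondeg_form X (om : pt X -> vec X -> vec X -> R) : Prop :=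
  forall x v, carrier x -> tangent x v ->
    (forall w, tangent x w -> om x v w = 0) -> v = 0.

Definition lie X (Z W : pt X -> vec X) : pt X -> vec X := fun x f =>
  if `[< smooth_at x f >]
  then Z x (fun y => W y f) - W x (fun y => Z y f) else 0.

(* [b = L_Z a] on [U], through [(L_Z a)(W) = Z[a(W)] - a([Z, W])]. *)
Definition is_lie_form X (U : set (pt X)) (Z : pt X -> vec X)
    (a b : pt X -> covec X) : Prop :=
  oneform U b /\
  forall V W, fopen V -> V `<=` U -> vfield V W ->
    forall x, carrier x -> V x ->
      b x (W x) = Z x (fun y => a y (W y)) - a x (lie Z W x).

(* [L_Z J = 0], i.e. [L_Z (J a) = J (L_Z a)] for all local one-forms [a]. *)
Definition lie_bundle_map_eq0 X (Z : pt X -> vec X)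
    (J : pt X -> covec X -> vec X) : Prop :=
  forall U a b, fopen U -> oneform U a -> is_lie_form U Z a b ->
    forall x, carrier x -> U x -> lie Z (fun y => J y (a y)) x = J x (b x).

(* [b] is a basis of the subspace [W]. *)
Definition lbasis (L : lmodType R) (W : set L) (m : nat) (b : 'I_m -> L)
    : Prop :=
  (forall w, W w <-> exists c : 'I_m -> R, w = \sum_i c i *: b i) /\
  (forall c : 'I_m -> R, \sum_i c i *: b i = 0 -> forall i, c i = 0).

Definition subbundle X (D : pt X -> set (vec X)) : Prop :=
  forall x, carrier x -> exists U m (Z : 'I_m -> pt X -> vec X),
    [/\ fopen U, U x, forall j, vfield U (Z j) &
        forall y, carrier y -> U y -> lbasis (D y) (fun j => Z j y)].

Definition subbundle2 X (D : pt X -> set (vec X * covec X)) : Prop :=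
  forall x, carrier x -> exists U m (Z : 'I_m -> pt X -> vec X)
                                (a : 'I_m -> pt X -> covec X),
    [/\ fopen U, U x, forall j, vfield U (Z j), forall j, oneform U (a j) &
        forall y, carrier y -> U y -> lbasis (D y) (fun j => (Z j y, a j y))].

Definition vsum X (D E : pt X -> set (vec X)) (x : pt X) : set (vec X) :=
  [set v | exists v1 v2, [/\ D x v1, E x v2 & v = v1 + v2]].

Definition annihilator X (D : set (vec X)) (a : covec X) : Prop :=
  forall w, D w -> a w = 0.

(* Generalized Poisson bracket: the Jacobi identity is not required. *)
Definition gen_poisson X (br : (pt X -> R) -> (pt X -> R) -> pt X -> R)
    : Prop :=
  [/\ forall f h, Csm f -> Csm h -> Csm (br f h),
      forall f h, Csm f -> Csm h -> forall x, carrier x ->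
        br f h x = - br h f x,
      forall (r : R) f g h, Csm f -> Csm g -> Csm h -> forall x, carrier x ->
        br (fun y => r * f y + g y) h x = r * br f h x + br g h x,
      forall f g h, Csm f -> Csm g -> Csm h -> forall x, carrier x ->
        br (fun y => f y * g y) h x = f x * br g h x + g x * br f h x &
      forall f g h, Csm f -> Csm g -> Csm h ->
        (forall x, carrier x -> f x = g x) ->
        forall x, carrier x -> br f h x = br g h x].

Definition bundle_map X (br : (pt X -> R) -> (pt X -> R) -> pt X -> R)
    (J : pt X -> covec X -> vec X) : Prop :=
  forall x, carrier x ->
    [/\ forall a, cotangent x a -> tangent x (J x a),
        forall (r : R) a b, cotangent x a -> cotangent x b ->
          J x (r *: a + b) = r *: J x a + J x b &
        forall f h, Csm f -> Csm h ->
          dform f x (J x (dform h x)) = br f h x].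

Definition dirac_fiber X (J : pt X -> covec X -> vec X)
    (D : pt X -> set (vec X)) (x : pt X) : set (vec X * covec X) :=
  [set p | [/\ tangent x p.1, cotangent x p.2, D x (p.1 - J x p.2) &
               annihilator (D x) p.2]].

(* Values at [x] of the local sections [(Z, a)] with [Z - J a] a section of
   [D] and [a] a section of its annihilator. *)
Definition dirac_sections X (J : pt X -> covec X -> vec X)
    (D : pt X -> set (vec X)) (x : pt X) : set (vec X * covec X) :=
  [set p | exists U Z a,
     [/\ fopen U, U x, vfield U Z, oneform U a &
         (forall y, carrier y -> U y ->
            D y (Z y - J y (a y)) /\ annihilator (D y) (a y)) /\
         p = (Z x, a x)]].

Definition fcontinuous_curve X (I : set R) (g : R -> pt X) : Prop :=
  (forall t, I t -> carrier (g t)) /\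
  (forall V, fopen V -> open (I `&` g @^-1` V)).

Definition velocity X (g : R -> pt X) (t : R) : vec X :=
  fun f => if `[< smooth_at (g t) f >] then derive1 (f \o g) t else 0.

Definition solution X (D : pt X -> set (vec X * covec X)) (H : pt X -> R)
    (I : set R) (g : R -> pt X) : Prop :=
  [/\ fcontinuous_curve I g,
      forall V f, fopen V -> fsmooth V f ->
        Cinf1 (I `&` g @^-1` V) (f \o g) &
      forall t, I t -> D (g t) (velocity g t, dform H (g t))].

End FSpaceTheory.

Record lieGroup (R : realType) (k : nat) := LieGroup {
  lman :> manifold R k;
  lone : lman;
  lmul : lman -> lman -> lman;
  linv : lman -> lman;
  lmulA : forall a b c, lmul a (lmul b c) = lmul (lmul a b) c;
  lmul1 : forall a, lmul lone a = a;
  lmulV : forall a, lmul (linv a) a = lone;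
  lmul_smooth : smooth_map (X := mprod lman lman) (Y := mspace lman)
    (fun p => lmul p.1 p.2);
  linv_smooth : smooth_map (X := mspace lman) (Y := mspace lman) linv }.

Record lieAction (R : realType) (k n : nat) (G : lieGroup R k)
    (M : manifold R n) := LieAction {
  act :> G -> M -> M;
  act1 : forall x, act (lone G) x = x;
  actM : forall a b x, act (lmul a b) x = act a (act b x);
  act_smooth : smooth_map (X := mprod G M) (Y := mspace M)
    (fun p => act p.1 p.2) }.

Section Reduction.
Variables (R : realType) (k n : nat) (G : lieGroup R k) (M : manifold R n).
Variable A : lieAction G M.
Implicit Types (x : M) (S : set M) (K : set G).

Local Notation GG := (mspace G).
Local Notation MM := (mspace M).

Definition proper_action : Prop :=
  forall C : set (M * M), compact C ->
    compact [set p : G * M | C (A p.1 p.2, p.2)].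

(* The Lie algebra is the tangent space at the unit. *)
Definition lie_alg : set (vec GG) := tangent (X := GG) (lone G).

(* [xi_M(x) = d/dt|_0 exp(t xi) . x], i.e. the image of [xi] under the
   tangent map at the unit of [g |-> g . x]. *)
Definition infgen (xi : vec GG) (x : M) : vec MM :=
  Tmap (X := GG) (Y := MM) (fun g => A g x) (lone G) xi.

Definition Ad (g : G) (xi : vec GG) : vec GG :=
  Tmap (X := GG) (Y := GG) (fun h => lmul (lmul g h) (linv g)) (lone G) xi.

Definition ginvariant (f : M -> R) : Prop := forall g x, f (A g x) = f x.

(* Here [P x] is an element of the dual of the Lie algebra, i.e. a covector
   at the unit, and [Ad^*_(g^-1)] is the transpose of [Ad_(g^-1)]. *)
Definition equivariant_map (P : M -> covec GG) : Prop :=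
  [/\ forall x, cotangent (X := GG) (lone G) (P x),
      forall xi, lie_alg xi -> Csm (X := MM) (fun x => P x xi) &
      forall g x xi, lie_alg xi -> P (A g x) xi = P x (Ad (linv g) xi)].

Definition zero_level (P : M -> covec GG) : set M := [set x | P x = 0].

Definition orbit_dir (x : M) : set (vec MM) :=
  [set infgen xi x | xi in lie_alg].

Definition compact_subgroup K : Prop :=
  [/\ compact K, K (lone G), forall a b, K a -> K b -> K (lmul a b) &
      forall a, K a -> K (linv a)].

Definition orbit_type K : set M :=
  [set x | exists g, [set h | A h x = x] =
                     [set lmul (lmul g h) (linv g) | h in K]].

Definition gorbit (x : M) : set M := [set A g x | g in setT].

(* The points of [S / G] are the orbits of the points of the invariant set
   [S]; it carries the quotient topology of [S].  The sheaf of functions is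
   that of the quotient manifold when [S] is a submanifold and [S / G] a
   manifold with submersion [gorbit]. *)
Definition qspace S : fspace R :=
  {| pt := set M;
     carrier := gorbit @` S;
     fopen := fun V => fopen (f := subspc S) (gorbit @^-1` V);
     fsmooth := fun V f =>
       fsmooth (f := subspc S) (gorbit @^-1` V) (f \o gorbit) |}.

(* [f] is a smooth invariant extension of [f0 \o pi]. *)
Definition extends S (f : M -> R) (f0 : set M -> R) : Prop :=
  [/\ Csm (X := MM) f, ginvariant f & forall x, S x -> f0 (gorbit x) = f x].

(* [C^oo(M_0)] for [S = P^-1(0)], and [W^oo((M_0)_(K))] for
   [S = P^-1(0) `&` M_(K)]. *)
Definition qfun S (f0 : set M -> R) : Prop :=
  (forall O : set R, open O -> fopen (f := qspace S) (f0 @^-1` O)) /\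
  (exists f, extends S f f0).

Definition qfun_loc S (V : set (set M)) (h : set M -> R) : Prop :=
  forall p, carrier (f := qspace S) p -> V p ->
    exists W h1, [/\ fopen (f := qspace S) W, W p, qfun S h1 &
      forall q, carrier (f := qspace S) q -> W q -> V q -> h q = h1 q].

(* A derivation of the algebra [qfun S], defined over the part [V] of [S / G]
   and with values in functions satisfying [B]. *)
Definition qderivation_on S (V : set (set M)) (B : (set M -> R) -> Prop)
    (D : (set M -> R) -> set M -> R) : Prop :=
  [/\ forall f, qfun S f -> B (D f),
      forall (r : R) f g, qfun S f -> qfun S g ->
        forall p, carrier (f := qspace S) p -> V p ->
        D (fun q => r * f q + g q) p = r * D f p + D g p,
      forall f g, qfun S f -> qfun S g ->
        forall p, carrier (f := qspace S) p -> V p ->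
        D (fun q => f q * g q) p = f p * D g p + g p * D f p &
      forall f g, qfun S f -> qfun S g ->
        (forall p, carrier (f := qspace S) p -> f p = g p) ->
        forall p, carrier (f := qspace S) p -> V p -> D f p = D g p].

Definition qderivation S := qderivation_on S setT (qfun S).
Definition qderivation_loc S V := qderivation_on S V (qfun_loc S V).

Section Systems.
Variables (br : (M -> R) -> (M -> R) -> M -> R).
Variables (J : M -> covec MM -> vec MM) (Delta : M -> set (vec MM)).
Variables (H : M -> R) (P : M -> covec GG).

Local Notation N := (zero_level P).

Definition piece K : set M := N `&` orbit_type K.
Definition Qpiece K : fspace R := qspace (piece K).

(* A local basis [Z_1, ..., Z_m] of sections of [Delta] over [U], commuting
   with the infinitesimal generators, together with the derivations
   [Zh_1, ..., Zh_m] on [M_0] (over the image of [U]) it projects to.  That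
   it does project is part of the definition: commuting with the generators
   by itself gives invariance along connected pieces of orbits only. *)
Definition proj_frame (U : set M) (m : nat) (Z : 'I_m -> M -> vec MM)
    (Zh : 'I_m -> (set M -> R) -> set M -> R) : Prop :=
  [/\ open U,
      forall j, vfield (X := MM) U (Z j),
      forall x, U x -> lbasis (Delta x) (fun j => Z j x),
      forall j xi x, lie_alg xi -> U x ->
        lie (X := MM) (infgen xi) (Z j) x = 0 &
      forall j, qderivation_loc N (gorbit @` (N `&` U)) (Zh j) /\
        forall f f0, qfun N f0 -> extends N f f0 ->
          forall x, N x -> U x -> Zh j f0 (gorbit x) = Z j x f].

(* The derivations of [C^oo(M_0)] that are locally combinations of
   [Zh_1, ..., Zh_m] with coefficients in [C^oo(M_0)]. *)
Definition Delta_hat (D : (set M -> R) -> set M -> R) : Prop :=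
  qderivation N D /\
  forall p, carrier (f := qspace N) p ->
    exists U m Z Zh (c : 'I_m -> set M -> R),
      [/\ proj_frame U Z Zh, (gorbit @` (N `&` U)) p,
          forall j, qfun_loc N (gorbit @` (N `&` U)) (c j) &
          forall f0, qfun N f0 -> forall q, (gorbit @` (N `&` U)) q ->
            D f0 q = \sum_j c j q * Zh j f0 q].

Definition singular_reduced (B0 : (set M -> R) -> (set M -> R) -> set M -> R)
    (H0 : set M -> R) : Prop :=
  [/\ forall f0 h0, qfun N f0 -> qfun N h0 -> qfun N (B0 f0 h0),
      forall f0 h0 f h, qfun N f0 -> qfun N h0 ->
        extends N f f0 -> extends N h h0 ->
        forall x, N x -> B0 f0 h0 (gorbit x) = br f h x,
      qfun N H0 &
      forall x, N x -> H0 (gorbit x) = H x].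

Definition singular_solution
    (B0 : (set M -> R) -> (set M -> R) -> set M -> R) (H0 : set M -> R)
    (I : set R) (g : R -> set M) : Prop :=
  [/\ fcontinuous_curve (X := qspace N) I g,
      forall f0, qfun N f0 -> Cinf1 I (f0 \o g) &
      exists2 D, qderivation N D & forall t, I t ->
        [/\ forall f0, qfun N f0 -> derive1 (f0 \o g) t = D f0 (g t),
            exists2 E, Delta_hat E & forall f0, qfun N f0 ->
              D f0 (g t) - B0 f0 H0 (g t) = E f0 (g t) &
            forall E, Delta_hat E -> E H0 (g t) = 0]].

(* The tangent space of the submanifold [S], inside that of [M]. *)
Definition Tincl S (x : M) (v : vec (subspc S)) : vec MM :=
  Tmap (X := subspc S) (Y := MM) id x v.

Definition Tsub S (x : M) : set (vec MM) :=
  [set Tincl x v | v in tangent (X := subspc S) x].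

(* The restricted Dirac structure of [S]. *)
Definition D_restr S (x : M)
    : set (vec (subspc S) * covec (subspc S)) :=
  [set p | tangent (X := subspc S) x p.1 /\
     exists2 b : covec MM,
       dirac_fiber (X := MM) J Delta x (Tincl x p.1, b) &
       p.2 = Tmap_dual (X := subspc S) (Y := MM) id x b].

Definition Delta_restr S (x : M) : set (vec (subspc S)) :=
  [set v | exists U Z,
     [/\ fopen (f := subspc S) U, U x, vfield (X := subspc S) U Z,
         forall y, S y -> U y -> D_restr (S := S) y (Z y, 0) & v = Z x]].

Definition ker_Tpi S (x : M) : set (vec (subspc S)) :=
  [set v | tangent (X := subspc S) x v /\
           Tmap (X := subspc S) (Y := qspace S) gorbit x v = 0].

Definition E_restr S (x : M) : set (vec (subspc S) * covec (subspc S)) :=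
  [set p | tangent (X := subspc S) x p.1 /\
     exists2 b : covec (qspace S), cotangent (X := qspace S) (gorbit x) b &
       p.2 = Tmap_dual (X := subspc S) (Y := qspace S) gorbit x b].

Definition regular_conditions S : Prop :=
  [/\ exists d, forall x, S x -> exists b : 'I_d -> vec MM * covec MM,
        lbasis [set p | dirac_fiber (X := MM) J Delta x p /\ Tsub S x p.1] b,
      subbundle (X := subspc S) (vsum (X := subspc S) (@ker_Tpi S) (@Delta_restr S)) &
      subbundle2 (X := subspc S)
        (fun x => D_restr (S := S) x `&` E_restr (S := S) x)].

(* Each of [BK], [JK], [DK] and [HK] is determined on [(M_0)_(K)] by its
   defining property; [DK] is spanned by the projections along [gorbit] of the
   restrictions to the piece of the fields of a [proj_frame]. *)
Definition regular_reduced K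
    (BK : (set M -> R) -> (set M -> R) -> set M -> R)
    (JK : set M -> covec (Qpiece K) -> vec (Qpiece K))
    (DK : set M -> set (vec (Qpiece K))) (HK : set M -> R) : Prop :=
  [/\ gen_poisson (X := Qpiece K) BK /\
      (forall f0 h0 f h, qfun (piece K) f0 -> qfun (piece K) h0 ->
         extends (piece K) f f0 -> extends (piece K) h h0 ->
         forall x, piece K x -> BK f0 h0 (gorbit x) = br f h x),
      bundle_map (X := Qpiece K) BK JK,
      forall U m Z Zh, proj_frame U (m := m) Z Zh ->
        exists Zb : 'I_m -> set M -> vec (Qpiece K),
        [/\ forall j, vfield (X := Qpiece K) (gorbit @` (piece K `&` U)) (Zb j),
            forall j x, piece K x -> U x ->
              exists v, [/\ tangent (X := subspc (piece K)) x v,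
                Tincl x v = Z j x &
                Tmap (X := subspc (piece K)) (Y := Qpiece K) gorbit x v
                  = Zb j (gorbit x)] &
            forall p, (gorbit @` (piece K `&` U)) p -> forall v,
              DK p v <-> exists c : 'I_m -> R, v = \sum_j c j *: Zb j p] &
      forall x, piece K x -> HK (gorbit x) = H x].

Definition Delta_hat_restricts K (DK : set M -> set (vec (Qpiece K)))
    : Prop :=
  forall U m Z Zh, proj_frame U (m := m) Z Zh ->
  exists (Db : 'I_m -> (set M -> R) -> set M -> R)
         (Zb : 'I_m -> set M -> vec (Qpiece K)),
    let V := gorbit @` (piece K `&` U) in
    [/\ forall j, qderivation_loc (piece K) V (Db j),
        forall j f0, qfun N f0 -> forall p, V p -> Db j f0 p = Zh j f0 p,
        forall j, vfield (X := Qpiece K) V (Zb j),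
        forall j f0, qfun (piece K) f0 -> forall p, V p ->
          Zb j p f0 = Db j f0 p &
        forall p, V p -> forall v,
          DK p v <-> exists c : 'I_m -> R, v = \sum_j c j *: Zb j p].

End Systems.
End Reduction.

Arguments lie_alg {R k} G _.

(* Main.v *)
Require Import Defs.
From HB Require Import structures.
From mathcomp Require Import all_boot all_order all_algebra.
From mathcomp Require Import all_classical all_reals all_analysis.
From mathcomp Require Import ring lra.
Import Order.TTheory GRing.Theory Num.Theory.
Import numFieldNormedType.Exports.
Local Open Scope classical_set_scope.
Local Open Scope ring_scope.

(* Part (1) holds because restricting an invariant extension from [N = P^-1(0)]
   to a piece does not change it.

   For part (2), fix [x] in [N] with stabilizer [K]. Averaging over [K] and
   over [G] (Haar integrals) gives a local slice at [x] with [K]-linear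
   coordinates, and an invariant smooth function [phi] which on the slice is a
   positive definite quadratic form of the coordinates [w] complementary to the
   [K]-fixed directions. Near [x] the zeros of [phi] in [N] lie in the piece of
   [x]. An invariant function that vanishes at these zeros is [O(phi)] on [N]:
   its first-order term in [w] vanishes by [K]-invariance, and the zeros of [P]
   fixed by [K] form a manifold, of which every point of the slice in [N] is
   within [O(|w|^2)] once [w] is removed.

   The fields [Z_j] of a local frame of [Delta] are independent at [x] against
   the invariant functions. Indeed, a combination killing all of them kills [w],
   by evaluating [Z phi], hence is tangent to the orbit and vanishes by
   [Delta `&` V = 0]. So the coefficients along a solution are bounded and
   [u = phi o gamma] satisfies [|u'| <= C u]; it vanishes near each of its
   zeros, so the set of times at which the orbit type is [(K)] is open and
   closed. Independence also lets us correct [dH_(K)] by differentials of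
   invariants to a one-form annihilating [Delta_(K)] near a point where
   [dH_(K)] does. *)

Set Implicit Arguments.
Unset Strict Implicit.
Unset Printing Implicit Defensive.

(** The curve in [M_0] comes with no lift to [M], and the coefficients of its [Delta] part are
    arbitrary functions of time. Preservation of the pieces is therefore not read off an equivariant
    flow but from a scalar differential inequality all of whose terms are values of invariant
    functions. The inequality needs a bound linear in [phi], while mere vanishing at the zeros of
    [phi] on [N] bounds an invariant by a square root of [phi] only; this is why invariance under
    [K] and the momentum map are expanded to second order. For the restricted solution, the
    condition on [H_0] holds along the curve only, whereas [dirac_sections] asks for one-forms on an
    open set; this is why the differential has to be corrected off the curve. Smoothness is defined
    by iterated directional derivatives in charts, and tangent vectors are derivations of germs; the
    implicit function theorem, differentiation under an integral, Hadamard's lemma and the Haar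
    integral are developed for these definitions. *)

Lemma near_normP (R : realType) (V : normedModType R) (x : V) (P : set V) :
  nbhs x P <-> exists2 d, 0 < d & forall y, `|y - x| < d -> P y.
Proof.
rewrite -nbhs_ballE; split=> -[d d0 h]; exists d => // y.
  by move=> yx; apply: h; rewrite -ball_normE /ball_/= distrC.
by rewrite -ball_normE /ball_/= distrC; exact: h.
Qed.

Lemma cont_normP (R : realType) (V W : normedModType R) (f : V -> W) x :
  {for x, continuous f} <->
  forall e, 0 < e -> exists2 d, 0 < d & forall y, `|y - x| < d -> `|f y - f x| < e.
Proof.
split=> [/cvgrPdist_lt cf e e0|h].
  have /near_normP[d d0 hd] := cf e e0.
  by exists d => // y /hd; rewrite distrC.
apply/cvgrPdist_lt => e e0; apply/near_normP; have [d d0 hd] := h e e0.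
by exists d => // y /hd; rewrite distrC.
Qed.

(** * Implicit functions *)

Section Calculus.
Variable R : realType.

Definition pd n (i : 'I_n) (f : 'rV[R]_n -> R) : 'rV[R]_n -> R :=
  'D_(delta_mx 0 i) f.

Definition grad n (f : 'rV[R]_n -> R) (x : 'rV[R]_n) : 'cV[R]_n :=
  \col_i pd i f x.

(** Strict differentiability: both points move. A C^1 function has it, and unlike plain
    differentiability it gives Lipschitz and contraction estimates on a whole ball around [x]. *)
Definition sdiff n (f : 'rV[R]_n -> R) (x : 'rV[R]_n) (A : 'cV[R]_n) : Prop :=
  forall e, 0 < e -> exists2 d : R, 0 < d & forall u v : 'rV[R]_n, `|u - x| < d ->
    `|v - x| < d -> `|f u - f v - ((u - v) *m A) 0 0| <= e * `|u - v|.

Definition crd (T : Type) m (F : T -> 'rV[R]_m) (j : 'I_m) : T -> R :=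
  fun x => F x 0 j.

Definition sdiffv n m (F : 'rV[R]_n -> 'rV[R]_m) x (A : 'M[R]_(n, m)) :=
  forall j, sdiff (crd F j) x (col j A).

Lemma ler_coord n (u : 'rV[R]_n) i : `|u 0 i| <= `|u|.
Proof.
rewrite [leRHS]/Num.Def.normr/= mx_normrE.
exact: (le_bigmax _ (fun p : 'I_1 * 'I_n => `|u p.1 p.2|) (0, i)).
Qed.

Lemma rV_norm_le n (u : 'rV[R]_n) (c : R) :
  0 <= c -> (forall i, `|u 0 i| <= c) -> `|u| <= c.
Proof.
move=> c0 h; rewrite [leLHS]/Num.Def.normr/= mx_normrE.
by apply: bigmax_le => //= -[i j] _ /=; rewrite ord1.
Qed.

Lemma rV_norm_lt n (u : 'rV[R]_n) (c : R) :
  0 < c -> (forall i, `|u 0 i| < c) -> `|u| < c.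
Proof.
move=> c0 h; rewrite [ltLHS]/Num.Def.normr/= mx_normrE.
by apply: bigmax_lt => //= -[i j] _ /=; rewrite ord1.
Qed.

Lemma mulmx_bound n m (A : 'M[R]_(n, m)) :
  exists2 c, 0 < c & forall u : 'rV[R]_n, `|u *m A| <= c * `|u|.
Proof.
exists (1 + \sum_i \sum_j `|A i j|) => [|u].
  by rewrite ltr_pwDl// sumr_ge0// => i _; rewrite sumr_ge0.
apply: rV_norm_le => [|j].
  by rewrite mulr_ge0// addr_ge0// sumr_ge0// => i _; rewrite sumr_ge0.
rewrite mxE (le_trans (ler_norm_sum _ _ _))//.
rewrite mulrDl mul1r ler_wpDl// mulr_suml ler_sum// => i _.
rewrite normrM mulrC ler_pM ?ler_coord//.
by rewrite (bigD1 j)//= lerDl sumr_ge0.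
Qed.

Lemma is_derive_sdiff n (f : 'rV[R]_n -> R) x A v :
  sdiff f x A -> is_derive x v f ((v *m A) 0 0).
Proof.
move=> sf.
have H : (fun t : R => t^-1 *: (f (t *: v + x) - f x)) @ 0^' --> (v *m A) 0 0.
  apply/cvgrPdist_le => e e0.
  have e'0 : 0 < e / (1 + `|v|) by rewrite divr_gt0// ltr_pwDl.
  have [d d0 h] := sf _ e'0.
  near=> t.
  have t0 : t != 0 by near: t; exact: nbhs_dnbhs_neq.
  have tv : `|t *: v + x - x| < d.
    rewrite addrK normrZ.
    have : `|t| * (1 + `|v|) < d.
      rewrite -ltr_pdivlMr ?ltr_pwDl//.
      near: t; apply: dnbhs0_lt; rewrite divr_gt0// ltr_pwDl//.
    by apply: le_lt_trans; rewrite ler_wpM2l// lerDr.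
  have := h _ x tv; rewrite subrr normr0 => /(_ d0).
  rewrite addrK -scalemxAl mxE => hh.
  rewrite -[_ *: _]/(t^-1 * _).
  have -> : (v *m A) 0 0 - t^-1 * (f (t *: v + x) - f x) =
      - (t^-1 * (f (t *: v + x) - f x - t * (v *m A) 0 0)) by field.
  rewrite normrN normrM normfV.
  rewrite ler_pdivrMl ?normr_gt0//; apply: le_trans hh _.
  rewrite normrZ mulrCA ler_wpM2l// mulrAC ler_pdivrMr ?ltr_pwDl//.
  by apply: ler_wpM2l; [exact: ltW|rewrite lerDr].
apply: DeriveDef; last exact/cvg_lim.
by apply/cvg_ex; exists ((v *m A) 0 0).
Unshelve. all: by end_near. Qed.

(** [Ck] takes its derivatives in the ambient space and quantifies over the points of [U], so it is
    a condition at each point; smoothness can thus be checked and glued pointwise. *)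
Lemma Ck_pt n k (U : set 'rV[R]_n) f :
  Ck k U f <-> forall x, U x -> Ck k [set x] f.
Proof.
elim: k f => [|k IH] f /=.
  by split=> [[h _] x Ux|h]; split=> // y; [move=> ->; exact: h|move=> /h[+ _]; exact].
split=> [[h1 h2] x Ux|h].
  split=> [y ->|i]; first exact: h1.
  have [h3 /IH h4] := h2 i.
  by split=> [y ->|]; [exact: h3|exact: h4].
split=> [x /h[+ _]|i]; first exact.
split=> [x /h[_ /(_ i)[+ _]]|]; first exact.
by apply/IH => x /h[_ /(_ i)[]].
Qed.

Lemma CkS n k (U : set 'rV[R]_n) f : Ck k.+1 U f -> Ck k U f.
Proof.
elim: k f => [|k IH] f [h1 h2]; split=> //= i.
by have [h3 h4] := h2 i; split=> //; exact: IH.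
Qed.

Lemma Ck_le n k l (U : set 'rV[R]_n) f : (k <= l)%N -> Ck l U f -> Ck k U f.
Proof.
move=> /subnK <-; elim: (l - k)%N => [|m IH]; first by rewrite add0n.
by rewrite addSn => /CkS.
Qed.

Lemma Ck_sub n k (U V : set 'rV[R]_n) f : V `<=` U -> Ck k U f -> Ck k V f.
Proof. by move=> VU /Ck_pt h; apply/Ck_pt => x /VU; exact: h. Qed.

Lemma near_eq_cont (T S : topologicalType) (f g : T -> S) x :
  {near x, f =1 g} -> {for x, continuous f} -> {for x, continuous g}.
Proof.
move=> fg cf; rewrite /prop_for /continuous_at -(nbhs_singleton fg).
by apply: cvg_trans cf; apply: near_eq_cvg.
Qed.

Lemma Ck_near n k (U : set 'rV[R]_n) f g :
  (forall x, U x -> {near x, f =1 g}) -> Ck k U f -> Ck k U g.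
Proof.
elim: k f g => [|k IH] f g fg [h1 h2].
  by split=> // x Ux; exact: near_eq_cont (fg x Ux) (h1 x Ux).
split=> [x Ux|i]; first exact: near_eq_cont (fg x Ux) (h1 x Ux).
have [h3 h4] := h2 i; split=> [x Ux|].
  exact: near_eq_derivable (fg x Ux) (h3 x Ux).
apply: IH h4 => x Ux.
near=> y; apply: near_eq_derive.
by near: y; exact: (nbhs_interior (fg x Ux)).
Unshelve. all: by end_near. Qed.

Lemma Ck_ext n k (U : set 'rV[R]_n) f g :
  open U -> (forall x, U x -> f x = g x) -> Ck k U f -> Ck k U g.
Proof.
move=> oU fg; apply: Ck_near => x Ux.
by near do apply: fg; exact: open_nbhs_nbhs.
Unshelve. all: by end_near. Qed.

Lemma Ck_cst n k (U : set 'rV[R]_n) (c : R) : Ck k U (fun=> c).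
Proof.
elim: k c => [|k IH] c; split=> //; first by move=> x _; exact: cst_continuous.
  by move=> x _; exact: cst_continuous.
move=> i; split=> [x _|]; first exact: derivable_cst.
have -> : (fun x => 'D_(delta_mx 0 i) (fun=> c : R) x) = (fun=> 0 : R).
  by move=> m; apply/funext => x; exact: derive_cst.
exact: IH.
Qed.

Lemma derive_coord n (i j : 'I_n) (x : 'rV[R]_n) v :
  is_derive x v (fun y : 'rV[R]_n => y 0 i) (v 0 i).
Proof.
have -> : v 0 i = (v *m (delta_mx i 0 : 'cV_n)) 0 0.
  rewrite mxE (bigD1 i)//= mxE !eqxx mulr1 big1 ?addr0// => l li.
  by rewrite mxE (negbTE li) mulr0.
apply: is_derive_sdiff => e e0; exists 1 => // u w _ _.
rewrite mxE (bigD1 i)//= !mxE !eqxx mulr1 big1 ?addr0 => [|l li].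
  by rewrite subrr normr0 mulr_ge0// ltW.
by rewrite !mxE (negbTE li) mulr0.
Qed.

Lemma Ck_coord n k (U : set 'rV[R]_n) i : Ck k U (fun y => y 0 i).
Proof.
have H : forall x, {for x, continuous (fun y : 'rV[R]_n => y 0 i)}.
  by move=> x; exact: coord_continuous.
case: k => [|k]; split=> // j; split=> [x _|].
  by have [] := derive_coord i i x (delta_mx 0 j).
have -> : (fun x : 'rV[R]_n => 'D_(delta_mx 0 j) (fun y : 'rV[R]_n => y 0 i) x)
     = (fun=> (delta_mx 0 j : 'rV[R]_n) 0 i).
  by apply/funext => x; have [_ ->] := derive_coord i i x (delta_mx 0 j).
exact: Ck_cst.
Qed.

Lemma CkD n k (U : set 'rV[R]_n) f g : open U ->
  Ck k U f -> Ck k U g -> Ck k U (fun x => f x + g x).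
Proof.
move=> oU; elim: k f g => [|k IH] f g [f1 f2] [g1 g2]; split=> //.
  by move=> x Ux; apply: continuousD; [exact: f1|exact: g1].
  by move=> x Ux; apply: continuousD; [exact: f1|exact: g1].
move=> i; have [f3 f4] := f2 i; have [g3 g4] := g2 i; split=> [x Ux|].
  by apply: derivableD; [exact: f3|exact: g3].
apply: Ck_ext (IH _ _ f4 g4) => // x Ux.
by rewrite -deriveD//; [exact: f3|exact: g3].
Qed.

Lemma CkM n k (U : set 'rV[R]_n) f g : open U ->
  Ck k U f -> Ck k U g -> Ck k U (fun x => f x * g x).
Proof.
move=> oU; elim: k f g => [|k IH] f g fU gU.
  split=> // x Ux; apply: continuousM; [exact: fU.1|exact: gU.1].
split.
  move=> x Ux; apply: continuousM; [exact: fU.1|exact: gU.1].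
move=> i; have [f3 f4] := fU.2 i; have [g3 g4] := gU.2 i; split=> [x Ux|].
  by apply: derivableM; [exact: f3|exact: g3].
have := CkD oU (IH _ _ (CkS fU) g4) (IH _ _ (CkS gU) f4).
apply: Ck_ext => // x Ux.
by rewrite -[LHS]deriveM//; [exact: f3|exact: g3].
Qed.

Lemma Ck_sum n k (U : set 'rV[R]_n) (I : Type) (r : seq I) (P : pred I) f :
  open U -> (forall i, P i -> Ck k U (f i)) ->
  Ck k U (fun x => \sum_(i <- r | P i) f i x).
Proof.
move=> oU h; elim: r => [|i r IH].
  by under eq_fun do rewrite big_nil; exact: Ck_cst.
under eq_fun do rewrite big_cons.
by have [Pi|nPi] := boolP (P i) => //; apply: CkD => //; exact: h.
Qed.

Lemma is_derive_line n (f : 'rV[R]_n -> R) x v (t : R) :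
  derivable f (x + t *: v) v ->
  is_derive t 1 (fun s : R => f (x + s *: v)) ('D_v f (x + t *: v)).
Proof.
move=> h.
have E : (fun s : R => s^-1 *: (f (x + (s *: (1 : R) + t) *: v) - f (x + t *: v))) =
  (fun s => s^-1 *: (f (s *: v + (x + t *: v)) - f (x + t *: v))).
  apply/funext => s; congr (_ *: (f _ - _)).
  by rewrite -[s *: 1]/(s * 1) mulr1 scalerDl addrCA.
by apply: DeriveDef; rewrite /derivable /derive /= E.
Qed.

(** The endpoints come in either order because they are coordinates of two arbitrary points, or 0
    and an increment of unknown sign. *)
Lemma MVT_unordered (g dg : R -> R) (a b : R) :
  (forall c : R, Num.min a b <= c <= Num.max a b -> is_derive c 1 g (dg c)) ->
  exists2 c, Num.min a b <= c <= Num.max a b & g b - g a = dg c * (b - a).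
Proof.
have H (a' b' : R) : a' <= b' -> (forall c : R, a' <= c <= b' -> is_derive c 1 g (dg c)) ->
  exists2 c, a' <= c <= b' & g b' - g a' = dg c * (b' - a').
  move=> ab h.
  have [||c] := @MVT_segment _ g dg a' b' ab.
  - by move=> y; rewrite in_itv/= => /andP[y1 y2]; apply: h; rewrite !ltW.
  - apply: derivable_within_continuous => y; rewrite in_itv/= => /h [] //.
  by rewrite in_itv/=; exists c.
have [ab|ba] := leP a b; first exact: H.
move=> h; have [c cab E] := H b a (ltW ba) h; exists c => //.
by rewrite -opprB E -mulrN opprB.
Qed.

Lemma C1_sdiff n (U : set 'rV[R]_n) f x :
  open U -> U x -> Ck 1 U f -> sdiff f x (grad f x).
Proof.
move=> oU Ux [_ h2] e e0.
(* The error is shared among the [n] coordinates; [n.+1] keeps the quotient meaningful for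
   [n = 0]. *)
pose e' := e / n.+1%:R; have e'0 : 0 < e' by rewrite divr_gt0.
have : \forall y \near x, U y /\ forall i, `|pd i f x - pd i f y| <= e'.
  apply: filterI; first exact: open_nbhs_nbhs.
  apply: (@filter_forall _ _ (fun (i : 'I_n) y => `|pd i f x - pd i f y| <= e') (nbhs x)) => i.
  by have [_ /= [/(_ _ Ux) /cvgrPdist_le + _]] := h2 i; apply.
move/near_normP => -[d d0 hd]; exists d => // u v ux vx.
(* [w j] takes its first [j] coordinates from [u], the others from [v]. The norm is the maximum
   norm, so all these points and the segments between them stay in the ball. *)
pose w (j : nat) : 'rV[R]_n := \row_(i < n) if (i < j)%N then u 0 i else v 0 i.
have w0 : w 0%N = v by apply/rowP => i; rewrite mxE.
have wn : w n = u by apply/rowP => i; rewrite mxE ltn_ord.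
have step (j : 'I_n) : `|f (w j.+1) - f (w j) - (u 0 j - v 0 j) * pd j f x| <=
    e' * `|u - v|.
  pose z : 'rV[R]_n := \row_(i < n) if (i < j)%N then u 0 i else if i == j then 0 else v 0 i.
  have zw t : (z + t *: delta_mx 0 j) = \row_(i < n) if (i < j)%N then u 0 i else
      if i == j then t else v 0 i.
    apply/rowP => i; rewrite !mxE eqxx /=.
    have [->|ij] := eqVneq i j; first by rewrite ltnn mulr1 add0r.
    by rewrite mulr0 addr0.
  have E1 : w j.+1 = z + (u 0 j) *: delta_mx 0 j.
    rewrite zw; apply/rowP => i; rewrite !mxE ltnS leq_eqVlt -val_eqE /=.
    by have [/val_inj->|] := eqVneq (i : nat) j; rewrite ?ltnn.
  have E2 : w j = z + (v 0 j) *: delta_mx 0 j.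
    rewrite zw; apply/rowP => i; rewrite !mxE.
    by have [->|] := eqVneq i j; rewrite ?ltnn.
  have zb c : Num.min (v 0 j) (u 0 j) <= c <= Num.max (v 0 j) (u 0 j) ->
      `|z + c *: delta_mx 0 j - x| < d.
    move=> cuv; rewrite zw; apply: rV_norm_lt => // i.
    rewrite !mxE; have := le_lt_trans (ler_coord (u - x) i) ux.
    have := le_lt_trans (ler_coord (v - x) i) vx.
    rewrite !mxE => vi ui; case: ifP => // _; case: eqP => // ij; subst i.
    move: vi ui; rewrite !ltr_norml => /andP[v1 v2] /andP[u1 u2].
    move: cuv; rewrite ge_min le_max => /andP[/orP[]c1 /orP[]c2]; apply/andP; split; lra.
  rewrite E1 E2; have [|c cuv ->] := @MVT_unordered (fun t => f (z + t *: delta_mx 0 j))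
     (fun t => pd j f (z + t *: delta_mx 0 j)) (v 0 j) (u 0 j).
    move=> c cuv; apply: is_derive_line.
    by apply: (h2 j).1; have [] := hd _ (zb c cuv).
  rewrite mulrC -mulrBr normrM mulrC ler_pM//.
    by have [_ /(_ j)] := hd _ (zb c cuv); rewrite distrC.
  by have := ler_coord (u - v) j; rewrite !mxE.
have -> : f u - f v = \sum_(j < n) (f (w j.+1) - f (w j)).
  by rewrite -(big_mkord xpredT (fun j => f (w j.+1) - f (w j))) telescope_sumr// w0 wn.
rewrite mxE -sumrB (le_trans (ler_norm_sum _ _ _))//.
have : \sum_(j < n) `|f (w j.+1) - f (w j) - (u - v) 0 j * grad f x j 0| <=
  \sum_(j < n) e' * `|u - v|.
  by apply: ler_sum => j _; have := step j; rewrite !mxE.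
move=> /le_trans; apply; rewrite sumr_const card_ord -mulr_natl mulrA ler_wpM2r//.
by rewrite /e' mulrCA ler_piMr ?(ltW e0)// ler_pdivrMr// mul1r ler_nat.
Qed.

Lemma sdiff_cont n (f : 'rV[R]_n -> R) x A : sdiff f x A -> {for x, continuous f}.
Proof.
move=> sf; apply/cont_normP => e e0.
have [c c0 hc] := mulmx_bound A.
have [d d0 h] := sf _ ltr01.
exists (Num.min d (e / (1 + c))) => [|y].
  by rewrite lt_min d0 divr_gt0// addr_gt0.
rewrite lt_min => /andP[yx]; rewrite ltr_pdivlMr ?addr_gt0// => yx2.
have := h y x yx; rewrite subrr normr0 => /(_ d0) h1.
have h2 := le_trans (ler_coord _ 0) (hc (y - x)).
rewrite -[f y - f x](subrK (((y - x) *m A) 0 0)).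
apply: le_lt_trans (ler_normD _ _) _; apply: le_lt_trans (lerD h1 h2) _.
by rewrite -mulrDl mulrC.
Qed.

Lemma sdiffv_le n m (F : 'rV[R]_n -> 'rV[R]_m) x A : sdiffv F x A ->
  forall e, 0 < e -> exists2 d : R, 0 < d & forall u v : 'rV[R]_n, `|u - x| < d ->
    `|v - x| < d -> `|F u - F v - (u - v) *m A| <= e * `|u - v|.
Proof.
move=> sF e e0.
pose P (j : 'I_m) d := 0 < d /\ forall u v, `|u - x| < d -> `|v - x| < d ->
    `|crd F j u - crd F j v - ((u - v) *m col j A) 0 0| <= e * `|u - v|.
have /choice[d hd] : forall j, exists d, P j d.
  by move=> j; have [d d0 h] := sF j _ e0; exists d.
exists (\big[Num.min/1]_j d j) => [|u v].
  by apply: lt_bigmin => // j _; case: (hd j).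
move=> /bigmin_gtP[_ ud] /bigmin_gtP[_ vd].
apply: rV_norm_le => [|j]; first by rewrite mulr_ge0// ltW.
have E : ((u - v) *m col j A) 0 0 = ((u - v) *m A) 0 j.
  by rewrite !mxE; apply: eq_bigr => l _; rewrite !mxE.
have [_ /(_ u v (ud j isT) (vd j isT))] := hd j.
by rewrite E /crd; rewrite !mxE.
Qed.

Lemma sdiffv_cont n m (F : 'rV[R]_n -> 'rV[R]_m) x A :
  sdiffv F x A -> {for x, continuous F}.
Proof.
move=> sF; have [c c0 hc] := mulmx_bound A.
have [d d0 h] := sdiffv_le sF ltr01.
apply/cont_normP => e e0.
exists (Num.min d (e / (1 + c))) => [|y].
  by rewrite lt_min d0 divr_gt0// addr_gt0.
rewrite lt_min => /andP[yx]; rewrite ltr_pdivlMr ?addr_gt0// => yx2.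
have := h y x yx; rewrite subrr normr0 => /(_ d0) h1.
rewrite -[F y - F x](subrK ((y - x) *m A)).
apply: le_lt_trans (ler_normD _ _) _; apply: le_lt_trans (lerD h1 (hc _)) _.
by rewrite -mulrDl mulrC.
Qed.

Lemma sdiff_comp n m (F : 'rV[R]_n -> 'rV[R]_m) f x A B :
  sdiffv F x A -> sdiff f (F x) B -> sdiff (f \o F) x (A *m B).
Proof.
move=> sF sf e e0.
have [a a0 ha] := mulmx_bound A; have [b b0 hb] := mulmx_bound B.
(* Chosen so that [b * e1] and [e2 * (a + e1)] are both [e / 2]; [a + e1] is a Lipschitz constant of
   [F] near [x]. *)
pose e1 := e / (2 * b); pose e2 := e / (2 * (a + e1)).
have e10 : 0 < e1 by rewrite divr_gt0// mulr_gt0.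
have e20 : 0 < e2 by rewrite divr_gt0// mulr_gt0// addr_gt0.
have [d1 d10 h1] := sdiffv_le sF e10; have [d2 d20 h2] := sf _ e20.
have /cont_normP/(_ _ d20)[d' d'0 hd'] := sdiffv_cont sF.
pose d := Num.min d1 d'; exists d => [|u v ux vx]; first by rewrite lt_min d10.
have hd y : `|y - x| < d -> `|y - x| < d1 /\ `|F y - F x| < d2.
  by rewrite lt_min => /andP[? /hd'].
have [u1 u2] := hd _ ux; have [v1 v2] := hd _ vx.
have H1 := h1 _ _ u1 v1; have H2 := h2 _ _ u2 v2.
have H3 : `|F u - F v| <= (a + e1) * `|u - v|.
  rewrite -[F u - F v](subrK ((u - v) *m A)) addrC mulrDl.
  by apply: le_trans (ler_normD _ _) _; apply: lerD.
have -> : (f \o F) u - (f \o F) v - ((u - v) *m (A *m B)) 0 0 =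
   (f (F u) - f (F v) - ((F u - F v) *m B) 0 0) +
   ((F u - F v - (u - v) *m A) *m B) 0 0.
  have -> : (F u - F v - (u - v) *m A) *m B = (F u - F v) *m B - (u - v) *m (A *m B).
    by rewrite mulmxBl mulmxA.
  by rewrite [((F u - F v) *m B - _) 0 0]mxE [(- _ : 'rV_1) 0 0]mxE /=; ring.
apply: le_trans (ler_normD _ _) _.
have := le_trans (ler_coord _ 0) (hb (F u - F v - (u - v) *m A)) => H4.
have H5 := le_trans H2 (ler_wpM2l (ltW e20) H3).
have H6 := le_trans H4 (ler_wpM2l (ltW b0) H1).
apply: le_trans (lerD H5 H6) _.
rewrite !mulrA -mulrDl ler_wpM2r// le_eqVlt; apply/orP; left; apply/eqP.
have ae : a + e1 != 0 by rewrite gt_eqF// addr_gt0.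
have b1 : b != 0 by rewrite gt_eqF.
have -> : e2 * (a + e1) = e / 2 by rewrite /e2; field.
by field.
Qed.

Lemma sdiffv_comp n m p (F : 'rV[R]_n -> 'rV[R]_m) (G : 'rV[R]_m -> 'rV[R]_p) x A B :
  sdiffv F x A -> sdiffv G (F x) B -> sdiffv (G \o F) x (A *m B).
Proof.
by move=> sF sG j; rewrite colE -mulmxA -colE; exact: (sdiff_comp sF (sG j)).
Qed.

Lemma cont_rV (T : topologicalType) n (F : T -> 'rV[R]_n) x :
  (forall j, {for x, continuous (fun y => F y 0 j)}) -> {for x, continuous F}.
Proof.
move=> h; apply/(@cvgrPdist_lt _ _ _ (nbhs x)) => e e0.
have : \forall y \near x, forall j, `|F x 0 j - F y 0 j| < e.
  apply: (@filter_forall _ _ _ (nbhs x)) => j.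
  by have /cvgrPdist_lt := h j; apply.
apply: filterS => y hy; apply: rV_norm_lt => // j.
by rewrite !mxE.
Qed.

Definition Ckv n m k (U : set 'rV[R]_n) (F : 'rV[R]_n -> 'rV[R]_m) :=
  forall j, Ck k U (crd F j).

Definition Cinfv n m (U : set 'rV[R]_n) (F : 'rV[R]_n -> 'rV[R]_m) :=
  forall j, Cinf U (crd F j).

Definition jac n m (F : 'rV[R]_n -> 'rV[R]_m) x : 'M[R]_(n, m) :=
  \matrix_(i, j) pd i (crd F j) x.

Lemma C1_sdiffv n m (U : set 'rV[R]_n) (F : 'rV[R]_n -> 'rV[R]_m) x :
  open U -> U x -> Ckv 1 U F -> sdiffv F x (jac F x).
Proof.
move=> oU Ux h j; have -> : col j (jac F x) = grad (crd F j) x.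
  by apply/colP => i; rewrite !mxE.
exact: C1_sdiff (h j).
Qed.

Lemma Ck_comp n m k (U : set 'rV[R]_n) (V : set 'rV[R]_m) F f :
  open U -> open V -> Ckv k U F -> Ck k V f -> (forall x, U x -> V (F x)) ->
  Ck k U (f \o F).
Proof.
move=> oU oV; elim: k f F => [|k IH] f F FU fV UV.
  split=> // x Ux; apply: continuous_comp; last exact: fV.1 (UV _ Ux).
  by apply: cont_rV => j; exact: (FU j).1.
have sd x : U x -> sdiff (f \o F) x (jac F x *m grad f (F x)).
  move=> Ux; apply: sdiff_comp.
    by apply: (C1_sdiffv oU) => // j; apply: Ck_le (FU j).
  by apply: (C1_sdiff oV) (UV _ Ux) _; apply: Ck_le fV.
split=> [x Ux|i]; first exact: sdiff_cont (sd x Ux).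
split=> [x Ux|]; first by have [] := is_derive_sdiff (delta_mx 0 i) (sd x Ux).
(* The chain rule writes a partial derivative of the composite as a sum of products of functions of
   class [k]; the induction applies to the composite factors. *)
have : Ck k U (fun x => \sum_(j < m) pd i (crd F j) x * (pd j f \o F) x).
  apply: Ck_sum => // j _; apply: CkM => //; first exact: ((FU j).2 i).2.
  by apply: IH; [move=> l; exact: CkS (FU l)|exact: (fV.2 j).2|].
apply: Ck_ext => // x Ux.
have [_ ->] := is_derive_sdiff (delta_mx 0 i) (sd x Ux).
rewrite mulmxA -rowE mxE; apply: eq_bigr => j _; rewrite !mxE //.
Qed.

Lemma Ck_inv n k (U : set 'rV[R]_n) f : open U -> (forall x, U x -> f x != 0) ->
  Ck k U f -> Ck k U (fun x => (f x)^-1).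
Proof.
move=> oU f0; elim: k => [|k IH] fU.
  by split=> // x Ux; apply: continuousV; [exact: f0|exact: fU.1].
split=> [x Ux|i].
  by apply: continuousV; [exact: f0|exact: fU.1].
have [f3 f4] := fU.2 i; split=> [x Ux|].
  by apply: derivableV; [exact: f0|exact: f3].
have IHf := IH (CkS fU).
have := CkM oU (Ck_cst k U (-1)) (CkM oU (CkM oU IHf IHf) f4).
apply: Ck_ext => // x Ux.
rewrite deriveV; [|exact: f0|exact: f3].
rewrite mulN1r -[_ *: _]/(_ * _) -invfM -expr2 mulNr//.
Qed.

Lemma CinfD n (U : set 'rV[R]_n) f g : open U ->
  Cinf U f -> Cinf U g -> Cinf U (fun x => f x + g x).
Proof. by move=> oU fU gU k; exact: CkD. Qed.

Lemma CinfM n (U : set 'rV[R]_n) f g : open U ->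
  Cinf U f -> Cinf U g -> Cinf U (fun x => f x * g x).
Proof. by move=> oU fU gU k; exact: CkM. Qed.

Lemma Cinf_sum n (U : set 'rV[R]_n) (I : Type) (r : seq I) (P : pred I) f :
  open U -> (forall i, P i -> Cinf U (f i)) ->
  Cinf U (fun x => \sum_(i <- r | P i) f i x).
Proof. by move=> oU h k; apply: Ck_sum => // i Pi; exact: h. Qed.

Lemma Cinf_comp n m (U : set 'rV[R]_n) (V : set 'rV[R]_m) F f :
  open U -> open V -> Cinfv U F -> Cinf V f -> (forall x, U x -> V (F x)) ->
  Cinf U (f \o F).
Proof. by move=> oU oV FU fV UV k; apply: Ck_comp oU oV _ _ UV => // j; exact: FU. Qed.

Lemma Cinf_ext n (U : set 'rV[R]_n) f g :
  open U -> (forall x, U x -> f x = g x) -> Cinf U f -> Cinf U g.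
Proof. by move=> oU fg h k; exact: Ck_ext (h k). Qed.

Lemma Cinf_sub n (U V : set 'rV[R]_n) f : V `<=` U -> Cinf U f -> Cinf V f.
Proof. by move=> VU h k; exact: Ck_sub (h k). Qed.

Lemma Cinf_pt n (U : set 'rV[R]_n) f :
  Cinf U f <-> forall x, U x -> Cinf [set x] f.
Proof.
split=> [h x Ux|h k]; first by apply: Cinf_sub h => _ ->.
by apply/Ck_pt => x Ux; exact: h.
Qed.

Lemma Cinf_cont n (U : set 'rV[R]_n) f x : Cinf U f -> U x -> {for x, continuous f}.
Proof. by move=> h; exact: (h 0%N).1. Qed.

Lemma Cinf_pd n (U : set 'rV[R]_n) f i : Cinf U f -> Cinf U (pd i f).
Proof. by move=> h k; exact: ((h k.+1).2 i).2. Qed.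

Lemma Cinf_lin n m (U : set 'rV[R]_n) (A : 'M[R]_(n, m)) (c : 'rV[R]_m) :
  open U -> Cinfv U (fun x => x *m A + c).
Proof.
move=> oU j; have E : crd (fun x => x *m A + c) j =
    (fun x : 'rV[R]_n => \sum_(i < n) x 0 i * A i j + c 0 j).
  by apply/funext => x; rewrite /crd !mxE.
rewrite E; apply: CinfD => //; last by move=> k; exact: Ck_cst.
apply: Cinf_sum => // i _; apply: CinfM => // k; first exact: Ck_coord.
exact: Ck_cst.
Qed.

Lemma Cinf_prod n (U : set 'rV[R]_n) (I : Type) (r : seq I) (P : pred I) f :
  open U -> (forall i, P i -> Cinf U (f i)) ->
  Cinf U (fun x => \prod_(i <- r | P i) f i x).
Proof.
move=> oU h; elim: r => [|i r IH].
  by under eq_fun do rewrite big_nil; move=> k; exact: Ck_cst.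
under eq_fun do rewrite big_cons.
by have [Pi|nPi] := boolP (P i) => //; apply: CinfM => //; exact: h.
Qed.

Lemma Cinf_cst n (U : set 'rV[R]_n) (c : R) : Cinf U (fun=> c).
Proof. by move=> k; exact: Ck_cst. Qed.

Lemma Cinf_det n m (U : set 'rV[R]_n) (M : 'rV[R]_n -> 'M[R]_m) :
  open U -> (forall i j, Cinf U (fun x => M x i j)) ->
  Cinf U (fun x => \det (M x)).
Proof.
move=> oU h; rewrite /determinant; apply: Cinf_sum => // s _.
by apply: CinfM => //; [exact: Cinf_cst|apply: Cinf_prod].
Qed.

Lemma Cinf_invmx n m (U : set 'rV[R]_n) (M : 'rV[R]_n -> 'M[R]_m) :
  open U -> (forall x, U x -> M x \in unitmx) ->
  (forall i j, Cinf U (fun x => M x i j)) ->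
  forall i j, Cinf U (fun x => invmx (M x) i j).
Proof.
move=> oU Mu h i j.
have : Cinf U (fun x => (\det (M x))^-1 * \adj (M x) i j).
  apply: CinfM => //.
    move=> k; apply: Ck_inv => //; last exact: Cinf_det.
    by move=> x /Mu; rewrite unitmxE unitfE.
  under eq_fun do rewrite mxE /cofactor; apply: CinfM => //; first exact: Cinf_cst.
  apply: Cinf_det => // i' j'; under eq_fun do rewrite !mxE; exact: h.
apply: Cinf_ext => // x Ux.
by rewrite /invmx Mu//= [RHS]mxE.
Qed.

(** A row [v] killed by [B] satisfies [|v| <= q * |v|] with [q < 1]. *)
Lemma mx_near1_unit m (B : 'M[R]_m) (q : R) : q < 1 ->
  (forall u : 'rV[R]_m, `|u *m B - u| <= q * `|u|) -> B \in unitmx.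
Proof.
move=> q1 h; rewrite -row_free_unit -kermx_eq0; apply/rowV0P => v /sub_kermxP vB.
have := h v; rewrite vB sub0r normrN => hv.
apply/eqP; rewrite -normr_eq0; apply/eqP/le_anti; rewrite normr_ge0 andbT.
have v0 := normr_ge0 v; nra.
Qed.

Lemma norm_row_mx_lt a b (u : 'rV[R]_a) (v : 'rV[R]_b) (d : R) :
  `|u| < d -> `|v| < d -> `|row_mx u v| < d.
Proof.
move=> ud vd; apply: rV_norm_lt => [|i]; first exact: le_lt_trans ud.
rewrite mxE; case: (fintype.split i) => j; first exact: le_lt_trans (ler_coord _ _) ud.
exact: le_lt_trans (ler_coord _ _) vd.
Qed.

Lemma norm_row_mx_le a b (u : 'rV[R]_a) (v : 'rV[R]_b) : `|row_mx u v| <= `|u| + `|v|.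
Proof.
apply: rV_norm_le => [|i]; first by rewrite addr_ge0.
rewrite mxE; case: (fintype.split i) => j; apply: le_trans (ler_coord _ _) _.
  by rewrite lerDl. by rewrite lerDr.
Qed.

Lemma closed_ball_compact n (r : R) : compact [set u : 'rV[R]_n | `|u| <= r].
Proof.
apply: bounded_closed_compact.
  exists r; split; first exact: num_real.
  by move=> M rM u /= ur; exact: le_trans ur (ltW rM).
apply: (@closed_comp _ _ (fun u : 'rV[R]_n => `|u|) [set y : R | y <= r]).
  by move=> u _; exact: norm_continuous.
exact: closed_le.
Qed.

Lemma open_nball n (x : 'rV[R]_n) (r : R) : open [set u : 'rV[R]_n | `|u - x| < r].
Proof.
move=> u /= ur; apply/near_normP; exists (r - `|u - x|); first by rewrite subr_gt0.
move=> y yu /=; rewrite -(subrK u y) -addrA (le_lt_trans (ler_normD _ _))//.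
by rewrite -ltrBrDr.
Qed.

Lemma open_nball0 n (r : R) : open [set u : 'rV[R]_n | `|u| < r].
Proof.
have := @open_nball n 0 r.
by rewrite (_ : [set u | `|u - 0| < r] = [set u | `|u| < r])//; apply/seteqP; split=> u /=; rewrite subr0.
Qed.

Lemma sdiffv_id n (x : 'rV[R]_n) : sdiffv (fun y : 'rV[R]_n => y) x 1%:M.
Proof.
move=> j e e0; exists 1 => // u v _ _.
have E : ((u - v) *m col j 1%:M) 0 0 = (u - v) 0 j.
  by rewrite colE mulmxA mulmx1 -colE mxE.
by rewrite E /crd !mxE subrr normr0 mulr_ge0// ltW.
Qed.

Lemma row_col_mx a b (B : 'M[R]_(a, b)) i j : ((delta_mx 0 i : 'rV[R]_a) *m col j B) 0 0 = B i j.
Proof. by rewrite -rowE !mxE. Qed.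

Section Implicit.
Variables (a b : nat) (G : 'rV[R]_(a + b) -> 'rV[R]_a) (U : set 'rV[R]_(a + b)).
Hypotheses (oU : open U) (U0 : U 0) (GU : Cinfv U G) (G0 : G 0 = 0)
  (GJ : usubmx (jac G 0) = 1%:M).

(** The zero [g e] is found as a minimum of [|G (row_mx al e)|] over a closed ball: from a nonzero
    minimum the step [al - G (row_mx al e)], Newton's method with the derivative frozen at the
    identity, would at least halve the value. The last bound controls [g e] by the defect at
    [row_mx 0 e]; it later measures how far a point must move to reach a zero set. *)
Theorem implicit_function : exists (d1 d2 c : R) (g : 'rV[R]_b -> 'rV[R]_a),
  [/\ 0 < d1, 0 < d2, 0 < c & Cinfv [set e | `|e| < d2] g] /\
  [/\ g 0 = 0, forall e : 'rV[R]_b, `|e| < d2 -> `|g e| < d1 /\ U (row_mx (g e) e),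
   forall e : 'rV[R]_b, `|e| < d2 -> G (row_mx (g e) e) = 0,
   forall (al : 'rV[R]_a) (e : 'rV[R]_b), `|al| < d1 -> `|e| < d2 -> G (row_mx al e) = 0 -> al = g e &
   forall e : 'rV[R]_b, `|e| < d2 -> `|g e| <= c * `|G (row_mx 0 e)|].
Proof.
have C1 x : U x -> sdiffv G x (jac G x).
  by move=> Ux; apply: (C1_sdiffv oU) => // j; exact: GU.
have [d0 d00 hd0] : exists2 d, 0 < d & forall u : 'rV_(a + b), `|u| < d -> U u.
  have /near_normP[d d0 h] : nbhs (0 : 'rV[R]_(a + b)) U by exact: open_nbhs_nbhs.
  by exists d => // u ud; apply: h; rewrite subr0.
have half0 : 0 < 2^-1 :> R by rewrite invr_gt0.
have [d' d'0 hd'] := sdiffv_le (C1 _ U0) half0.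
pose d := Num.min d0 d'; have d_gt0 : 0 < d by rewrite lt_min d00.
have bd u v : `|u| < d -> `|v| < d ->
    `|G u - G v - (u - v) *m jac G 0| <= 2^-1 * `|u - v|.
  by rewrite !lt_min => /andP[_ u1] /andP[_ v1]; apply: hd'; rewrite subr0.
have bdU u : `|u| < d -> U u by rewrite lt_min => /andP[/hd0].
have [c c0 hc] := mulmx_bound (jac G 0).
pose L := c + 1.
have lipG u v : `|u| < d -> `|v| < d -> `|G u - G v| <= L * `|u - v|.
  move=> u1 v1; rewrite -[G u - G v](subrK ((u - v) *m jac G 0)).
  apply: le_trans (ler_normD _ _) _.
  by have := bd _ _ u1 v1; have := hc (u - v); have := normr_ge0 (u - v); rewrite /L; lra.
have row_sub (al al' : 'rV[R]_a) (e e' : 'rV[R]_b) :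
    row_mx al e - row_mx al' e' = row_mx (al - al') (e - e').
  by rewrite opp_row_mx add_row_mx.
have rowA (al : 'rV[R]_a) : row_mx al (0 : 'rV_b) *m jac G 0 = al.
  by rewrite -[jac G 0]vsubmxK mul_row_col mul0mx addr0 GJ mulmx1.
have norm0 (al : 'rV[R]_a) : `|row_mx al (0 : 'rV_b)| <= `|al|.
  by have := norm_row_mx_le al (0 : 'rV_b); rewrite normr0 addr0.
have norm1 (e : 'rV[R]_b) : `|row_mx (0 : 'rV_a) e| <= `|e|.
  by have := norm_row_mx_le (0 : 'rV_a) e; rewrite normr0 add0r.
have ctr (al al' : 'rV[R]_a) (e : 'rV[R]_b) : `|al| < d -> `|al'| < d -> `|e| < d ->
    `|G (row_mx al e) - G (row_mx al' e) - (al - al')| <= 2^-1 * `|al - al'|.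
  move=> h1 h2 h3; have := bd _ _ (norm_row_mx_lt h1 h3) (norm_row_mx_lt h2 h3).
  rewrite row_sub subrr rowA => /le_trans; apply.
  by apply: ler_wpM2l => //; exact: ltW.
have inj (al al' : 'rV[R]_a) (e : 'rV[R]_b) : `|al| < d -> `|al'| < d -> `|e| < d ->
    `|al - al'| <= 2 * `|G (row_mx al e) - G (row_mx al' e)|.
  move=> h1 h2 h3; have := ctr _ _ _ h1 h2 h3; rewrite distrC => h.
  have := ler_normD (al - al' - (G (row_mx al e) - G (row_mx al' e)))
           (G (row_mx al e) - G (row_mx al' e)).
  by rewrite subrK; lra.
pose r := d / 2; have r0 : 0 < r by rewrite divr_gt0.
have rd : r < d by rewrite /r; lra.
pose d2 := Num.min r (r / (2 * L)).
have L0 : 0 < L by rewrite /L addr_gt0.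
have d20 : 0 < d2 by rewrite lt_min r0 divr_gt0// mulr_gt0.
have small e : `|e| < d2 -> `|G (row_mx 0 e)| <= r / 2 /\ `|e| < d.
  rewrite lt_min => /andP[e1 e2]; have ed := lt_trans e1 rd; split=> //.
  have d0' : `|(0 : 'rV[R]_(a + b))| < d by rewrite normr0.
  have := lipG _ _ (norm_row_mx_lt (_ : `|0 : 'rV[R]_a| < d) ed) d0'.
  rewrite normr0 G0 !subr0 => /(_ d_gt0) /le_trans; apply.
  apply: le_trans (ler_wpM2l (ltW L0) (norm1 e)) _.
  rewrite mulrC -ler_pdivlMr//; apply: le_trans (ltW e2) _.
  by rewrite invfM mulrA.
have ex e : `|e| < d2 -> exists al, `|al| <= r /\ G (row_mx al e) = 0.
  move=> /small[e1 e2].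
  have [||| al] := @EVT_min_rV R a (fun al => `|G (row_mx al e)|) [set u | `|u| <= r].
  - by exists 0; rewrite /= normr0 ltW.
  - exact: closed_ball_compact.
  - apply: continuous_in_subspaceT => al; rewrite inE /= => alr.
    apply/cont_normP => t t0; exists (Num.min (d - r) (t / (2 * L))) => [|y].
      by rewrite lt_min subr_gt0 rd divr_gt0// mulr_gt0.
    rewrite lt_min => /andP[y1 y2].
    have yd : `|y| < d.
      by have := ler_normD (y - al) al; rewrite subrK; lra.
    apply: le_lt_trans (ler_dist_dist _ _) _.
    apply: le_lt_trans (lipG _ _ (norm_row_mx_lt yd e2) (norm_row_mx_lt (le_lt_trans alr rd) e2)) _.
    rewrite row_sub subrr mulrC -ltr_pdivlMr//.
    apply: le_lt_trans (norm0 _) _; apply: lt_le_trans y2 _.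
    by rewrite ler_wpM2l ?(ltW t0)// lef_pV2 ?posrE ?mulr_gt0// ler_peMl ?(ltW L0)// ler1n.
  rewrite inE /= => alr almin; exists al; split=> //.
  have ald := le_lt_trans alr rd.
  pose al' := al - G (row_mx al e).
  have al'r : `|al'| <= r.
    have := ctr al 0 e ald; rewrite normr0 => /(_ d_gt0 e2).
    have -> : G (row_mx al e) - G (row_mx 0 e) - (al - 0) = - al' - G (row_mx 0 e).
      by rewrite subr0 /al' opprB addrAC.
    have := ler_normD (- al' - G (row_mx 0 e)) (G (row_mx 0 e)).
    rewrite subrK normrN subr0; lra.
  have := almin al'; rewrite inE => /(_ al'r) h1.
  have := ctr al' al e (le_lt_trans al'r rd) ald e2.
  have -> : al' - al = - G (row_mx al e) by rewrite /al' addrAC subrr add0r.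
  rewrite opprK subrK normrN => h2.
  by apply/eqP; rewrite -normr_eq0; apply/eqP/le_anti; rewrite normr_ge0 andbT; lra.
have /choice[g hg] : forall e, exists al, `|e| < d2 -> `|al| <= r /\ G (row_mx al e) = 0.
  move=> e; have [ed|] := ltP `|e| d2; first by have [al hal] := ex e ed; exists al.
  by exists 0.
have gd e : `|e| < d2 -> `|g e| < d by move=> /hg[h _]; exact: le_lt_trans rd.
have gG e : `|e| < d2 -> G (row_mx (g e) e) = 0 by move=> /hg[].
have gU e : `|e| < d2 -> U (row_mx (g e) e).
  by move=> ed; apply: bdU; apply: norm_row_mx_lt; [exact: gd|have [] := small e ed].
have guniq al e : `|al| < d -> `|e| < d2 -> G (row_mx al e) = 0 -> al = g e.
  move=> ald ed Gal; apply/eqP; rewrite -subr_eq0 -normr_eq0; apply/eqP/le_anti.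
  have [_ e2] := small e ed.
  by rewrite normr_ge0 andbT (le_trans (inj _ _ e ald (gd _ ed) e2))// Gal gG// subrr normr0 mulr0.
have lipg e e' : `|e| < d2 -> `|e'| < d2 -> `|g e - g e'| <= (2 * L) * `|e - e'|.
  move=> h1 h2; have [_ e1] := small e h1; have [_ e2] := small e' h2.
  apply: le_trans (inj _ _ e' (gd _ h1) (gd _ h2) e2) _.
  rewrite gG// -mulrA ler_wpM2l// -(gG e h1).
  apply: le_trans (lipG _ _ (norm_row_mx_lt (gd _ h1) e2) (norm_row_mx_lt (gd _ h1) e1)) _.
  by rewrite row_sub subrr ler_wpM2l ?(ltW L0)// distrC (le_trans (norm1 _)).
pose p e := row_mx (g e) e.
pose B1 q := usubmx (jac G q); pose B2 q := dsubmx (jac G q).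
have mulB q (al : 'rV[R]_a) (e : 'rV[R]_b) : row_mx al e *m jac G q = al *m B1 q + e *m B2 q.
  by rewrite -{1}[jac G q]vsubmxK mul_row_col.
(* On the whole ball [G] follows its linear part at 0 with relative error [1/2]; a difference
   quotient at [q] with error [1/4] transfers this to the partial derivative at [q], whence
   [3/4]. *)
have B1u q : `|q| < d -> B1 q \in unitmx.
  move=> qd; apply: (@mx_near1_unit _ _ (3 / 4)); first by lra.
  move=> u; have e40 : 0 < 4^-1 :> R by rewrite invr_gt0.
  have [s s0 hs] := sdiffv_le (C1 _ (bdU _ qd)) e40.
  pose t := Num.min s (d - `|q|) / (2 * (1 + `|u|)).
  have u1 : 0 < 1 + `|u| by rewrite ltr_pwDl.
  have m0 : 0 < Num.min s (d - `|q|) by rewrite lt_min s0 subr_gt0.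
  have t0 : 0 < t by rewrite divr_gt0// mulr_gt0.
  pose v := row_mx (t *: u) (0 : 'rV[R]_b).
  have tu : `|v| < Num.min s (d - `|q|).
    apply: le_lt_trans (norm0 _) _; rewrite normrZ gtr0_norm// /t.
    rewrite mulrAC ltr_pdivrMr ?mulr_gt0// ltr_pM2l//.
    by have := normr_ge0 u; lra.
  move: tu; rewrite lt_min => /andP[tu1 tu2].
  have qv : `|q + v| < d by apply: le_lt_trans (ler_normD _ _) _; lra.
  have Eqv : q + v - q = v by rewrite addrAC subrr add0r.
  have h1 := hs (q + v) q; rewrite Eqv subrr normr0 in h1.
  have {}h1 := h1 tu1 s0.
  have h2 := bd _ _ qv qd; rewrite Eqv rowA in h2.
  have E : v *m jac G q = t *: (u *m B1 q) by rewrite mulB mul0mx addr0 scalemxAl.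
  rewrite E in h1.
  have : `|t *: (u *m B1 q - u)| <= t * (3 / 4 * `|u|).
    rewrite scalerBr.
    have -> : t *: (u *m B1 q) - t *: u = (G (q + v) - G q - t *: u) -
       (G (q + v) - G q - t *: (u *m B1 q)).
      by rewrite opprB [RHS]addrC addrA subrK.
    apply: le_trans (ler_normB _ _) _; apply: le_trans (lerD h2 h1) _.
    have := norm0 (t *: u); rewrite normrZ gtr0_norm//; lra.
  by rewrite normrZ gtr0_norm// ler_pM2l.
have pd' e : `|e| < d2 -> `|p e| < d.
  by move=> ed; apply: norm_row_mx_lt; [exact: gd|have [] := small e ed].
have sdg e : `|e| < d2 -> sdiffv g e (- (B2 (p e) *m invmx (B1 (p e)))).
  move=> ed; set B := - _.
  have [s s0 hs] := mulmx_bound (invmx (B1 (p e))).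
  have L20 : 0 < 2 * L + 1 by rewrite addr_gt0// mulr_gt0.
  have key : forall t, 0 < t -> exists2 f, 0 < f & forall u v, `|u - e| < f ->
    `|v - e| < f -> `|g u - g v - (u - v) *m B| <= t * `|u - v|.
    (* [s] bounds the inverse of the partial derivative and [2 * L + 1] the increment of
       [row_mx (g e) e] per unit of [e]; together they turn the error [t'] into [t]. *)
    move=> t t0; pose t' := t / (s * (2 * L + 1)).
    have t'0 : 0 < t' by rewrite divr_gt0// mulr_gt0.
    have [f f0 hf] := sdiffv_le (C1 _ (gU _ ed)) t'0.
    exists (Num.min (d2 - `|e|) (f / (2 * L + 1))) => [|u v].
      by rewrite lt_min subr_gt0 ed divr_gt0.
    have H u' : `|u' - e| < Num.min (d2 - `|e|) (f / (2 * L + 1)) ->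
        `|u'| < d2 /\ `|p u' - p e| < f.
      rewrite lt_min => /andP[u1 u2].
      have u'd : `|u'| < d2 by have := ler_normD (u' - e) e; rewrite subrK; lra.
      split=> //; rewrite row_sub; apply: le_lt_trans (norm_row_mx_le _ _) _.
      have := lipg _ _ u'd ed; move: u2; rewrite ltr_pdivlMr//; lra.
    move=> /H[ud ue] /H[vd ve].
    have := hf _ _ ue ve; rewrite !gG// subrr sub0r normrN row_sub mulB => h.
    have h2 : `|row_mx (g u - g v) (u - v)| <= (2 * L + 1) * `|u - v|.
      by apply: le_trans (norm_row_mx_le _ _) _; have := lipg _ _ ud vd; lra.
    have -> : g u - g v - (u - v) *m B =
       ((g u - g v) *m B1 (p e) + (u - v) *m B2 (p e)) *m invmx (B1 (p e)).
      rewrite mulmxDl -!mulmxA mulmxV ?mulmx1; last by apply: B1u; exact: pd'.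
      by rewrite /B mulmxN opprK.
    apply: le_trans (hs _) _.
    apply: le_trans (ler_wpM2l (ltW s0) (le_trans h (ler_wpM2l (ltW t'0) h2))) _.
    rewrite !mulrA ler_wpM2r// /t' le_eqVlt; apply/orP; left; apply/eqP.
    by field; rewrite !gt_eqF.
  move=> j t /key[f f0 hf]; exists f => // u v ue ve.
  have := le_trans (ler_coord _ j) (hf u v ue ve).
  have -> : ((u - v) *m col j B) 0 0 = ((u - v) *m B) 0 j.
    by rewrite colE mulmxA -colE mxE.
  by rewrite /crd !mxE.
pose W : set 'rV[R]_(a + b) := [set q | `|q - 0| < d].
have oW : open W by exact: open_nball.
have Wd q : W q -> `|q| < d by rewrite /W/= subr0.
have oD : open [set e : 'rV[R]_b | `|e| < d2].
  exact: open_nball0.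
have GW i j : Cinf W (fun q => jac G q i j).
  under eq_fun do rewrite mxE; apply: Cinf_pd; apply: Cinf_sub (GU j).
  by move=> q /Wd/bdU.
have PhiW i j : Cinf W (fun q => (- (B2 q *m invmx (B1 q))) i j).
  have E q : (- (B2 q *m invmx (B1 q))) i j =
     \sum_l (-1) * (jac G q (rshift a i) l * invmx (B1 q) l j).
    by rewrite !mxE -sumrN; apply: eq_bigr => l _; rewrite mulN1r mxE.
  under eq_fun do rewrite E.
  apply: Cinf_sum => // l _; apply: CinfM => //; first exact: Cinf_cst.
  apply: CinfM => //; apply: Cinf_invmx => // [q /Wd/B1u //|i' j'].
  under eq_fun do rewrite mxE; exact: GW.
(* The derivative of [g] at [e] is a smooth function of [row_mx (g e) e], so each order of
   smoothness of [g] yields the next. *)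
have gk k : Ckv k [set e | `|e| < d2] g.
  elim: k => [|k IH] j.
    by split=> // e ed; exact: sdiff_cont (sdg e ed j).
  split=> [e ed|i]; first exact: sdiff_cont (sdg e ed j).
  split=> [e ed|].
    by have [] := is_derive_sdiff (delta_mx 0 i) (sdg e ed j).
  have : Ck k [set e | `|e| < d2] ((fun q => (- (B2 q *m invmx (B1 q))) i j) \o p).
    apply: (Ck_comp oD oW _ (PhiW i j k)) => [l|e ed]; last first.
      by rewrite /W /= subr0; exact: pd'.
    have [[l' ->]|[l' ->]] : (exists l', l = lshift b l') \/ (exists l', l = rshift a l').
      by case: (splitP l) => l' E; [left|right]; exists l'; apply: val_inj.
      have -> : crd p (lshift b l') = crd g l'.
        by apply/funext => e; rewrite /crd /p row_mxEl.
      exact: IH.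
    have -> : crd p (rshift a l') = (fun e => e 0 l').
      by apply/funext => e; rewrite /crd /p row_mxEr.
    exact: Ck_coord.
  apply: Ck_ext => // e ed.
  have [_ ->] := is_derive_sdiff (delta_mx 0 i) (sdg e ed j).
  by rewrite row_col_mx.
exists d, d2, 2, g; split; split=> //.
- by move=> j k; exact: gk.
- by apply/esym/guniq; rewrite ?normr0// row_mx0.
- by move=> e ed; split; [exact: gd|exact: gU].
- move=> e ed; have [_ e2] := small e ed.
  have := inj (g e) 0 e (gd _ ed) _ e2; rewrite normr0 => /(_ d_gt0).
  by rewrite gG// subr0 sub0r normrN.
Qed.

End Implicit.

End Calculus.

(** * Smooth functions on manifolds *)

Section SmoothStep.
Variable R : realType.

(** The negative powers of [t] are included to make the family closed under derivation. *)
Definition flat (m : nat) (t : R) : R :=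
  if 0 < t then t^-1 ^+ m * expR (- t^-1) else 0.

Lemma flat_ge0 m t : 0 <= flat m t.
Proof.
rewrite /flat; case: ifP => // t0.
by rewrite mulr_ge0 ?expR_ge0// exprn_ge0// invr_ge0 ltW.
Qed.

(** From [exp u = (exp (u / m.+1)) ^ m.+1] and [exp v >= 1 + v], with [u = 1 / t]. Applied to
    [flat m.+1], it gives the zero derivative of [flat m] at the origin. *)
Lemma flat_le m t : 0 < t -> flat m t <= (m.+1)%:R ^+ m.+1 * t.
Proof.
move=> t0; rewrite /flat t0 expRN.
have u0 : 0 < t^-1 by rewrite invr_gt0.
have m0 : 0 < m.+1%:R :> R by rewrite ltr0n.
rewrite ler_pdivrMr ?expR_gt0//.
have -> : t^-1 ^+ m = t * t^-1 ^+ m.+1 by rewrite exprS mulrA mulfV ?mul1r// gt_eqF.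
rewrite [leLHS]mulrC mulrAC; apply: ler_wpM2r; first exact: ltW.
have -> : t^-1 = m.+1%:R * (t^-1 / m.+1%:R) by rewrite mulrC divfK// gt_eqF.
rewrite expRM_natl exprMn; apply: ler_wpM2l; first by rewrite exprn_ge0// ltW.
rewrite lerXn2r ?nnegrE ?expR_ge0 ?divr_ge0 ?(ltW u0)// ?(ltW m0)//.
by apply: le_trans (expR_ge1Dx _); rewrite lerDr.
Qed.

Lemma is_derive_flat m (t : R) :
  is_derive t 1 (flat m) (flat m.+2 t - m%:R * flat m.+1 t).
Proof.
have [t0|t0|<-] := ltgtP 0 t.
- pose g (s : R) := s^-1 ^+ m * expR (- s^-1).
  have gf : \near t, g t = flat m t.
    near=> s; rewrite /g /flat ifT//; near: s; exact: lt_nbhsr.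
  apply: near_eq_is_derive gf _.
  have tn0 : t != 0 by rewrite gt_eqF.
  have dV : is_derive t 1 (fun s : R => s^-1) (- t ^- 2).
    have dt := @derivable_id _ _ t (1 : R).
    by apply: DeriveDef; [exact: derivableV|rewrite (@deriveV _ _ (id : R -> R) _ _ tn0 dt) derive_id /GRing.scale/= mulr1].
  have dN : is_derive t 1 (fun s : R => - s^-1) (- - t ^- 2) by exact: is_deriveN.
  have dE : is_derive t 1 (fun s : R => expR (- s^-1)) (expR (- t^-1) * (- - t ^- 2)).
    exact: (@is_derive1_comp _ (@expR R) (fun s : R => - s^-1)).
  have dX : is_derive t 1 (fun s : R => s^-1 ^+ m) ((m%:R * t^-1 ^+ m.-1) *: (- t ^- 2)).
    have -> : (fun s : R => s^-1 ^+ m) = (fun s : R => s^-1) ^+ m.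
      by apply/funext => s; rewrite exprfctE.
    exact: (@is_deriveX _ _ (fun s : R => s^-1) m).
  have := @is_deriveM _ _ _ _ _ _ _ _ dX dE; rewrite -[X in is_derive _ _ X]/g.
  congr is_derive.
  rewrite /flat t0 /GRing.scale /= opprK -exprVn.
  by case: m {g dX} => [|m] /=; rewrite ?exprS ?expr0; move: (expR (- t^-1)) (t^-1) => u v; ring.
- have gf : \near t, (fun=> 0 : R) t = flat m t.
    near=> s; rewrite /flat ifF//; apply/negbTE; rewrite -leNgt ltW//; near: s; exact: lt_nbhsl.
  apply: near_eq_is_derive gf _.
  rewrite /flat ltNge (ltW t0)/= mulr0 subr0; exact: is_derive_cst.
- have -> : flat m.+2 0 - m%:R * flat m.+1 0 = 0 by rewrite /flat ltxx mulr0 subr0.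
  have H : (fun h : R => h^-1 *: (flat m (h *: (1 : R) + 0) - flat m 0)) @ 0^' --> (0 : R).
    apply/cvgrPdist_le => e e0.
    near=> h; rewrite addr0 -[h *: 1]/(h * 1) mulr1 [flat m 0]/flat ltxx subr0 sub0r normrN.
    have [h0|h0] := ltP 0 h; last by rewrite /flat ltNge h0 /= scaler0 normr0 ltW.
    have -> : h^-1 *: flat m h = flat m.+1 h.
      by rewrite /flat h0 /GRing.scale /= mulrA -exprS.
    rewrite ger0_norm ?flat_ge0//; apply: le_trans (flat_le _ h0) _.
    rewrite -ler_pdivlMl ?exprn_gt0//.
    apply: le_trans (ler_norm _) _; apply: ltW; near: h; apply: dnbhs0_lt.
    by rewrite mulr_gt0// invr_gt0 exprn_gt0.
  by apply: DeriveDef; [apply/cvg_ex; exists 0|exact/cvg_lim].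
Unshelve. all: by end_near. Qed.

(** One variable is encoded as a row of length one, so that [Cinf_comp] applies. *)
Definition sm1 (g : R -> R) := Cinf setT (fun z : 'rV[R]_1 => g (z 0 0)).

Lemma is_derive_rV1 (g : R -> R) (z : 'rV[R]_1) i d :
  is_derive (z 0 0) 1 g d -> is_derive z (delta_mx 0 i) (fun z : 'rV[R]_1 => g (z 0 0)) d.
Proof.
move=> [dg <-]; rewrite (ord1 i).
have E : (fun h : R => h^-1 *: (g ((h *: delta_mx 0 0 + z) 0 0) - g (z 0 0))) =
   (fun h => h^-1 *: (g (h *: (1 : R) + z 0 0) - g (z 0 0))).
  by apply/funext => h; rewrite !mxE eqxx.
by apply: DeriveDef; rewrite /derivable /derive /= E.
Qed.

Lemma sm1_flat m : sm1 (flat m).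
Proof.
have cf l (z : 'rV[R]_1) : {for z, continuous (fun z : 'rV[R]_1 => flat l (z 0 0))}.
  apply: (@continuous_comp _ _ _ (fun z : 'rV[R]_1 => z 0 0) (flat l)).
    exact: coord_continuous.
  have [d _] := is_derive_flat l (z 0 0).
  exact/differentiable_continuous/derivable1_diffP.
move=> k; elim: k m => [|k IH] m; split=> // i.
split=> [z _|]; first by have [] := is_derive_rV1 i (is_derive_flat m (z 0 0)).
have := CkD openT (IH m.+2) (CkM openT (Ck_cst k setT (- m%:R)) (IH m.+1)).
apply: Ck_ext => [|z _]; first exact: openT.
by have [_ ->] := is_derive_rV1 i (is_derive_flat m (z 0 0)); rewrite mulNr.
Qed.

Definition sstep (t : R) : R := flat 0 t / (flat 0 t + flat 0 (1 - t)).

Lemma flat0_gt0 t : 0 < t -> 0 < flat 0 t.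
Proof. by move=> t0; rewrite /flat t0 expr0 mul1r expR_gt0. Qed.

Lemma sstep_den t : 0 < flat 0 t + flat 0 (1 - t).
Proof.
have [t0|t0] := ltP 0 t; first by rewrite ltr_wpDr ?flat_ge0 ?flat0_gt0.
by rewrite ltr_wpDl ?flat_ge0// flat0_gt0//; lra.
Qed.

Lemma sstep0 t : t <= 0 -> sstep t = 0.
Proof. by move=> t0; rewrite /sstep {1}/flat ltNge t0 mul0r. Qed.

Lemma sstep1 t : 1 <= t -> sstep t = 1.
Proof.
move=> t1; rewrite /sstep.
have -> : flat 0 (1 - t) = 0 by rewrite /flat ltNge subr_le0 t1.
by rewrite addr0 divff// gt_eqF// flat0_gt0// (lt_le_trans ltr01).
Qed.

Lemma sstep_ge0 t : 0 <= sstep t.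
Proof. by rewrite divr_ge0 ?flat_ge0// ltW// sstep_den. Qed.

Lemma sm1_comp n (U : set 'rV[R]_n) (g : R -> R) f :
  open U -> sm1 g -> Cinf U f -> Cinf U (fun x => g (f x)).
Proof.
move=> oU sg fU.
have := @Cinf_comp R n 1 U setT (fun x => \row_(_ < 1) f x) _ oU openT _ sg (fun _ _ => I).
rewrite (_ : _ \o _ = fun x => g (f x)); last by apply/funext => x /=; rewrite mxE.
apply=> j; rewrite (_ : crd _ _ = f)//.
by apply/funext => x; rewrite /crd mxE.
Qed.

Lemma sm1_sstep : sm1 sstep.
Proof.
have c1 : Cinf setT (fun z : 'rV[R]_1 => flat 0 (1 - z 0 0)).
  apply: (@sm1_comp _ _ (flat 0)); [exact: openT|exact: sm1_flat|].
  apply: CinfD; [exact: openT|exact: Cinf_cst|].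
  have -> : (fun z : 'rV[R]_1 => - z 0 0) = (fun z => -1 * z 0 0).
    by apply/funext => z; rewrite mulN1r.
  by apply: CinfM; [exact: openT|exact: Cinf_cst|move=> k; exact: Ck_coord].
apply: CinfM; [exact: openT|exact: sm1_flat|move=> k; apply: Ck_inv; first exact: openT].
  by move=> z _; rewrite gt_eqF// sstep_den.
by apply: CkD; [exact: openT|exact: sm1_flat|exact: c1].
Qed.

(** A smooth function on the whole line which is [1 / t] for [t >= c] and 0 for [t <= c / 2]; it
    serves to divide by averages whose positivity is known near a point only. *)
Definition sinv (c t : R) : R := sstep (2 * t / c - 1) / t.

Lemma sinvE c t : 0 < c -> c <= t -> sinv c t = t^-1.
Proof.
move=> c0 ct; rewrite /sinv sstep1 ?mul1r// lerBrDr ler_pdivlMr//; lra.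
Qed.

Lemma sm1_sinv c : 0 < c -> sm1 (sinv c).
Proof.
move=> c0; apply/Cinf_pt => z _.
have co : continuous (fun z : 'rV[R]_1 => z 0 0) by exact: coord_continuous.
have [z0|z0] := ltP 0 (z 0 0).
  have oU : open [set z : 'rV[R]_1 | 0 < z 0 0].
    by apply: (open_comp (fun z _ => co z) (@open_gt R 0)).
  apply: (@Cinf_sub _ _ [set z : 'rV[R]_1 | 0 < z 0 0]); first by move=> _ ->.
  apply: CinfM => //; last first.
    by move=> k; apply: Ck_inv => // [x /gt_eqF ->//|]; exact: Ck_coord.
  apply: (@sm1_comp _ _ sstep) => //; first exact: sm1_sstep.
  apply: CinfD => //; last exact: Cinf_cst.
  apply: CinfM => //; last exact: Cinf_cst.
  by apply: CinfM => //; [exact: Cinf_cst|move=> k; exact: Ck_coord].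
have oU : open [set z : 'rV[R]_1 | z 0 0 < c / 2].
  by apply: (open_comp (fun z _ => co z) (@open_lt R (c / 2))).
apply: (@Cinf_sub _ _ [set z : 'rV[R]_1 | z 0 0 < c / 2]).
  by move=> _ ->; rewrite /=; lra.
apply: Cinf_ext oU _ (Cinf_cst _ 0) => x /= xc.
by rewrite /sinv sstep0 ?mul0r// subr_le0 ler_pdivrMr//; lra.
Qed.

End SmoothStep.

Section SmoothNear.
Variable R : realType.

Definition CN m (z : 'rV[R]_m) (f : 'rV[R]_m -> R) :=
  exists W : set 'rV[R]_m, [/\ open W, W z & Cinf W f].

Lemma CN_near m (z : 'rV[R]_m) f g : {near z, f =1 g} -> CN z f -> CN z g.
Proof.
rewrite /prop_near1 nbhsE => -[V [oV Vz] fg] [W [oW Wz fW]].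
exists (W `&` V); split; [exact: openI|by []|].
apply: (Cinf_ext (openI oW oV) (f := f)); first by move=> y [_ /fg].
by apply: Cinf_sub fW => y [].
Qed.

Lemma CN_cont m (z : 'rV[R]_m) f : CN z f -> {for z, continuous f}.
Proof. by move=> [W [oW Wz fW]]; exact: Cinf_cont fW Wz. Qed.

Lemma CN_cst m (z : 'rV[R]_m) a : CN z (fun=> a).
Proof. by exists setT; split=> //; [exact: openT|exact: Cinf_cst]. Qed.

Lemma CND m (z : 'rV[R]_m) f g : CN z f -> CN z g -> CN z (fun y => f y + g y).
Proof.
move=> [V [oV Vz fV]] [W [oW Wz gW]]; exists (V `&` W); split=> //.
  exact: openI.
by apply: CinfD; [exact: openI|apply: Cinf_sub fV => y []|apply: Cinf_sub gW => y []].
Qed.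

Lemma CNM m (z : 'rV[R]_m) f g : CN z f -> CN z g -> CN z (fun y => f y * g y).
Proof.
move=> [V [oV Vz fV]] [W [oW Wz gW]]; exists (V `&` W); split=> //.
  exact: openI.
by apply: CinfM; [exact: openI|apply: Cinf_sub fV => y []|apply: Cinf_sub gW => y []].
Qed.

Lemma CN_sum m (z : 'rV[R]_m) (I : Type) (r : seq I) f :
  (forall i, CN z (f i)) -> CN z (fun y => \sum_(i <- r) f i y).
Proof.
move=> h; elim: r => [|i r IH].
  by under eq_fun do rewrite big_nil; exact: CN_cst.
by under eq_fun do rewrite big_cons; exact: CND.
Qed.

Lemma CN_open m (z : 'rV[R]_m) f (U : set 'rV[R]_m) : open U -> U z -> Cinf U f -> CN z f.
Proof. by move=> oU Uz fU; exists U. Qed.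

Lemma CN_comp m p (z : 'rV[R]_m) (F : 'rV[R]_m -> 'rV[R]_p) f :
  (forall i, CN z (crd F i)) -> CN (F z) f -> CN z (f \o F).
Proof.
move=> hF [W [oW Wz fW]].
have /choice[V hV] : forall i, exists V, [/\ open V, V z & Cinf V (crd F i)].
  by move=> i; have [V] := hF i; exists V.
have cF : {for z, continuous F} by apply: cont_rV => i; exact: CN_cont (hF i).
have : \forall y \near z, (forall i, V i y) /\ W (F y).
  apply: filterI; last by apply: cF; exact: open_nbhs_nbhs.
  apply: (@filter_forall _ _ _ (nbhs z)) => i.
  by have [h1 h2 _] := hV i; exact: open_nbhs_nbhs.
move=> /near_normP[d d0 hd]; exists [set y | `|y - z| < d].
split; [exact: open_nball|by rewrite /= subrr normr0|].
apply: (Cinf_comp (open_nball (r := d)) oW _ fW) => [i|y /hd[_ //]].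
by have [_ _] := hV i; apply: Cinf_sub => y /hd[+ _]; exact.
Qed.

Lemma CN_coord m (z : 'rV[R]_m) i : CN z (fun y => y 0 i).
Proof. by exists setT; split=> //; [exact: openT|move=> k; exact: Ck_coord]. Qed.

Lemma CN_sm1 m (z : 'rV[R]_m) g f : sm1 g -> CN z f -> CN z (fun y => g (f y)).
Proof. by move=> gs [W [oW Wz fW]]; exists W; split=> //; exact: sm1_comp. Qed.

End SmoothNear.

Section Manifold.
Variables (R : realType) (n : nat) (M : manifold R n).
Implicit Types (x y : M) (c d : chart R n M).

Local Notation atl := (atlas (m := M)).
Local Notation msm U f := (fsmooth (f := mspace M) U f).
Local Notation CsmM f := (Csm (X := mspace M) f).

Definition cimg c := cmap c @` cdom c.

Lemma cimg_cinv c z : cimg c z -> cdom c (cinv c z) /\ cmap c (cinv c z) = z.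
Proof. by move=> [x xc <-]; rewrite cmapK. Qed.

Lemma open_cimg c (U : set M) : open U -> open (cmap c @` (cdom c `&` U)).
Proof.
move=> oU.
have -> : cmap c @` (cdom c `&` U) = cimg c `&` cinv c @^-1` U.
  apply/seteqP; split=> [_ [x [xc xU] <-]|z [zc zU]].
    by split; [exists x|rewrite /preimage/= cmapK].
  by have [h1 h2] := cimg_cinv zc; exists (cinv c z).
move=> z [zc zU]; apply: filterI.
  by apply: open_nbhs_nbhs; split=> //; exact: cimg_open.
by apply: (@cinv_cont _ _ _ c z zc); exact: open_nbhs_nbhs.
Qed.

Definition snear x f := exists c, [/\ atl c, cdom c x & CN (cmap c x) (f \o cinv c)].

(** Smoothness in one chart passes to the others through the smooth transition maps, so two germs
    can always be computed in a common chart. *)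
Lemma snear_chart x f c : snear x f -> atl c -> cdom c x -> CN (cmap c x) (f \o cinv c).
Proof.
move=> [d [ad xd fd]] ac xc.
have tr : forall i, CN (cmap c x) (crd (cmap d \o cinv c) i).
  move=> i; exists (cmap c @` (cdom c `&` cdom d)); split; last exact: atlas_compat.
    exact/open_cimg/cdom_open.
  by exists x.
have := CN_comp tr; rewrite /= cmapK// => /(_ _ fd).
apply: CN_near; have : (cmap c @` (cdom c `&` cdom d)) (cmap c x) by exists x.
move=> h; have := open_nbhs_nbhs (conj (open_cimg (cdom_open d)) h).
by apply: filterS => _ [y [yc yd] <-] /=; rewrite (cmapK yc) (cmapK yd).
Qed.

Lemma near_chart x c (Q : set M) : cdom c x -> nbhs x Q ->
  \forall z \near cmap c x, cimg c z /\ Q (cinv c z).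
Proof.
move=> xc xQ; have ic : cimg c (cmap c x) by exists x.
apply: filterI; first by apply: open_nbhs_nbhs; split=> //; exact: cimg_open.
by apply: (cinv_cont ic); rewrite cmapK.
Qed.

Lemma msm_snear (U : set M) f x : nbhs x U -> msm U f -> snear x f.
Proof.
rewrite nbhsE => -[V [oV Vx] VU] fU; have [c ac xc] := atlas_cover x.
exists c; split=> //; exists (cmap c @` (cdom c `&` V)); split.
- exact: open_cimg.
- by exists x.
- by apply: Cinf_sub (fU c ac) => _ [y [yc /VU yU] <-]; exists y.
Qed.

Lemma snear_msm (U : set M) f : (forall x, U x -> snear x f) -> msm U f.
Proof.
move=> h c ac; apply/Cinf_pt => _ [x [xc xU] <-].
have [W [oW Wx fW]] := snear_chart (h x xU) ac xc.
by apply: Cinf_sub fW => _ ->.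
Qed.

Lemma Csm_snear f x : CsmM f -> snear x f.
Proof. by apply: msm_snear; exact: filterT. Qed.

Lemma snear_Csm f : (forall x, snear x f) -> CsmM f.
Proof. by move=> h; apply: snear_msm => x _. Qed.

Lemma snear_eq x f g : {near x, f =1 g} -> snear x f -> snear x g.
Proof.
move=> fg [c [ac xc fc]]; exists c; split=> //; apply: CN_near fc.
by apply: filterS (near_chart xc fg) => z [].
Qed.

Lemma snear_cont x f : snear x f -> {for x, continuous f}.
Proof.
move=> [c [ac xc fc]].
apply: (@near_eq_cont _ _ ((f \o cinv c) \o cmap c)).
  have := open_nbhs_nbhs (conj (cdom_open c) xc).
  by apply: filterS => y yc /=; rewrite cmapK.
by apply: continuous_comp; [exact: cmap_cont|exact: CN_cont].
Qed.

Lemma Csm_cont f : CsmM f -> continuous f.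
Proof. by move=> h x; apply: snear_cont; exact: Csm_snear. Qed.

Lemma snear_cst x (a : R) : snear x (fun=> a).
Proof. by have [c ac xc] := atlas_cover x; exists c; split=> //; exact: CN_cst. Qed.

Lemma snearD x f g : snear x f -> snear x g -> snear x (fun y => f y + g y).
Proof.
move=> [c [ac xc fc]] gx; exists c; split=> //.
exact: CND fc (snear_chart gx ac xc).
Qed.

Lemma snearM x f g : snear x f -> snear x g -> snear x (fun y => f y * g y).
Proof.
move=> [c [ac xc fc]] gx; exists c; split=> //.
exact: CNM fc (snear_chart gx ac xc).
Qed.

Lemma snear_sum x (I : Type) (r : seq I) f :
  (forall i, snear x (f i)) -> snear x (fun y => \sum_(i <- r) f i y).
Proof.
move=> h; elim: r => [|i r IH].
  by under eq_fun do rewrite big_nil; exact: snear_cst.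
by under eq_fun do rewrite big_cons; exact: snearD.
Qed.

Lemma snear_comp p x (F : M -> 'rV[R]_p) f :
  (forall i, snear x (fun y => F y 0 i)) -> CN (F x) f -> snear x (f \o F).
Proof.
move=> hF fF; have [c ac xc] := atlas_cover x; exists c; split=> //.
have := @CN_comp R _ _ (cmap c x) (F \o cinv c) f; rewrite /= cmapK//; apply=> //.
by move=> i; exact: snear_chart (hF i) ac xc.
Qed.

Lemma snear_sm1 x g f : sm1 g -> snear x f -> snear x (fun y => g (f y)).
Proof.
move=> gs [c [ac xc fc]]; exists c; split=> //; exact: (CN_sm1 gs fc).
Qed.

Lemma snear_coord x c i : atl c -> cdom c x -> snear x (fun y => cmap c y 0 i).
Proof.
move=> ac xc; exists c; split=> //; apply: CN_near (CN_coord _ i).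
apply: filterS (near_chart xc filterT) => z [zc _].
by rewrite /= (cimg_cinv zc).2.
Qed.

Lemma cmap_nbhs x c (W : set 'rV[R]_n) : cdom c x -> nbhs (cmap c x) W ->
  nbhs x (cdom c `&` cmap c @^-1` W).
Proof.
move=> xc hW; apply: filterI; first exact: open_nbhs_nbhs (conj (cdom_open c) xc).
exact: (cmap_cont xc).
Qed.

Lemma bump x (U : set M) : nbhs x U -> exists b : M -> R, exists C : set M,
  [/\ CsmM b, forall y, 0 <= b y, nbhs x [set y | b y = 1], compact C &
      C `<=` U /\ forall y, ~ C y -> b y = 0].
Proof.
move=> xU; have [c ac xc] := atlas_cover x.
have /near_normP[r r0 hr] := near_chart xc xU.
(* The squared Euclidean distance is used because the norm of rows, a maximum, is not smooth. *)
pose N2 (z : 'rV[R]_n) : R := \sum_i (z 0 i - cmap c x 0 i) ^+ 2.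
have r2 : 0 < (r / 2) ^+ 2 by rewrite exprn_gt0// divr_gt0.
pose S := [set z : 'rV[R]_n | N2 z <= (r / 2) ^+ 2].
have N2x : N2 (cmap c x) = 0 by rewrite /N2 big1// => i _; rewrite subrr expr0n.
have SN z : S z -> `|z - cmap c x| < r.
  move=> hz; apply: rV_norm_lt => // i; rewrite !mxE.
  have h : (z 0 i - cmap c x 0 i) ^+ 2 <= (r / 2) ^+ 2.
    by apply: le_trans hz; rewrite /N2 (bigD1 i)//= lerDl sumr_ge0// => j _; rewrite sqr_ge0.
  rewrite -ler_sqrt ?sqr_ge0// in h; rewrite ?sqrtr_sqr in h.
  by apply: le_lt_trans h _; rewrite ger0_norm; lra.
have CNN2 z : CN z N2.
  apply: CN_sum => i; under eq_fun do rewrite expr2.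
  by apply: CNM; apply: CND; (try exact: CN_coord); exact: CN_cst.
have cN2 : continuous N2 by move=> z; exact: CN_cont (CNN2 z).
(* The argument of [sstep] is at least 1 where [N2 <= (r / 2) ^+ 2 / 2] and negative off [S]. *)
pose b y := if `[< cdom c y >] then sstep (2 - N2 (cmap c y) * (2 / (r / 2) ^+ 2)) else 0.
pose C := cinv c @` S.
have cC : compact C.
  apply: continuous_compact.
    apply: continuous_in_subspaceT => z; rewrite inE => /SN/hr[zc _].
    exact: cinv_cont.
  apply: bounded_closed_compact.
    exists (`|cmap c x| + r); split; first exact: num_real.
    move=> K rK z /SN zx; apply: ltW; apply: le_lt_trans rK.
    have := ler_normD (z - cmap c x) (cmap c x); rewrite subrK; lra.
  apply: (@closed_comp _ _ N2 [set t : R | t <= (r / 2) ^+ 2]) => [z _|]; first exact: cN2.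
  exact: closed_le.
have b0 y : ~ C y -> b y = 0.
  move=> Cy; rewrite /b; case: ifP => // /asboolP yc; apply: sstep0.
  rewrite subr_le0 leNgt; apply/negP => h; apply: Cy; exists (cmap c y); last exact: cmapK.
  by move: h; rewrite mulrA ltr_pdivrMr// mulrC ltr_pM2l// => /ltW.
exists b, C; split=> //.
- apply: snear_Csm => y; have [yc|yc] := pselect (cdom c y).
    exists c; split=> //; apply: (@CN_near R _ _ (fun z => sstep (2 - N2 z * (2 / (r / 2) ^+ 2)))).
      apply: filterS (near_chart yc filterT) => z [zc _].
      by have [z1 z2] := cimg_cinv zc; rewrite /b /= ifT ?z2//; apply/asboolP.
    apply: (CN_sm1 (@sm1_sstep R)); apply: CND; first exact: CN_cst.
    under eq_fun do rewrite -mulrN; apply: CNM (CNN2 _) (CN_cst _ _).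
  (* Outside the chart domain [b] vanishes near [y]: the compact set [C] is closed because the
     manifold is Hausdorff. *)
  have : nbhs y (~` C).
    apply: open_nbhs_nbhs; split; last first.
      by move=> [z /SN/hr[/cimg_cinv[h _] _] E]; apply: yc; rewrite -E.
    by apply: closed_openC; apply: compact_closed => //; exact: mhausdorff.
  move=> h; apply: snear_eq (snear_cst y 0); apply: filterS h => z zC.
  by rewrite b0.
- by move=> y; rewrite /b; case: ifP => // _; exact: sstep_ge0.
- have : nbhs (cmap c x) [set z | N2 z < (r / 2) ^+ 2 / 2].
    apply: open_nbhs_nbhs; split; last by rewrite /= N2x divr_gt0.
    by apply: (open_comp (fun z _ => cN2 z) (@open_lt R ((r / 2) ^+ 2 / 2))).
  move=> /(cmap_nbhs xc); apply: filterS => y [yc /= yN].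
  rewrite /b ifT; last exact/asboolP.
  rewrite sstep1// lerBrDr mulrA -lerBrDl ler_pdivrMr// .
  by move: yN; rewrite ltr_pdivlMr//; lra.
- by split=> // _ [z /SN/hr[_ h] <-].
Qed.

Lemma Csm_bumpM (U C : set M) (b : M -> R) f : CsmM b -> compact C -> C `<=` U ->
  open U -> (forall y, ~ C y -> b y = 0) -> msm U f -> CsmM (fun y => b y * f y).
Proof.
move=> bs cC CU oU b0 fU; apply: snear_Csm => y; have [yU|yU] := pselect (U y).
  by apply: snearM (Csm_snear y bs) (msm_snear _ fU); exact: open_nbhs_nbhs.
apply: snear_eq (snear_cst y 0).
have : nbhs y (~` C).
  apply: open_nbhs_nbhs; split; last by move=> /CU.
  by apply: closed_openC; apply: compact_closed => //; exact: mhausdorff.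
by apply: filterS => z zC; rewrite b0// mul0r.
Qed.

(* Local coordinates [tau] at [x], given by global smooth functions, with local
   inverse [kap]. *)
Definition lcoord x (tau : M -> 'rV[R]_n) (kap : 'rV[R]_n -> M) (dl : R) :=
  [/\ 0 < dl, forall i, CsmM (crd tau i) & tau x = 0 /\ kap 0 = x] /\
  [/\ forall z, `|z| < dl -> tau (kap z) = z,
      exists c, [/\ atl c, forall z, `|z| < dl -> cdom c (kap z) &
        Cinfv [set z | `|z| < dl] (cmap c \o kap)] &
      \forall y \near x, `|tau y| < dl /\ kap (tau y) = y].

Lemma lcoord_CN x tau kap dl f z : lcoord x tau kap dl -> `|z| < dl ->
  snear (kap z) f -> CN z (f \o kap).
Proof.
move=> [[d0 _ _] [_ [c [ac ck kc]] _]] zd fz.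
have := @CN_comp R _ _ z (cmap c \o kap) (f \o cinv c).
have kCN i : CN z (crd (cmap c \o kap) i).
  by apply: (CN_open _ _ (kc i)) => //; exact: open_nball0.
move=> /(_ kCN (snear_chart fz ac (ck _ zd))).
apply: CN_near; have := open_nbhs_nbhs (conj (@open_nball0 R n dl) zd).
by apply: filterS => w wd /=; rewrite cmapK//; exact: ck.
Qed.

Lemma lcoord_Cinf x tau kap dl f : lcoord x tau kap dl -> CsmM f ->
  Cinf [set z | `|z| < dl] (f \o kap).
Proof.
move=> h fs; apply/Cinf_pt => z zd.
have [W [oW Wz fW]] := lcoord_CN h zd (Csm_snear _ fs).
by apply: Cinf_sub fW => _ ->.
Qed.

Lemma lcoord_cont x tau kap dl z : lcoord x tau kap dl -> `|z| < dl ->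
  {for z, continuous kap}.
Proof.
move=> [[d0 _ _] [_ [c [ac ck kc]] _]] zd.
apply: (@near_eq_cont _ _ (cinv c \o (cmap c \o kap))).
  have := open_nbhs_nbhs (conj (@open_nball0 R n dl) zd).
  by apply: filterS => w wd /=; rewrite cmapK//; exact: ck.
apply: continuous_comp; last by apply: cinv_cont; exists (kap z) => //; exact: ck.
apply: cont_rV => i; have := kc i 0%N; rewrite /= => -[+ _]; exact.
Qed.

Lemma tau_cont x tau kap dl : lcoord x tau kap dl -> continuous tau.
Proof. by move=> [[_ h _] _] y; apply: cont_rV => i; exact: Csm_cont (h i) y. Qed.

(** The chart is cut off by a bump function, so that its coordinates become global smooth functions,
    which can be averaged over a group. *)
Lemma lcoord_chart x : exists tau kap dl, lcoord x tau kap dl.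
Proof.
have [c ac xc] := atlas_cover x.
have xU := open_nbhs_nbhs (conj (cdom_open c) xc).
have [b [C [bs b0 b1 cC [CU bC]]]] := bump xU.
have /near_normP[d d0 hd] := near_chart xc b1.
pose tau y : 'rV[R]_n := \row_i (b y * (cmap c y 0 i - cmap c x 0 i)).
exists tau, (fun z => cinv c (z + cmap c x)), d.
have kd z : `|z| < d -> cimg c (z + cmap c x) /\ b (cinv c (z + cmap c x)) = 1.
  by move=> zd; apply: hd; rewrite addrK.
have tau1 y : b y = 1 -> tau y = cmap c y - cmap c x.
  by move=> by1; apply/rowP => i; rewrite !mxE by1 mul1r.
split; split=> //.
- move=> i; have -> : crd tau i = fun y => b y * (cmap c y 0 i - cmap c x 0 i).
    by apply/funext => y; rewrite /crd mxE.
  apply: (Csm_bumpM bs cC CU (cdom_open c) bC); apply: snear_msm => y yc.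
  by apply: snearD; [exact: snear_coord|exact: snear_cst].
- by rewrite add0r cmapK// tau1 ?subrr//; exact: (nbhs_singleton b1).
- by move=> z /kd[h1 h2]; rewrite tau1// (cimg_cinv h1).2 addrK.
- exists c; split=> // [z /kd[/cimg_cinv[] //]|i].
  apply: (@Cinf_ext _ _ _ (fun z => z 0 i + cmap c x 0 i)); first exact: open_nball0.
    by move=> z /kd[/cimg_cinv[_ h] _]; rewrite /crd /= h mxE.
  by apply: CinfD; [exact: open_nball0|move=> k; exact: Ck_coord|exact: Cinf_cst].
- have h2 : nbhs (cmap c x) [set z | `|z - cmap c x| < d].
    by apply/near_normP; exists d.
  apply: filterS2 b1 (cmap_nbhs xc h2) => y by1 [yc /= yd].
  by rewrite tau1// subrK cmapK.
Qed.

End Manifold.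

Lemma finite_subcover (T : topologicalType) (C : set T) (U : T -> set T) :
  compact C -> (forall x, C x -> nbhs x (U x)) ->
  exists s : seq T, {in s, forall x, C x} /\ forall y, C y -> exists2 x, x \in s & U x y.
Proof.
move=> /compact_near_coveringP kC hU.
(* The filter of eventual sets of the finite lists of points of [C] ordered by inclusion: the
   near-covering property for this filter is the finite subcover property. *)
pose F : set_system (seq T) := [set S | exists2 s0 : seq T, {in s0, forall x, C x} &
  forall s : seq T, {subset s0 <= s} -> {in s, forall x, C x} -> S s].
have FF : Filter F.
  split; first by exists [::].
    move=> P Q [s1 h1 p1] [s2 h2 p2]; exists (s1 ++ s2).
      by move=> x; rewrite mem_cat => /orP[/h1|/h2].
    by move=> s hs sC; split; [apply: p1|apply: p2] => // x xs; apply: hs;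
       rewrite mem_cat xs ?orbT.
  by move=> P Q PQ [s1 h1 p1]; exists s1 => // s hs sC; apply: PQ; exact: p1.
have [x Cx|s0 h0 p0] := kC _ F (fun s y => exists2 x, x \in s & U x y) FF.
  exists (U x, [set s : seq T | x \in s]) => /=; last by move=> [y s] [/= yU xs]; exists x.
  split; first exact: hU.
  exists [:: x]; first by move=> y; rewrite inE => /eqP ->.
  by move=> s hs _; apply: hs; rewrite inE.
by exists s0; split=> // y; apply: p0.
Qed.

(** * Haar integral *)

Section LieGroupBasics.
Variables (R : realType) (k : nat) (G : lieGroup R k).
Implicit Types g h : G.

Local Notation "1" := (lone G).
Local Infix "*g" := (@lmul _ _ G) (at level 40).
Local Notation "g ^-" := (linv g) (at level 3, format "g ^-").

Lemma lmulgV g : g *g g^- = 1.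
Proof.
rewrite -[LHS]lmul1 -{1}(lmulV (g^-)) -lmulA.
by rewrite [g^- *g _]lmulA lmulV lmul1 lmulV.
Qed.

Lemma lmulg1 g : g *g 1 = g.
Proof. by rewrite -(lmulV g) lmulA lmulgV lmul1. Qed.

Lemma lmulKV g h : g^- *g (g *g h) = h.
Proof. by rewrite lmulA lmulV lmul1. Qed.

Lemma lmulVK g h : g *g (g^- *g h) = h.
Proof. by rewrite lmulA lmulgV lmul1. Qed.

Lemma lmulgK g h : (h *g g) *g g^- = h.
Proof. by rewrite -lmulA lmulgV lmulg1. Qed.

Lemma lmulgKV g h : (h *g g^-) *g g = h.
Proof. by rewrite -lmulA lmulV lmulg1. Qed.

Lemma linv_uniq g h : g *g h = 1 -> h = g^-.
Proof. by move=> E; rewrite -[h]lmul1 -(lmulV g) -lmulA E lmulg1. Qed.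

Lemma linvK g : (g^-)^- = g.
Proof. by apply/esym/linv_uniq/lmulV. Qed.

Lemma linvM g h : (g *g h)^- = h^- *g g^-.
Proof. by apply/esym/linv_uniq; rewrite -lmulA lmulVK lmulgV. Qed.

Lemma linv1 : (1)^- = 1.
Proof. by apply/esym/linv_uniq; rewrite lmul1. Qed.

Lemma lmul_cont : continuous (fun p : G * G => p.1 *g p.2).
Proof.
apply/continuousP => V oV; case: (lmul_smooth G) => _ h _; exact: h.
Qed.

Lemma linv_cont : continuous (@linv _ _ G).
Proof.
apply/continuousP => V oV; case: (linv_smooth G) => _ h _; exact: h.
Qed.

Lemma lmulr_cont h : continuous (fun g => g *g h).
Proof.
move=> g; apply: (@continuous_comp _ _ _ (fun g => (g, h)) (fun p : G * G => p.1 *g p.2)).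
  by apply: cvg_pair; [exact: cvg_id|exact: cvg_cst].
exact: lmul_cont.
Qed.

Lemma lmull_cont h : continuous (fun g => h *g g).
Proof.
move=> g; apply: (@continuous_comp _ _ _ (fun g => (h, g)) (fun p : G * G => p.1 *g p.2)).
  by apply: cvg_pair; [exact: cvg_cst|exact: cvg_id].
exact: lmul_cont.
Qed.

Definition closed_subgroup (Gam : set G) :=
  [/\ closed Gam, Gam 1, forall a b, Gam a -> Gam b -> Gam (a *g b) &
      forall a, Gam a -> Gam (a^-)].

Definition Cc (f : G -> R) := continuous f /\
  exists2 C, compact C & forall g, ~ C g -> f g = 0.

Definition Ccp (f : G -> R) := Cc f /\ forall g, 0 <= f g.

Lemma CcD f1 f2 (a : R) : Cc f1 -> Cc f2 -> Cc (fun g => a * f1 g + f2 g).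
Proof.
move=> [c1 [C1 k1 z1]] [c2 [C2 k2 z2]]; split.
  move=> g; apply: (@continuousD _ _ _ (fun g => a * f1 g) f2); last exact: c2.
  by apply: (@continuousM _ _ (fun=> a) f1); [exact: cst_continuous|exact: c1].
exists (C1 `|` C2); first exact: compactU.
by move=> g C12; rewrite z1 ?z2 ?mulr0 ?addr0// => ?; apply: C12; [right|left].
Qed.

Lemma Cc_max f : Cc f -> Ccp (fun g => Num.max (f g) 0).
Proof.
move=> [c1 [C1 k1 z1]]; split; last by move=> g; rewrite le_max lexx orbT.
split; last by exists C1 => // g /z1 ->; rewrite maxxx.
by move=> g; apply: continuous_max; [exact: c1|exact: cst_continuous].
Qed.

Lemma Cc_trans f g : Cc f -> Cc (fun h => f (h *g g)).
Proof.
move=> [c1 [C1 k1 z1]]; split.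
  by move=> h; apply: (@continuous_comp _ _ _ (fun h => h *g g)); [exact: lmulr_cont|exact: c1].
exists ((fun h => h *g g^-) @` C1).
  by apply: continuous_compact => //; apply: continuous_subspaceT; exact: lmulr_cont.
by move=> h hC; apply: z1 => hg; apply: hC; exists (h *g g) => //; rewrite lmulgK.
Qed.

Lemma compact_bound (T : topologicalType) (C : set T) (f : T -> R) :
  compact C -> (forall x, C x -> {for x, continuous f}) ->
  exists2 B, 0 < B & forall x, C x -> `|f x| <= B.
Proof.
move=> cC cf; have [->|/set0P C0] := eqVneq C set0; first by exists 1%R.
have cn : {within C, continuous (fun x => `|f x|)}.
  apply: continuous_in_subspaceT => x; rewrite inE => Cx.
  by apply: (@continuous_comp _ _ _ f Num.norm); [exact: cf|exact: norm_continuous].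
have [x xC hx] := compact_EVT_max C0 cC cn.
by exists (`|f x| + 1) => [|y Cy]; [rewrite ltr_wpDl|rewrite ler_wpDr// hx// inE].
Qed.

Lemma Ccp_bound f : Ccp f -> exists2 B, 0 < B & forall g, f g <= B.
Proof.
move=> [[c1 [C1 k1 z1]] f0].
have [B B0 hB] := compact_bound k1 (fun x _ => c1 x).
exists B => // g; have [/hB|/z1 ->] := pselect (C1 g); last exact: ltW.
by rewrite ger0_norm.
Qed.

Lemma Cc_bump (U : set G) g0 : nbhs g0 U -> exists b : G -> R,
  [/\ Ccp b, 0 < b g0, \forall g \near g0, 0 < b g & forall g, b g != 0 -> U g].
Proof.
move=> /(@bump _ _ G)[b [C [bs b0 b1 kC [CU bC]]]].
exists b; split.
- by split=> //; split; [exact: Csm_cont|exists C].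
- by have := nbhs_singleton b1 => /= ->.
- by apply: filterS b1 => g /= ->.
- by move=> g; apply: contra_neqP => gU; apply: bC => /CU.
Qed.

Lemma Cc_pos (C : set G) : compact C -> exists g0 : G -> R, Ccp g0 /\
  forall g, C g -> 0 < g0 g.
Proof.
move=> kC; have /choice[b hb] : forall g1 : G, exists b : G -> R,
   [/\ Ccp b, 0 < b g1, \forall g \near g1, 0 < b g & forall g, b g != 0 -> setT g].
  by move=> g1; exact: Cc_bump filterT.
have [g _|D [DC cD]] := finite_subcover (U := fun g1 => [set g | 0 < b g1 g]) kC.
  by have [_ _ + _] := hb g.
exists (fun g => \sum_(g1 <- D) b g1 g); split.
  elim: {DC cD} D => [|g1 r IH].
    under eq_fun do rewrite big_nil; split=> //; split; first by move=> g; exact: cst_continuous.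
    by exists set0 => //; exact: compact0.
  under eq_fun do rewrite big_cons; have [[h1 h2] _ _ _] := hb g1; split.
    by have := CcD 1 h1 IH.1; under eq_fun do rewrite mul1r.
  by move=> g; apply: addr_ge0 => //; exact: IH.2.
move=> g /cD[g1 g1D /= gb]; rewrite (big_rem g1)//= ltr_wpDr// sumr_ge0// => g2 _.
by have [[_ h] _ _ _] := hb g2.
Qed.

(** Uniform continuity by compactness, in two cases: [t] lies in the support, or its translate does.
    When neither does, both values are zero. *)
Lemma Cc_unif f (e : R) : Cc f -> 0 < e ->
  \forall v \near 1, forall t, `|f (v *g t) - f t| <= e.
Proof.
move=> [c1 [C /compact_near_coveringP kC z1]] e0.
have A : \forall v \near 1, C `<=` (fun t => `|f (v *g t) - f t| <= e).
  apply: kC => t Ct.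
  have : {for (t, 1), continuous (fun p : G * G => f (p.2 *g p.1) - f p.1)}.
    apply: continuousB.
      apply: (@continuous_comp _ _ _ (fun p : G * G => p.2 *g p.1)); last exact: c1.
      apply: (@continuous_comp _ _ _ (fun p : G * G => (p.2, p.1)) (fun p : G * G => p.1 *g p.2)).
        by apply: cvg_pair; [exact: cvg_snd|exact: cvg_fst].
      exact: lmul_cont.
    by apply: (@continuous_comp _ _ _ fst); [exact: cvg_fst|exact: c1].
  move=> /cvgrPdist_le/(_ _ e0); rewrite /= lmul1 subrr.
  by apply: filterS => p; rewrite sub0r normrN.
have B : \forall v \near 1, C `<=` (fun t => `|f t - f (v^- *g t)| <= e).
  apply: kC => t Ct.
  have : {for (t, 1), continuous (fun p : G * G => f p.1 - f (p.2^- *g p.1))}.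
    apply: continuousB.
      by apply: (@continuous_comp _ _ _ fst); [exact: cvg_fst|exact: c1].
    apply: (@continuous_comp _ _ _ (fun p : G * G => p.2^- *g p.1)); last exact: c1.
    apply: (@continuous_comp _ _ _ (fun p : G * G => (p.2^-, p.1)) (fun p : G * G => p.1 *g p.2)).
      apply: cvg_pair; last exact: cvg_fst.
      by apply: (@continuous_comp _ _ _ snd); [exact: cvg_snd|exact: linv_cont].
    exact: lmul_cont.
  move=> /cvgrPdist_le/(_ _ e0); rewrite /= linv1 lmul1 subrr.
  by apply: filterS => p; rewrite sub0r normrN.
apply: filterS2 A B => v hA hB t.
have [/hA//|Ct] := pselect (C t).
have [/hB|Cvt] := pselect (C (v *g t)); first by rewrite lmulKV.
by rewrite !z1// subrr normr0 ltW.
Qed.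

End LieGroupBasics.

Section Haar.
Variables (R : realType) (k : nat) (G : lieGroup R k) (Gam : set G).
Hypothesis Gsub : closed_subgroup Gam.
Implicit Types (g h : G) (s : seq (R * G)) (f phi : G -> R).

Local Notation e1 := (lone G).
Local Infix "*g" := (@lmul _ _ G) (at level 40).
Local Notation "g ^-" := (linv g) (at level 3, format "g ^-").

(** Only translates by elements of [Gam] are allowed and domination is required on [Gam] only, while
    the functions live on [G]. One construction then serves for [G] itself and for compact
    stabilizers. *)
Definition cov f phi s := (forall p, p \in s -> 0 <= p.1 /\ Gam p.2) /\
  forall h, Gam h -> f h <= \sum_(p <- s) p.1 * phi (h *g p.2).

Definition wt s : R := \sum_(p <- s) p.1.

(* Weil's covering number [(f : phi)]. *)
Definition Qc f phi : R := inf [set x | exists2 s, cov f phi s & x = wt s].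

Definition good phi := Ccp phi /\ 0 < phi e1.

Lemma wt_ge0 f phi s : cov f phi s -> 0 <= wt s.
Proof. by move=> [h _]; rewrite /wt big_seq sumr_ge0// => p /h[]. Qed.

Lemma cov_ex f phi : Ccp f -> good phi -> exists s, cov f phi s.
Proof.
have [clG G1 GM GV] := Gsub.
move=> fC [phiC phi0]; have [B B0 hB] := Ccp_bound fC.
have [[_ [C kC z1]] _] := fC; have [[cphi _] phige] := phiC.
have kD : compact (C `&` Gam) by exact: compact_closedI.
have [g _|D [DG cD]] := finite_subcover
    (U := fun g => [set h | phi e1 / 2 < phi (h *g g^-)]) kD.
  apply: open_nbhs_nbhs; split; last by rewrite /= lmulgV; lra.
  apply: (@open_comp _ _ (fun h => phi (h *g g^-)) [set y | phi e1 / 2 < y]).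
    move=> h _; apply: (@continuous_comp _ _ _ (fun h => h *g g^-)); last exact: cphi.
    exact: lmulr_cont.
  exact: open_gt.
(* Near each centre the translate of [phi] exceeds [phi e1 / 2], so this weight already dominates
   the bound [B] of [f]. *)
exists [seq (B / (phi e1 / 2), g^-) | g <- D]; split.
  move=> _ /mapP[g gD ->]; split; first by rewrite divr_ge0 ?ltW// divr_gt0.
  by apply: GV; case: (DG g gD).
move=> h Gh; rewrite big_map.
have S0 (r : seq G) : 0 <= \sum_(j <- r) B / (phi e1 / 2) * phi (h *g j^-).
  by apply: sumr_ge0 => j _; rewrite mulr_ge0// divr_ge0 ?ltW// divr_gt0.
have [Ch|/z1 ->] := pselect (C h); last exact: S0.
have [g gD /= hg] := cD h (conj Ch Gh).
rewrite (big_rem g)//= ler_wpDr ?S0//; apply: le_trans (hB h) _.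
rewrite mulrAC ler_pdivlMr ?divr_gt0// ler_wpM2l ?(ltW B0)// ltW//.
Qed.

Lemma Qle f phi s : cov f phi s -> Qc f phi <= wt s.
Proof.
move=> hs; apply: ge_inf; last by exists s.
by exists 0 => _ [t ht ->]; exact: wt_ge0 ht.
Qed.

Lemma leQ f phi y : Ccp f -> good phi -> (forall s, cov f phi s -> y <= wt s) ->
  y <= Qc f phi.
Proof.
move=> fC ph h; apply: lb_le_inf; last by move=> _ [s /h ? ->].
by have [s hs] := cov_ex fC ph; exists (wt s), s.
Qed.

Lemma Q_ge0 f phi : Ccp f -> good phi -> 0 <= Qc f phi.
Proof. by move=> fC ph; apply: leQ => // s; exact: wt_ge0. Qed.

Lemma QD f1 f2 phi : Ccp f1 -> Ccp f2 -> good phi ->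
  Qc (fun h => f1 h + f2 h) phi <= Qc f1 phi + Qc f2 phi.
Proof.
move=> h1 h2 ph; rewrite -lerBlDl; apply: leQ => // s2 [a2 b2].
rewrite lerBlDl -lerBlDr; apply: leQ => // s1 [a1 b1].
rewrite lerBlDr; have -> : wt s1 + wt s2 = wt (s1 ++ s2) by rewrite /wt big_cat.
apply: Qle; split=> [p|h Gh].
  by rewrite mem_cat => /orP[/a1|/a2].
by rewrite big_cat lerD ?b1 ?b2.
Qed.

Lemma QZ f phi (c : R) : Ccp f -> good phi -> 0 < c ->
  Qc (fun h => c * f h) phi <= c * Qc f phi.
Proof.
move=> fC ph c0; rewrite mulrC -ler_pdivrMr//; apply: leQ => // s [a b].
rewrite ler_pdivrMr// mulrC.
have -> : c * wt s = wt [seq (c * p.1, p.2) | p <- s].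
  by rewrite /wt big_map mulr_sumr.
apply: Qle; split=> [_ /mapP[p /a[p0 pG] ->]|h Gh].
  by split=> //; rewrite mulr_ge0// ltW.
rewrite big_map; under eq_bigr do rewrite -mulrA.
by rewrite -mulr_sumr ler_wpM2l ?(ltW c0) ?b.
Qed.

Lemma Q_mono f1 f2 phi : Ccp f2 -> good phi -> (forall h, Gam h -> f1 h <= f2 h) ->
  Qc f1 phi <= Qc f2 phi.
Proof.
move=> h2 ph f12; apply: leQ => // s [a b]; apply: Qle; split=> // h Gh.
exact: le_trans (f12 h Gh) (b h Gh).
Qed.

(** Covering [psi] by translates of [f], and [f] by translates of [phi], covers [psi] with the
    products of the weights. *)
Lemma Q_sub f phi psi : good f -> good phi -> Ccp psi ->
  Qc psi phi <= Qc psi f * Qc f phi.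
Proof.
move=> [fC f1] ph psiC; have [_ _ GM _] := Gsub.
have key s t : cov psi f s -> cov f phi t -> Qc psi phi <= wt s * wt t.
  move=> hs [a' b']; have [a b] := hs.
  have -> : wt s * wt t = wt [seq (p.1 * q.1, p.2 *g q.2) | p <- s, q <- t].
    rewrite /wt big_allpairs_dep big_distrlr /=; apply: eq_bigr => p _.
    by apply: eq_bigr.
  apply: Qle; split=> [_ /allpairsP[[p q] /= [/a[p0 pG] /a'[q0 qG] ->]]|h Gh].
    by split; [exact: mulr_ge0|exact: GM].
  apply: le_trans (b h Gh) _; rewrite big_allpairs_dep /=.
  rewrite big_seq [leRHS]big_seq; apply: ler_sum => p /a[p0 pG].
  under [leRHS]eq_bigr do rewrite -mulrA lmulA.
  by rewrite -mulr_sumr; apply: ler_wpM2l => //; apply: b'; exact: GM.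
have k2 s : cov psi f s -> Qc psi phi <= wt s * Qc f phi.
  move=> hs; have := wt_ge0 hs; rewrite le_eqVlt => /orP[/eqP s0|s0].
    have [t ht] := cov_ex fC ph; have := key s t hs ht.
    by rewrite -s0 !mul0r.
  rewrite mulrC -ler_pdivrMr//; apply: leQ => // t ht.
  by rewrite ler_pdivrMr// mulrC; exact: key.
have := Q_ge0 fC ph; rewrite le_eqVlt => /orP[/eqP q0|q0].
  have [s hs] := cov_ex psiC (conj fC f1); have := k2 s hs.
  by rewrite -q0 !mulr0.
by rewrite -ler_pdivrMr//; apply: leQ => // s hs; rewrite ler_pdivrMr//; exact: k2.
Qed.

Lemma Q_gt0 f phi : good f -> good phi -> 0 < Qc f phi.
Proof.
move=> [fC f1] ph; have [_ G1 _ _] := Gsub.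
have [B B0 hB] := Ccp_bound ph.1.
apply: (@lt_le_trans _ _ (f e1 / B)); first exact: divr_gt0.
apply: leQ => // s [a b]; rewrite ler_pdivrMr//; apply: le_trans (b _ G1) _.
rewrite /wt mulr_suml big_seq [leRHS]big_seq; apply: ler_sum => p /a[p0 _].
by rewrite ler_wpM2l.
Qed.

Lemma Q_trans_le f phi g : Ccp f -> good phi -> Gam g ->
  Qc (fun h => f (h *g g)) phi <= Qc f phi.
Proof.
move=> fC ph Gg; have [_ _ GM _] := Gsub; apply: leQ => // s [a b].
have -> : wt s = wt [seq (p.1, g *g p.2) | p <- s] by rewrite /wt big_map.
apply: Qle; split=> [_ /mapP[p /a[p0 pG] ->]|h Gh]; first by split=> //; exact: GM.
rewrite big_map /=; under eq_bigr do rewrite lmulA.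
by apply: b; exact: GM.
Qed.

Lemma Ccp_trans f g : Ccp f -> Ccp (fun h => f (h *g g)).
Proof. by move=> [h1 h2]; split=> [|h]; [exact: Cc_trans|exact: h2]. Qed.

Lemma Q_trans f phi g : Ccp f -> good phi -> Gam g ->
  Qc (fun h => f (h *g g)) phi = Qc f phi.
Proof.
move=> fC ph Gg; have [_ _ _ GV] := Gsub.
apply/eqP; rewrite eq_le Q_trans_le//=.
have := Q_trans_le (Ccp_trans g fC) ph (GV _ Gg).
rewrite (_ : (fun h => _) = f)//.
by apply/funext => h; rewrite lmulgKV.
Qed.

(** Weil's argument. The quotients [h1] and [h2] of [f1] and [f2] by a slightly larger [p] are
    uniformly continuous. When [phi] has small support, multiplying the weights of a covering of [p]
    by nearby values of [h1] and [h2] covers [f1] and [f2], at a total cost close to that of [p].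
    The term [dl * g0] keeps [p] positive on the supports. *)
Lemma Q_additive f1 f2 f0 (e : R) : Ccp f1 -> Ccp f2 -> good f0 -> 0 < e ->
  exists2 V, nbhs e1 V & forall phi, good phi -> (forall g, phi g != 0 -> V g) ->
  Qc f1 phi + Qc f2 phi <= Qc (fun h => f1 h + f2 h) phi + e * Qc f0 phi.
Proof.
move=> C1 C2 f0G e0.
have [[c1 [K1 k1 z1]] p1] := C1; have [[c2 [K2 k2 z2]] p2] := C2.
have [_ G1 GM GV] := Gsub.
have [g0 [g0C g0P]] : exists g0 : G -> R, Ccp g0 /\ forall g, (K1 `|` K2) g -> 0 < g0 g.
  exact: Cc_pos (compactU k1 k2).
pose A := Qc (fun h => f1 h + f2 h) f0; pose B := Qc g0 f0.
have CC : Ccp (fun h => f1 h + f2 h).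
  split; last by move=> g; exact: addr_ge0.
  by have := CcD 1 C1.1 C2.1; under eq_fun do rewrite mul1r.
have A0 : 0 <= A by exact: Q_ge0.
have B0 : 0 <= B by exact: Q_ge0.
(* With these constants, and [et <= 1], the excess is at most [3 * e / 8 + e / 2] times
   [Qc f0 phi]. *)
pose dl := e / (8 * (B + 1)); pose et := Num.min 1 (e / (4 * (A + 1))).
have dl0 : 0 < dl by rewrite divr_gt0// mulr_gt0// ltr_wpDl.
have et0 : 0 < et by rewrite lt_min ltr01 divr_gt0// mulr_gt0// ltr_wpDl.
pose p g := f1 g + f2 g + dl * g0 g.
have pC : Ccp p.
  split; last by move=> g; rewrite !addr_ge0// mulr_ge0 ?(ltW dl0)//; case: g0C.
  by have := CcD dl g0C.1 CC.1; under eq_fun do rewrite addrC.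
have cp : continuous p by case: pC => -[].
have hC f K : continuous f -> (forall g, ~ K g -> f g = 0) -> compact K -> K `<=` K1 `|` K2 ->
    (forall g, 0 <= f g <= p g) -> Cc (fun g => f g / p g).
  move=> cf zf kK KK fp; split; last by exists K => // g /zf ->; rewrite mul0r.
  move=> g; have [gK|gK] := pselect (K g).
    apply: (@continuousM _ _ f (fun g => (p g)^-1)); first exact: cf.
    apply: continuousV; last exact: cp.
    rewrite gt_eqF// /p ltr_wpDl ?addr_ge0// mulr_gt0// g0P//; exact: KK.
  have gn : nbhs g (~` K).
    apply: open_nbhs_nbhs; split=> //; apply: closed_openC; apply: compact_closed => //.
    exact: mhausdorff.
  apply: (@near_eq_cont _ _ (fun=> 0 : R)); last exact: cst_continuous.
  by apply: filterS gn => g' /zf ->; rewrite mul0r.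
pose h1 g := f1 g / p g; pose h2 g := f2 g / p g.
have g0ge g : 0 <= g0 g by case: g0C.
have fp1 g : 0 <= f1 g <= p g.
  by rewrite p1 /p -addrA lerDl addr_ge0// mulr_ge0// ltW.
have fp2 g : 0 <= f2 g <= p g.
  by rewrite p2 /p addrAC lerDr addr_ge0// mulr_ge0// ltW.
have H1 : Cc h1 by apply: (hC f1 K1) => // g; left.
have H2 : Cc h2 by apply: (hC f2 K2) => // g; right.
have V1 := Cc_unif H1 et0; have V2 := Cc_unif H2 et0.
exists [set v | (forall t, `|h1 (v *g t) - h1 t| <= et) /\ (forall t, `|h2 (v *g t) - h2 t| <= et)].
  exact: filterI.
move=> phi ph phV; have phge : forall g, 0 <= phi g by case: ph => -[].
have key : Qc f1 phi + Qc f2 phi <= (1 + 2 * et) * Qc p phi.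
  rewrite mulrC -ler_pdivrMr; last by rewrite ltr_wpDr// mulr_ge0// ltW.
  apply: leQ => // s [a b]; rewrite ler_pdivrMr; last by rewrite ltr_wpDr// mulr_ge0// ltW.
  have Qi f (h : G -> R) : (forall g, f g = p g * h g) -> Cc h -> (forall g, 0 <= h g) ->
      (forall v t, phi v != 0 -> `|h (v *g t) - h t| <= et) ->
      Qc f phi <= \sum_(q <- s) q.1 * (h (q.2^-) + et).
    move=> fph Ch hge hu.
    have -> : \sum_(q <- s) q.1 * (h (q.2^-) + et) =
       wt [seq (q.1 * (h (q.2^-) + et), q.2) | q <- s] by rewrite /wt big_map.
    apply: Qle; split=> [_ /mapP[q /a[q0 qG] ->]|g Gg].
      by split=> //; rewrite mulr_ge0// addr_ge0// ltW.
    rewrite fph big_map /=; apply: le_trans (ler_wpM2r (hge g) (b g Gg)) _.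
    rewrite mulr_suml big_seq [leRHS]big_seq; apply: ler_sum => q /a[q0 _].
    rewrite -[leLHS]mulrA -[leRHS]mulrA; apply: ler_wpM2l => //; rewrite [leRHS]mulrC.
    have [->|ph0] := eqVneq (phi (g *g q.2)) 0; first by rewrite !mul0r.
    apply: ler_wpM2l => //.
    have := hu _ (q.2^-) ph0; rewrite lmulgK ler_norml => /andP[_].
    by rewrite lerBlDr addrC.
  have d0 (f : G -> R) : (forall g, 0 <= f g <= p g) -> forall g, f g = p g * (f g / p g).
    move=> fp g; have [E|E] := eqVneq (p g) 0; last by rewrite mulrC divfK.
    by have := fp g; rewrite E mul0r => /le_anti.
  have hg (f : G -> R) : (forall g, 0 <= f g <= p g) -> forall g, 0 <= f g / p g.
    by move=> fp g; have /andP[f0' fp'] := fp g; rewrite divr_ge0// (le_trans f0').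
  have q1 := Qi f1 h1 (d0 _ fp1) H1 (hg _ fp1) (fun v t hv => (phV v hv).1 t).
  have q2 := Qi f2 h2 (d0 _ fp2) H2 (hg _ fp2) (fun v t hv => (phV v hv).2 t).
  apply: le_trans (lerD q1 q2) _; rewrite -big_split /= /wt mulr_suml.
  rewrite big_seq [leRHS]big_seq; apply: ler_sum => q /a[q0 _].
  rewrite -mulrDr ler_wpM2l//.
  suff : h1 (q.2^-) + h2 (q.2^-) <= 1 by lra.
  rewrite /h1 /h2 -mulrDl; set g := q.2^-.
  have [E|E] := eqVneq (p g) 0; first by rewrite E invr0 mulr0.
  have pg : 0 < p g by have [_ pge] := pC; rewrite lt_def E pge.
  by rewrite ler_pdivrMr// mul1r /p lerDl mulr_ge0// ltW.
have q3 : Qc p phi <= Qc (fun h => f1 h + f2 h) phi + dl * Qc g0 phi.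
  have dC : Ccp (fun h => dl * g0 h).
    split; last by move=> g; rewrite mulr_ge0// ltW.
    have := CcD dl g0C.1 (CcD (-1) g0C.1 g0C.1).
    by under eq_fun do rewrite mulN1r addNr addr0.
  by apply: le_trans (QD CC dC ph) _; rewrite lerD2l QZ.
have q4 := Q_sub f0G ph CC; have q5 := Q_sub f0G ph g0C.
have q6 := Q_ge0 f0G.1 ph; rewrite -/A in q4; rewrite -/B in q5.
have e1' : et * (A + 1) <= e / 4.
  have : et <= e / (4 * (A + 1)) by rewrite ge_min lexx orbT.
  by rewrite invfM mulrA ler_pdivlMr// ltr_wpDl.
have e2' : dl * (B + 1) = e / 8 by rewrite /dl; field; rewrite gt_eqF// ltr_wpDl.
have e3' : et <= 1 by rewrite ge_min lexx.
set S := Qc (fun h => f1 h + f2 h) phi in q3 q4 *.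
set q0 := Qc f0 phi in q4 q5 q6 *; set T := Qc g0 phi in q3 q5 *.
have S0 : 0 <= S by exact: Q_ge0.
have T0 : 0 <= T by exact: Q_ge0 g0C ph.
have r1 : dl * T <= e / 8 * q0.
  have : dl * T <= dl * ((B + 1) * q0) by rewrite ler_wpM2l ?(ltW dl0)//; nra.
  by rewrite mulrA e2'.
have r2 : et * S <= e / 4 * q0.
  have : et * S <= et * ((A + 1) * q0) by rewrite ler_wpM2l ?(ltW et0)//; nra.
  by move=> /le_trans; apply; rewrite mulrA ler_wpM2r.
have dT0 : 0 <= dl * T by rewrite mulr_ge0// ltW.
have r3 : et * (dl * T) <= dl * T by rewrite ler_piMl.
apply: le_trans key _.
have r4 : (1 + 2 * et) * Qc p phi <= (1 + 2 * et) * (S + dl * T).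
  by rewrite ler_wpM2l// addr_ge0// mulr_ge0// ltW.
apply: le_trans r4 _; lra.
Qed.

Lemma Q_le0 f phi : (forall h, Gam h -> f h <= 0) -> Qc f phi <= 0.
Proof.
move=> f0; have : cov f phi [::] by split=> // h /f0; rewrite big_nil.
by move=> /Qle; rewrite /wt big_nil.
Qed.

(** Compactness of the segment gives a cluster point, and an ultrafilter converges to each of its
    cluster points. *)
Lemma ultra_limit (T : Type) (U : set_system T) (F : T -> R) (B : R) :
  UltraFilter U -> (\forall t \near U, 0 <= F t <= B) -> cvg (F @ U).
Proof.
move=> UU hB; have PU : ProperFilter U by exact: ultra_proper.
have [p [_ pc]] : [set` `[0, B]] `&` cluster (F @ U) !=set0.
  apply: segment_compact => //=; apply: filterS hB => t; by rewrite in_itv.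
apply/cvg_ex; exists p => W pW.
have [//|UW] := in_ultra_setVsetC (F @^-1` W) UU.
by have [y [y1 y2]] := pc (~` W) W UW pW; case: (y1 y2).
Qed.

(** Normalized covering numbers are subadditive for every [phi], and additive up to any given error
    once the support of [phi] is small. An ultrafilter finer than these shrinking supports turns
    them into an exactly additive functional of nonnegative functions; signed functions are handled
    by their positive and negative parts. *)
Theorem haar : exists I : (G -> R) -> R,
  [/\ forall f1 f2 (a : R), Cc f1 -> Cc f2 ->
        I (fun h => a * f1 h + f2 h) = a * I f1 + I f2,
      forall f1 f2, Cc f1 -> Cc f2 -> (forall h, Gam h -> f1 h <= f2 h) -> I f1 <= I f2,
      forall f g, Cc f -> Gam g -> I (fun h => f (h *g g)) = I f &
      forall f, Cc f -> (forall h, Gam h -> 0 <= f h) -> 0 < f e1 -> 0 < I f].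
Proof.
have [f0 [f0C f01 _ _]] := Cc_bump (@filterT _ (nbhs e1) _).
have f0G : good f0 by [].
pose Bs V := [set phi | good phi /\ forall g, phi g != 0 -> V g].
have FP : ProperFilter (filter_from (nbhs e1) Bs).
  apply: filter_from_proper; last first.
    by move=> V /Cc_bump[b [h1 h2 _ h3]]; exists b.
  apply: filter_from_filter; first by exists setT; exact: filterT.
  move=> V W hV hW; exists (V `&` W); first exact: filterI.
  by move=> phi [ph h]; split; split=> // g /h[].
have [U [UU FU]] := ultraFilterLemma FP.
have PU : ProperFilter U by exact: ultra_proper.
have Ugood : \forall phi \near U, good phi.
  by apply: FU; exists setT => [|phi []]; first exact: filterT.
have q0 phi : good phi -> 0 < Qc f0 phi by exact: Q_gt0.
pose r f phi := Qc f phi / Qc f0 phi.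
pose L f : R := lim (r f @ U).
have rcvg f : Ccp f -> r f @ U --> L f.
  move=> fC; apply: (@ultra_limit _ _ _ (Qc f f0)) => //; apply: filterS Ugood => phi ph.
  rewrite divr_ge0 ?Q_ge0//= /r ?ler_pdivrMr ?q0//; last exact: Q_sub.
have lec (a b : (G -> R) -> R) (la lb : R) : a @ U --> la -> b @ U --> lb ->
    (\forall phi \near U, a phi <= b phi) -> la <= lb.
  move=> /cvgrPdist_lt h1 /cvgrPdist_lt h2 h3; rewrite leNgt; apply/negP => lab.
  have e0 : 0 < (la - lb) / 2 by rewrite divr_gt0// subr_gt0.
  have [phi [[p1 p2] p3]] := filter_ex (filterI (filterI (h1 _ e0) (h2 _ e0)) h3).
  by move: p1 p2; rewrite !ltr_norml => /andP[_ p1] /andP[p2 _]; lra.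
have le_L f1 f2 : Ccp f1 -> Ccp f2 -> (forall h, Gam h -> f1 h <= f2 h) -> L f1 <= L f2.
  move=> C1 C2 f12; apply: (lec _ _ _ _ (rcvg _ C1) (rcvg _ C2)).
  apply: filterS Ugood => phi ph.
  by rewrite /r ler_wpM2r ?invr_ge0 ?(ltW (q0 _ ph))// Q_mono.
have L_ge0 f : Ccp f -> 0 <= L f.
  move=> fC; apply: (lec _ _ _ _ (@cvg_cst _ 0 _ U _) (rcvg _ fC)).
  by apply: filterS Ugood => phi ph; rewrite divr_ge0 ?Q_ge0// ltW// q0.
have L_eq0 f : Ccp f -> (forall h, Gam h -> f h <= 0) -> L f = 0.
  move=> fC f0'; apply/eqP; rewrite eq_le L_ge0// andbT.
  apply: (lec _ _ _ _ (rcvg _ fC) (@cvg_cst _ 0 _ U _)).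
  apply: filterS Ugood => phi ph; rewrite /r -(mul0r (Qc f0 phi)^-1).
  by rewrite ler_wpM2r ?invr_ge0 ?(ltW (q0 _ ph))// Q_le0.
have CD f1 f2 : Ccp f1 -> Ccp f2 -> Ccp (fun h => f1 h + f2 h).
  move=> [h1 p1] [h2 p2]; split; last by move=> g; exact: addr_ge0.
  by have := CcD 1 h1 h2; under eq_fun do rewrite mul1r.
have LD f1 f2 : Ccp f1 -> Ccp f2 -> L (fun h => f1 h + f2 h) = L f1 + L f2.
  move=> C1 C2.
  have c12 : (fun phi => r f1 phi + r f2 phi) @ U --> L f1 + L f2.
    exact: (cvgD (rcvg _ C1) (rcvg _ C2)).
  apply/eqP; rewrite eq_le; apply/andP; split.
    apply: (lec _ _ _ _ (rcvg _ (CD _ _ C1 C2)) c12).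
    apply: filterS Ugood => phi ph.
    rewrite /r -mulrDl; by rewrite ler_wpM2r ?invr_ge0 ?(ltW (q0 _ ph))// QD.
  apply/ler_addgt0Pr => e e0.
  have c3 : (fun phi => r (fun h => f1 h + f2 h) phi + e) @ U --> L (fun h => f1 h + f2 h) + e.
    exact: (cvgD (rcvg _ (CD _ _ C1 C2)) (@cvg_cst _ e _ U _)).
  apply: (lec _ _ _ _ c12 c3).
  have [V hV Vadd] := Q_additive C1 C2 f0G e0.
  have : U (Bs V) by apply: FU; exists V.
  apply: filterS => phi [ph phV].
  rewrite /r -mulrDl ler_pdivrMr ?q0// [leRHS]mulrDl divfK ?gt_eqF ?q0//.
  exact: Vadd.
have CZ f (a : R) : Ccp f -> 0 <= a -> Ccp (fun h => a * f h).
  move=> [h1 p1] a0; split; last by move=> g; exact: mulr_ge0.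
  have := CcD a h1 (CcD (-1) h1 h1).
  by under eq_fun do rewrite mulN1r addNr addr0.
have LZ_le f (a : R) : Ccp f -> 0 < a -> L (fun h => a * f h) <= a * L f.
  move=> fC a0; apply: (lec _ _ _ _ (rcvg _ (CZ _ _ fC (ltW a0))) (cvgMr (rcvg _ fC))).
  apply: filterS Ugood => phi ph.
  by rewrite /r mulrA ler_wpM2r ?invr_ge0 ?(ltW (q0 _ ph))// QZ.
have LZ f (a : R) : Ccp f -> 0 <= a -> L (fun h => a * f h) = a * L f.
  move=> fC; rewrite le_eqVlt => /orP[/eqP <-|a0].
    rewrite mul0r L_eq0//; first exact: CZ.
    by move=> h _; rewrite mul0r.
  apply/eqP; rewrite eq_le LZ_le//= -ler_pdivlMl//.
  have a'0 : 0 < a^-1 by rewrite invr_gt0.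
  apply: le_trans (LZ_le _ _ (CZ _ _ fC (ltW a0)) a'0).
  by under [in leRHS]eq_fun do rewrite mulKf ?gt_eqF//.
pose I f := L (fun h => Num.max (f h) 0) - L (fun h => Num.max (- f h) 0).
have CcN f : Cc f -> Cc (fun h => - f h).
  move=> fC; have := CcD (-2) fC fC; congr Cc; apply/funext => h; ring.
have IE f a b : Cc f -> Ccp a -> Ccp b -> (forall h, f h = a h - b h) -> I f = L a - L b.
  move=> fC aC bC fab; have fp := Cc_max fC; have fm := Cc_max (CcN _ fC).
  suff : L (fun h => Num.max (f h) 0) + L b = L (fun h => Num.max (- f h) 0) + L a.
    by rewrite /I => E; apply/eqP; rewrite subr_eq addrAC eq_sym subr_eq eq_sym E addrC.
  rewrite -!LD//; congr L; apply/funext => h.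
  have -> : Num.max (f h) 0 = f h + Num.max (- f h) 0.
    by case: (ltP (f h) 0) => h0; [rewrite max_l|rewrite max_r]; lra.
  by rewrite fab; ring.
exists I; split.
- move=> f1 f2 a C1 C2.
  have p1 := Cc_max C1; have m1 := Cc_max (CcN _ C1).
  have p2 := Cc_max C2; have m2 := Cc_max (CcN _ C2).
  have E f h : f h = Num.max (f h) 0 - Num.max (- f h) 0 :> R.
    by case: (ltP (f h) 0) => h0; [rewrite max_l|rewrite max_r]; lra.
  have [a0|a0] := leP 0 a.
    rewrite (IE _ _ _ _ (CD _ _ (CZ _ _ p1 a0) p2) (CD _ _ (CZ _ _ m1 a0) m2)).
    + by rewrite !LD ?LZ//; try exact: CZ; rewrite /I; ring.
    + exact: CcD.
    + by move=> h; rewrite {1}(E f1 h) {1}(E f2 h); ring.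
  have a0' : 0 <= - a by lra.
  rewrite (IE _ _ _ _ (CD _ _ (CZ _ _ m1 a0') p2) (CD _ _ (CZ _ _ p1 a0') m2)).
  + by rewrite !LD ?LZ//; try exact: CZ; rewrite /I; ring.
  + exact: CcD.
  + by move=> h; rewrite {1}(E f1 h) {1}(E f2 h); ring.
- move=> f1 f2 C1 C2 f12; apply: lerB; apply: le_L; (try exact: Cc_max);
    (try by apply: Cc_max; exact: CcN) => h /f12 h12.
    by rewrite ge_max !le_max h12 /= lexx orbT.
  by rewrite ge_max !le_max lerN2 h12 /= lexx orbT.
- have Ltr f g : Ccp f -> Gam g -> L (fun h => f (h *g g)) = L f.
    move=> fC Gg; have gC := Ccp_trans g fC.
    by apply/eqP; rewrite eq_le; apply/andP; split;
      [apply: (lec _ _ _ _ (rcvg _ gC) (rcvg _ fC))|apply: (lec _ _ _ _ (rcvg _ fC) (rcvg _ gC))];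
      apply: filterS Ugood => phi ph; rewrite /r Q_trans.
  move=> f g fC Gg; rewrite /I (Ltr (fun h => Num.max (f h) 0) g (Cc_max fC) Gg).
  by rewrite (Ltr (fun h => Num.max (- f h) 0) g (Cc_max (CcN _ fC)) Gg).
- move=> f fC fge f1.
  have -> : I f = L (fun h => Num.max (f h) 0).
    rewrite /I [X in _ - X]L_eq0 ?subr0//; first by apply: Cc_max; exact: CcN.
    by move=> h /fge fh; rewrite ge_max lexx andbT oppr_le0.
  have fG : good (fun h => Num.max (f h) 0).
    by split; [exact: Cc_max|rewrite lt_max f1].
  have q1 := Q_gt0 f0G fG.
  (* Covering [f0] by translates of the positive part of [f] bounds the normalized covering numbers
     of the latter below by this constant, uniformly in [phi]. *)
  apply: (@lt_le_trans _ _ (Qc f0 (fun h => Num.max (f h) 0))^-1); first by rewrite invr_gt0.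
  apply: (lec _ _ _ _ (@cvg_cst _ _ _ U _) (rcvg _ fG.1)).
  apply: filterS Ugood => phi ph.
  rewrite /r ler_pdivlMr ?q0// ler_pdivrMl//.
  exact: Q_sub f0G.1.
Qed.

End Haar.

(** * Averaging over the group *)

Section Parametric.
Variables (R : realType) (T : topologicalType) (n : nat).
Implicit Types (Phi : T -> 'rV[R]_n -> R) (U : set 'rV[R]_n).

(** Joint continuity of all derivatives in the second variable up to order [k]. The parameter space
    carries a topology only; this is what differentiating under a functional in the parameter
    requires. *)
Fixpoint PCk (k : nat) U Phi : Prop :=
  (forall h z, U z -> {for (h, z), continuous (fun p : T * 'rV[R]_n => Phi p.1 p.2)}) /\
  (if k is k'.+1 then forall i : 'I_n,
     (forall h z, U z -> derivable (Phi h) z (delta_mx 0 i)) /\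
     PCk k' U (fun h => pd i (Phi h))
   else True).

(** Covers Haar integrals with a cut-off, means over compact groups and the integral over the unit
    segment, so that smooth dependence on a variable is proved once. *)
Definition cfunctional (C : set T) (J : (T -> R) -> R) :=
  [/\ compact C,
    forall f1 f2 (a : R), continuous f1 -> continuous f2 ->
      J (fun h => a * f1 h + f2 h) = a * J f1 + J f2 &
    exists2 B, 0 <= B & forall f M, continuous f ->
      0 <= M -> (forall h, C h -> `|f h| <= M) -> `|J f| <= B * M].

Variables (C : set T) (J : (T -> R) -> R).
Hypothesis HJ : cfunctional C J.

Lemma PCk_cont k U Phi h z : PCk k U Phi -> U z ->
  {for (h, z), continuous (fun p : T * 'rV[R]_n => Phi p.1 p.2)}.
Proof. by case: k => [|k] [H _]; exact: H. Qed.

Lemma PCk_cont1 k U Phi z : PCk k U Phi -> U z -> continuous (fun h => Phi h z).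
Proof.
move=> P Uz h; have := @PCk_cont k U Phi h z P Uz.
apply: (@continuous_comp _ _ _ (fun h => (h, z)) (fun p : T * 'rV[R]_n => Phi p.1 p.2)).
move=> W [[W1 W2] [/= h1 h2] sW]; rewrite /nbhs /=; apply: filterS h1 => y y1.
by apply: sW; split=> //=; exact: nbhs_singleton h2.
Qed.

Lemma PCk_unif k U Phi z e : open U -> PCk k U Phi -> U z -> 0 < e ->
  exists2 d, 0 < d & forall w, `|w - z| < d ->
    U w /\ forall h, C h -> `|Phi h w - Phi h z| <= e.
Proof.
move=> oU P Uz e0; have [/compact_near_coveringP kC _ _] := HJ.
have FF : Filter (nbhs z) by exact: nbhs_filter.
have : \forall w \near z, C `<=` (fun h => `|Phi h w - Phi h z| <= e).
  apply: (kC _ (nbhs z) (fun w h => `|Phi h w - Phi h z| <= e)) => h Ch; have e2 : 0 < e / 2 by rewrite divr_gt0.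
  have c1 := @PCk_cont k U Phi h z P Uz; have c2 : {for h, continuous (fun h => Phi h z)} := @PCk_cont1 k U Phi z P Uz h.
  have /cvgrPdist_le/(_ _ e2) h1 := c1.
  have /cvgrPdist_le/(_ _ e2) h2 := c2.
  have h2' : \forall p \near (h, z), `|Phi h z - Phi p.1 z| <= e / 2.
    exact: (@cvg_fst _ _ (nbhs h) (nbhs z) _ _ h2).
  apply: filterS2 h1 h2' => p /= h3 h4.
  rewrite -(subrK (Phi h z) (Phi p.1 p.2)) -addrA (le_trans (ler_normD _ _))//.
  by rewrite distrC; have := lerD h3 h4; rewrite -splitr.
move=> hC; have /near_normP[d d0 hd] : nbhs z (U `&` [set w | C `<=` (fun h => `|Phi h w - Phi h z| <= e)]).
  by apply: filterI => //; exact: open_nbhs_nbhs.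
by exists d => // w /hd[h1 h2]; split=> // h Ch; exact: h2.
Qed.

Lemma J_sub f1 f2 : continuous f1 -> continuous f2 ->
  J (fun h => f1 h - f2 h) = J f1 - J f2.
Proof.
move=> c1 c2; have [_ lin _] := HJ.
have := lin f2 f1 (-1) c2 c1.
by rewrite mulN1r addrC => <-; congr J; apply/funext => h; rewrite mulN1r addrC.
Qed.

Lemma J_scale f (a : R) : continuous f ->
  J (fun h => a * f h) = a * J f.
Proof.
move=> cf; have [_ lin _] := HJ; have := lin f f (a - 1) cf cf.
rewrite (_ : (fun h => (a - 1) * f h + f h) = (fun h => a * f h)).
  by move=> ->; ring.
by apply/funext => h; ring.
Qed.

(** For each parameter the difference quotient is a derivative at an intermediate point, and this is
    uniformly close to the derivative at [z] for parameters in the compact set [C]. *)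
Lemma is_derive_J U Phi i z : open U -> PCk 1 U Phi -> U z ->
  is_derive z (delta_mx 0 i) (fun z => J (fun h => Phi h z)) (J (fun h => pd i (Phi h) z)).
Proof.
move=> oU P Uz; have [kC lin [B B0 bd]] := HJ; have [Pi1 Pi2] := P.2 i.
have cP w : U w -> continuous (fun h => Phi h w) by move=> Uw; exact: PCk_cont1 P Uw.
have cD w : U w -> continuous (fun h => pd i (Phi h) w) by move=> Uw; exact: (@PCk_cont1 0 U (fun h => pd i (Phi h)) w Pi2 Uw).
have H : (fun t : R => t^-1 *: (J (fun h => Phi h (t *: delta_mx 0 i + z)) -
     J (fun h => Phi h z))) @ 0^' --> J (fun h => pd i (Phi h) z).
  apply/cvgrPdist_le => e e0.
  have e'0 : 0 < e / (B + 1) by rewrite divr_gt0// ltr_wpDl.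
  have [d d0 hd] := @PCk_unif 0 U (fun h => pd i (Phi h)) z _ oU Pi2 Uz e'0.
  near=> t.
  have t0 : t != 0 by near: t; exact: nbhs_dnbhs_neq.
  have td : `|t| < d by near: t; exact: dnbhs0_lt.
  have small s : `|s| <= `|t| -> `|z + s *: delta_mx 0 i - z| < d.
    move=> st; rewrite addrAC subrr add0r normrZ.
    apply: le_lt_trans td; rewrite -[leRHS]mulr1 ler_pM//.
    apply: rV_norm_le => // j; rewrite mxE; case: eqP => _ /=; last by rewrite normr0.
    by case: eqP; rewrite ?normr1 ?normr0.
  have Ut : U (t *: delta_mx 0 i + z) by rewrite addrC; exact: (hd _ (small t (lexx _))).1.
  pose q h := t^-1 * (Phi h (t *: delta_mx 0 i + z) - Phi h z).
  have cq : continuous q.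
    move=> h; apply: (@continuousM _ _ (fun=> t^-1) (fun h => Phi h (t *: delta_mx 0 i + z) - Phi h z)); first exact: cst_continuous.
    by apply: continuousB; [exact: cP|exact: cP].
  have -> : t^-1 *: (J (fun h => Phi h (t *: delta_mx 0 i + z)) - J (fun h => Phi h z)) = J q.
    rewrite -J_sub; try exact: cP.
    rewrite -[LHS]J_scale//.
    by move=> h; apply: continuousB; [exact: cP|exact: cP].
  rewrite -J_sub//; last exact: cD.
  have -> : e = (B + 1) * (e / (B + 1)) by rewrite mulrC divfK// gt_eqF// ltr_wpDl.
  apply: (@le_trans _ _ (B * (e / (B + 1)))); last by rewrite ler_wpM2r ?(ltW e'0)// lerDl.
  apply: bd => //; last 1 first.
  - move=> h Ch; rewrite /q.
    have [|c hc E] := @MVT_unordered R (fun s => Phi h (z + s *: delta_mx 0 i))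
      (fun s => pd i (Phi h) (z + s *: delta_mx 0 i)) 0 t.
      move=> s hs; apply: is_derive_line; apply: Pi1; apply: (hd _ (small s _)).1.
      by move: hs; rewrite /Num.min /Num.max; case: ltP => h0 /andP[h1 h2]; rewrite ler_norml; have := ler_norm t; have := ler_norm (- t); rewrite normrN; lra.
    rewrite addrC [z + t *: _]addrC in E.
    have ct : `|c| <= `|t|.
      by move: hc; rewrite /Num.min /Num.max; case: ltP => h0 /andP[h1 h2]; rewrite ler_norml; have := ler_norm t; have := ler_norm (- t); rewrite normrN; lra.
    have := (hd _ (small c ct)).2 h Ch.
    rewrite scale0r addr0 subr0 in E; rewrite [_ - Phi h z]addrC E mulrCA mulVf// mulr1.
    by rewrite distrC.
  - by move=> h; apply: (@continuousB _ _ _ (fun h => pd i (Phi h) z) q); [exact: cD|exact: cq].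
  - exact: ltW.
by apply: DeriveDef; [apply/cvg_ex; eexists; exact: H|exact/cvg_lim].
Unshelve. all: by end_near. Qed.

Lemma J_Ck k U Phi : open U -> PCk k U Phi -> Ck k U (fun z => J (fun h => Phi h z)).
Proof.
move=> oU; have [kC lin [B B0 bd]] := HJ.
have cont l Psi : PCk l U Psi ->
    forall z, U z -> {for z, continuous (fun z => J (fun h => Psi h z))}.
  move=> P z Uz; apply/cont_normP => e e0.
  have e'0 : 0 < e / (B + 1) by rewrite divr_gt0// ltr_wpDl.
  have [d d0 hd] := PCk_unif oU P Uz e'0; exists d => // w /hd[Uw hw].
  rewrite -J_sub; [|exact: PCk_cont1 P Uw|exact: PCk_cont1 P Uz].
  have E : e = (B + 1) * (e / (B + 1)) by rewrite mulrC divfK// gt_eqF// ltr_wpDl.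
  rewrite [ltRHS]E; apply: (@le_lt_trans _ _ (B * (e / (B + 1)))); last by rewrite ltr_pM2r// ltrDl.
  apply: bd => //; last exact: ltW.
  by move=> h; apply: continuousB; [exact: PCk_cont1 P Uw h|exact: PCk_cont1 P Uz h].
elim: k Phi => [|k IH] Phi P; split=> //; try exact: cont P.
move=> i; have P1 : PCk 1 U Phi.
  split; first by move=> h z Uz; exact: PCk_cont P Uz.
  move=> j; have [h1 h2] := P.2 j; split=> //.
  by case: (k) h2 => [|k'] [].
split=> [z Uz|]; first by have [] := is_derive_J i oU P1 Uz.
apply: (Ck_ext oU (f := fun z => J (fun h => pd i (Phi h) z))).
  by move=> z Uz; have [_ ->] := is_derive_J i oU P1 Uz.
by apply: IH; have [] := P.2 i.
Qed.

Lemma cont_row_mx p (th : T -> 'rV[R]_p) h (z : 'rV[R]_n) : {for h, continuous th} ->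
  {for (h, z), continuous (fun q : T * 'rV[R]_n => row_mx (th q.1) q.2)}.
Proof.
move=> ct; apply: cont_rV => j; rewrite /crd.
case: (splitP j) => i ji.
  apply: (@near_eq_cont _ _ (fun q : T * 'rV[R]_n => th q.1 0 i)).
    by apply: filterE => q; rewrite (_ : j = lshift n i) ?row_mxEl//; exact/val_inj.
  apply: (@continuous_comp _ _ _ (fun q : T * 'rV[R]_n => q.1) (fun h => th h 0 i)).
    exact: cvg_fst.
  apply: (@continuous_comp _ _ _ th (fun u : 'rV[R]_p => u 0 i)) => //.
  exact: coord_continuous.
apply: (@near_eq_cont _ _ (fun q : T * 'rV[R]_n => q.2 0 i)).
  by apply: filterE => q; rewrite (_ : j = rshift p i) ?row_mxEr//; exact/val_inj.
apply: (@continuous_comp _ _ _ (fun q : T * 'rV[R]_n => q.2) (fun u : 'rV[R]_n => u 0 i)).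
  exact: cvg_snd.
exact: coord_continuous.
Qed.

Lemma is_derive_row_mx p (psi : 'rV[R]_(p + n) -> R) (a : 'rV[R]_p) (z : 'rV[R]_n) i :
  derivable psi (row_mx a z) (delta_mx 0 (rshift p i)) ->
  is_derive z (delta_mx 0 i) (fun z : 'rV[R]_n => psi (row_mx a z)) (pd (rshift p i) psi (row_mx a z)).
Proof.
have E : (fun h : R => h^-1 *: (((fun z : 'rV[R]_n => psi (row_mx a z)) \o shift z) (h *: delta_mx 0 i) - psi (row_mx a z)))
  = (fun h : R => h^-1 *: ((psi \o shift (row_mx a z)) (h *: delta_mx 0 (rshift p i)) - psi (row_mx a z))).
  apply/funext => h /=; congr (_ *: (psi _ - _)).
  by rewrite delta_mx_rshift scale_row_mx scaler0 add_row_mx add0r.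
by move=> d; apply: DeriveDef; rewrite ?/derivable ?/pd ?/derive E.
Qed.

(** Locally the parameter is read through a continuous map [th] into rows, so the derivatives of
    [Phi h] are partial derivatives of a smooth function of finitely many variables; this form is
    stable under derivation. *)
Lemma PCk_chart k U Phi :
  (forall h0 : T, exists (p : nat) (V : set T) (th : T -> 'rV[R]_p)
     (W : set 'rV[R]_(p + n)) (psi : 'rV[R]_(p + n) -> R),
   [/\ nbhs h0 V, forall h, V h -> {for h, continuous th},
     open W /\ (forall h z, V h -> U z -> W (row_mx (th h) z)), Cinf W psi &
     forall h z, V h -> U z -> Phi h z = psi (row_mx (th h) z)]) ->
  open U -> PCk k U Phi.
Proof.
move=> + oU; have C0 Psi : (forall h0 : T, exists (p : nat) (V : set T) (th : T -> 'rV[R]_p)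
     (W : set 'rV[R]_(p + n)) (psi : 'rV[R]_(p + n) -> R),
   [/\ nbhs h0 V, forall h, V h -> {for h, continuous th},
     open W /\ (forall h z, V h -> U z -> W (row_mx (th h) z)), Cinf W psi &
     forall h z, V h -> U z -> Psi h z = psi (row_mx (th h) z)]) ->
    forall h z, U z -> {for (h, z), continuous (fun p : T * 'rV[R]_n => Psi p.1 p.2)}.
  move=> H h z Uz; have [p [V [th [W [psi [hO cth [oW OW] sp E]]]]]] := H h.
  apply: (@near_eq_cont _ _ (fun p : T * 'rV[R]_n => psi (row_mx (th p.1) p.2))).
    have : nbhs (h, z) (V `*` U) by exists (V, U) => //; split=> //; exact: open_nbhs_nbhs.
    by apply: filterS => -[h' z'] [/= h1 h2]; rewrite E.
  have Vh : V h := nbhs_singleton hO.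
  apply: (@continuous_comp _ _ _ (fun p : T * 'rV[R]_n => row_mx (th p.1) p.2) psi).
    by apply: cont_row_mx; exact: cth.
  by apply: (Cinf_cont sp); exact: OW.
elim: k Phi => [|k IH] Phi H; first by split=> //; exact: C0.
split=> [|i]; first exact: C0.
have D h z p V (th : T -> 'rV[R]_p) W psi : nbhs h V -> (forall h z, V h -> U z -> W (row_mx (th h) z)) ->
    Cinf W psi -> (forall h z, V h -> U z -> Phi h z = psi (row_mx (th h) z)) -> U z ->
    is_derive z (delta_mx 0 i) (Phi h) (pd (rshift p i) psi (row_mx (th h) z)).
  move=> hV VW sp E Uz; have Vh : V h := nbhs_singleton hV.
  have ne : {near z, (fun z => psi (row_mx (th h) z)) =1 Phi h}.
    have := open_nbhs_nbhs (conj oU Uz); apply: filterS => w Uw.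
    by rewrite E.
  apply: (near_eq_is_derive ne).
  apply: is_derive_row_mx; have [_ /(_ (rshift p i))[+ _]] := sp 1%N.
  by apply; exact: VW.
split=> [h z Uz|].
  by have [p [V [th [W [psi [hO cth [oW OW] sp E]]]]]] := H h; have [] := D _ _ _ _ _ _ _ hO OW sp E Uz.
apply: IH => h0; have [p [V [th [W [psi [hO cth [oW OW] sp E]]]]]] := H h0.
exists p, V^°, th, W, (pd (rshift p i) psi); split=> //.
- exact: nbhs_interior.
- by move=> h /interior_subset; exact: cth.
- by split=> // h z /interior_subset; exact: OW.
- exact: Cinf_pd.
- by move=> h z hV Uz; rewrite {1}/pd; have [_ ->] := D h z _ _ _ _ _ hV OW sp E Uz.
Qed.

End Parametric.

Section ProductCharts.
Variables (R : realType).

Lemma open_rect a b (U : set 'rV[R]_a) (V : set 'rV[R]_b) : open U -> open V ->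
  open [set z : 'rV[R]_(a + b) | U (lsubmx z) /\ V (rsubmx z)].
Proof.
move=> oU oV; rewrite openE => z [zU zV]; rewrite /interior.
have /near_normP[d1 d10 h1] : nbhs (lsubmx z) U by exact: open_nbhs_nbhs.
have /near_normP[d2 d20 h2] : nbhs (rsubmx z) V by exact: open_nbhs_nbhs.
apply/near_normP; exists (Num.min d1 d2); first by rewrite lt_min d10.
move=> w; rewrite lt_min => /andP[w1 w2]; split.
- apply: h1; rewrite -linearB/=; apply: le_lt_trans w1.
  by apply: rV_norm_le => // i; rewrite mxE; exact: ler_coord.
- apply: h2; rewrite -linearB/=; apply: le_lt_trans w2.
  by apply: rV_norm_le => // i; rewrite mxE; exact: ler_coord.
Qed.

Variables (n1 n2 : nat) (M1 : manifold R n1) (M2 : manifold R n2).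

Lemma mprod_Cinf (F : M1 * M2 -> R) x1 t1 k1 d1 x2 t2 k2 d2 :
  fsmooth (f := mprod M1 M2) setT F ->
  @lcoord R n1 M1 x1 t1 k1 d1 -> @lcoord R n2 M2 x2 t2 k2 d2 ->
  Cinf [set z : 'rV[R]_(n1 + n2) | `|lsubmx z| < d1 /\ `|rsubmx z| < d2]
    (fun z => F (k1 (lsubmx z), k2 (rsubmx z))).
Proof.
move=> Fs [_ [_ [c1 [ac1 ck1 sk1]] _]] [_ [_ [c2 [ac2 ck2 sk2]] _]].
have oU : open [set z : 'rV[R]_(n1 + n2) | `|lsubmx z| < d1 /\ `|rsubmx z| < d2].
  exact: (open_rect (@open_nball0 _ _ _) (@open_nball0 _ _ _)).
pose W0 := [set z : 'rV[R]_(n1 + n2) | cimg c1 (lsubmx z) /\ cimg c2 (rsubmx z)].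
have oW0 : open W0 by apply: open_rect; exact: cimg_open.
have F0 : Cinf W0 (fun z => F (cinv c1 (lsubmx z), cinv c2 (rsubmx z))).
  apply: Cinf_sub (Fs c1 c2 ac1 ac2) => z [/= /cimg_cinv[z1 z2] /cimg_cinv[z3 z4]].
  by exists (cinv c1 (lsubmx z), cinv c2 (rsubmx z)); split=> //=; rewrite z2 z4 hsubmxK.
pose Th (z : 'rV[R]_(n1 + n2)) := row_mx (cmap c1 (k1 (lsubmx z))) (cmap c2 (k2 (rsubmx z))).
have sl j : Cinf [set z : 'rV[R]_(n1 + n2) | `|lsubmx z| < d1 /\ `|rsubmx z| < d2] (crd Th j).
  case: (splitP j) => i ji.
    apply: (@Cinf_ext _ _ _ (crd (cmap c1 \o k1) i \o lsubmx)) => //.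
      by move=> z _; rewrite /crd /Th (_ : j = lshift n2 i) ?row_mxEl//; exact/val_inj.
    apply: (Cinf_comp oU (@open_nball0 R n1 d1) _ (sk1 i)); last by move=> z [].
    move=> l q; apply: (@Ck_ext _ _ _ _ (fun z => z 0 (lshift n2 l))) => //; last exact: Ck_coord.
    by move=> z _; rewrite /crd mxE.
  apply: (@Cinf_ext _ _ _ (crd (cmap c2 \o k2) i \o rsubmx)) => //.
    by move=> z _; rewrite /crd /Th (_ : j = rshift n1 i) ?row_mxEr//; exact/val_inj.
  apply: (Cinf_comp oU (@open_nball0 R n2 d2) _ (sk2 i)); last by move=> z [].
  move=> l q; apply: (@Ck_ext _ _ _ _ (fun z => z 0 (rshift n1 l))) => //; last exact: Ck_coord.
  by move=> z _; rewrite /crd mxE.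
apply: (@Cinf_ext _ _ _ ((fun z => F (cinv c1 (lsubmx z), cinv c2 (rsubmx z))) \o Th)) => //.
  by move=> z [/= z1 z2]; rewrite /Th row_mxKl row_mxKr !cmapK//; [exact: ck2|exact: ck1].
apply: (Cinf_comp oU oW0 sl F0) => z [/= z1 z2]; rewrite /W0 /= row_mxKl row_mxKr.
by split; [exists (k1 (lsubmx z)); first exact: ck1|exists (k2 (rsubmx z)); first exact: ck2].
Qed.

Lemma mprod_PCk q (F : M1 * M2 -> R) x2 t2 k2 d2 :
  fsmooth (f := mprod M1 M2) setT F -> @lcoord R n2 M2 x2 t2 k2 d2 ->
  PCk q [set z | `|z| < d2] (fun h z => F (h, k2 z)).
Proof.
move=> Fs l2; apply: PCk_chart; last exact: open_nball0.
move=> h0; have [t1 [k1 [d1 l1]]] := lcoord_chart h0.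
have [_ [_ _ nb]] := l1.
exists n1, [set h | `|t1 h| < d1 /\ k1 (t1 h) = h], t1, [set z | `|lsubmx z| < d1 /\ `|rsubmx z| < d2], (fun z => F (k1 (lsubmx z), k2 (rsubmx z))).
split; [exact: nb|by move=> h _; exact: (tau_cont l1)| |exact: (mprod_Cinf Fs l1 l2)|].
  split; first exact: (open_rect (@open_nball0 _ _ _) (@open_nball0 _ _ _)).
  by move=> h z [h1 h2] zd; rewrite /= row_mxKl row_mxKr.
by move=> h z [h1 h2] zd; rewrite row_mxKl row_mxKr h2.
Qed.

End ProductCharts.

Section Functionals.
Variables (R : realType) (k : nat) (G : lieGroup R k).

Lemma cfunctional_mul (C : set G) (J : (G -> R) -> R) (a : G -> R) :
  cfunctional C J -> continuous a -> cfunctional C (fun f => J (fun h => a h * f h)).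
Proof.
move=> [kC lin [B B0 bd]] ca; split=> //.
  move=> f1 f2 r c1 c2; rewrite -lin; first by congr J; apply/funext => h; ring.
  - by move=> h; apply: (@continuousM _ _ a f1); [exact: ca|exact: c1].
  - by move=> h; apply: (@continuousM _ _ a f2); [exact: ca|exact: c2].
have [b b0 hb] := compact_bound kC (fun x _ => ca x).
exists (B * b) => [|f m cf m0 hf]; first by rewrite mulr_ge0// ltW.
rewrite -mulrA; apply: bd => [h||h Ch].
- by apply: (@continuousM _ _ a f); [exact: ca|exact: cf].
- by rewrite mulr_ge0// ltW.
- by rewrite normrM ler_pM//; [exact: hb|exact: hf].
Qed.

(** The Haar functional is linear on compactly supported functions; the factor [chi] extends it to
    all continuous functions, with a bound by the supremum over [C]. *)
Lemma haar_cfunctional (Gam C : set G) (I : (G -> R) -> R) (chi : G -> R) :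
  (forall f1 f2 (a : R), Cc f1 -> Cc f2 -> I (fun h => a * f1 h + f2 h) = a * I f1 + I f2) ->
  (forall f1 f2, Cc f1 -> Cc f2 -> (forall h, Gam h -> f1 h <= f2 h) -> I f1 <= I f2) ->
  Ccp chi -> compact C -> (forall h, Gam h -> chi h != 0 -> C h) ->
  cfunctional C (fun f => I (fun h => chi h * f h)).
Proof.
move=> lin mono [[cchi [C0 k0 z0]] chi0] kC hC.
have CcM f : continuous f -> Cc (fun h => chi h * f h).
  move=> cf; split; first by move=> h; apply: (@continuousM _ _ chi f); [exact: cchi|exact: cf].
  by exists C0 => // h /z0 ->; rewrite mul0r.
have Cchi : Cc chi by split=> //; exists C0.
have I0 : I (fun=> 0) = 0.
  have c0 : Cc (fun _ : G => 0 : R) by split; [exact: cst_continuous|exists C0].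
  transitivity (-1 * I (fun=> 0) + I (fun=> 0)); last by ring.
  by rewrite -lin//; congr I; apply/funext => h; rewrite mulr0 addr0.
have IZ f a : Cc f -> I (fun h => a * f h) = a * I f.
  move=> cf; have c0 : Cc (fun _ : G => 0 : R) by split; [exact: cst_continuous|exists C0].
  by have := lin _ _ a cf c0; rewrite I0 addr0 => <-; congr I; apply/funext => h; rewrite addr0.
split=> //.
  move=> f1 f2 a c1 c2; rewrite -lin; [|exact: CcM|exact: CcM].
  by congr I; apply/funext => h; ring.
exists (I chi) => [|f m cf m0 hf].
  by rewrite -I0; apply: mono => //; split; [exact: cst_continuous|exists C0].
have cm a : Cc (fun h => a * chi h).
  have := CcD (a - 1) Cchi Cchi; congr Cc; apply/funext => h; ring.
have le h : Gam h -> `|chi h * f h| <= m * chi h.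
  move=> Gh; rewrite normrM (ger0_norm (chi0 h)) mulrC.
  have [->|c0] := eqVneq (chi h) 0; first by rewrite !mulr0.
  by apply: ler_wpM2r => //; apply: hf; exact: hC.
rewrite ler_norml; apply/andP; split.
  rewrite [I chi * m]mulrC -mulNr -IZ//; apply: mono => [||h /le]; [exact: cm|exact: CcM|].
  by rewrite ler_norml mulNr => /andP[].
rewrite [I chi * m]mulrC -IZ//; apply: mono => [||h /le]; [exact: CcM|exact: cm|].
by rewrite ler_norml => /andP[].
Qed.

Lemma Cc_cutoff (C : set G) : compact C -> exists chi : G -> R,
  Ccp chi /\ forall h, C h -> chi h = 1.
Proof.
move=> kC; have [g0 [[[cg [C0 k0 z0]] g00] gC]] := Cc_pos kC.
have [B B0 hB] : exists2 B, 0 < B & forall h, C h -> `|(g0 h)^-1| <= B.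
  apply: compact_bound => // h Ch; apply: (@continuousV _ _ g0); last exact: cg.
  by rewrite gt_eqF// gC.
(* [B] bounds [1 / g0] on [C], so [B * g0] is at least 1 there. *)
exists (fun h => Num.min (B * g0 h) 1); split; last first.
  move=> h Ch; have := hB h Ch; rewrite gtr0_norm ?invr_gt0 ?gC// => h1.
  by apply/min_idPr; rewrite -[leLHS](mulVf (lt0r_neq0 (gC h Ch))) ler_wpM2r.
split; last by move=> h; rewrite le_min ler01 mulr_ge0// ltW.
split; last by exists C0 => // h /z0 ->; rewrite mulr0; apply/min_idPl.
move=> h; apply: (@continuous_min _ _ (fun h => B * g0 h) (fun=> 1)); last exact: cst_continuous.
by apply: (@continuousM _ _ (fun=> B) g0); [exact: cst_continuous|exact: cg].
Qed.

End Functionals.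

(** * Averages of functions along orbits *)

Section Averaging.
Variables (R : realType) (k n : nat) (G : lieGroup R k) (M : manifold R n).
Variable A : lieAction G M.
Hypothesis hproper : proper_action A.
Local Notation CsmM f := (Csm (X := mspace M) f).

Lemma act_fsmooth u : CsmM u -> fsmooth (f := mprod G M) setT (fun p => u (A p.1 p.2)).
Proof. by move=> us; case: (act_smooth A) => _ _ /(_ setT u openT us). Qed.

Lemma act_cont : continuous (fun p : G * M => A p.1 p.2).
Proof. by apply/continuousP => V oV; case: (act_smooth A) => _ h _; exact: h. Qed.

Lemma act_contl (y : M) : continuous (fun h => A h y).
Proof.
move=> h; apply: (@continuous_comp _ _ _ (fun h => (h, y)) (fun p : G * M => A p.1 p.2)).
  by apply: cvg_pair; [exact: cvg_id|exact: cvg_cst].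
exact: act_cont.
Qed.

Lemma act_contr g : continuous (fun y => A g y).
Proof.
move=> y; apply: (@continuous_comp _ _ _ (fun y => (g, y)) (fun p : G * M => A p.1 p.2)).
  by apply: cvg_pair; [exact: cvg_cst|exact: cvg_id].
exact: act_cont.
Qed.

Definition Csc (u : M -> R) := CsmM u /\ exists2 C, compact C & forall y, ~ C y -> u y = 0.

Lemma compact_nbhs (x : M) (U : set M) : nbhs x U -> exists C : set M, [/\ compact C, nbhs x C & C `<=` U].
Proof.
move=> /bump[b [C [_ _ b1 kC [CU b0]]]]; exists C; split=> //.
apply: filterS b1 => y b1; have [//|/b0 E] := pselect (C y).
by move: b1; rewrite /= E => /eqP; rewrite eq_sym oner_eq0.
Qed.

(** Properness enters here: the elements carrying points near [x] into the support of [u] stay in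
    one compact set. The average is thus locally an integral over a fixed compact set, to which the
    parametric results apply. *)
Lemma Csc_orbit u (x : M) : Csc u -> exists2 S : set G, compact S &
  nbhs x [set y | forall h, u (A h y) != 0 -> S h].
Proof.
move=> [us [C kC u0]]; have [C0 [kC0 nC0 _]] := compact_nbhs (@filterT _ (nbhs x) _).
have kS := @hproper (C `*` C0) (compact_setX kC kC0).
exists (fst @` [set p : G * M | (C `*` C0) (A p.1 p.2, p.2)]).
  by apply: continuous_compact => //; apply: continuous_subspaceT => p; exact: cvg_fst.
apply: filterS nC0 => y yC h uh; exists (h, y) => //; split=> //=.
by have [//|/u0 E] := pselect (C (A h y)); rewrite E eqxx in uh.
Qed.

Lemma Csc_Cc u (y : M) : Csc u -> Cc (fun h : G => u (A h y)).
Proof.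
move=> uc; have [S kS nS] := Csc_orbit y uc; split.
  move=> h; apply: (@continuous_comp _ _ _ (fun h => A h y) u); first exact: act_contl.
  exact: Csm_cont uc.1 _.
by exists S => // h; apply: contra_notP => /eqP; exact: (nbhs_singleton nS).
Qed.

Variable I : (G -> R) -> R.
Hypothesis Ilin : forall (f1 f2 : G -> R) (a : R), Cc f1 -> Cc f2 ->
  I (fun h => a * f1 h + f2 h) = a * I f1 + I f2.
Hypothesis Imono : forall f1 f2 : G -> R, Cc f1 -> Cc f2 -> (forall h, setT h -> f1 h <= f2 h) -> I f1 <= I f2.
Hypothesis Itr : forall (f : G -> R) g, Cc f -> setT g -> I (fun h => f (lmul h g)) = I f.
Hypothesis Ipos : forall f : G -> R, Cc f -> (forall h, setT h -> 0 <= f h) -> 0 < f (lone G) -> 0 < I f.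

Definition Av (u : M -> R) (y : M) : R := I (fun h => u (A h y)).

Lemma AvD u1 u2 a y : Csc u1 -> Csc u2 -> Av (fun y => a * u1 y + u2 y) y = a * Av u1 y + Av u2 y.
Proof. by move=> c1 c2; rewrite /Av Ilin//; exact: Csc_Cc. Qed.

Lemma Av_inv u : Csc u -> ginvariant A (Av u).
Proof.
move=> uc g x; rewrite /Av -[RHS](@Itr _ g)//; last exact: Csc_Cc.
by congr I; apply/funext => h; rewrite actM.
Qed.

Lemma Csc0 : Csc (fun=> 0).
Proof. by split; [apply: snear_Csm => x; exact: snear_cst|exists set0 => //; exact: compact0]. Qed.

Lemma Av0 y : Av (fun=> 0) y = 0.
Proof.
have := AvD (-1) y Csc0 Csc0; under [in X in X -> _]eq_fun do rewrite mulr0 addr0.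
by move=> E; rewrite E; ring.
Qed.

Lemma AvM u F y : Csc u -> (forall h, F (A h y) = F y) -> Av (fun y => F y * u y) y = F y * Av u y.
Proof.
move=> uc Fi; have -> : Av (fun y => F y * u y) y = Av (fun z => F y * u z + 0) y.
  by congr I; apply/funext => h; rewrite Fi addr0.
by rewrite AvD//; [rewrite Av0 addr0|exact: Csc0].
Qed.

Lemma Av_gt0 u y : Csc u -> (forall z, 0 <= u z) -> 0 < u y -> 0 < Av u y.
Proof. by move=> uc u0 uy; apply: Ipos; [exact: Csc_Cc| |rewrite act1]. Qed.

Lemma Av_smooth u : Csc u -> CsmM (Av u).
Proof.
move=> uc; apply: snear_Csm => x; have [tau [kap [dl lc]]] := lcoord_chart x.
have [S kS nS] := Csc_orbit x uc.
have [chi [chip chi1]] := Cc_cutoff kS; have [[cchi [C kC z0]] chi0] := chip.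
have [[dl0 st [tx kx]] [tk _ nb]] := lc.
have JC : cfunctional C (fun f => I (fun h => chi h * f h)).
  apply: (haar_cfunctional Ilin Imono) => // h _; apply: contraPP => /z0 ->.
  by rewrite eqxx.
pose Phi (h : G) (z : 'rV[R]_n) := u (A h (kap z)).
have oB := @open_nball0 R n dl.
have sm : Cinf [set z | `|z| < dl] (fun z => I (fun h => chi h * Phi h z)).
  by move=> q; apply: (J_Ck JC oB); exact: (mprod_PCk q (act_fsmooth uc.1) lc).
apply: (@snear_eq _ _ _ _ ((fun z => I (fun h => chi h * Phi h z)) \o tau)).
  apply: filterS2 nS nb => y yS [_ yk] /=; rewrite /Av; congr I; apply/funext => h.
  rewrite /Phi yk; have [->|/yS/chi1 ->] := eqVneq (u (A h y)) 0; last by rewrite mul1r.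
  by rewrite mulr0.
apply: snear_comp => [i|]; first exact: Csm_snear (st i).
by apply: (CN_open oB _ sm); rewrite tx /= normr0.
Qed.

(** [F] is the average of [b * psi] divided by that of the bump [b]: local invariance lets the value
    of [psi] come out of the integral near [x]. The division goes through [sinv], since the average
    of [b] may vanish far from [x]. *)
Lemma inv_extension (psi : M -> R) (x : M) (U : set M) : nbhs x U ->
  fsmooth (f := mspace M) U psi ->
  (forall y h, U y -> U (A h y) -> psi (A h y) = psi y) ->
  exists F, [/\ CsmM F, ginvariant A F & \forall y \near x, F y = psi y].
Proof.
rewrite nbhsE => -[V [oV Vx] VU] ps pinv.
have [b [C [bs b0 b1 kC [CV bC]]]] := bump (open_nbhs_nbhs (conj oV Vx)).
have bc : Csc b by split=> //; exists C.
have psV : fsmooth (f := mspace M) V psi.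
  by move=> c ac; apply: Cinf_sub (ps c ac) => _ [z [z1 /VU z2] <-]; exists z.
have bpc : Csc (fun y => b y * psi y).
  split; first exact: (Csm_bumpM bs kC CV oV bC psV).
  by exists C => // y /bC ->; rewrite mul0r.
pose m := Av b x / 2; have m0 : 0 < m.
  by rewrite divr_gt0//; apply: Av_gt0 => //; rewrite (nbhs_singleton b1) ltr01.
exists (fun y => Av (fun y => b y * psi y) y * sinv m (Av b y)); split.
- apply: snear_Csm => y; apply: snearM; first exact/Csm_snear/Av_smooth.
  by apply: snear_sm1; [exact: sm1_sinv|exact/Csm_snear/Av_smooth].
- by move=> g y; rewrite !Av_inv.
- have Vn := open_nbhs_nbhs (conj oV Vx).
  have nb : \forall y \near x, m < Av b y.
    have : {for x, continuous (Av b)} := @Csm_cont _ _ _ _ (Av_smooth bc) x.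
    move=> /cvgr_gt; apply.
    by rewrite /m ltr_pdivrMr// ltr_pMr ?ltr1n//; apply: Av_gt0 => //; rewrite (nbhs_singleton b1) ltr01.
  apply: filterS2 Vn nb => y yV my; rewrite sinvE//; last exact: ltW.
  have -> : Av (fun y => b y * psi y) y = psi y * Av b y.
    rewrite -[RHS](@AvM b (fun=> psi y))//; congr I; apply/funext => h.
    rewrite mulrC; have [hC|/bC ->] := pselect (C (A h y)); last by rewrite !mulr0.
    by rewrite pinv//; apply: VU => //; exact: CV.
  by rewrite mulfK// gt_eqF// (lt_trans m0).
Qed.

End Averaging.

(** * Tangent vectors in coordinates *)

Section Hadamard.
Variable R : realType.
Local Notation mu := (@lebesgue_measure R).

Lemma mu01 (m : R) : \int[mu]_(x in `[0%R, 1%R]) m = m.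
Proof.
rewrite Rintegral_cst//= lebesgue_measure_itv/= lte_fin ltr01.
by rewrite -EFinB subr0 /= mulr1.
Qed.

Lemma cont_integrable01 (f : R -> R) : continuous f -> mu.-integrable `[0%R, 1%R] (EFin \o f).
Proof.
move=> cf; apply: continuous_compact_integrable; first exact: segment_compact.
exact: continuous_subspaceT.
Qed.

Lemma int01_cfunctional :
  @cfunctional R R^o `[0%R, 1%R]%classic (fun f => \int[mu]_(x in `[0%R, 1%R]) f x).
Proof.
split.
- exact: segment_compact.
- move=> f1 f2 a c1 c2; rewrite RintegralD ?RintegralZl//; try exact: cont_integrable01.
  by apply: cont_integrable01 => x; apply: (@continuousM _ _ (fun=> a) f1); [exact: cst_continuous|exact: c1].
exists 1 => // f m cf m0 fm; rewrite mul1r.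
have i1 := cont_integrable01 cf.
apply: (le_trans (le_normr_Rintegral _ i1)) => //.
have -> : m = \int[mu]_(x in `[0%R, 1%R]) (fun=> m) x.
  by rewrite mu01.
apply: le_Rintegral => //.
- by apply: cont_integrable01 => x; apply: (@continuous_comp _ _ _ f Num.norm); [exact: cf|exact: norm_continuous].
- by apply: cont_integrable01 => x; exact: cst_continuous.
Qed.

Lemma J_sum (T : topologicalType) (C : set T) J (I : Type) (r : seq I) (f : I -> T -> R) (a : I -> R) :
  cfunctional C J -> (forall i, continuous (f i)) ->
  J (fun h => \sum_(i <- r) a i * f i h) = \sum_(i <- r) a i * J (f i).
Proof.
move=> HJ cf; have [_ lin _] := HJ; elim: r => [|i r IH].
  under eq_fun do rewrite big_nil; rewrite big_nil.
  have c0 : continuous (fun _ : T => 0 : R) by exact: cst_continuous.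
  by have := J_scale HJ 0 c0; rewrite !mul0r.
under eq_fun do rewrite big_cons; rewrite big_cons -IH lin//.
elim: r {IH} => [|j r IH]; first by under eq_fun do rewrite big_nil; exact: cst_continuous.
under eq_fun do rewrite big_cons.
move=> h; apply: (@continuousD _ _ _ (fun h => a j * f j h)); last exact: IH.
by apply: (@continuousM _ _ (fun=> a j) (f j)); [exact: cst_continuous|exact: cf].
Qed.

(** The parameter of a segment has to range over the whole line; clamping keeps [t *: z] in the ball
    without changing the integral over the unit segment. *)
Definition clamp (t : R) : R := Num.max 0 (Num.min t 1).

Lemma clampP t : 0 <= clamp t <= 1.
Proof. by rewrite /clamp le_max lexx /= ge_max ler01 ge_min lexx orbT. Qed.

Lemma clampE t : 0 <= t <= 1 -> clamp t = t.
Proof. by move=> /andP[t0 t1]; rewrite /clamp (min_idPl t1) (max_idPr t0). Qed.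

Lemma clamp_cont : continuous clamp.
Proof.
move=> t; apply: (@continuous_max _ R^o (fun=> 0) (fun t => Num.min t 1)); first exact: cst_continuous.
by apply: (@continuous_min _ R^o id (fun=> 1)); [exact: cvg_id|exact: cst_continuous].
Qed.

Lemma scale_ball n (z : 'rV[R]_n) (t d : R) : 0 <= t <= 1 -> `|z| < d -> `|t *: z| < d.
Proof.
move=> /andP[t0 t1] zd; rewrite normrZ ger0_norm//; apply: le_lt_trans zd.
by rewrite ler_piMl.
Qed.

(** [g i z] is the integral over the unit segment of the partial derivative at [t *: z]; the
    identity is the fundamental theorem of calculus along the segment from 0 to [z]. *)
Lemma hadamard n (f : 'rV[R]_n -> R) (d : R) : 0 < d -> Cinf [set z : 'rV[R]_n | `|z| < d] f ->
  exists g : 'I_n -> 'rV[R]_n -> R, [/\ forall i, Cinf [set z : 'rV[R]_n | `|z| < d] (g i),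
     forall i, g i 0 = pd i f 0 & forall z : 'rV[R]_n, `|z| < d -> f z = f 0 + \sum_i z 0 i * g i z].
Proof.
move=> d0 fs; have oB := @open_nball0 R n d.
pose Phi i (t : R^o) (z : 'rV[R]_n) := pd i f (clamp t *: z).
pose J (h : R -> R) : R := \int[mu]_(x in `[0%R, 1%R]) h x.
have HJ : @cfunctional R R^o `[0%R, 1%R]%classic J := int01_cfunctional.
have P q i : PCk q [set z : 'rV[R]_n | `|z| < d] (Phi i).
  apply: PCk_chart => // t0.
  exists 1%N, setT, (fun t : R^o => (clamp t)%:M), [set z : 'rV[R]_(1 + n) | `|(lsubmx z) 0 0 *: rsubmx z| < d],
    (fun z : 'rV[R]_(1 + n) => pd i f ((lsubmx z) 0 0 *: rsubmx z)).
  have cl j : Cinf setT (crd (fun z : 'rV[R]_(1 + n) => (lsubmx z) 0 0 *: rsubmx z) j).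
    apply: (@Cinf_ext _ _ _ (fun z : 'rV[R]_(1 + n) => z 0 (lshift n 0) * z 0 (rshift 1 j))); first exact: openT.
      by move=> z _; rewrite /crd !mxE.
    by apply: CinfM; [exact: openT|move=> l; exact: Ck_coord|move=> l; exact: Ck_coord].
  have cc : continuous (fun z : 'rV[R]_(1 + n) => (lsubmx z) 0 0 *: rsubmx z).
    by move=> z; apply: cont_rV => j; exact: Cinf_cont (cl j) _.
  have oW : open [set z : 'rV[R]_(1 + n) | `|(lsubmx z) 0 0 *: rsubmx z| < d].
    exact: (open_comp (fun z _ => cc z) oB).
  split.
  - exact: filterT.
  - move=> t _; apply: cont_rV => j; rewrite /crd.
    rewrite (_ : (fun y => _) = clamp); first exact: clamp_cont.
    by apply/funext => y; rewrite mxE ord1 eqxx mulr1n.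
  - split=> // t z _ zd; rewrite /= row_mxKl row_mxKr mxE eqxx mulr1n.
    by apply: scale_ball => //; exact: clampP.
  - apply: (Cinf_comp oW oB _ (Cinf_pd i fs)) => //.
    by move=> j; apply: Cinf_sub (cl j).
  - by move=> t z _ zd; rewrite row_mxKl row_mxKr mxE eqxx mulr1n.
exists (fun i z => J (fun t => Phi i t z)); split.
- by move=> i q; apply: (J_Ck HJ oB); exact: P.
- move=> i; rewrite /Phi; under eq_fun do rewrite scaler0.
  by rewrite /J mu01.
move=> z zd; rewrite -(@J_sum R^o _ J _ _ (fun i t => Phi i t z) _ HJ); last first.
  by move=> j; exact: (PCk_cont1 (P 0%N j) zd).
pose F (t : R) := f (t *: z).
have dF (t : R) : 0 <= t <= 1 -> is_derive t 1 F (\sum_(j < n) z 0 j * Phi j t z).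
  move=> t01; have tz := scale_ball t01 zd.
  have oz := open_nbhs_nbhs (conj oB tz).
  have dz := is_derive_sdiff z (C1_sdiff oB tz (fs 1%N)).
  have dz' : derivable f (0 + t *: z) z by rewrite add0r; case: dz.
  have [h1 h2] := is_derive_line dz'.
  have E : F = (fun s => f (0 + s *: z)) by apply/funext => s; rewrite add0r.
  rewrite E; apply: DeriveDef => //; rewrite h2.
  rewrite add0r; case: dz => _ ->; rewrite mxE; apply: eq_bigr => j _.
  by rewrite mxE /Phi clampE.
have cF (t : R) : 0 <= t <= 1 -> {for t, continuous F}.
  by move=> /dF[/derivable1_diffP/differentiable_continuous].
apply/eqP; rewrite addrC -subr_eq; apply/eqP/esym.
have := @continuous_FTC2 R (fun t => \sum_(j < n) z 0 j * Phi j t z) F 0 1 ltr01.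
rewrite /F scale1r scale0r => h; rewrite /J /Rintegral h//.
- apply: continuous_subspaceT; elim: (index_enum _) => [|j r IH].
    by under eq_fun do rewrite big_nil; exact: cst_continuous.
  under eq_fun do rewrite big_cons.
  move=> t; apply: (@continuousD _ _ _ (fun t => z 0 j * Phi j t z)); last exact: IH.
  apply: (@continuousM _ _ (fun=> z 0 j) (fun t => Phi j t z)); first exact: cst_continuous.
  exact: (PCk_cont1 (P 0%N j) zd).
- split.
  + by move=> t; rewrite in_itv /= => /andP[t0 t1]; case: (dF t) => //; rewrite !ltW.
  + by apply: cvg_at_right_filter; apply: cF; rewrite lexx ler01.
  + by apply: cvg_at_left_filter; apply: cF; rewrite lexx ler01.
- move=> t; rewrite in_itv /= => /andP[t0 t1]; rewrite derive1E.
  have t01 : 0 <= t <= 1 by rewrite !ltW.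
  by have [_ ->] := dF t t01.
Qed.
End Hadamard.

Section TangentCoordinates.
Variables (R : realType) (n : nat) (M : manifold R n).
Implicit Types (x y : M).
Local Notation CsmM f := (Csm (X := mspace M) f).
Local Notation tan := (tangent (X := mspace M)).

Lemma smooth_atP x f : smooth_at (X := mspace M) x f <-> snear x f.
Proof.
split=> [[U [oU Ux fU]]|[c [ac xc [W [oW Wx fW]]]]].
  by apply: (msm_snear _ fU); exact: open_nbhs_nbhs.
exists (cdom c `&` cmap c @^-1` W); split=> //.
- rewrite /= openE => y [yc yW]; apply: filterI; first exact: open_nbhs_nbhs (conj (cdom_open c) yc).
  by apply: (cmap_cont yc); exact: open_nbhs_nbhs.
- by apply: snear_msm => y [yc yW]; exists c; split=> //; exists W.
Qed.

Lemma germ_eqP x f g : {near x, f =1 g} -> germ_eq (X := mspace M) x f g.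
Proof.
by rewrite /prop_near1 nbhsE => -[V [oV Vx] VU]; exists V; split=> // y _ /VU.
Qed.

Variables (x : M) (v : vec (mspace M)).
Hypothesis tv : tan x v.

Lemma tan_eq f g : snear x f -> {near x, f =1 g} -> v f = v g.
Proof. by move=> /smooth_atP fs fg; have [_ _ + _] := tv; apply=> //; exact: germ_eqP. Qed.

Lemma tan_lin a f g : snear x f -> snear x g -> v (fun y => a * f y + g y) = a * v f + v g.
Proof. by move=> /smooth_atP fs /smooth_atP gs; have [+ _ _ _] := tv; apply. Qed.

Lemma tanM f g : snear x f -> snear x g -> v (fun y => f y * g y) = f x * v g + g x * v f.
Proof. by move=> /smooth_atP fs /smooth_atP gs; have [_ + _ _] := tv; apply. Qed.

Lemma tan_cst a : v (fun=> a) = 0.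
Proof.
have v1 : v (fun=> 1) = 0.
  have s1 := snear_cst x 1; have := tanM s1 s1; rewrite !mul1r.
  by move=> /(congr1 (fun t => t - v (fun=> 1))); rewrite subrr addrK => <-.
have := tan_lin a (snear_cst x 1) (snear_cst x 0).
have := tan_lin (-1) (snear_cst x 0) (snear_cst x 0).
by rewrite mulr0 !addr0 mulr1 v1 mulr0 add0r mulN1r addNr => -> ->.
Qed.

Lemma tanD f g : snear x f -> snear x g -> v (fun y => f y + g y) = v f + v g.
Proof.
move=> fs gs; have := tan_lin 1 fs gs; rewrite mul1r => <-; congr v.
by apply/funext => y; rewrite mul1r.
Qed.

Lemma tanZ a f : snear x f -> v (fun y => a * f y) = a * v f.
Proof.
move=> fs; have := tan_lin a fs (snear_cst x 0); rewrite tan_cst addr0 => <-; congr v.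
by apply/funext => y; rewrite addr0.
Qed.

Lemma tan_sum (I : Type) (r : seq I) f : (forall i, snear x (f i)) ->
  v (fun y => \sum_(i <- r) f i y) = \sum_(i <- r) v (f i).
Proof.
move=> fs; elim: r => [|i r IH].
  by under eq_fun do rewrite big_nil; rewrite tan_cst big_nil.
under eq_fun do rewrite big_cons; rewrite tanD// ?IH ?big_cons//.
exact: snear_sum.
Qed.

Variables (tau : M -> 'rV[R]_n) (kap : 'rV[R]_n -> M) (dl : R).
Hypothesis lc : lcoord x tau kap dl.

Lemma lcoord_small d : 0 < d -> \forall y \near x, `|tau y| < d.
Proof.
have [[dl0 st [tx kx]] _] := lc.
move=> d0; have /cvgrPdist_lt/(_ _ d0) := @tau_cont _ _ _ _ _ _ _ lc x.
by apply: filterS => y; rewrite tx sub0r normrN.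
Qed.

Lemma lcoord_snear f : CN 0 f -> snear x (f \o tau).
Proof.
have [[dl0 st [tx kx]] [tk _ nb]] := lc => fs.
by apply: snear_comp => [i|]; [exact: Csm_snear (st i)|rewrite tx].
Qed.

(** Hadamard's expansion writes [f] as a constant plus products of coordinates with smooth
    functions. The product rule at the common zero of the coordinates leaves only the first
    derivatives of [f]. *)
Lemma tan_coord f : snear x f -> v f = \sum_i v (crd tau i) * pd i (f \o kap) 0.
Proof.
have [[dl0 st [tx kx]] [tk _ nb]] := lc => fs.
have : CN 0 (f \o kap) by apply: (lcoord_CN lc); rewrite ?normr0 ?kx.
move=> [W [oW W0 fW]]; have /near_normP[d d0 hd] := open_nbhs_nbhs (conj oW W0).
have fB : Cinf [set z : 'rV[R]_n | `|z| < d] (f \o kap).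
  by apply: Cinf_sub fW => z zd; apply: hd; rewrite subr0.
have [g [gB g0 gE]] := hadamard d0 fB.
have gs i : snear x (g i \o tau).
  by apply: lcoord_snear; apply: (CN_open (@open_nball0 R n d) _ (gB i)); rewrite /= normr0.
have ts i : snear x (crd tau i) by exact: Csm_snear.
rewrite (@tan_eq f (fun y => f x + \sum_i crd tau i y * (g i \o tau) y))//; last first.
  have nt : \forall y \near x, `|tau y| < d.
    exact: lcoord_small.
  apply: filterS2 nb nt => y [_ yk] /gE; rewrite /= yk kx; exact.
rewrite tanD ?tan_cst ?add0r ?tan_sum//; first apply: eq_bigr => i _.
- by rewrite tanM//= tx g0 /crd tx mxE mul0r add0r mulrC.
- by move=> i; exact: snearM.
- exact: snear_cst.
- by apply: snear_sum => i; exact: snearM.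
Qed.

End TangentCoordinates.

Section TangentMore.
Variables (R : realType) (n : nat) (M : manifold R n).
Implicit Types (x y : M).
Local Notation tan := (tangent (X := mspace M)).

Lemma tan_min x (v : vec (mspace M)) f : tan x v -> snear x f ->
  (\forall y \near x, 0 <= f y) -> f x = 0 -> v f = 0.
Proof.
move=> tv fs f0 fx; have [tau [kap [dl lc]]] := lcoord_chart x.
rewrite (tan_coord tv lc fs) big1// => i _; suff -> : pd i (f \o kap) 0 = 0 by rewrite mulr0.
have [[dl0 st [tx kx]] [tk _ nb]] := lc.
have [W [oW W0 fW]] : CN 0 (f \o kap) by apply: (lcoord_CN lc); rewrite ?normr0 ?kx.
have sd := C1_sdiff oW W0 (fW 1%N).
set a := pd i _ 0; apply/eqP/negPn/negP => an.
have a0 : 0 < `|a| by rewrite normr_gt0.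
have kc : {for 0, continuous kap} by apply: (lcoord_cont lc); rewrite normr0.
have /near_normP[d1 d10 h1] : nbhs (0 : 'rV[R]_n) (fun z => 0 <= f (kap z)).
  by apply: (kc [set y | 0 <= f y]); rewrite kx.
have [d2 d20 h2] := sd _ (divr_gt0 a0 (ltr0n R 2)).
pose s := Num.min d1 d2 / 2; have s0 : 0 < s by rewrite divr_gt0// lt_min d10.
have sm : s < Num.min d1 d2 by rewrite ltr_pdivrMr// ltr_pMr ?ltr1n// lt_min d10.
(* A step against the sign of the derivative: with an error of at most [|a| / 2] per unit of length,
   it would make [f] negative near its minimum. *)
pose u : 'rV[R]_n := (- Num.sg a * s) *: delta_mx 0 i.
have nu : `|u| = s.
  rewrite normrZ normrM normrN normr_sg an mul1r (gtr0_norm s0).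
  rewrite (_ : `|_| = 1) ?mulr1//; apply/eqP; rewrite eq_le; apply/andP; split.
    apply: rV_norm_le => // j; rewrite mxE; case: eqP => _ /=; last by rewrite normr0.
    by case: eqP; rewrite ?normr1 ?normr0.
  by have := @ler_coord R n (delta_mx 0 i) i; rewrite mxE !eqxx normr1.
have u1 : `|u| < d1 by rewrite nu (lt_le_trans sm)// ge_min lexx.
have u2 : `|u| < d2 by rewrite nu (lt_le_trans sm)// ge_min lexx orbT.
have := h1 u; rewrite subr0 => /(_ u1) /= F0.
have := h2 u 0; rewrite subrr normr0 !subr0 => /(_ u2 d20).
rewrite /= kx fx subr0 nu -scalemxAl -rowE !mxE -/a ler_norml => /andP[_].
have -> : - Num.sg a * s * a = - (`|a| * s) by rewrite [`|a|]normrEsg; ring.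
rewrite opprK => h.
suff : `|a| / 2 * s < `|a| * s by move: F0; lra.
by rewrite ltr_pM2r// gtr_pMr// invf_lt1// ltr1n.
Qed.

Definition coord_vec x (tau : M -> 'rV[R]_n) (kap : 'rV[R]_n -> M) (a : 'rV[R]_n) : vec (mspace M) :=
  fun f => if `[< snear x f >] then \sum_i a 0 i * pd i (f \o kap) 0 else 0.

Lemma coord_vecP x tau kap dl a : lcoord x tau kap dl -> tan x (coord_vec x tau kap a) /\
  forall i, coord_vec x tau kap a (crd tau i) = a 0 i.
Proof.
move=> lc; have [[dl0 st [tx kx]] [tk _ nb]] := lc.
have cn f : snear x f -> CN 0 (f \o kap).
  by move=> fs; apply: (lcoord_CN lc); rewrite ?normr0 ?kx.
have cd f i : snear x f -> derivable (f \o kap) 0 (delta_mx 0 i).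
  move=> /cn[W [oW W0 fW]]; have [_ /(_ i)[+ _]] := fW 1%N; exact.
have kc : {for 0, continuous kap} by apply: (lcoord_cont lc); rewrite normr0.
split; first split.
- move=> b f g /smooth_atP fs /smooth_atP gs.
  rewrite /coord_vec !asboolT//; last by apply: snearD => //; apply: snearM => //; exact: snear_cst.
  rewrite mulr_sumr -big_split/=; apply: eq_bigr => i _.
  rewrite mulrCA -mulrDr; congr (_ * _).
  rewrite /pd (_ : (fun y => _) \o kap = (b \*: (f \o kap) + (g \o kap))%R)//.
  by rewrite deriveD ?deriveZ//; [exact: cd|apply: derivableZ; exact: cd|exact: cd].
- move=> f g /smooth_atP fs /smooth_atP gs.
  rewrite /coord_vec !asboolT//; last exact: snearM.
  rewrite !mulr_sumr -big_split/=; apply: eq_bigr => i _.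
  rewrite mulrCA [g x * _]mulrCA -mulrDr; congr (_ * _).
  rewrite /pd (_ : (fun y => _) \o kap = ((f \o kap) * (g \o kap))%R)//.
  by rewrite deriveM/= ?kx//; exact: cd.
- move=> f g /smooth_atP fs [U [oU Ux fg]].
  have nfg : {near x, f =1 g} by apply: filterS (open_nbhs_nbhs (conj oU Ux)) => y; exact: fg.
  rewrite /coord_vec !asboolT//; last exact: snear_eq fs.
  apply: eq_bigr => i _; congr (_ * _); apply: near_eq_derive.
  by apply: (kc [set y | f y = g y]); rewrite kx.
- by move=> f nf; rewrite /coord_vec asboolF// => /smooth_atP.
move=> j; rewrite /coord_vec asboolT; last exact: Csm_snear (st j).
have E i : pd i (crd tau j \o kap) 0 = (i == j)%:R.
  rewrite /pd (@near_eq_derive _ _ _ _ (fun z : 'rV[R]_n => z 0 j)).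
    rewrite (@derive_val _ _ _ _ _ _ _ (derive_coord j j (0 : 'rV[R]_n) (delta_mx 0 i))).
    by rewrite mxE eqxx /= eq_sym.
  have := open_nbhs_nbhs (conj (@open_nball0 R n dl) (_ : `|0| < dl)).
  by rewrite normr0 => /(_ dl0); apply: filterS => z zd; rewrite /crd /= tk.
under eq_bigr do rewrite E; rewrite (bigD1 j)//= eqxx mulr1 big1 ?addr0// => i /negPf ->.
by rewrite mulr0.
Qed.

End TangentMore.

(** * Linear coordinates at a compact stabilizer *)

Section Jacobian.
Variable R : realType.

Definition CNv m p (z : 'rV[R]_m) (F : 'rV[R]_m -> 'rV[R]_p) := forall j, CN z (crd F j).

Lemma CNv_sdiffv m p (z : 'rV[R]_m) (F : 'rV[R]_m -> 'rV[R]_p) : CNv z F -> sdiffv F z (jac F z).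
Proof.
move=> FN j; have [W [oW Wz FW]] := FN j.
have -> : col j (jac F z) = grad (crd F j) z by apply/colP => i; rewrite !mxE.
exact: C1_sdiff oW Wz (FW 1%N).
Qed.

Lemma sdiffv_jac m p (z : 'rV[R]_m) (F : 'rV[R]_m -> 'rV[R]_p) B : sdiffv F z B -> jac F z = B.
Proof.
move=> h; apply/matrixP => i j; rewrite mxE.
by have [_] := is_derive_sdiff (delta_mx 0 i) (h j); rewrite row_col_mx.
Qed.

Lemma jac_near m p (z : 'rV[R]_m) (F H : 'rV[R]_m -> 'rV[R]_p) : {near z, F =1 H} ->
  jac F z = jac H z.
Proof.
move=> h; apply/matrixP => i j; rewrite !mxE; apply: near_eq_derive.
by apply: filterS h => y; rewrite /crd => ->.
Qed.

Lemma CNv_near m p (z : 'rV[R]_m) (F H : 'rV[R]_m -> 'rV[R]_p) : {near z, F =1 H} ->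
  CNv z F -> CNv z H.
Proof. by move=> h FN j; apply: CN_near (FN j); apply: filterS h => y; rewrite /crd => ->. Qed.

Lemma CNv_comp m p q (z : 'rV[R]_m) (F : 'rV[R]_m -> 'rV[R]_p) (H : 'rV[R]_p -> 'rV[R]_q) :
  CNv z F -> CNv (F z) H -> CNv z (H \o F).
Proof. by move=> FN HN j; apply: (CN_comp FN (HN j)). Qed.

Lemma jac_comp m p q (z : 'rV[R]_m) (F : 'rV[R]_m -> 'rV[R]_p) (H : 'rV[R]_p -> 'rV[R]_q) :
  CNv z F -> CNv (F z) H -> jac (H \o F) z = jac F z *m jac H (F z).
Proof.
by move=> FN HN; apply: sdiffv_jac; apply: sdiffv_comp; exact: CNv_sdiffv.
Qed.

Lemma CNv_lin m p (z : 'rV[R]_m) (B : 'M[R]_(m, p)) c : CNv z (fun y => y *m B + c).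
Proof. by move=> j; exact: (CN_open (@openT _) _ (Cinf_lin B c (@openT _) j)). Qed.

Lemma jac_lin m p (z : 'rV[R]_m) (B : 'M[R]_(m, p)) c : jac (fun y => y *m B + c) z = B.
Proof.
apply: sdiffv_jac => j e e0; exists 1 => // u v _ _.
have -> : ((u - v) *m col j B) 0 0 = ((u - v) *m B) 0 j by rewrite colE mulmxA -colE mxE.
have E : crd (fun y => y *m B + c) j u - crd (fun y => y *m B + c) j v = ((u - v) *m B) 0 j.
  by rewrite /crd mulmxBl !mxE; ring.
by rewrite E subrr normr0 mulr_ge0// ltW.
Qed.

Lemma CNv_mull m p (z : 'rV[R]_m) (B : 'M[R]_(m, p)) : CNv z (fun y => y *m B).
Proof. by apply: (CNv_near _ (CNv_lin z B 0)); apply: filterE => y; rewrite addr0. Qed.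

Lemma jac_mull m p (z : 'rV[R]_m) (B : 'M[R]_(m, p)) : jac (fun y => y *m B) z = B.
Proof.
by rewrite -[RHS](jac_lin z B 0); apply: jac_near; apply: filterE => y; rewrite addr0.
Qed.

Lemma CNvD m p (z : 'rV[R]_m) (F H : 'rV[R]_m -> 'rV[R]_p) : CNv z F -> CNv z H ->
  CNv z (fun y => F y + H y).
Proof.
move=> FN HN j; apply: CN_near (CND (FN j) (HN j)).
by apply: filterE => y; rewrite /crd mxE.
Qed.

Lemma CNv_mulr m p q (z : 'rV[R]_m) (F : 'rV[R]_m -> 'rV[R]_p) (B : 'M[R]_(p, q)) : CNv z F ->
  CNv z (fun y => F y *m B).
Proof. by move=> FN; apply: (@CNv_comp _ _ _ _ F (fun y => y *m B) FN); exact: CNv_mull. Qed.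

Lemma jac_mulr m p q (z : 'rV[R]_m) (F : 'rV[R]_m -> 'rV[R]_p) (B : 'M[R]_(p, q)) : CNv z F ->
  jac (fun y => F y *m B) z = jac F z *m B.
Proof.
by move=> FN; rewrite -[in RHS](jac_mull (F z) B); apply: (jac_comp FN); exact: CNv_mull.
Qed.

Lemma CNv_cont m p (z : 'rV[R]_m) (F : 'rV[R]_m -> 'rV[R]_p) : CNv z F -> {for z, continuous F}.
Proof. by move=> FN; apply: cont_rV => j; exact: CN_cont (FN j). Qed.

Lemma Cinfv_CNv m p (U : set 'rV[R]_m) (z : 'rV[R]_m) (F : 'rV[R]_m -> 'rV[R]_p) : open U -> U z ->
  Cinfv U F -> CNv z F.
Proof. by move=> oU Uz FU j; apply: (CN_open oU Uz). Qed.

Lemma CNv_row_mx m p q (z : 'rV[R]_m) (F : 'rV[R]_m -> 'rV[R]_p) (H : 'rV[R]_m -> 'rV[R]_q) :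
  CNv z F -> CNv z H -> CNv z (fun y => row_mx (F y) (H y)).
Proof.
move=> FN HN j; case: (splitP j) => i ji.
  apply: CN_near (FN i); apply: filterE => y.
  by rewrite /crd (_ : j = lshift q i) ?row_mxEl//; exact/val_inj.
apply: CN_near (HN i); apply: filterE => y.
by rewrite /crd (_ : j = rshift p i) ?row_mxEr//; exact/val_inj.
Qed.

Lemma jac_row_mx m p q (z : 'rV[R]_m) (F : 'rV[R]_m -> 'rV[R]_p) (H : 'rV[R]_m -> 'rV[R]_q) :
  jac (fun y => row_mx (F y) (H y)) z = row_mx (jac F z) (jac H z).
Proof.
apply/matrixP => l j; rewrite mxE; case: (splitP j) => i ji.
  rewrite (_ : j = lshift q i) ?row_mxEl ?mxE; last exact/val_inj.
  by apply: near_eq_derive; apply: filterE => y; rewrite /crd row_mxEl.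
rewrite (_ : j = rshift p i) ?row_mxEr ?mxE; last exact/val_inj.
by apply: near_eq_derive; apply: filterE => y; rewrite /crd row_mxEr.
Qed.

Lemma CNv_lsubmx p q (z : 'rV[R]_(p + q)) : CNv z (fun y => lsubmx y).
Proof. by move=> j; apply: CN_near (CN_coord z (lshift q j)); apply: filterE => y; rewrite /crd mxE. Qed.

Lemma CNv_rsubmx p q (z : 'rV[R]_(p + q)) : CNv z (fun y => rsubmx y).
Proof. by move=> j; apply: CN_near (CN_coord z (rshift p j)); apply: filterE => y; rewrite /crd mxE. Qed.

Lemma CNv_id m (z : 'rV[R]_m) : CNv z id.
Proof. by move=> j; exact: CN_coord. Qed.

Lemma CNv_cst m p (z : 'rV[R]_m) (c : 'rV[R]_p) : CNv z (fun=> c).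
Proof. by move=> j; exact: CN_cst. Qed.

Lemma jac_id m (z : 'rV[R]_m) : jac id z = 1%:M.
Proof. exact/sdiffv_jac/sdiffv_id. Qed.

Lemma jac_cst m p (z : 'rV[R]_m) (c : 'rV[R]_p) : jac (fun=> c) z = 0.
Proof. by apply/matrixP => i j; rewrite !mxE; exact: derive_cst. Qed.

Lemma jac_usubmx p q r (z : 'rV[R]_p) (y : 'rV[R]_q) (F : 'rV[R]_(p + q) -> 'rV[R]_r) :
  CNv (row_mx z y) F -> jac (fun u => F (row_mx u y)) z = usubmx (jac F (row_mx z y)).
Proof.
move=> FN; have h : CNv z (fun u : 'rV[R]_p => row_mx u y).
  by apply: CNv_row_mx; [exact: CNv_id|exact: CNv_cst].
rewrite -[LHS]/(jac (F \o (fun u => row_mx u y)) z) (jac_comp h FN).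
by rewrite jac_row_mx jac_id jac_cst -[X in _ *m X]vsubmxK mul_row_col mul1mx mul0mx addr0.
Qed.

Lemma jac_dsubmx p q r (z : 'rV[R]_p) (y : 'rV[R]_q) (F : 'rV[R]_(p + q) -> 'rV[R]_r) :
  CNv (row_mx z y) F -> jac (fun u => F (row_mx z u)) y = dsubmx (jac F (row_mx z y)).
Proof.
move=> FN; have h : CNv y (fun u : 'rV[R]_q => row_mx z u).
  by apply: CNv_row_mx; [exact: CNv_cst|exact: CNv_id].
rewrite -[LHS]/(jac (F \o (fun u => row_mx z u)) y) (jac_comp h FN).
by rewrite jac_row_mx jac_id jac_cst -[X in _ *m X]vsubmxK mul_row_col mul1mx mul0mx add0r.
Qed.

End Jacobian.

(** * Invariant means over a compact subgroup *)

Section Mean.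
Variables (R : realType) (k : nat) (G : lieGroup R k) (K : set G).

(** A normalized Haar integral of [K], acting on continuous functions on all of [G]. Monotonicity
    tests values on [K] only, so the mean depends on restrictions to [K], and no function space over
    [K] has to be introduced. *)
Definition mean (m : (G -> R) -> R) :=
  [/\ forall f1 f2 (a : R), continuous f1 -> continuous f2 ->
        m (fun h => a * f1 h + f2 h) = a * m f1 + m f2,
      forall f1 f2, continuous f1 -> continuous f2 -> (forall h, K h -> f1 h <= f2 h) -> m f1 <= m f2,
      m (fun=> 1) = 1 &
      forall f g, continuous f -> K g -> m (fun h => f (lmul h g)) = m f].

Lemma mean_exists : compact_subgroup K -> exists m, mean m.
Proof.
move=> [cK K1 KM KV].
have cl : closed_subgroup K by split=> //; apply: compact_closed => //; exact: mhausdorff.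
have [I [lin mono tr pos]] := haar cl.
have [chi [[[cchi [C kC z0]] chi0] chi1]] := Cc_cutoff cK.
have CcM f : continuous f -> Cc (fun h => chi h * f h).
  move=> cf; split; first by move=> h; apply: (@continuousM _ _ chi f); [exact: cchi|exact: cf].
  by exists C => // h /z0 ->; rewrite mul0r.
have Cchi : Cc chi by split=> //; exists C.
have p0 : 0 < I chi by apply: pos => //; rewrite chi1.
have e0 : I chi != 0 by rewrite gt_eqF.
have CcE f1 f2 : Cc f1 -> Cc f2 -> (forall h, K h -> f1 h = f2 h) -> I f1 = I f2.
  by move=> c1 c2 e; apply/eqP; rewrite eq_le !mono// => h /e ->.
exists (fun f => I (fun h => chi h * f h) / I chi); split.
- move=> f1 f2 a c1 c2; rewrite mulrA -mulrDl -lin; [|exact: CcM|exact: CcM].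
  by congr (I _ / _); apply/funext => h; ring.
- move=> f1 f2 c1 c2 h12; rewrite ler_pM2r ?invr_gt0//; apply: mono; [exact: CcM|exact: CcM|].
  by move=> h Kh; rewrite ler_wpM2l// h12.
- rewrite (_ : (fun h => chi h * 1) = chi) ?divff//.
  by apply/funext => h; rewrite mulr1.
- move=> f g cf Kg; congr (_ / _).
  have cg : continuous (fun h => f (lmul h g)).
    move=> h; apply: (@continuous_comp _ _ _ (fun h => lmul h g) f); [exact: lmulr_cont|exact: cf].
  rewrite -(tr _ g (CcM _ cf) Kg); apply: CcE => [||h Kh].
  + exact: CcM.
  + by have := Cc_trans g (CcM _ cf).
  + by rewrite !chi1//; exact: KM.
Qed.

Variable m : (G -> R) -> R.
Hypotheses (cK : compact K) (mm : mean m).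

Lemma mean_eq f1 f2 : continuous f1 -> continuous f2 -> (forall h, K h -> f1 h = f2 h) -> m f1 = m f2.
Proof.
by case: mm => _ mono _ _ c1 c2 e; apply/eqP; rewrite eq_le !mono// => h /e ->.
Qed.

Lemma mean_cfunctional : cfunctional K m.
Proof.
have [lin mono m1 _] := mm.
have c1 (a : R) : continuous (fun _ : G => a) by exact: cst_continuous.
have m0 : m (fun=> 0) = 0.
  transitivity (-1 * m (fun=> 0) + m (fun=> 0)); last by ring.
  by rewrite -lin//; congr m; apply/funext => h; rewrite mulr0 addr0.
have mc a : m (fun=> a) = a.
  transitivity (a * m (fun=> 1) + m (fun=> 0)); last by rewrite m1 m0 mulr1 addr0.
  by rewrite -lin//; congr m; apply/funext => h; rewrite mulr1 addr0.
split=> //; exists 1 => // f M cf M0 fM; rewrite mul1r ler_norml -{1}(mc (- M)) -{2}(mc M).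
by apply/andP; split; apply: mono => // h /fM; rewrite ler_norml => /andP[].
Qed.

Lemma mean_cst a : m (fun=> a) = a.
Proof.
have [lin mono m1 _] := mm.
have c1 : continuous (fun _ : G => 1 : R) by exact: cst_continuous.
have := J_scale mean_cfunctional a c1.
by rewrite m1 !mulr1.
Qed.

Definition ccont a b (F : G -> 'M[R]_(a, b)) := forall i j, continuous (fun h => F h i j).

Definition mmx a b (F : G -> 'M[R]_(a, b)) : 'M[R]_(a, b) := \matrix_(i, j) m (fun h => F h i j).

Lemma ccont_cst a b (B : 'M[R]_(a, b)) : ccont (fun=> B).
Proof. by move=> i j; exact: cst_continuous. Qed.

Lemma cont_sum (T : topologicalType) (I : Type) (r : seq I) (f : I -> T -> R) : (forall i, continuous (f i)) ->
  continuous (fun h => \sum_(i <- r) f i h).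
Proof.
move=> cf; elim: r => [|i r IH]; first by under eq_fun do rewrite big_nil; exact: cst_continuous.
under eq_fun do rewrite big_cons.
by move=> h; apply: (@continuousD _ _ _ (f i)); [exact: cf|exact: IH].
Qed.

Lemma ccontM a b c (F : G -> 'M[R]_(a, b)) (H : G -> 'M[R]_(b, c)) : ccont F -> ccont H ->
  ccont (fun h => F h *m H h).
Proof.
move=> cF cH i j; under eq_fun do rewrite mxE; apply: cont_sum => l h.
by apply: (@continuousM _ _ (fun h => F h i l)); [exact: cF|exact: cH].
Qed.

Lemma ccont_comp a b (F : G -> 'M[R]_(a, b)) (u : G -> G) : continuous u -> ccont F -> ccont (F \o u).
Proof.
move=> cu cF i j h; apply: (@continuous_comp _ _ _ u (fun h => F h i j)); [exact: cu|exact: cF].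
Qed.

Lemma mmx_mull a b c (B : 'M[R]_(a, b)) (F : G -> 'M[R]_(b, c)) : ccont F ->
  mmx (fun h => B *m F h) = B *m mmx F.
Proof.
move=> cF; apply/matrixP => i j; rewrite !mxE; under [in X in m X]eq_fun do rewrite mxE.
rewrite (@J_sum R _ _ m _ _ (fun l h => F h l j) (B i) mean_cfunctional)//.
by apply: eq_bigr => l _; rewrite mxE.
Qed.

Lemma mmx_mulr a b c (B : 'M[R]_(b, c)) (F : G -> 'M[R]_(a, b)) : ccont F ->
  mmx (fun h => F h *m B) = mmx F *m B.
Proof.
move=> cF; apply/matrixP => i j; rewrite !mxE.
rewrite (_ : (fun h => _) = (fun h => \sum_l B l j * F h i l)).
  rewrite (@J_sum R _ _ m _ _ (fun l h => F h i l) (B^~ j) mean_cfunctional)//.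
  by apply: eq_bigr => l _; rewrite mxE mulrC.
by apply/funext => h; rewrite mxE; apply: eq_bigr => l _; rewrite mulrC.
Qed.

Lemma mmx_eq a b (F H : G -> 'M[R]_(a, b)) : ccont F -> ccont H -> (forall h, K h -> F h = H h) ->
  mmx F = mmx H.
Proof. by move=> cF cH e; apply/matrixP => i j; rewrite !mxE; apply: mean_eq => // h /e ->. Qed.

Lemma mmx_tr a b (F : G -> 'M[R]_(a, b)) g : ccont F -> K g -> mmx (fun h => F (lmul h g)) = mmx F.
Proof.
move=> cF Kg; apply/matrixP => i j; rewrite !mxE; have [_ _ _ tr] := mm.
exact: (tr (fun h => F h i j)).
Qed.

Lemma mmx_cst a b (B : 'M[R]_(a, b)) : mmx (fun=> B) = B.
Proof. by apply/matrixP => i j; rewrite mxE mean_cst. Qed.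

End Mean.

Section LocalInverse.
Variables (R : realType) (n : nat) (M : manifold R n).

Lemma inverse_function p (F : 'rV[R]_p -> 'rV[R]_p) (U : set 'rV[R]_p) : open U -> U 0 ->
  Cinfv U F -> F 0 = 0 -> jac F 0 = 1%:M ->
  exists (d1 d2 : R) (g : 'rV[R]_p -> 'rV[R]_p),
  [/\ 0 < d1, 0 < d2, Cinfv [set e | `|e| < d2] g & g 0 = 0] /\
  [/\ forall e : 'rV[R]_p, `|e| < d2 -> U (g e),
     forall e : 'rV[R]_p, `|e| < d2 -> F (g e) = e &
     forall al e : 'rV[R]_p, `|al| < d1 -> `|e| < d2 -> F al = e -> al = g e].
Proof.
move=> oU U0 FU F0 J1.
(* The inverse is the implicit function of [F al - e = 0], where the derivative in [al] at the
   origin is the identity. *)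
pose GG (z : 'rV[R]_(p + p)) := F (lsubmx z) - rsubmx z.
pose V := [set z : 'rV[R]_(p + p) | U (lsubmx z) /\ setT (rsubmx z)].
have oV : open V by apply: (open_rect oU); exact: openT.
have GN z : V z -> CNv z GG.
  move=> [Uz _]; apply: CNvD.
    by apply: (CNv_comp (CNv_lsubmx z)); exact: Cinfv_CNv oU Uz FU.
  move=> j; apply: CN_near (CNM (CN_cst z (-1)) (CNv_rsubmx z j)).
  by apply: filterE => y; rewrite /crd [RHS]mxE mulN1r.
have V0 : V 0 by split=> //; rewrite linear0.
have V00 : V (row_mx 0 0) by rewrite row_mx0.
have GU : Cinfv V GG.
  move=> j; apply/Cinf_pt => z Vz; have [W [oW Wz fW]] := GN z Vz j.
  by apply: Cinf_sub fW => _ ->.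
have G0 : GG 0 = 0 by rewrite /GG !linear0 F0 addr0.
have GJ : usubmx (jac GG 0) = 1%:M.
  rewrite -row_mx0 -(jac_usubmx (GN _ V00)) -J1; apply: jac_near; apply: filterE => u.
  by rewrite /GG row_mxKl row_mxKr subr0.
have [d1 [d2 [cc [g [[d10 d20 _ gs] [g0 gU gE gu _]]]]]] := implicit_function oV V0 GU G0 GJ.
exists d1, d2, g; split=> //; split.
- by move=> e /gU[_ []]; rewrite row_mxKl.
- move=> z zd; have := gE z zd; rewrite /GG row_mxKl row_mxKr => /eqP.
  by rewrite subr_eq0 => /eqP.
- by move=> al e h1 h2 E; apply: gu => //; rewrite /GG row_mxKl row_mxKr E subrr.
Qed.

(** The new inverse is [kap0] followed on the inner side by the local inverse of [tau \o kap0], so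
    smoothness is inherited from the old coordinates. *)
Lemma lcoord_of_jac (x : M) c kap0 d0 (tau : M -> 'rV[R]_n) : lcoord x c kap0 d0 ->
  (forall i, Csm (X := mspace M) (crd tau i)) -> tau x = 0 -> jac (tau \o kap0) 0 = 1%:M ->
  exists kap dl, lcoord x tau kap dl.
Proof.
move=> lc st tx J1; have [[d00 sc [cx kx]] [ck [ch [ach ckch skch]] nb]] := lc.
have stk : Cinfv [set z | `|z| < d0] (tau \o kap0).
  by move=> j; exact: (lcoord_Cinf lc (st j)).
have [||d1 [d2 [g [[d10 d20 gs g0] [gd gE gu]]]]] := inverse_function (@open_nball0 R n d0) _ stk _ J1.
- by rewrite /= normr0.
- by rewrite /= kx.
exists (kap0 \o g), d2; split; split=> //; first by rewrite /= g0 kx.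
- exists ch; split=> // [z zd|j]; first by apply: ckch; exact: gd.
  by apply: (Cinf_comp (@open_nball0 _ _ _) (@open_nball0 R n d0) gs (skch j)) => z /gd.
- have c1 := lcoord_small lc d10; have c0 := lcoord_small lc d00.
  have t1 : \forall y \near x, `|tau y| < d2.
    have ct : {for x, continuous tau} by apply: cont_rV => j; exact: Csm_cont (st j) x.
    have /cvgrPdist_lt/(_ _ d20) := ct.
    by apply: filterS => y; rewrite tx sub0r normrN.
  apply: filterS2 (filterI c1 c0) (filterI t1 nb) => y [y1 y0] [y2 [_ yk]].
  by split=> //=; rewrite -(gu (c y) (tau y))//= yk.
Qed.

End LocalInverse.

Lemma PCk_Ck (R : realType) (T : topologicalType) p q (U : set 'rV[R]_p) (Phi : T -> 'rV[R]_p -> R) h :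
  PCk q U Phi -> Ck q U (Phi h).
Proof.
elim: q Phi => [|q IH] Phi [c H]; split=> //.
1,2: move=> z Uz.
1,2: apply: (@continuous_comp _ _ _ (fun z => (h, z)) (fun p : T * 'rV[R]_p => Phi p.1 p.2)); last exact: c.
1,2: move=> W [[W1 W2] [/= h1 h2] sW]; rewrite /nbhs /=; apply: filterS h2 => y y1.
1,2: by apply: sW; split=> //=; exact: nbhs_singleton h1.
by move=> i; have [H1 H2] := H i; split=> [z|]; [exact: H1|exact: (IH _ H2)].
Qed.

Lemma Csm_slice (R : realType) n1 n2 (M1 : manifold R n1) (M2 : manifold R n2) (F : M1 * M2 -> R) g :
  fsmooth (f := mprod M1 M2) setT F -> Csm (X := mspace M2) (fun y => F (g, y)).
Proof.
move=> Fs; apply: snear_Csm => y; have [tau [kap [dl lc]]] := lcoord_chart y.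
have [[dl0 st [tx kx]] [tk _ nb]] := lc.
have sm : Cinf [set z : 'rV[R]_n2 | `|z| < dl] (fun z => F (g, kap z)).
  by move=> q; exact: (@PCk_Ck _ _ _ _ _ (fun h z => F (h, kap z)) g (mprod_PCk q Fs lc)).
apply: (@snear_eq _ _ _ _ ((fun z => F (g, kap z)) \o tau)).
  by apply: filterS nb => z [_ /= ->].
by apply: (lcoord_snear lc); apply: (CN_open (@open_nball0 R n2 dl) _ sm); rewrite /= normr0.
Qed.

Section LinearCoordinates.
Variables (R : realType) (k n : nat) (G : lieGroup R k) (M : manifold R n).
Variable A : lieAction G M.
Hypothesis hproper : proper_action A.
Local Notation CsmM f := (Csm (X := mspace M) f).

Lemma Csm_act u g : CsmM u -> CsmM (u \o A g).
Proof. by move=> us; exact: (Csm_slice g (act_fsmooth A us)). Qed.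

Definition stab (x : M) : set G := [set h | A h x = x].

Lemma stab_compact x : compact_subgroup (stab x).
Proof.
split; rewrite /stab /=.
- have k1 : compact [set (x, x)] by exact: compact_set1.
  have k2 := hproper k1.
  have -> : [set h | A h x = x] = fst @` [set p : G * M | [set (x, x)] (A p.1 p.2, p.2)].
    apply/seteqP; split=> [h hx|_ [[h y] /= [h1 h2] <-]]; last by rewrite -{2}h1 h2.
    by exists (h, x) => //=; rewrite hx.
  by apply: continuous_compact => //; apply: continuous_subspaceT => p; exact: cvg_fst.
- by rewrite act1.
- by move=> a b ha hb; rewrite actM hb.
- by move=> a ha; rewrite -{1}ha -actM lmulV act1.
Qed.

Variables (x : M) (m : (G -> R) -> R).
Local Notation K := (stab x).
Hypothesis mm : mean K m.

(** Bochner's linearization: [c (A h y) *m rho (linv h)] is averaged over the stabilizer. Each term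
    has the identity as derivative at [x], so the average is again a coordinate system. Vectors are
    rows, hence [rho] reverses products. *)
Lemma linear_coords : exists (rho : G -> 'M[R]_n) (tau : M -> 'rV[R]_n) kap dl,
  [/\ lcoord x tau kap dl, ccont rho, rho (lone G) = 1%:M,
     forall a b, K a -> K b -> rho (lmul a b) = rho b *m rho a &
     forall a y, K a -> tau (A a y) = tau y *m rho a].
Proof.
have [cK K1 KM KV] := stab_compact x.
have [c [kap0 [d0 lc]]] := lcoord_chart x.
have [[d00 sc [cx kx]] [ck _ nb]] := lc.
pose F h z := c (A h (kap0 z)).
have FN h : CNv 0 (F h).
  move=> j; apply: (@lcoord_CN _ _ _ _ _ _ _ (crd c j \o A h) 0 lc); first by rewrite normr0.
  exact/Csm_snear/Csm_act/sc.
(* The isotropy representation on the tangent space at [x]. The formula makes sense for every [h];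
   multiplicativity is proved on the stabilizer. *)
pose rho h := jac (F h) 0.
have P1 q j : PCk q [set z : 'rV[R]_n | `|z| < d0] (fun h z => crd (F h) j z).
  exact: (mprod_PCk q (act_fsmooth A (sc j)) lc).
have B0 : [set z : 'rV[R]_n | `|z| < d0] 0 by rewrite /= normr0.
have cr : ccont rho.
  move=> i j; rewrite /rho; under eq_fun do rewrite mxE.
  have [_ /(_ i)[_ P0]] := P1 1%N j.
  exact: (@PCk_cont1 _ _ _ 0 _ (fun h => pd i (crd (F h) j)) _ P0 B0).
have rM a b : K a -> K b -> rho (lmul a b) = rho b *m rho a.
  move=> Ka Kb; have Fb0 : F b 0 = 0 by rewrite /F kx Kb.
  have Fa : CNv (F b 0) (F a) by rewrite Fb0.
  rewrite [RHS](_ : _ = jac (F a \o F b) 0); last by rewrite (jac_comp (FN b) Fa) Fb0.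
  apply: jac_near; have cb : {for 0, continuous (A b \o kap0)}.
    apply: continuous_comp; last exact: act_contr.
    by apply: (lcoord_cont lc); rewrite normr0.
  have : nbhs ((A b \o kap0) 0) [set y | `|c y| < d0 /\ kap0 (c y) = y].
    by rewrite /= kx Kb; exact: nb.
  move=> /cb h; have FF : Filter (nbhs (0 : 'rV[R]_n)) by exact: nbhs_filter.
  by apply: (@filterS _ (nbhs (0 : 'rV[R]_n)) _ _ _ _ h) => z /= [_ E]; rewrite /F E actM.
have r1 : rho (lone G) = 1%:M.
  rewrite -(jac_id (0 : 'rV[R]_n)); apply: jac_near.
  have := open_nbhs_nbhs (conj (@open_nball0 R n d0) B0); apply: filterS => z zd.
  by rewrite /F act1 ck.
have crV : ccont (rho \o @linv _ _ G) by apply: ccont_comp => //; exact: linv_cont.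
have rV a : K a -> rho a *m rho (linv a) = 1%:M.
  by move=> Ka; rewrite -rM ?lmulV//; exact: KV.
have cact y : ccont (fun h => c (A h y)).
  move=> i j h; apply: (@continuous_comp _ _ _ (fun h => A h y) (fun y => c y i j)).
    exact: act_contl.
  by rewrite ord1; exact: Csm_cont (sc j) _.
pose tau y : 'rV[R]_n := mmx m (fun h => c (A h y) *m rho (linv h)).
have tE j y : crd tau j y = \sum_i m (fun h => rho (linv h) i j * c (A h y) 0 i).
  rewrite /crd /tau mxE; under [in LHS]eq_fun do rewrite mxE.
  have := @J_sum R _ _ m _ (index_enum 'I_n) (fun i h => rho (linv h) i j * c (A h y) 0 i) (fun=> 1) (mean_cfunctional cK mm).
  move=> h; rewrite -[RHS](eq_bigr _ (fun i _ => mul1r _)) -h.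
    by congr m; apply/funext => h'; apply: eq_bigr => i _; rewrite mul1r mulrC.
  by move=> i h'; apply: (@continuousM _ _ (fun h => rho (linv h) i j)); [exact: crV|exact: cact].
have MC i j := cfunctional_mul (mean_cfunctional cK mm) (crV i j).
have ts j : CsmM (crd tau j).
  apply: snear_Csm => y; have [t1 [k1 [e1 l1]]] := lcoord_chart y.
  have [[e10 s1 [t1x k1x]] [tk1 _ nb1]] := l1.
  have sm : Cinf [set z : 'rV[R]_n | `|z| < e1] (fun z => \sum_i m (fun h => rho (linv h) i j * crd c i (A h (k1 z)))).
    apply: Cinf_sum => [|i _ q]; first exact: open_nball0.
    apply: (J_Ck (MC i j) (@open_nball0 R n e1)).
    exact: (mprod_PCk q (act_fsmooth A (sc i)) l1).
  apply: (@snear_eq _ _ _ _ ((fun z => \sum_i m (fun h => rho (linv h) i j * crd c i (A h (k1 z)))) \o t1)).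
    by apply: filterS nb1 => z [_ zk]; rewrite tE /= zk.
  by apply: (lcoord_snear l1); apply: (CN_open (@open_nball0 R n e1) _ sm); rewrite /= normr0.
have tx : tau x = 0.
  rewrite /tau -(@mmx_cst _ _ _ K m cK mm 1 n 0); apply: (mmx_eq mm) => [||h Kh].
  - by apply: ccontM; [exact: cact|exact: crV].
  - exact: ccont_cst.
  - by rewrite Kh cx mul0mx.
have J1 : jac (tau \o kap0) 0 = 1%:M.
  apply/matrixP => i j; rewrite mxE.
  have D : is_derive 0 (delta_mx 0 i : 'rV[R]_n) (crd (tau \o kap0) j)
     (\sum_l m (fun h => rho (linv h) l j * pd i (crd (F h) l) 0)).
    have -> : crd (tau \o kap0) j = \sum_l (fun z => m (fun h => rho (linv h) l j * crd (F h) l z)).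
      by apply/funext => z; rewrite fct_sumE; exact: tE.
    apply: is_derive_sum => l.
    exact: (is_derive_J (MC l j) i (@open_nball0 R n d0) (P1 1%N l) B0).
  rewrite /pd (@derive_val _ _ _ _ _ _ _ D).
  rewrite -(@mean_cst _ _ _ K m cK mm (1%:M i j)).
  have := @J_sum R _ _ m _ (index_enum 'I_n) (fun l h => rho (linv h) l j * pd i (crd (F h) l) 0) (fun=> 1) (mean_cfunctional cK mm).
  have cpd l : continuous (fun h => rho (linv h) l j * pd i (crd (F h) l) 0).
    move=> h; apply: (@continuousM _ _ (fun h => rho (linv h) l j)); first exact: crV.
    have [_ /(_ i)[_ P0]] := P1 1%N l.
    exact: (@PCk_cont1 _ _ _ 0 _ (fun h => pd i (crd (F h) l)) _ P0 B0).
  move=> /(_ cpd) h; rewrite -[LHS](eq_bigr _ (fun i _ => mul1r _)) -h.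
  apply: (mean_eq mm) => [||a Ka].
  - by under eq_fun do under eq_bigr do rewrite mul1r; exact: cont_sum.
  - exact: cst_continuous.
  - rewrite -(rV a Ka) mxE; apply: eq_bigr => l _.
    have -> : rho a i l = pd i (crd (F a) l) 0 by rewrite mxE.
    by rewrite mul1r mulrC.
have [kap [dl lt]] := lcoord_of_jac lc ts tx J1.
exists rho, tau, kap, dl; split=> // a y Ka.
rewrite /tau -(mmx_mulr cK mm); last by apply: ccontM; [exact: cact|exact: crV].
rewrite -[LHS](mmx_tr mm _ (KV _ Ka)); last by apply: ccontM; [exact: cact|exact: crV].
apply: (mmx_eq mm) => [||h Kh].
- have := ccont_comp (@lmulr_cont _ _ _ (linv a)) (ccontM (cact (A a y)) crV).
  by apply.
- by do 2?apply: ccontM; [exact: cact|exact: crV|exact: ccont_cst].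
- rewrite actM -[A (linv a) _]actM lmulV act1 linvM linvK rM//; last exact: KV.
  by rewrite mulmxA.
Qed.

End LinearCoordinates.

Section MatrixContinuity.
Variables (R : realType) (T : topologicalType).

Lemma cont_sum_at (I : Type) (r : seq I) (f : I -> T -> R) t : (forall i, {for t, continuous (f i)}) ->
  {for t, continuous (fun h => \sum_(i <- r) f i h)}.
Proof.
move=> cf; elim: r => [|i r IH].
  apply: (@near_eq_cont _ _ (fun=> 0 : R)); last exact: cst_continuous.
  by apply: filterE => h; rewrite big_nil.
apply: (@near_eq_cont _ _ (fun h => f i h + \sum_(i <- r) f i h)).
  by apply: filterE => h; rewrite big_cons.
by apply: (@continuousD _ _ _ (f i)); [exact: cf|exact: IH].
Qed.

Lemma cont_prod_at (I : Type) (r : seq I) (f : I -> T -> R) t : (forall i, {for t, continuous (f i)}) ->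
  {for t, continuous (fun h => \prod_(i <- r) f i h)}.
Proof.
move=> cf; elim: r => [|i r IH].
  apply: (@near_eq_cont _ _ (fun=> 1 : R)); last exact: cst_continuous.
  by apply: filterE => h; rewrite big_nil.
apply: (@near_eq_cont _ _ (fun h => f i h * \prod_(i <- r) f i h)).
  by apply: filterE => h; rewrite big_cons.
by apply: (@continuousM _ _ (f i)); [exact: cf|exact: IH].
Qed.

Definition mcont a b (F : T -> 'M[R]_(a, b)) t := forall i j, {for t, continuous (fun h => F h i j)}.

Lemma mcontM a b c (F : T -> 'M[R]_(a, b)) (H : T -> 'M[R]_(b, c)) t : mcont F t -> mcont H t ->
  mcont (fun h => F h *m H h) t.
Proof.
move=> cF cH i j; apply: (@near_eq_cont _ _ (fun h => \sum_l F h i l * H h l j)).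
  by apply: filterE => h; rewrite mxE.
apply: cont_sum_at => l.
by apply: (@continuousM _ _ (fun h => F h i l)); [exact: cF|exact: cH].
Qed.

Lemma mcont_cst a b (B : 'M[R]_(a, b)) t : mcont (fun=> B) t.
Proof. by move=> i j; exact: cst_continuous. Qed.

Lemma cont_det a (F : T -> 'M[R]_a) t : mcont F t -> {for t, continuous (fun h => \det (F h))}.
Proof.
move=> cF; apply: cont_sum_at => s.
apply: continuousM; first exact: cst_continuous.
by apply: cont_prod_at => i; exact: cF.
Qed.

Lemma unit_near a (F : T -> 'M[R]_a) t : mcont F t -> F t \in unitmx ->
  \forall h \near t, F h \in unitmx.
Proof.
move=> cF; rewrite unitmxE unitfE => Ft.
have := @cvgr_neq0 _ _ _ (nbhs t) _ _ _ (cont_det cF) Ft.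
move=> h; have FF : Filter (nbhs t) by exact: nbhs_filter.
by apply: filterS (h FF) => y hn; rewrite unitmxE unitfE.
Qed.

End MatrixContinuity.

Section JacobianMore.
Variable R : realType.

Lemma nball_nbhs p (d : R) : 0 < d -> nbhs (0 : 'rV[R]_p) [set u | `|u| < d].
Proof. by move=> d0; apply: (open_nbhs_nbhs (conj (@open_nball0 R p d) _)); rewrite /= normr0. Qed.

Lemma CN_pd p (z : 'rV[R]_p) f i : CN z f -> CN z (pd i f).
Proof. by move=> [W [oW Wz fW]]; exists W; split=> //; exact: Cinf_pd. Qed.

Lemma jac_mcont (T : topologicalType) p q (h : T -> 'rV[R]_p) t (F : 'rV[R]_p -> 'rV[R]_q) :
  {for t, continuous h} -> CNv (h t) F -> mcont (fun s => jac F (h s)) t.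
Proof.
move=> ch FN i j; apply: (@near_eq_cont _ _ (fun s => pd i (crd F j) (h s))).
  by apply: filterE => s; rewrite mxE.
by apply: (@continuous_comp _ _ _ h (pd i (crd F j))) => //; apply: CN_cont; exact: CN_pd.
Qed.

Lemma CNv_Cinfv p q (U : set 'rV[R]_p) (F : 'rV[R]_p -> 'rV[R]_q) : (forall z, U z -> CNv z F) -> Cinfv U F.
Proof.
move=> h j; apply/Cinf_pt => z Uz; have [W [oW Wz fW]] := h z Uz j.
by apply: Cinf_sub fW => _ ->.
Qed.

Lemma jac0_const p q (F : 'rV[R]_p -> 'rV[R]_q) (d : R) :
  (forall e : 'rV[R]_p, `|e| < d -> CNv e F /\ jac F e = 0) ->
  forall e : 'rV[R]_p, `|e| < d -> F e = F 0.
Proof.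
move=> h e ed; apply/rowP => j.
have [|c _] := @MVT_unordered R (fun s => crd F j (s *: e)) (fun=> 0) 0 1.
  rewrite /Num.min /Num.max ltr01 => s s01; have [FN J0] := h _ (scale_ball s01 ed).
  have := is_derive_sdiff e (CNv_sdiffv FN j).
  rewrite J0 (_ : (e *m col j 0) 0 0 = 0); last by rewrite colE !mul0mx mulmx0 mxE.
  move=> [D E]; have D' : derivable (crd F j) (0 + s *: e) e by rewrite add0r.
  have [D1 E1] := is_derive_line D'.
  rewrite (_ : (fun s => _) = (fun s => crd F j (0 + s *: e))).
    by apply: DeriveDef => //; rewrite E1 add0r.
  by apply/funext => t; rewrite add0r.
by rewrite mul0r scale0r scale1r => /eqP; rewrite subr_eq0 => /eqP.
Qed.

End JacobianMore.

(** * Second order expansions *)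

Section SecondOrder.
Variable R : realType.

Lemma CN_lipschitz p (f : 'rV[R]_p -> R) : CN 0 f -> exists (C d : R), [/\ 0 < C, 0 < d &
  forall u v : 'rV[R]_p, `|u| < d -> `|v| < d -> `|f u - f v| <= C * `|u - v|].
Proof.
move=> [W [oW W0 fW]]; have sd := C1_sdiff oW W0 (fW 1%N).
have [d d0 hd] := sd 1 ltr01; have [c c0 hc] := mulmx_bound (grad f 0).
exists (c + 1), d; split; [by rewrite addr_gt0|by []|].
move=> u v ud vd; have := hd u v; rewrite !subr0 mul1r => /(_ ud vd) h1.
have h2 := hc (u - v); have h3 := ler_coord ((u - v) *m grad f 0) 0.
rewrite -[f u - f v](subrK (((u - v) *m grad f 0) 0 0)).
apply: (le_trans (ler_normD _ _)); rewrite mulrDl mul1r addrC; apply: lerD => //.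
exact: le_trans h3 h2.
Qed.

Lemma CN_line p (f : 'rV[R]_p -> R) e w : (forall s : R, 0 <= s <= 1 -> CN (e + s *: w) f) ->
  exists2 s : R, 0 <= s <= 1 & f (e + w) - f e = (w *m grad f (e + s *: w)) 0 0.
Proof.
move=> fN; have [|c] := @MVT_unordered R (fun s => f (e + s *: w)) (fun s => (w *m grad f (e + s *: w)) 0 0) 0 1.
  rewrite /Num.min /Num.max ltr01 => s s01; have [W [oW Ws fW]] := fN s s01.
  have [D E] := is_derive_sdiff w (C1_sdiff oW Ws (fW 1%N)).
  by rewrite -E; exact: is_derive_line.
rewrite /Num.min /Num.max ltr01 scale1r scale0r addr0 subr0 mulr1 => c01 E.
by exists c.
Qed.

Lemma CN_near0 p (f : 'rV[R]_p -> R) : CN 0 f -> exists2 d, 0 < d & forall u : 'rV[R]_p, `|u| < d -> CN u f.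
Proof.
move=> [W [oW W0 fW]]; have /near_normP[d d0 hd] : nbhs (0 : 'rV[R]_p) W by exact: open_nbhs_nbhs.
by exists d => // u ud; exists W; split=> //; apply: hd; rewrite subr0.
Qed.

(** The partial derivatives are Lipschitz near 0, so one constant serves for all base points [e].
    This uniformity is needed because the base point later varies over the vectors fixed by [K]. *)
Lemma taylor2 p (f : 'rV[R]_p -> R) : CN 0 f -> exists (C d : R), [/\ 0 < C, 0 < d &
  forall e w : 'rV[R]_p, `|e| < d -> `|w| < d ->
    `|f (e + w) - f e - (w *m grad f e) 0 0| <= C * `|w| ^+ 2].
Proof.
move=> fN; have [d1 d10 h1] := CN_near0 fN.
have /choice[Cd hC] : forall i : 'I_p, exists q : R * R, [/\ 0 < q.1, 0 < q.2 &
  forall u v : 'rV[R]_p, `|u| < q.2 -> `|v| < q.2 -> `|pd i f u - pd i f v| <= q.1 * `|u - v|].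
  by move=> i; have [C [d h]] := CN_lipschitz (CN_pd i fN); exists (C, d).
have [d2 d20 h2] : exists2 d2, 0 < d2 & forall i, d2 <= (Cd i).2.
  exists (\big[Num.min/1]_i (Cd i).2); last by move=> i; exact: bigmin_le_cond.
  by apply: lt_bigmin => // i _; have [] := hC i.
pose C := \sum_i (Cd i).1 + 1; pose d := Num.min d1 d2 / 2.
have m0 : 0 < Num.min d1 d2 by rewrite lt_min d10.
have C0 : 0 < C.
  by rewrite ltr_wpDl//; apply: sumr_ge0 => i _; have [/ltW] := hC i.
exists C, d; split=> //; first by rewrite divr_gt0.
move=> e w ed wd.
have small (s : R) : 0 <= s <= 1 -> `|e + s *: w| < Num.min d1 d2.
  move=> s01; apply: (le_lt_trans (ler_normD _ _)); rewrite (splitr (Num.min d1 d2)) ltrD//.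
  exact: scale_ball.
have [|s s01 E] := @CN_line p f e w.
  by move=> s /small; rewrite lt_min => /andP[/h1].
have e1 : `|e| < Num.min d1 d2.
  by have := small 0; rewrite scale0r addr0; apply; rewrite lexx ler01.
rewrite E !mxE -sumrB (le_trans (ler_norm_sum _ _ _))//.
rewrite mulrDl mul1r -[leLHS]addr0 lerD ?exprn_ge0// mulr_suml; apply: ler_sum => i _.
rewrite -mulrBr !mxE normrM expr2 mulrCA ler_pM//; first exact: ler_coord.
have [c0 c1 h] := hC i; apply: (le_trans (h _ _ _ _)).
- by apply: lt_le_trans (small s s01) _; rewrite (le_trans _ (h2 i))// ge_min lexx orbT.
- by apply: lt_le_trans e1 _; rewrite (le_trans _ (h2 i))// ge_min lexx orbT.
rewrite addrC addKr ler_wpM2l//; first exact: ltW.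
by rewrite normrZ; case/andP: s01 => s0 s1; rewrite ger0_norm// ler_piMl.
Qed.

Lemma grad_eq p (f : 'rV[R]_p -> R) x B : sdiff f x B -> grad f x = B.
Proof.
move=> h; apply/colP => i; rewrite mxE.
by have [_] := is_derive_sdiff (delta_mx 0 i) h; rewrite -rowE mxE.
Qed.

Lemma CN_sdiff p (f : 'rV[R]_p -> R) x : CN x f -> sdiff f x (grad f x).
Proof. by move=> [W [oW Wx fW]]; exact: C1_sdiff oW Wx (fW 1%N). Qed.

Lemma grad_comp p q (F : 'rV[R]_p -> 'rV[R]_q) f x : CNv x F -> CN (F x) f ->
  grad (f \o F) x = jac F x *m grad f (F x).
Proof.
by move=> FN fN; apply: grad_eq; apply: sdiff_comp; [exact: CNv_sdiffv|exact: CN_sdiff].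
Qed.

Lemma grad_near p (f g : 'rV[R]_p -> R) x : {near x, f =1 g} -> grad f x = grad g x.
Proof. by move=> h; apply/colP => i; rewrite !mxE; exact: near_eq_derive. Qed.

Lemma grad_cst p (c : R) (x : 'rV[R]_p) : grad (fun=> c) x = 0.
Proof. by apply/colP => i; rewrite !mxE; exact: derive_cst. Qed.

Lemma nball_near p (z : 'rV[R]_p) (d : R) : `|z| < d -> nbhs z [set u : 'rV[R]_p | `|u| < d].
Proof. by move=> zd; apply: (open_nbhs_nbhs (conj (@open_nball0 R p d) _)). Qed.

End SecondOrder.

Section TangentSpace.
Variables (R : realType) (n : nat) (M : manifold R n) (x : M).
Variables (tau : M -> 'rV[R]_n) (kap : 'rV[R]_n -> M) (dl : R).
Hypothesis lc : lcoord x tau kap dl.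
Local Notation tan := (tangent (X := mspace M)).
Local Notation cv := (coord_vec x tau kap).

Definition tcrd (v : vec (mspace M)) : 'rV[R]_n := \row_i v (crd tau i).

Lemma cv_tan a : tan x (cv a). Proof. by have [] := coord_vecP a lc. Qed.

Lemma tcrd_cv a : tcrd (cv a) = a.
Proof. by apply/rowP => i; rewrite mxE; have [_ ->] := coord_vecP a lc. Qed.

Lemma tan_cv v : tan x v -> v = cv (tcrd v).
Proof.
move=> tv; apply/funext => f; rewrite /coord_vec.
case: asboolP => fs; first by rewrite (tan_coord tv lc fs); apply: eq_bigr => i _; rewrite mxE.
by have [_ _ _ h] := tv; apply: h => /smooth_atP.
Qed.

Lemma cvE a f : snear x f -> cv a f = (a *m grad (f \o kap) 0) 0 0.
Proof.
move=> fs; rewrite /coord_vec asboolT// mxE; apply: eq_bigr => i _.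
by rewrite mxE.
Qed.

Lemma cv_lin (c : R) a b : cv (c *: a + b) = c *: cv a + cv b.
Proof.
apply/funext => f; rewrite /coord_vec; case: asboolP => fs.
  rewrite -[RHS]/(c * cv a f + cv b f) /coord_vec !asboolT//.
  rewrite mulr_sumr -big_split/=; apply: eq_bigr => i _.
  by rewrite !mxE; ring.
by rewrite -[RHS]/(c * cv a f + cv b f) /coord_vec !asboolF// mulr0 addr0.
Qed.

Lemma cv0 : cv 0 = 0.
Proof.
apply/funext => f; rewrite /coord_vec; case: asboolP => // _.
by rewrite big1// => i _; rewrite mxE mul0r.
Qed.

Lemma cv_sum (I : Type) (r : seq I) (c : I -> R) (a : I -> 'rV[R]_n) :
  cv (\sum_(i <- r) c i *: a i) = \sum_(i <- r) c i *: cv (a i).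
Proof.
elim: r => [|i r IH]; first by rewrite !big_nil cv0.
by rewrite !big_cons cv_lin IH.
Qed.

Lemma cov_cv (al : covec (mspace M)) a : cotangent (X := mspace M) x al ->
  al (cv a) = \sum_i a 0 i * al (cv (delta_mx 0 i)).
Proof.
move=> [lin _]; have al0 : al 0 = 0.
  have := lin (-1) _ _ (cv_tan 0) (cv_tan 0); rewrite -cv_lin scaler0 addr0 cv0.
  by rewrite mulN1r addNr.
rewrite {1}(row_sum_delta a) cv_sum; elim: (index_enum _) => [|i r IH]; first by rewrite !big_nil.
by rewrite !big_cons lin ?IH//; [exact: cv_tan|rewrite -cv_sum; exact: cv_tan].
Qed.

End TangentSpace.

Section GroupTranslations.
Variables (R : realType) (k : nat) (G : lieGroup R k).
Local Notation CsmG f := (Csm (X := mspace G) f).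

Lemma lmul_fsmooth u : CsmG u -> fsmooth (f := mprod G G) setT (fun p => u (lmul p.1 p.2)).
Proof. by move=> us; case: (lmul_smooth G) => _ _ /(_ setT u openT us). Qed.

Lemma Csm_lmull u g : CsmG u -> CsmG (fun h => u (lmul g h)).
Proof. by move=> us; exact: (Csm_slice g (lmul_fsmooth us)). Qed.

Lemma Csm_linv u : CsmG u -> CsmG (fun h => u (linv h)).
Proof. by move=> us; case: (linv_smooth G) => _ _ /(_ setT u openT us). Qed.

Lemma Csm_lmulr u g : CsmG u -> CsmG (fun h => u (lmul h g)).
Proof.
move=> us; have := Csm_linv (Csm_lmull (linv g) (Csm_linv us)).
by congr Csm; apply/funext => h; rewrite linvM !linvK.
Qed.

End GroupTranslations.

(** * The slice *)

Section Slice.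
Variables (R : realType) (k n : nat) (G : lieGroup R k) (M : manifold R n).
Variable A : lieAction G M.
Hypothesis hproper : proper_action A.
Variables (x : M) (m : (G -> R) -> R).
Local Notation K := (stab A x).
Hypothesis mm : mean K m.
Variables (rho : G -> 'M[R]_n) (tau : M -> 'rV[R]_n) (kap : 'rV[R]_n -> M) (dl : R).
Hypotheses (lc : lcoord x tau kap dl) (crho : ccont rho) (rho1 : rho (lone G) = 1%:M)
  (rhoM : forall a b, K a -> K b -> rho (lmul a b) = rho b *m rho a)
  (tauK : forall a y, K a -> tau (A a y) = tau y *m rho a).
Variables (th : G -> 'rV[R]_k) (gam : 'rV[R]_k -> G) (dg : R).
Hypothesis lg : lcoord (lone G) th gam dg.

Let dl0 : 0 < dl. Proof. by case: lc => [[]]. Qed.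
Let dg0 : 0 < dg. Proof. by case: lg => [[]]. Qed.
Let tx : tau x = 0. Proof. by case: lc => [[_ _ []]]. Qed.
Let kx : kap 0 = x. Proof. by case: lc => [[_ _ []]]. Qed.
Let t1 : th (lone G) = 0. Proof. by case: lg => [[_ _ []]]. Qed.
Let g1 : gam 0 = lone G. Proof. by case: lg => [[_ _ []]]. Qed.
Let tk z : `|z| < dl -> tau (kap z) = z. Proof. by case: lc => _ [+ _ _]; apply. Qed.
Let tg s : `|s| < dg -> th (gam s) = s. Proof. by case: lg => _ [+ _ _]; apply. Qed.
Let nbx : nbhs x [set y | `|tau y| < dl /\ kap (tau y) = y]. Proof. by case: lc => _ []. Qed.
Let nb1 : nbhs (lone G) [set h | `|th h| < dg /\ gam (th h) = h]. Proof. by case: lg => _ []. Qed.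
Let cK : compact_subgroup K := stab_compact hproper x.

Definition acoord (z : 'rV[R]_(k + n)) := tau (A (gam (lsubmx z)) (kap (rsubmx z))).
Let W0 := [set z : 'rV[R]_(k + n) | `|lsubmx z| < dg /\ `|rsubmx z| < dl].
Let oW0 : open W0. Proof. exact: (open_rect (@open_nball0 _ _ _) (@open_nball0 _ _ _)). Qed.

Lemma acoord_Cinf : Cinfv W0 acoord.
Proof.
by move=> j; case: lc => [[_ st _] _]; exact: (mprod_Cinf (act_fsmooth A (st j)) lg lc).
Qed.

Lemma acoord_CN s z : `|s| < dg -> `|z| < dl -> CNv (row_mx s z) acoord.
Proof.
move=> sd zd; apply: (Cinfv_CNv oW0 _ acoord_Cinf).
by rewrite /W0 /= row_mxKl row_mxKr.
Qed.

Lemma acoord0 z : `|z| < dl -> acoord (row_mx 0 z) = z.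
Proof. by move=> zd; rewrite /acoord row_mxKl row_mxKr g1 act1 tk. Qed.

(** Derivative of the orbit map of [x] at the unit, rows acting on the left: its row space is the
    tangent space of the orbit, its left kernel the Lie algebra of the stabilizer. *)
Definition Lx := jac (fun s => tau (A (gam s) x)) 0.

Let n0g : `|0 : 'rV[R]_k| < dg. Proof. by rewrite normr0. Qed.
Let n0l : `|0 : 'rV[R]_n| < dl. Proof. by rewrite normr0. Qed.

Lemma fs_CN s : `|s| < dg -> CNv s (fun s => tau (A (gam s) x)).
Proof.
move=> sd; have h : CNv s (fun s : 'rV[R]_k => row_mx s (0 : 'rV[R]_n)).
  by apply: CNv_row_mx; [exact: CNv_id|exact: CNv_cst].
apply: CNv_near (CNv_comp h (acoord_CN sd n0l)).
by apply: filterE => u; rewrite /= /acoord row_mxKl row_mxKr kx.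
Qed.

Lemma Lx_u : Lx = usubmx (jac acoord (row_mx 0 0)).
Proof.
rewrite -(jac_usubmx (acoord_CN n0g n0l)); apply: jac_near; apply: filterE => u.
by rewrite /acoord row_mxKl row_mxKr kx.
Qed.

Lemma acoord_d0 : dsubmx (jac acoord (row_mx 0 0)) = 1%:M.
Proof.
rewrite -(jac_dsubmx (acoord_CN n0g n0l)) -(jac_id (0 : 'rV[R]_n)); apply: jac_near.
have := open_nbhs_nbhs (conj (@open_nball0 R n dl) n0l).
by apply: filterS => z zd; rewrite acoord0.
Qed.

Lemma rhoV l : K l -> rho l *m rho (linv l) = 1%:M.
Proof. by have [_ _ _ KV] := cK => Kl; rewrite -rhoM ?lmulV//; exact: KV. Qed.

Lemma rhoV' l : K l -> rho (linv l) *m rho l = 1%:M.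
Proof. by have [_ _ _ KV] := cK => Kl; rewrite -rhoM ?lmulgV//; exact: KV. Qed.

Lemma near_gam (Q : set G) : nbhs (lone G) Q -> nbhs (0 : 'rV[R]_k) (Q \o gam).
Proof. by move=> h; apply: (lcoord_cont lg n0g); rewrite g1. Qed.

Lemma near_kap (Q : set M) : nbhs x Q -> nbhs (0 : 'rV[R]_n) (Q \o kap).
Proof. by move=> h; apply: (lcoord_cont lc n0l); rewrite kx. Qed.

(** For [l] fixing [x], moving [g x] by [l] gives [(l g l^-1) x]; [C] is the derivative of
    conjugation by [l]. *)
Lemma Lx_rho l : K l -> exists C, Lx *m rho l = C *m Lx.
Proof.
have [_ _ _ KV] := cK => Kl.
pose sg s := th (lmul (lmul l (gam s)) (linv l)).
have sgN : CNv 0 sg.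
  move=> j; case: (lg) => [[_ st _] _].
  apply: (@lcoord_CN _ _ _ _ _ _ _ (fun h => crd th j (lmul (lmul l h) (linv l))) 0 lg) => //.
  by apply: Csm_snear; apply: (Csm_lmull l (Csm_lmulr (linv l) (st j))).
have sg0 : sg 0 = 0 by rewrite /sg g1 lmulg1 lmulgV t1.
have fN : CNv (sg 0) (fun s => tau (A (gam s) x)) by rewrite sg0; exact: fs_CN.
have E : jac ((fun s => tau (A (gam s) x)) \o sg) 0 = jac sg 0 *m Lx.
  by rewrite (jac_comp sgN fN) sg0.
exists (jac sg 0); rewrite -E /Lx -(jac_mulr _ (fs_CN n0g)); apply: jac_near.
have : nbhs (lone G) [set h | gam (th (lmul (lmul l h) (linv l))) = lmul (lmul l h) (linv l)].
  have c1 : {for lone G, continuous (fun h => lmul (lmul l h) (linv l))}.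
    apply: (@continuous_comp _ _ _ (fun h => lmul l h) (fun h => lmul h (linv l))).
      exact: lmull_cont.
    exact: lmulr_cont.
  have : nbhs (lmul (lmul l (lone G)) (linv l)) [set h | gam (th h) = h].
    by rewrite lmulg1 lmulgV; apply: filterS nb1 => h [].
  by move=> /c1.
move=> /near_gam; apply: filterS => s /= Es.
by rewrite /= /sg Es -tauK// !actM; congr (tau (A _ (A _ _))); rewrite KV.
Qed.

(* [Bx] is a row basis of [Lx]. *)
Variables (r : nat) (Bx : 'M[R]_(r, n)) (Bx' : 'M[R]_(n, r)) (Dx : 'M[R]_(r, k)).
Hypotheses (BxV : Bx *m Bx' = 1%:M) (DL : Dx *m Lx = Bx) (LB : Lx *m Bx' *m Bx = Lx).

Lemma subBx p (v : 'M[R]_(p, n)) : (v <= Lx)%MS -> v *m Bx' *m Bx = v.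
Proof. by move=> /submxP[w ->]; rewrite -{2}LB !mulmxA. Qed.

Lemma Bx_sub : (Bx <= Lx)%MS.
Proof. by rewrite -DL submxMl. Qed.

(* [PV] is a [K]-equivariant projection onto the row space of [Lx], the tangent
   space of the orbit of [x]; the slice is [tau y *m PV = 0]. *)
Definition PV : 'M[R]_n := mmx m (fun h => rho h *m (Bx' *m Bx) *m rho (linv h)).

Lemma Lx_stable p (v : 'M[R]_(p, n)) l : K l -> (v <= Lx)%MS -> (v *m rho l <= Lx)%MS.
Proof.
move=> Kl /submxP[w ->]; have [C E] := Lx_rho Kl.
by rewrite -mulmxA E mulmxA submxMl.
Qed.

Let cPV : ccont (fun h => rho h *m (Bx' *m Bx) *m rho (linv h)).
Proof.
apply: ccontM; last exact: (ccont_comp (@linv_cont _ _ G) crho).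
by apply: ccontM; [exact: crho|exact: ccont_cst].
Qed.

Lemma PV_id p (v : 'M[R]_(p, n)) : (v <= Lx)%MS -> v *m PV = v.
Proof.
have [kK _ _ _] := cK => vL; rewrite /PV -(mmx_mull kK mm)//; rewrite -[RHS](mmx_cst kK mm).
apply: (mmx_eq mm) => [||l Kl]; [|exact: ccont_cst|].
  by apply: ccontM; [exact: ccont_cst|exact: cPV].
rewrite !mulmxA.
rewrite subBx; last exact: Lx_stable.
by rewrite -mulmxA rhoV// mulmx1.
Qed.

Lemma PV_sub : (PV <= Lx)%MS.
Proof.
have [kK _ _ KV] := cK.
suff -> : PV = PV *m Bx' *m Bx by exact: submx_trans (submxMl _ _) Bx_sub.
rewrite /PV -!(mmx_mulr kK mm)//; last by apply: ccontM; [exact: cPV|exact: ccont_cst].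
apply: (mmx_eq mm) => [//||l Kl].
  by do 2?[apply: ccontM; last exact: ccont_cst]; exact: cPV.
rewrite subBx//; rewrite -mulmxA mulmxA; apply: Lx_stable; first exact: KV.
by rewrite mulmxA; exact: submx_trans (submxMl _ _) Bx_sub.
Qed.

Lemma PV_rho l : K l -> PV *m rho l = rho l *m PV.
Proof.
have [kK _ KM KV] := cK => Kl.
rewrite /PV -(mmx_mull kK mm)// -(mmx_mulr kK mm)//.
have cl : ccont (fun h => rho h *m (Bx' *m Bx) *m rho (linv h) *m rho l).
  by apply: ccontM; [exact: cPV|exact: ccont_cst].
rewrite -[LHS](mmx_tr mm cl Kl); apply: (mmx_eq mm) => [||h Kh].
- exact: (ccont_comp (@lmulr_cont _ _ _ l) cl).
- by apply: ccontM; [exact: ccont_cst|exact: cPV].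
- by rewrite linvM !rhoM//; [|exact: KV|exact: KV]; rewrite !mulmxA -[X in X = _]mulmxA rhoV'// mulmx1.
Qed.

(** Coordinates of the orbit component in the basis [Bx]. The slice is cut out by these [r]
    independent equations, as the implicit function theorem wants, rather than by the [n] equations
    [z *m PV = 0]. *)
Definition Qx : 'M[R]_(n, r) := locked (PV *m Bx').

Lemma QxE : Qx = PV *m Bx'.
Proof. by rewrite /Qx -lock. Qed.

Lemma BQ : Bx *m Qx = 1%:M.
Proof. by rewrite QxE mulmxA (PV_id Bx_sub) BxV. Qed.

Lemma QB : Qx *m Bx = PV.
Proof. by rewrite QxE subBx// PV_sub. Qed.

Lemma Q_eq0 p (z : 'M[R]_(p, n)) : z *m Qx = 0 <-> z *m PV = 0.
Proof.
split=> h; first by rewrite -QB mulmxA h mul0mx.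
by rewrite QxE mulmxA h mul0mx.
Qed.

Lemma Q_rho p (z : 'M[R]_(p, n)) l : K l -> z *m Qx = 0 -> z *m rho l *m Qx = 0.
Proof.
move=> Kl /Q_eq0 h; apply/Q_eq0.
by rewrite -mulmxA -PV_rho// mulmxA h mul0mx.
Qed.

Lemma LQB : Lx *m Qx *m Bx = Lx.
Proof. by rewrite -mulmxA QB PV_id. Qed.

(** A projection onto the left kernel of [Lx], the Lie algebra of the stabilizer, along the rows of
    [Dx]. *)
Definition E0 : 'M[R]_k := 1%:M - Lx *m Qx *m Dx.

Lemma E0L : E0 *m Lx = 0.
Proof. by rewrite mulmxBl mul1mx -[Lx *m Qx *m Dx *m Lx]mulmxA DL LQB subrr. Qed.

Definition fx (s : 'rV[R]_k) := tau (A (gam s) x).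

Let fx0 : fx 0 = 0. Proof. by rewrite /fx g1 act1 tx. Qed.

Lemma fxN s : `|s| < dg -> CNv s fx. Proof. exact: fs_CN. Qed.

Lemma fxJ : jac fx 0 = Lx. Proof. by []. Qed.

Lemma near_orb (Q : set M) : nbhs x Q -> nbhs (0 : 'rV[R]_k) [set s | Q (A (gam s) x)].
Proof.
move=> h; apply: (near_gam (Q := [set h | Q (A h x)])).
by apply: (@act_contl _ _ _ _ _ A x (lone G) Q); rewrite act1.
Qed.

Lemma nbx' : nbhs x [set y | kap (tau y) = y].
Proof. by apply: filterS nbx => y []. Qed.

Definition lam (z : 'rV[R]_(k + k)) := th (lmul (gam (lsubmx z)) (gam (rsubmx z))).

Lemma lam_CN s u : `|s| < dg -> `|u| < dg -> CNv (row_mx s u) lam.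
Proof.
move=> sd ud; apply: (@Cinfv_CNv _ _ _ [set z : 'rV[R]_(k + k) | `|lsubmx z| < dg /\ `|rsubmx z| < dg]).
- exact: (open_rect (@open_nball0 _ _ _) (@open_nball0 _ _ _)).
- by rewrite /= row_mxKl row_mxKr.
- by move=> j; case: (lg) => [[_ st _] _]; exact: (mprod_Cinf (lmul_fsmooth (st j)) lg lg).
Qed.

Lemma cont_rowl p q (s : 'rV[R]_p) (y : 'rV[R]_q) : {for s, continuous (fun s : 'rV[R]_p => row_mx s y)}.
Proof. by apply: CNv_cont; apply: CNv_row_mx; [exact: CNv_id|exact: CNv_cst]. Qed.

(* The orbit map [g |-> g x] has constant rank. *)
Lemma ker_near : exists2 d, 0 < d & forall s : 'rV[R]_k, `|s| < d -> `|s| < dg /\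
  forall p (u : 'M[R]_(p, k)), u *m jac fx s *m Qx = 0 -> u *m jac fx s = 0.
Proof.
pose O1 : set G := interior [set h | `|th h| < dg /\ gam (th h) = h].
have O11 : nbhs (0 : 'rV[R]_k) [set s | O1 (gam s)].
  by apply: near_gam; apply: open_nbhs_nbhs; split; [exact: open_interior|exact: nb1].
have c1 := jac_mcont (@cont_rowl k k 0 0) (lam_CN n0g n0g).
have c2 := jac_mcont (@cont_rowl k n 0 0) (acoord_CN n0g n0l).
have U1 : nbhs (0 : 'rV[R]_k) [set s | dsubmx (jac lam (row_mx s 0)) \in unitmx].
  apply: (@unit_near _ _ _ (fun s => dsubmx (jac lam (row_mx s 0)))).
    move=> i j; apply: (@near_eq_cont _ _ (fun s => jac lam (row_mx s 0) (rshift k i) j)).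
      by apply: filterE => s; rewrite [RHS]mxE.
    exact: c1.
  rewrite -(jac_dsubmx (lam_CN n0g n0g)) (_ : jac _ 0 = 1%:M) ?unitmx1//.
  rewrite -(jac_id (0 : 'rV[R]_k)); apply: jac_near.
  have := open_nbhs_nbhs (conj (@open_nball0 R k dg) n0g); apply: filterS => u ud.
  by rewrite /lam row_mxKl row_mxKr g1 lmul1 tg.
have U2 : nbhs (0 : 'rV[R]_k) [set s | Bx *m dsubmx (jac acoord (row_mx s 0)) *m Qx \in unitmx].
  apply: (@unit_near _ _ _ (fun s => Bx *m dsubmx (jac acoord (row_mx s 0)) *m Qx)).
    apply: mcontM; last exact: mcont_cst; apply: mcontM; first exact: mcont_cst.
    move=> i j; apply: (@near_eq_cont _ _ (fun s => jac acoord (row_mx s 0) (rshift k i) j)).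
      by apply: filterE => s; rewrite [RHS]mxE.
    exact: c2.
  by rewrite acoord_d0 mulmx1 BQ unitmx1.
have Bg := open_nbhs_nbhs (conj (@open_nball0 R k dg) n0g).
have HH : nbhs (0 : 'rV[R]_k) (([set s | O1 (gam s)] `&` [set s | `|s| < dg]) `&`
    ([set s | dsubmx (jac lam (row_mx s 0)) \in unitmx] `&`
     [set s | Bx *m dsubmx (jac acoord (row_mx s 0)) *m Qx \in unitmx])).
  by apply: filterI; apply: filterI.
have /near_normP[d d0 hd] := HH.
exists d => // s sd; have := hd s; rewrite subr0 => /(_ sd)[[sO sg] [/= s1 s2]]; split=> // p u uQ.
(* The derivative at [u = 0] of [gam s * gam u] acting on [x], computed through the product of [G]
   and through the action of [gam s] on [M]. It expresses the derivative of the orbit map at [s] by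
   the one at the unit. *)
have key : dsubmx (jac lam (row_mx s 0)) *m jac fx s = Lx *m dsubmx (jac acoord (row_mx s 0)).
  have lN : CNv 0 (fun u => lam (row_mx s u)).
    by apply: (CNv_comp _ (lam_CN sg n0g)); apply: CNv_row_mx; [exact: CNv_cst|exact: CNv_id].
  have aN : CNv 0 (fun u => acoord (row_mx s u)).
    by apply: (CNv_comp _ (acoord_CN sg n0l)); apply: CNv_row_mx; [exact: CNv_cst|exact: CNv_id].
  have l0 : lam (row_mx s 0) = s by rewrite /lam row_mxKl row_mxKr g1 lmulg1 tg.
  rewrite -(jac_dsubmx (lam_CN sg n0g)) -(jac_dsubmx (acoord_CN sg n0l)).
  have fN : CNv (lam (row_mx s 0)) fx by rewrite l0; exact: fs_CN.
  have E1 := jac_comp lN fN; rewrite l0 in E1; rewrite -E1.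
  have aN' : CNv (fx 0) (fun u => acoord (row_mx s u)) by rewrite fx0.
  have E2 := jac_comp (fxN n0g) aN'; rewrite fx0 fxJ in E2; rewrite -E2.
  apply: jac_near.
  have h1 : nbhs (0 : 'rV[R]_k) [set u | O1 (lmul (gam s) (gam u))].
    apply: (near_gam (Q := [set h | O1 (lmul (gam s) h)])).
    apply: (@lmull_cont _ _ _ (gam s) (lone G) O1).
    by rewrite lmulg1; apply: open_nbhs_nbhs; split => //; exact: open_interior.
  have h2 : nbhs (0 : 'rV[R]_k) [set u | kap (tau (A (gam u) x)) = A (gam u) x].
    exact: near_orb nbx'.
  apply: filterS2 h1 h2 => w /interior_subset[_ hw] /= kw.
  by rewrite /fx /= /lam /acoord !row_mxKl !row_mxKr hw kw actM.
have [v uE] : exists v : 'M[R]_(p, k), u = v *m dsubmx (jac lam (row_mx s 0)).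
  by exists (u *m invmx (dsubmx (jac lam (row_mx s 0)))); rewrite mulmxKV.
move: key s2 uQ; set JA := dsubmx (jac acoord _) => key s2.
have uJ : u *m jac fx s = v *m Lx *m JA by rewrite uE -mulmxA key mulmxA.
have vL : v *m Lx = v *m Lx *m Qx *m Bx.
  by rewrite -{1}LQB [v *m (_ *m Bx)]mulmxA [v *m (_ *m Qx)]mulmxA.
rewrite uJ => h; have h2 : v *m Lx *m Qx *m (Bx *m JA *m Qx) = 0.
  by rewrite [_ *m (_ *m Qx)]mulmxA [_ *m (Bx *m JA)]mulmxA -vL.
have h3 : v *m Lx *m Qx = 0.
  by rewrite -[LHS](mulmxK s2) h2 mul0mx.
by rewrite vL h3 !mul0mx.
Qed.

(** Only the [r] equations [fx s *m Qx = 0] are solved; constant rank then makes the derivative of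
    [fx] along the solutions zero, so [fx] itself vanishes on them. The parameter runs over all [k]
    coordinates, with the projection [E0] as derivative, which avoids choosing a basis of the Lie
    algebra of [K]. *)
Lemma stab_param : exists (d : R) (c : 'rV[R]_k -> 'rV[R]_k), [/\ 0 < d, c 0 = 0,
  forall e : 'rV[R]_k, `|e| < d -> CNv e c, jac c 0 = E0 &
  forall e : 'rV[R]_k, `|e| < d -> `|c e| < dg /\ K (gam (c e))].
Proof.
pose ll (z : 'rV[R]_(r + k)) := lsubmx z *m Dx + rsubmx z *m E0.
have llN z : CNv z ll.
  by apply: CNvD; apply: CNv_mulr; [exact: CNv_lsubmx|exact: CNv_rsubmx].
pose U := [set z : 'rV[R]_(r + k) | `|ll z| < dg].
have oU : open U.
  have cl : continuous ll by move=> z; exact: CNv_cont (llN z).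
  exact: (open_comp (fun z _ => cl z) (@open_nball0 R k dg)).
have ll0 : ll 0 = 0 by rewrite /ll !linear0 !mul0mx addr0.
have U0 : U 0 by rewrite /U /= ll0 normr0.
pose H z := fx (ll z) *m Qx.
have HN z : U z -> CNv z H.
  by move=> Uz; apply: CNv_mulr; apply: (CNv_comp (llN z)); exact: fs_CN.
have H0 : H 0 = 0 by rewrite /H ll0 fx0 mul0mx.
have HJ : usubmx (jac H 0) = 1%:M.
  have U00 : U (row_mx 0 0) by rewrite row_mx0.
  rewrite -row_mx0 -(jac_usubmx (HN _ U00)).
  rewrite (_ : (fun u => _) = (fun u => fx (u *m Dx) *m Qx)); last first.
    by apply/funext => u; rewrite /H /ll row_mxKl row_mxKr mul0mx addr0.
  have f0N : CNv ((0 : 'rV[R]_r) *m Dx) fx by rewrite mul0mx; exact: fs_CN.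
  have E := jac_comp (CNv_mull (0 : 'rV[R]_r) Dx) f0N; rewrite mul0mx jac_mull in E.
  rewrite (jac_mulr (F := fx \o (fun u => u *m Dx))) ?E; last by apply: CNv_comp f0N; exact: CNv_mull.
  by rewrite DL BQ.
have [d1 [d2 [cc [g [[d10 d20 _ gs] [g0 gU gE gu _]]]]]] := implicit_function oU U0 (CNv_Cinfv HN) H0 HJ.
pose c e := ll (row_mx (g e) e).
have gN e : `|e| < d2 -> CNv e g by move=> ed; exact: (Cinfv_CNv (@open_nball0 _ _ _) ed gs).
have cN e : `|e| < d2 -> CNv e c.
  move=> ed; apply: (CNv_comp (F := fun e => row_mx (g e) e)) => //.
  by apply: CNv_row_mx; [exact: gN|exact: CNv_id].
have c0 : c 0 = 0 by rewrite /c g0 row_mx0.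
have cg e : `|e| < d2 -> `|c e| < dg by move=> /gU[].
have cQ e : `|e| < d2 -> fx (c e) *m Qx = 0 by move=> /gE.
have z2 : `|0 : 'rV[R]_k| < d2 by rewrite normr0.
have jacc : jac c 0 = jac g 0 *m Dx + E0.
  have -> : c = (fun e => row_mx (g e) e *m col_mx Dx E0).
    by apply/funext => e; rewrite /c /ll row_mxKl row_mxKr mul_row_col.
  rewrite jac_mulr ?jac_row_mx ?jac_id ?mul_row_col ?mul1mx//.
  by apply: CNv_row_mx; [exact: gN|exact: CNv_id].
have jfc e : `|e| < d2 -> jac c e *m jac fx (c e) *m Qx = 0.
  move=> ed; rewrite -(jac_comp (cN _ ed) (fs_CN (cg _ ed))) -jac_mulr.
    rewrite -[RHS](jac_cst e (0 : 'rV[R]_r)); apply: jac_near.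
    have := open_nbhs_nbhs (conj (@open_nball0 R k d2) ed).
    by apply: filterS => e' e'd; exact: cQ.
  by apply: (CNv_comp (cN _ ed)); exact/fs_CN/cg.
have jg0 : jac g 0 = 0.
  have : (jac g 0 *m Dx + E0) *m Lx *m Qx = 0 by have := jfc 0 z2; rewrite c0 jacc.
  by rewrite mulmxDl E0L addr0 -[_ *m Dx *m Lx]mulmxA DL -[_ *m Bx *m Qx]mulmxA BQ mulmx1.
have [d3 d30 hd3] := ker_near.
have /near_normP[d4 d40 hd4] : nbhs (0 : 'rV[R]_k) [set e | `|c e| < d3 /\ kap (fx (c e)) = A (gam (c e)) x].
  have cc0 : {for 0, continuous c} := CNv_cont (cN 0 z2).
  apply: (cc0 [set e | `|e| < d3 /\ kap (fx e) = A (gam e) x]); rewrite c0; apply: filterI.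
    exact: nball_nbhs.
  exact: near_orb nbx'.
pose d := Num.min d2 d4; have dd2 (e : 'rV[R]_k) : `|e| < d -> `|e| < d2 by rewrite lt_min => /andP[].
have dd4 (e : 'rV[R]_k) : `|e| < d -> `|c e| < d3 /\ kap (fx (c e)) = A (gam (c e)) x.
  by rewrite lt_min => /andP[_ ed]; apply: hd4; rewrite subr0.
have fc0 e : `|e| < d -> fx (c e) = 0.
  move=> ed; have := @jac0_const R k n (fx \o c) d _ e ed; rewrite /= c0 fx0; apply=> u ud.
  have h1 := cN _ (dd2 _ ud); have h2 := fs_CN (cg _ (dd2 _ ud)).
  split; first exact: CNv_comp.
  by rewrite (jac_comp h1 h2); apply: (hd3 _ (dd4 _ ud).1).2; exact: jfc (dd2 _ ud).
exists d, c; split=> //; first by rewrite lt_min d20.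
- by move=> e /dd2/cN.
- by rewrite jacc jg0 mul0mx add0r.
- move=> e ed; split; first exact/cg/dd2.
  by rewrite /stab /= -(dd4 _ ed).2 fc0.
Qed.

Lemma stab_tube (W : set M) : nbhs x W -> nbhs x [set y | forall l, K l -> W (A l y)].
Proof.
have [/compact_near_coveringP kC _ _ _] := cK => xW.
have FF : Filter (nbhs x) by exact: nbhs_filter.
have : \forall y \near x, K `<=` (fun l => W (A l y)).
  apply: (kC _ (nbhs x) (fun y l => W (A l y))) => l Kl.
  by apply: (@act_cont _ _ _ _ _ A (l, x) W); rewrite /= Kl.
by apply: filterS => y h l Kl; exact: h.
Qed.

(** By properness the elements joining two points of a compact neighbourhood of [x] form a compact
    set. Those outside [V] move [x], and a tube argument excludes them near [x]. *)
Lemma stab_proper (V : set G) : open V -> K `<=` V ->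
  exists2 W, nbhs x W & forall y g, W y -> W (A g y) -> V g.
Proof.
move=> oV KV; have [C0 [kC0 nC0 _]] := compact_nbhs (@filterT _ (nbhs x) _).
pose S := (fst @` [set p : G * M | (C0 `*` C0) (A p.1 p.2, p.2)]) `&` ~` V.
have kS : compact S.
  apply: compact_closedI; last exact: open_closedC.
  apply: continuous_compact; last exact: hproper (compact_setX kC0 kC0).
  by apply: continuous_subspaceT => p; exact: cvg_fst.
have FF : Filter (nbhs (x, x)) by exact: nbhs_filter.
have [[W1 W2] [/= n1 n2] sW] : \forall p \near ((x, x) : M * M), S `<=` (fun g => A g p.1 <> p.2).
  move: kS => /compact_near_coveringP kS.
  apply: (kS _ (nbhs (x, x)) (fun p g => A g p.1 <> p.2)) => g [_ gV].
  have gx : A g x != x by apply/eqP => E; apply: gV; exact: KV.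
  have := @mhausdorff _ _ M; rewrite open_hausdorff => /(_ _ _ gx)[[U1 U2] /= [u1 u2] [p1 p2 /eqP d12]].
  rewrite !inE in u1 u2.
  have h1 : nbhs (g, x) [set q | U1 (A q.1 q.2)].
    by apply: (@act_cont _ _ _ _ _ A (g, x) U1); exact: open_nbhs_nbhs.
  have [[E1 E2] [/= e1 e2] sE] := h1.
  exists (E1, E2 `*` U2) => /=.
    split=> //; exists (E2, U2) => //=; split=> //; exact: open_nbhs_nbhs.
  move=> [h [y y']] /= [h1' [y1 y2]] E.
  have : (U1 `&` U2) (A h y) by split; [exact: (sE (h, y))|rewrite E].
  by rewrite d12.
exists (C0 `&` (W1 `&` W2)); first by apply: filterI => //; exact: filterI.
move=> y g [yC [y1 y2]] [gC [g1' g2']]; apply: contrapT => gV.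
by apply: (sW (y, A g y) _ g) => //; split=> //; exists (g, y).
Qed.

Lemma near_th (Q : set 'rV[R]_k) : nbhs (0 : 'rV[R]_k) Q -> nbhs (lone G) (Q \o th).
Proof. by move=> h; apply: (tau_cont lg (x := lone G)); rewrite t1. Qed.

(** Inverse function theorem for the product of a displacement along the rows of [Dx] with a
    parametrized element of [K]: the two derivatives, [Lx *m Qx *m Dx] and [E0], add up to the
    identity. *)
Lemma decomp e : 0 < e -> nbhs (lone G) [set g | exists t : 'rV[R]_r, `|t| < e /\
  exists2 l, K l & g = lmul (gam (t *m Dx)) l].
Proof.
move=> e0; have [d [c [d0 c0 cN Jc cK']]] := stab_param.
pose U := [set s : 'rV[R]_k | `|s| < d /\ `|s *m (Lx *m Qx *m Dx)| < dg].
have cP : continuous (fun s : 'rV[R]_k => s *m (Lx *m Qx *m Dx)) by move=> s; exact: CNv_cont (CNv_mull _ _).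
have oU : open U.
  by apply: openI; [exact: open_nball0|exact: (open_comp (fun z _ => cP z) (@open_nball0 R k dg))].
have U0 : U 0 by rewrite /U /= mul0mx !normr0.
pose F s := lam (row_mx (s *m (Lx *m Qx *m Dx)) (c s)).
have rN s : U s -> CNv s (fun s => row_mx (s *m (Lx *m Qx *m Dx)) (c s)).
  by move=> [sd _]; apply: CNv_row_mx; [exact: CNv_mull|exact: cN].
have FU : Cinfv U F.
  by apply: CNv_Cinfv => s Us; apply: (CNv_comp (rN s Us)); apply: lam_CN; [case: Us|case: (cK' s); case: Us].
have r0 : row_mx ((0 : 'rV[R]_k) *m (Lx *m Qx *m Dx)) (c 0) = row_mx 0 0 by rewrite mul0mx c0.
have F0 : F 0 = 0 by rewrite /F r0 /lam row_mxKl row_mxKr g1 lmul1 t1.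
have JF : jac F 0 = 1%:M.
  have lN : CNv (row_mx ((0 : 'rV[R]_k) *m (Lx *m Qx *m Dx)) (c 0)) lam by rewrite r0; exact: lam_CN.
  rewrite (jac_comp (rN 0 U0) lN) r0 jac_row_mx jac_mull Jc.
  rewrite -[jac lam _]vsubmxK -(jac_usubmx (lam_CN n0g n0g)) -(jac_dsubmx (lam_CN n0g n0g)).
  have -> : jac (fun u => lam (row_mx u 0)) 0 = 1%:M.
    rewrite -(jac_id (0 : 'rV[R]_k)); apply: jac_near; apply: filterS (nball_nbhs _ dg0) => u ud.
    by rewrite /lam row_mxKl row_mxKr g1 lmulg1 tg.
  have -> : jac (fun u => lam (row_mx 0 u)) 0 = 1%:M.
    rewrite -(jac_id (0 : 'rV[R]_k)); apply: jac_near; apply: filterS (nball_nbhs _ dg0) => u ud.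
    by rewrite /lam row_mxKl row_mxKr g1 lmul1 tg.
  by rewrite mul_row_col !mulmx1 /E0 addrC subrK.
have [d1 [d2 [g [[d10 d20 gs g0] [gU gE _]]]]] := inverse_function oU U0 FU F0 JF.
have cg : {for 0, continuous g}.
  by apply: CNv_cont; apply: (Cinfv_CNv (@open_nball0 R k d2) _ gs); rewrite /= normr0.
pose u (e : 'rV[R]_k) := lmul (gam (g e *m (Lx *m Qx *m Dx))) (gam (c (g e))).
have near1 : nbhs (0 : 'rV[R]_k) [set s | gam (th (u s)) = u s].
  have cu : {for 0, continuous u}.
    have c1 : {for 0, continuous (fun e => gam (g e *m (Lx *m Qx *m Dx)))}.
      apply: (@continuous_comp _ _ _ (fun e => g e *m (Lx *m Qx *m Dx)) gam).
        by apply: (@continuous_comp _ _ _ g (fun s => s *m (Lx *m Qx *m Dx))); [exact: cg|exact: cP].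
      by rewrite g0 mul0mx; exact: lcoord_cont lg n0g.
    have c2 : {for 0, continuous (fun e => gam (c (g e)))}.
      apply: (@continuous_comp _ _ _ g (gam \o c)); [exact: cg|rewrite g0].
      apply: continuous_comp; first by apply: CNv_cont; apply: cN; rewrite normr0.
      by rewrite c0; exact: lcoord_cont lg n0g.
    apply: (@continuous_comp _ _ _ (fun e => (gam (g e *m (Lx *m Qx *m Dx)), gam (c (g e)))) (fun p : G * G => lmul p.1 p.2)).
      exact: cvg_pair c1 c2.
    exact: lmul_cont.
  apply: (cu [set h | gam (th h) = h]).
  by rewrite /u g0 mul0mx c0 g1 lmul1; apply: filterS nb1 => h [].
have near2 : nbhs (0 : 'rV[R]_k) [set s | `|g s *m (Lx *m Qx)| < e].
  have cq : {for 0, continuous (fun s => g s *m (Lx *m Qx))}.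
    by apply: (@continuous_comp _ _ _ g (fun s => s *m (Lx *m Qx))); [exact: cg|apply: CNv_cont; exact: CNv_mull].
  by apply: (cq [set t | `|t| < e]); rewrite g0 mul0mx; exact: nball_nbhs.
have HH : nbhs (0 : 'rV[R]_k) ([set s | `|s| < d2] `&` ([set s | gam (th (u s)) = u s] `&` [set s | `|g s *m (Lx *m Qx)| < e])).
  by apply: filterI; [exact: nball_nbhs|exact: filterI].
apply: filterS2 (near_th HH) nb1 => h [/= hd [hu hg]] [_ hh].
have Eu : u (th h) = h.
  rewrite -hu; have := gE _ hd; rewrite /F /lam row_mxKl row_mxKr -/(u (th h)) => ->.
  exact: hh.
exists (g (th h) *m (Lx *m Qx)); split=> //.
exists (gam (c (g (th h)))); first by have [sd _] := gU _ hd; have [] := cK' _ sd.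
by rewrite -{1}Eu /u mulmxA.
Qed.

(** [tz z] is the displacement, transverse to the stabilizer, that carries [kap z] into the slice
    along its orbit. Its uniqueness serves to compare two slice points of one orbit. *)
Lemma slice_time : exists (d1 d2 : R) (tz : 'rV[R]_n -> 'rV[R]_r),
  [/\ 0 < d1, 0 < d2, d2 <= dl, tz 0 = 0 &
   forall z : 'rV[R]_n, `|z| < d2 -> CNv z tz] /\
  [/\ forall z : 'rV[R]_n, `|z| < d2 -> `|tz z *m Dx| < dg,
   forall z : 'rV[R]_n, `|z| < d2 -> acoord (row_mx (tz z *m Dx) z) *m Qx = 0 &
   forall t (z : 'rV[R]_n), `|t| < d1 -> `|z| < d2 -> acoord (row_mx (t *m Dx) z) *m Qx = 0 -> t = tz z].
Proof.
pose ll (z : 'rV[R]_(r + n)) := row_mx (lsubmx z *m Dx) (rsubmx z).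
have llN z : CNv z ll.
  by apply: CNv_row_mx; [apply: CNv_mulr; exact: CNv_lsubmx|exact: CNv_rsubmx].
pose U := [set z : 'rV[R]_(r + n) | W0 (ll z)].
have oU : open U.
  have cl : continuous ll by move=> z; exact: CNv_cont (llN z).
  exact: (open_comp (fun z _ => cl z) oW0).
have ll0 : ll 0 = row_mx 0 0 by rewrite /ll !linear0 mul0mx.
have U0 : U 0 by rewrite /U /= ll0 /W0 /= row_mxKl row_mxKr !normr0.
pose H z := acoord (ll z) *m Qx.
have HN z : U z -> CNv z H.
  move=> [z1 z2]; apply: CNv_mulr; apply: (CNv_comp (llN z)).
  by rewrite -[ll z]hsubmxK; exact: acoord_CN.
have H0 : H 0 = 0 by rewrite /H ll0 acoord0 ?normr0// mul0mx.
have HJ : usubmx (jac H 0) = 1%:M.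
  have U00 : U (row_mx 0 0) by rewrite row_mx0.
  have hN : CNv (0 : 'rV[R]_r) (fun u => row_mx (u *m Dx) (0 : 'rV[R]_n)).
    by apply: CNv_row_mx; [exact: CNv_mull|exact: CNv_cst].
  have aN : CNv (row_mx ((0 : 'rV[R]_r) *m Dx) (0 : 'rV[R]_n)) acoord by rewrite mul0mx; exact: acoord_CN.
  rewrite -row_mx0 -(jac_usubmx (HN _ U00)).
  rewrite (_ : (fun u => _) = (fun u => (acoord \o (fun u => row_mx (u *m Dx) (0 : 'rV[R]_n))) u *m Qx)); last first.
    by apply/funext => u; rewrite /H /ll row_mxKl row_mxKr.
  rewrite jac_mulr; last exact: CNv_comp hN aN.
  rewrite (jac_comp hN aN) mul0mx jac_row_mx jac_mull jac_cst -[jac acoord _]vsubmxK mul_row_col.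
  by rewrite mul0mx addr0 -Lx_u DL BQ.
have [d1 [d2 [cc [g [[d10 d20 _ gs] [g0 gU gE gu _]]]]]] := implicit_function oU U0 (CNv_Cinfv HN) H0 HJ.
have dd (z : 'rV[R]_n) : `|z| < Num.min d2 dl -> `|z| < d2 by rewrite lt_min => /andP[].
exists d1, (Num.min d2 dl), g; split; split=> //.
- by rewrite lt_min d20.
- by rewrite ge_min lexx orbT.
- by move=> z /dd zd; exact: (Cinfv_CNv (@open_nball0 _ _ _) zd gs).
- by move=> z /dd/gU[_ []]; rewrite /ll /= row_mxKl row_mxKl.
- by move=> z /dd/gE; rewrite /H /ll row_mxKl row_mxKr.
- by move=> t z td /dd zd h; apply: gu => //; rewrite /H /ll row_mxKl row_mxKr.
Qed.

(** By properness [g] is close to [K], hence a small displacement [gam (t *m Dx)] times an element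
    of [K]. As [K] preserves the slice, uniqueness of the displacement forces [t = 0]. *)
Lemma slice_stab : exists2 W, nbhs x W & forall y g, W y -> W (A g y) ->
  tau y *m Qx = 0 -> tau (A g y) *m Qx = 0 -> K g.
Proof.
have [_ K1 KM KV] := cK.
have [d1 [d2 [tz [[d10 d20 _ tz0 _] [_ _ tzu]]]]] := slice_time.
pose O1 := interior [set g | exists t : 'rV[R]_r, `|t| < d1 /\ exists2 l, K l & g = lmul (gam (t *m Dx)) l].
have O11 : O1 (lone G) by exact: decomp.
pose V := \bigcup_(l in K) ((fun g => lmul g (linv l)) @^-1` O1).
have oV : open V.
  apply: bigcup_open => l _; apply: (open_comp (fun z _ => @lmulr_cont _ _ _ (linv l) z)).
  exact: open_interior.
have KV' : K `<=` V by move=> l Kl; exists l => //=; rewrite lmulgV.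
have [W1 nW1 hW1] := stab_proper oV KV'.
have /stab_tube nW2 : nbhs x [set y | `|tau y| < d2 /\ kap (tau y) = y].
  by apply: filterI; [exact: (lcoord_small lc d20)|exact: nbx'].
exists (W1 `&` [set y | forall l, K l -> `|tau (A l y)| < d2 /\ kap (tau (A l y)) = A l y]).
  exact: filterI.
move=> y g [y1 y2] [gy1 _] ty tgy.
have [l Kl /= /interior_subset[t [td [l' Kl' E]]]] := hW1 _ _ y1 gy1.
have Eg : g = lmul (gam (t *m Dx)) (lmul l' l) by rewrite lmulA -E lmulgKV.
have Kll := KM _ _ Kl' Kl; have [h1 h2] := y2 _ Kll.
have t0 : t = 0.
  transitivity (tz (tau (A (lmul l' l) y))).
    by apply: tzu => //; rewrite /acoord row_mxKl row_mxKr h2 -actM -Eg.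
  apply/esym/tzu => //; first by rewrite normr0.
  by rewrite /acoord row_mxKl row_mxKr mul0mx g1 act1 h2 tauK// Q_rho.
by rewrite Eg t0 mul0mx g1 lmul1.
Qed.

(** [rr] moves points into the slice along their orbits. So its derivative differs from the identity
    by orbit directions only, and two points of one orbit land on slice points related by [K]. *)
Lemma slice_map : exists (rr : 'rV[R]_n -> 'rV[R]_n) (Y : 'M[R]_(n, k)),
  [/\ CNv 0 rr, rr 0 = 0, jac rr 0 = 1%:M + Y *m Lx,
    nbhs x [set y | rr (tau y) *m Qx = 0 /\ exists g, A g y = kap (rr (tau y))] /\
    nbhs (0 : 'rV[R]_n) [set z | z *m Qx = 0 -> rr z = z] &
    exists2 W, nbhs x W & forall y h, W y -> W (A h y) ->
      exists2 l, K l & rr (tau (A h y)) = rr (tau y) *m rho l].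
Proof.
have [d1 [d2 [tz [[d10 d20 d2l tz0 tzN] [tzg tzE tzu]]]]] := slice_time.
pose hh z := row_mx (tz z *m Dx) z.
pose rr z := acoord (hh z).
have z20 : `|0 : 'rV[R]_n| < d2 by rewrite normr0.
have hN : CNv 0 hh.
  by apply: CNv_row_mx; [apply: CNv_mulr; exact: tzN|exact: CNv_id].
have h0 : hh 0 = row_mx 0 0 by rewrite /hh tz0 mul0mx.
have aN : CNv (hh 0) acoord by rewrite h0; exact: acoord_CN.
have rN : CNv 0 rr := CNv_comp hN aN.
have rr0 : rr 0 = 0 by rewrite /rr h0 acoord0.
pose gy y := gam (tz (tau y) *m Dx).
have tauc : {for x, continuous tau} by exact: (tau_cont lc).
have near_tau (Q : set 'rV[R]_n) : nbhs (0 : 'rV[R]_n) Q -> nbhs x [set y | Q (tau y)].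
  by move=> hQ; apply: tauc; rewrite tx.
have cgy : {for x, continuous (fun y => A (gy y) y)}.
  apply: (@continuous_comp _ _ _ (fun y => (gy y, y)) (fun p : G * M => A p.1 p.2)).
    have c1 : {for x, continuous gy}.
      apply: (@continuous_comp _ _ _ tau (fun z => gam (tz z *m Dx))); first exact: tauc.
      apply: (@continuous_comp _ _ _ (fun z => tz z *m Dx) gam).
        by rewrite tx; apply: CNv_cont; apply: CNv_mulr; exact: tzN.
      by rewrite tx tz0 mul0mx; exact: lcoord_cont lg n0g.
    exact: (cvg_pair c1 cvg_id).
  exact: act_cont.
have gyx : A (gy x) x = x by rewrite /gy tx tz0 mul0mx g1 act1.
have nR (Q : set M) : nbhs x Q -> nbhs x [set y | Q (A (gy y) y)].
  by move=> hQ; apply: (cgy Q); rewrite gyx.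
have nT : nbhs x [set y | tau (A (gy y) y) = rr (tau y) /\ (kap (tau (A (gy y) y)) = A (gy y) y /\ `|tau y| < d2)].
  apply: filterS2 (filterI nbx' (lcoord_small lc d20)) (nR _ nbx') => y [y1 y2] y3.
  by split=> //; rewrite /rr /hh /acoord row_mxKl row_mxKr y1.
exists rr, (jac tz 0 *m Dx); split=> //.
- rewrite (jac_comp hN aN) h0 /hh jac_row_mx jac_id jac_mulr; last exact: tzN.
  by rewrite -[jac acoord _]vsubmxK mul_row_col -Lx_u acoord_d0 mulmx1 addrC.
- split; first apply: filterS nT => y [y1 [y2 y3]].
    by split; [exact: tzE|exists (gy y); rewrite -y1 y2].
  apply: filterS (nball_nbhs _ d20) => z zd zQ; have zl : `|z| < dl := lt_le_trans zd d2l.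
  have t0 : 0 = tz z by apply: tzu; rewrite ?normr0// mul0mx acoord0.
  by rewrite /rr /hh -t0 mul0mx acoord0.
have [W nW hW] := slice_stab.
exists ([set y | W (A (gy y) y)] `&` [set y | tau (A (gy y) y) = rr (tau y) /\ (kap (tau (A (gy y) y)) = A (gy y) y /\ `|tau y| < d2)]).
  by apply: filterI => //; exact: nR.
move=> y h [y1 [y2 [_ y3]]] [h1 [h2 [_ h3]]].
have E : A (gy (A h y)) (A h y) = A (lmul (lmul (gy (A h y)) h) (linv (gy y))) (A (gy y) y).
  by rewrite -!actM lmulgKV.
exists (lmul (lmul (gy (A h y)) h) (linv (gy y))).
  apply: (hW (A (gy y) y)) => //; rewrite -?E// ?y2 ?h2; exact: tzE.
rewrite -h2 E tauK ?y2//.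
by apply: (hW (A (gy y) y)) => //; rewrite -?E// ?y2 ?h2; exact: tzE.
Qed.

Definition Pi : 'M[R]_n := mmx m rho.

(** [Pi] is the projection onto the vectors fixed by [K]. The mean is invariant under translations
    on one side; the other side follows by comparing [Pi] with the mean of [rho] at the inverses. *)
Lemma Pi_rho l : K l -> Pi *m rho l = Pi /\ rho l *m Pi = Pi.
Proof.
have [kK K1 KM KV] := cK.
have crV := ccont_comp (@linv_cont _ _ G) crho.
have h1 a : K a -> rho a *m Pi = Pi.
  move=> Ka; rewrite /Pi -(mmx_mull kK mm)// -[RHS](mmx_tr mm crho Ka).
  apply: (mmx_eq mm) => [||h Kh].
  - by apply: ccontM; [exact: ccont_cst|exact: crho].
  - exact: (ccont_comp (@lmulr_cont _ _ _ a) crho).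
  - by rewrite rhoM.
have h2 a : K a -> mmx m (rho \o @linv _ _ G) *m rho a = mmx m (rho \o @linv _ _ G).
  move=> Ka; rewrite -(mmx_mulr kK mm)// -[RHS](mmx_tr mm crV (KV _ Ka)).
  apply: (mmx_eq mm) => [||h Kh].
  - by apply: ccontM; [exact: crV|exact: ccont_cst].
  - exact: (ccont_comp (@lmulr_cont _ _ _ (linv a)) crV).
  - by rewrite /= linvM linvK rhoM//; exact: KV.
have E : Pi = mmx m (rho \o @linv _ _ G).
  have e1 : mmx m (rho \o @linv _ _ G) *m Pi = Pi.
    rewrite -(mmx_mulr kK mm)// -[RHS](mmx_cst kK mm).
    apply: (mmx_eq mm) => [||h Kh]; [|exact: ccont_cst|by apply: h1; exact: KV].
    by apply: ccontM; [exact: crV|exact: ccont_cst].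
  rewrite -e1 /Pi -(mmx_mull kK mm)// -[RHS](mmx_cst kK mm).
  apply: (mmx_eq mm) => [||h Kh]; [|exact: ccont_cst|exact: h2].
  by apply: ccontM; [exact: ccont_cst|exact: crho].
by move=> Kl; split; [rewrite E h2|exact: h1].
Qed.

Lemma Pi2 : Pi *m Pi = Pi.
Proof.
have [kK K1 KM KV] := cK; rewrite {1}/Pi -(mmx_mulr kK mm)// -[RHS](mmx_cst kK mm).
apply: (mmx_eq mm) => [||h Kh]; [|exact: ccont_cst|exact: (Pi_rho Kh).2].
by apply: ccontM; [exact: crho|exact: ccont_cst].
Qed.

(** A slice point fixed by [Pi] is fixed by [K], and its stabilizer is not larger since elements
    joining slice points lie in [K]; [y] lies on the orbit of such a point. *)
Lemma orbit_type_fix rr : CNv 0 rr -> rr 0 = 0 ->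
  nbhs x [set y | rr (tau y) *m Qx = 0 /\ exists g, A g y = kap (rr (tau y))] ->
  nbhs x [set y | rr (tau y) *m Pi = rr (tau y) -> orbit_type A K y].
Proof.
move=> rN rr0 nR; have [W nW hW] := slice_stab.
have nQ : nbhs (0 : 'rV[R]_n) [set z | W (kap z) /\ (tau (kap z) = z /\ forall l, K l -> kap (tau (A l (kap z))) = A l (kap z))].
  have n1 := near_kap nW; have n2 := near_kap (stab_tube nbx').
  apply: filterS2 (filterI n1 n2) (nball_nbhs _ dl0) => z [z1 z2] zd.
  by split=> //; split=> [|l Kl]; [exact: tk|exact: z2].
have nQ' : nbhs x [set y | W (kap (rr (tau y))) /\ (tau (kap (rr (tau y))) = rr (tau y) /\ forall l, K l -> kap (tau (A l (kap (rr (tau y))))) = A l (kap (rr (tau y))))].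
  have crt : {for x, continuous (rr \o tau)}.
    by apply: continuous_comp; [exact: (tau_cont lc)|rewrite tx; exact: CNv_cont].
  by apply: (crt [set z | W (kap z) /\ (tau (kap z) = z /\ forall l, K l -> kap (tau (A l (kap z))) = A l (kap z))]); rewrite /= tx rr0.
apply: filterS2 nR nQ' => y [yQ [g gy]] [yW [yk yK]] yP.
have fixK l : K l -> A l (kap (rr (tau y))) = kap (rr (tau y)).
  by move=> Kl; rewrite -yK// tauK// yk -yP -mulmxA (Pi_rho Kl).1.
exists (linv g); apply/seteqP; split=> [h /= hy|_ [l Kl <-] /=].
  exists (lmul (lmul g h) (linv g)); last by rewrite linvK !lmulA lmulV lmul1 lmulgKV.
  have E : A (lmul (lmul g h) (linv g)) (kap (rr (tau y))) = kap (rr (tau y)).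
    by rewrite -gy -actM lmulgKV actM hy.
  by apply: (hW (kap (rr (tau y)))) => //; rewrite ?E ?yk.
by rewrite linvK -lmulA actM [A (lmul l g) y]actM gy fixK// -gy -actM lmulV act1.
Qed.

(** * Invariant functions built on the slice *)

Variable I : (G -> R) -> R.
Hypotheses (Ilin : forall (f1 f2 : G -> R) (a : R), Cc f1 -> Cc f2 ->
    I (fun h => a * f1 h + f2 h) = a * I f1 + I f2)
  (Imono : forall f1 f2 : G -> R, Cc f1 -> Cc f2 -> (forall h, setT h -> f1 h <= f2 h) -> I f1 <= I f2)
  (Itr : forall (f : G -> R) g, Cc f -> setT g -> I (fun h => f (lmul h g)) = I f)
  (Ipos : forall f : G -> R, Cc f -> (forall h, setT h -> 0 <= f h) -> 0 < f (lone G) -> 0 < I f).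

Variables (rr : 'rV[R]_n -> 'rV[R]_n) (Y : 'M[R]_(n, k)).
Hypotheses (rrN : CNv 0 rr) (rr0 : rr 0 = 0) (rrJ : jac rr 0 = 1%:M + Y *m Lx)
  (rrx : nbhs x [set y | rr (tau y) *m Qx = 0 /\ exists g, A g y = kap (rr (tau y))])
  (rrQ : nbhs (0 : 'rV[R]_n) [set z | z *m Qx = 0 -> rr z = z])
  (rrinv : exists2 W, nbhs x W & forall y h, W y -> W (A h y) ->
      exists2 l, K l & rr (tau (A h y)) = rr (tau y) *m rho l).

Definition wx (y : M) : 'rV[R]_n := rr (tau y) *m (1%:M - Pi).
(** Gram matrix of the Euclidean inner product averaged over [K], hence a form invariant under
    [rho]. *)
Definition Sx : 'M[R]_n := mmx m (fun h => rho h *m (rho h)^T).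
Definition quad (u : 'rV[R]_n) : R := (u *m Sx *m u^T) 0 0.

Let crhoT : ccont (fun h => rho h *m (rho h)^T).
Proof.
apply: ccontM => // i j; rewrite (_ : (fun h => _) = (fun h => rho h j i)) //.
by apply/funext => h; rewrite mxE.
Qed.

Lemma quadE u : quad u = m (fun h => \sum_j (u *m rho h) 0 j ^+ 2).
Proof.
have [kK _ _ _] := cK; rewrite /quad /Sx -(mmx_mull kK mm)//.
rewrite -(mmx_mulr kK mm); last by apply: ccontM; [exact: ccont_cst|].
rewrite mxE; congr m; apply/funext => h.
rewrite mulmxA -mulmxA -trmx_mul mxE; apply: eq_bigr => j _.
by rewrite [X in _ * X]mxE expr2.
Qed.

Lemma quad_rho u l : K l -> quad (u *m rho l) = quad u.
Proof.
have [kK _ _ _] := cK => Kl; rewrite /quad; congr (fun_of_matrix _ 0 0).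
rewrite trmx_mul -!mulmxA; congr (_ *m _); rewrite !mulmxA; congr (_ *m _).
rewrite /Sx -(mmx_mull kK mm)// -(mmx_mulr kK mm); last by apply: ccontM; [exact: ccont_cst|].
rewrite -[RHS](mmx_tr mm crhoT Kl); apply: (mmx_eq mm) => [||h Kh].
- by apply: ccontM; [apply: ccontM; [exact: ccont_cst|]|exact: ccont_cst].
- exact: (ccont_comp (@lmulr_cont _ _ _ l) crhoT).
- by rewrite rhoM// trmx_mul !mulmxA.
Qed.

Lemma rho_bound : exists2 B, 0 < B & forall (v : 'rV[R]_n) l, K l -> `|v *m rho l| <= B * `|v|.
Proof.
have [kK _ _ _] := cK.
have /choice[b hb] : forall p : 'I_n * 'I_n, exists b, 0 < b /\ forall h, K h -> `|rho h p.1 p.2| <= b.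
  move=> [i j]; have ci : continuous (fun h => rho h i j) by exact: crho.
  have [b b0 hb] := compact_bound kK (fun h _ => ci h).
  by exists b; split.
exists (\sum_i \sum_j b (i, j) + 1).
  by rewrite ltr_wpDl//; apply: sumr_ge0 => i _; apply: sumr_ge0 => j _; have [/ltW] := hb (i, j).
have B0 : 0 <= \sum_i \sum_j b (i, j) + 1.
  by rewrite addr_ge0//; apply: sumr_ge0 => i _; apply: sumr_ge0 => j _; have [/ltW] := hb (i, j).
move=> v l Kl; apply: rV_norm_le => [|j]; first by rewrite mulr_ge0.
rewrite mxE (le_trans (ler_norm_sum _ _ _))// (@le_trans _ _ (\sum_i b (i, j) * `|v|))//.
  apply: ler_sum => i _; rewrite normrM mulrC ler_pM//; first exact: (hb (i, j)).2.
  exact: ler_coord.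
rewrite -mulr_suml; apply: ler_wpM2r => //.
apply: (@le_trans _ _ (\sum_j \sum_i b (i, j))); last by rewrite [leLHS]exchange_big lerDl.
rewrite [leRHS](bigD1 j)//= lerDl.
by apply: sumr_ge0 => i _; apply: sumr_ge0 => i' _; have [/ltW] := hb (i', i).
Qed.

Lemma quad_ge : exists2 c, 0 < c & forall u, c * `|u| ^+ 2 <= quad u.
Proof.
have [kK K1 KM KV] := cK.
have [B B0 hB'] := rho_bound.
have hB h (v : 'rV[R]_n) : K h -> `|v *m rho (linv h)| <= B * `|v| by move=> Kh; apply/hB'/KV.
(* [B] bounds [rho] at the inverses of elements of [K], so [|u|] is at most [B] times the norm of
   each [u *m rho h]; the sum of squares dominates the square of the maximum norm. *)
exists (B ^- 2); first by rewrite invr_gt0 exprn_gt0.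
move=> u; rewrite quadE -(mean_cst kK mm (B ^- 2 * _)); have [_ mono _ _] := mm.
apply: mono => [||h Kh]; first exact: cst_continuous.
  apply: cont_sum => j h.
  have cj : continuous (fun h => (u *m rho h) 0 j).
    have cc : ccont (fun h => u *m rho h) by apply: ccontM; [exact: ccont_cst|exact: crho].
    exact: cc.
  exact: (@continuousM _ _ (fun h => (u *m rho h) 0 j) (fun h => (u *m rho h) 0 j) h (cj h) (cj h)).
set v := u *m rho h; have uv : u = v *m rho (linv h) by rewrite -mulmxA rhoV// mulmx1.
have h1 : `|u| <= B * `|v| by rewrite {1}uv; exact: hB.
have h2 : `|v| ^+ 2 <= \sum_j v 0 j ^+ 2.
  have s0 : 0 <= \sum_j v 0 j ^+ 2 by apply: sumr_ge0 => j _; exact: sqr_ge0.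
  rewrite -[leRHS]sqr_sqrtr// lerXn2r ?nnegrE ?sqrtr_ge0//.
  apply: rV_norm_le => [|j]; first exact: sqrtr_ge0.
  rewrite -sqrtr_sqr ler_wsqrtr// (bigD1 j)//= lerDl.
  by apply: sumr_ge0 => i _; exact: sqr_ge0.
apply: le_trans h2; rewrite mulrC ler_pdivrMr ?exprn_gt0// -exprMn mulrC.
by rewrite lerXn2r ?nnegrE// mulr_ge0// ltW.
Qed.

Lemma rrtau_snear q (B : 'M[R]_(n, q)) j : snear x (fun y => (rr (tau y) *m B) 0 j).
Proof. exact: (lcoord_snear lc (CNv_mulr B rrN j)). Qed.

Lemma snear_nbhs f : snear x f -> exists2 U : set M, nbhs x U & fsmooth (f := mspace M) U f.
Proof. by move=> /smooth_atP[U [oU Ux fU]]; exists U => //; exact: open_nbhs_nbhs. Qed.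

Lemma local_extension psi : snear x psi ->
  (exists2 W, nbhs x W & forall y h, W y -> W (A h y) -> psi (A h y) = psi y) ->
  exists F, [/\ Csm (X := mspace M) F, ginvariant A F & \forall y \near x, F y = psi y].
Proof.
move=> /snear_nbhs[U nU sU] [W nW hW].
have [V [oV Vx] sV] : exists2 V, open_nbhs x V & V `<=` U `&` W.
  have : nbhs x (U `&` W) by exact: filterI.
  by rewrite nbhsE => -[V ? ?]; exists V.
apply: (inv_extension hproper Ilin Imono Itr Ipos (U := V)); first exact: open_nbhs_nbhs.
  by move=> c ac; apply: Cinf_sub (sU c ac) => _ [z [z1 /sV[z2 _]] <-]; exists z.
by move=> y h /sV[_ y1] /sV[_ h1]; exact: hW.
Qed.

Lemma phi_exists : exists phi, [/\ Csm (X := mspace M) phi, ginvariant A phi &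
  \forall y \near x, phi y = quad (wx y)].
Proof.
apply: local_extension.
  rewrite (_ : (fun y => _) = (fun y => \sum_j (rr (tau y) *m ((1%:M - Pi) *m Sx)) 0 j * (rr (tau y) *m (1%:M - Pi)) 0 j)).
    by apply: snear_sum => j; apply: snearM; exact: rrtau_snear.
  by apply/funext => y; rewrite /quad /wx mulmxA mxE; apply: eq_bigr => j _; rewrite [X in _ * X]mxE.
have [W nW hW] := rrinv; exists W => // y h y1 h1; have [l Kl E] := hW y h y1 h1.
have [e1 e2] := Pi_rho Kl.
rewrite /wx E -mulmxA (_ : rho l *m _ = (1%:M - Pi) *m rho l) ?mulmxA ?quad_rho//.
by rewrite mulmxBr mulmxBl e1 e2 mulmx1 mul1mx.
Qed.

Lemma Pi_extension j : exists F, [/\ Csm (X := mspace M) F, ginvariant A F &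
  \forall y \near x, F y = (rr (tau y) *m Pi) 0 j].
Proof.
apply: local_extension; first exact: rrtau_snear.
have [W nW hW] := rrinv; exists W => // y h y1 h1; have [l Kl ->] := hW y h y1 h1.
by rewrite -mulmxA (Pi_rho Kl).2.
Qed.

Local Notation ctan := (coord_vec x tau kap).

Lemma infgen_coord xi : lie_alg G xi -> infgen A xi x = ctan (tcrd th xi *m Lx).
Proof.
move=> txi; apply/funext => f; rewrite /infgen /Tmap act1 /coord_vec.
case: asboolP => [/smooth_atP fs|fs]; last by rewrite asboolF// => /smooth_atP.
rewrite asboolT//.
have fkN : CN (fx 0) (f \o kap) by rewrite fx0; apply: (lcoord_CN lc n0l); rewrite kx.
have cN : CN 0 ((f \o kap) \o fx) by apply: CN_comp fkN; exact: (fxN n0g).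
have E : {near (0 : 'rV[R]_k), (f \o kap) \o fx =1 (f \o (fun g => A g x)) \o gam}.
  by apply: filterS (near_orb nbx') => s; rewrite /= /fx => ->.
have fs' : snear (lone G) (f \o (fun g => A g x)).
  apply: snear_eq (lcoord_snear lg cN).
  apply: filterS2 nb1 (near_th (near_orb nbx')) => g [_ gg] /=.
  by rewrite /fx gg => ->.
rewrite (tan_coord txi lg fs').
have Eg i : pd i ((f \o (fun g => A g x)) \o gam) 0 = (row i Lx *m grad (f \o kap) 0) 0 0.
  have [W [oW W0' fW]] := fkN; have sdf := C1_sdiff oW W0' (fW 1%N); rewrite fx0 in sdf.
  have sdfx := CNv_sdiffv (fxN n0g); rewrite fxJ in sdfx.
  have sdf' : sdiff (f \o kap) (fx 0) (grad (f \o kap) 0) by rewrite fx0.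
  have [_ h] := is_derive_sdiff (delta_mx 0 i) (sdiff_comp sdfx sdf').
  by rewrite /pd -(near_eq_derive _ E) h mulmxA -rowE.
rewrite -[RHS](_ : ((tcrd th xi *m Lx) *m grad (f \o kap) 0) 0 0 = _); last first.
  by rewrite mxE; apply: eq_bigr => i _; rewrite [grad _ _ _ _]mxE.
rewrite -mulmxA mxE; apply: eq_bigr => i _.
by rewrite Eg [tcrd _ _ _ _]mxE -row_mul [row _ _ _ _]mxE.
Qed.

(** [v] kills [w] by assumption, and the [K]-fixed part of the slice coordinates because this part
    extends to invariant functions. So the derivative [1%:M + Y *m Lx] of [rr] kills [v], which puts
    [v] in the row space of [Lx]. *)
Lemma slice_tangent v : tangent (X := mspace M) x v -> (forall j, v (fun y => wx y 0 j) = 0) ->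
  (forall F, Csm (X := mspace M) F -> ginvariant A F -> v F = 0) -> orbit_dir A x v.
Proof.
move=> tv vw vF; set a := tcrd tau v.
have vr q (B : 'M[R]_(n, q)) j : v (fun y => (rr (tau y) *m B) 0 j) = (a *m jac rr 0 *m B) 0 j.
  rewrite (tan_cv lc tv) cvE; last exact: rrtau_snear.
  have -> : grad ((fun y => (rr (tau y) *m B) 0 j) \o kap) 0 = col j (jac rr 0 *m B).
    rewrite -(jac_mulr B rrN); apply/colP => i; rewrite !mxE; apply: near_eq_derive.
    by apply: filterS (nball_nbhs _ dl0) => z zd; rewrite /crd /= tk.
  by rewrite -/a colE !mulmxA -colE mxE.
have h1 : a *m jac rr 0 *m (1%:M - Pi) = 0 by apply/rowP => j; rewrite -vr vw mxE.
have h2 : a *m jac rr 0 *m Pi = 0.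
  apply/rowP => j; rewrite -vr mxE; have [F [Fs Fi nF]] := Pi_extension j.
  by rewrite -(tan_eq tv (Csm_snear x Fs) nF); exact: vF.
have : a *m jac rr 0 = 0 by rewrite -[LHS]mulmx1 -[1%:M](subrK Pi) mulmxDr h1 h2 addr0.
rewrite rrJ mulmxDr mulmx1 => /eqP; rewrite addr_eq0 => /eqP aE.
exists (coord_vec (lone G) th gam (- (a *m Y))); first exact: (cv_tan lg).
rewrite infgen_coord; last exact: (cv_tan lg).
by rewrite (tcrd_cv lg) mulNmx -mulmxA -aE -(tan_cv lc tv).
Qed.

Lemma phi_orbit_type phi : (\forall y \near x, phi y = quad (wx y)) ->
  nbhs x [set y | phi y = 0 -> orbit_type A K y].
Proof.
move=> nphi; have [c c0 hc] := quad_ge.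
apply: filterS2 nphi (orbit_type_fix rrN rr0 rrx) => y yq yo y0; apply: yo.
have : `|wx y| ^+ 2 <= 0 by rewrite -(ler_pM2l c0) mulr0 -y0 yq.
move=> h; have : wx y = 0.
  by apply/eqP; rewrite -normr_eq0 -sqrf_eq0 eq_le h sqr_ge0.
by rewrite /wx mulmxBr mulmx1 => /eqP; rewrite subr_eq0 => /eqP <-.
Qed.

Local Notation ds s := (coord_vec (lone G) th gam (delta_mx 0 s)).

Lemma pd_eq0 z f : `|z| < dl -> snear (kap z) f ->
  (forall v, tangent (X := mspace M) (kap z) v -> v f = 0) -> grad (f \o kap) z = 0.
Proof.
move=> zd fs hv; have [tau1 [kap1 [e1 l1]]] := lcoord_chart (kap z).
have [[e10 st1 [t1x k1x]] [tk1 _ nb1']] := l1.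
have tN : CNv z (tau1 \o kap).
  by move=> j; exact: (lcoord_CN (f := crd tau1 j) lc zd (Csm_snear _ (st1 j))).
have fN : CN ((tau1 \o kap) z) (f \o kap1).
  by rewrite /= t1x; apply: (lcoord_CN l1); rewrite ?normr0 ?k1x.
rewrite (@grad_near _ _ _ ((f \o kap1) \o (tau1 \o kap))).
  rewrite (grad_comp tN fN) /= t1x; suff -> : grad (f \o kap1) 0 = 0 by rewrite mulmx0.
  apply/colP => i; have := hv _ (cv_tan l1 (delta_mx 0 i)).
  by rewrite cvE// -rowE !mxE.
have kc : {for z, continuous kap} := lcoord_cont lc zd.
have nk : nbhs z [set u | kap1 (tau1 (kap u)) = kap u].
  by apply: (kc [set y | kap1 (tau1 y) = y]); apply: filterS nb1' => y [].
by apply: filterS nk => u /= ->.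
Qed.

(** The condition on [b] says that it is tangent to [K]. The map [c] of [stab_param] takes values
    fixing [y], and its derivative [E0] fixes [b]. *)
Lemma infgen_fix y b : K `<=` stab A y -> b *m Lx = 0 ->
  infgen A (coord_vec (lone G) th gam b) y = 0.
Proof.
move=> Ky bL; have bE : b *m E0 = b.
  by rewrite /E0 mulmxBr mulmx1 !mulmxA bL !mul0mx subr0.
apply/funext => f; rewrite /infgen /Tmap act1; case: asboolP => // /smooth_atP fs.
have [tau1 [kap1 [e1 l1]]] := lcoord_chart y.
have [[e10 st1 [t1x k1x]] [tk1 _ nb1']] := l1.
have [d [c [d0 c0 cN Jc cK']]] := stab_param.
pose F s := tau1 (A (gam s) y).
have FN : CNv (0 : 'rV[R]_k) F.
  have F2 : CNv (row_mx (0 : 'rV[R]_k) (0 : 'rV[R]_n)) (fun z => tau1 (A (gam (lsubmx z)) (kap1 (rsubmx z)))).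
    apply: (@Cinfv_CNv _ _ _ [set z : 'rV[R]_(k + n) | `|lsubmx z| < dg /\ `|rsubmx z| < e1]).
    - exact: (open_rect (@open_nball0 _ _ _) (@open_nball0 _ _ _)).
    - by rewrite /= row_mxKl row_mxKr !normr0.
    - by move=> j; exact: (mprod_Cinf (act_fsmooth A (st1 j)) lg l1).
  have h : CNv (0 : 'rV[R]_k) (fun s : 'rV[R]_k => row_mx s (0 : 'rV[R]_n)).
    by apply: CNv_row_mx; [exact: CNv_id|exact: CNv_cst].
  apply: CNv_near (CNv_comp h F2).
  by apply: filterE => u; rewrite /= row_mxKl row_mxKr k1x.
have F0 : F 0 = 0 by rewrite /F g1 act1 t1x.
have fN : CN (F 0) (f \o kap1) by rewrite F0; apply: (lcoord_CN l1); rewrite ?normr0 ?k1x.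
have fFN : CN 0 ((f \o kap1) \o F) by exact: CN_comp FN fN.
have nby (Q : set M) : nbhs y Q -> nbhs (lone G) [set g | Q (A g y)].
  by move=> hQ; apply: (@act_contl _ _ _ _ _ A y (lone G) Q); rewrite act1.
have nk : nbhs (lone G) [set g | kap1 (tau1 (A g y)) = A g y].
  by apply: (nby [set z | kap1 (tau1 z) = z]); apply: filterS nb1' => z [].
have E : {near (0 : 'rV[R]_k), (f \o kap1) \o F =1 (f \o (fun g => A g y)) \o gam}.
  by apply: filterS (near_gam nk) => s; rewrite /= /F => ->.
have fs' : snear (lone G) (f \o (fun g => A g y)).
  apply: snear_eq (lcoord_snear lg fFN).
  apply: filterS2 nb1 (near_th (near_gam nk)) => g [_ gg] /=.
  by rewrite /F gg => ->.
rewrite cvE//; rewrite -(grad_near E).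
have cN0 : CNv 0 c by apply: cN; rewrite normr0.
have fFN' : CN (c 0) ((f \o kap1) \o F) by rewrite c0.
have : grad (((f \o kap1) \o F) \o c) 0 = 0.
  rewrite -(grad_cst (f (kap1 (tau1 y))) (0 : 'rV[R]_k)); apply: grad_near.
  apply: filterS (nball_nbhs _ d0) => e /cK'[_ /Ky Ke] /=.
  by rewrite /F Ke.
rewrite (grad_comp cN0 fFN') Jc c0 => h.
by rewrite -bE -mulmxA h mulmx0 mxE.
Qed.

(** * The momentum map on the slice *)

Variables (om : M -> vec (mspace M) -> vec (mspace M) -> R) (P : M -> covec (mspace G)).
Hypotheses (hom2 : twoform (X := mspace M) om) (homnd : nondeg_form (X := mspace M) om)
  (hP : equivariant_map A P)
  (hPom : forall xi x w, lie_alg G xi -> tangent (X := mspace M) x w ->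
     dform (X := mspace M) (fun y => P y xi) x w = om x (infgen A xi x) w)
  (Px : P x = 0).

Let lds s : lie_alg G (ds s). Proof. exact: (cv_tan lg). Qed.

Lemma PE y b : P y (coord_vec (lone G) th gam b) = \sum_s b 0 s * P y (ds s).
Proof. by have [hP1 _ _] := hP; exact: (cov_cv lg _ (hP1 y)). Qed.

Definition pp (z : 'rV[R]_n) : 'rV[R]_k := \row_s P (kap z) (ds s).

Lemma P_eq0 y : P y = 0 <-> forall s, P y (ds s) = 0.
Proof.
split=> [-> //|h]; apply/funext => xi; have [hP1 _ _] := hP.
have [txi|ntxi] := pselect (lie_alg G xi); last by have [_ ->] := hP1 y.
by rewrite (tan_cv lg txi) PE big1// => s _; rewrite h mulr0.
Qed.

Lemma pp_eq0 z : pp z = 0 <-> P (kap z) = 0.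
Proof.
rewrite P_eq0; split=> [h s|h]; first by have := congr1 (fun u : 'rV[R]_k => u 0 s) h; rewrite !mxE.
by apply/rowP => s; rewrite !mxE.
Qed.

Lemma P_inv g y : P y = 0 -> P (A g y) = 0.
Proof.
by move=> y0; apply/P_eq0 => s; have [_ _ ->] := hP; rewrite ?y0.
Qed.

Let P_Csm xi : lie_alg G xi -> Csm (X := mspace M) (fun y => P y xi).
Proof. by have [_ + _] := hP; apply. Qed.

Lemma pp_CN z : `|z| < dl -> CNv z pp.
Proof.
move=> zd s; apply: CN_near (lcoord_CN lc zd (Csm_snear _ (P_Csm (lds s)))).
by apply: filterE => u; rewrite /crd mxE.
Qed.

Definition Tx := jac pp 0.
Definition Omx : 'M[R]_n := \matrix_(i, j) om x (ctan (delta_mx 0 i)) (ctan (delta_mx 0 j)).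

Lemma om_cvl a w : tangent (X := mspace M) x w ->
  om x (ctan a) w = \sum_i a 0 i * om x (ctan (delta_mx 0 i)) w.
Proof.
move=> tw; have [lin _ _] := hom2.
pose al : covec (mspace M) := fun v => if `[< tangent (X := mspace M) x v >] then om x v w else 0.
have cal : cotangent (X := mspace M) x al.
  split=> [c v1 v2 h1 h2|v nv]; last by rewrite /al asboolF.
  rewrite /al !asboolT//; first exact: lin.
  by rewrite (tan_cv lc h1) (tan_cv lc h2) -cv_lin; exact: (cv_tan lc).
have := cov_cv lc a cal; rewrite /al asboolT; last exact: (cv_tan lc).
by move=> ->; apply: eq_bigr => i _; rewrite asboolT//; exact: (cv_tan lc).
Qed.

Lemma Tx_E : Tx = (Lx *m Omx)^T.
Proof.
apply/matrixP => i s; rewrite !mxE.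
have -> : pd i (crd pp s) 0 = ctan (delta_mx 0 i) (fun y => P y (ds s)).
  rewrite cvE; last exact/Csm_snear/P_Csm/lds.
  rewrite -rowE !mxE; apply: near_eq_derive.
  by apply: filterE => u; rewrite /crd mxE.
have := hPom (lds s) (cv_tan lc (delta_mx 0 i)).
rewrite /dform asboolT; last exact: (cv_tan lc).
move=> ->; rewrite infgen_coord// (tcrd_cv lg) om_cvl; last exact: (cv_tan lc).
by apply: eq_bigr => l _; rewrite -rowE !mxE.
Qed.

Lemma Omx_unit : Omx \in unitmx.
Proof.
have [_ anti _] := hom2.
rewrite -row_free_unit -kermx_eq0; apply/rowV0P => u /sub_kermxP uO.
suff : ctan u = 0.
  by move=> /(congr1 (tcrd tau)); rewrite (tcrd_cv lc) => ->; apply/rowP => i; rewrite !mxE.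
apply: (homnd (x := x)) => //; first exact: (cv_tan lc).
move=> w tw; rewrite anti//; last exact: (cv_tan lc).
rewrite (tan_cv lc tw) om_cvl; last exact: (cv_tan lc).
apply/eqP; rewrite oppr_eq0; apply/eqP; apply: big1 => j _.
rewrite anti//; try exact: (cv_tan lc).
rewrite om_cvl; last exact: (cv_tan lc).
have := congr1 (fun B : 'rV[R]_n => B 0 j) uO; rewrite [LHS]mxE [RHS]mxE.
under eq_bigr do rewrite [Omx _ _]mxE.
by move=> ->; rewrite oppr0 mulr0.
Qed.

(** By equivariance [P] vanishes on the whole orbit of [x]. *)
Lemma LT : Lx *m Tx = 0.
Proof.
have pN : CNv (fx 0) pp by rewrite fx0; exact: pp_CN.
have := jac_comp (fxN n0g) pN; rewrite fx0 fxJ => <-.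
rewrite -(jac_cst (0 : 'rV[R]_k) (0 : 'rV[R]_k)); apply: jac_near.
apply: filterS (near_orb nbx') => s hs; apply/pp_eq0.
by rewrite hs; exact: P_inv.
Qed.

Lemma PVT : PV *m Tx = 0.
Proof. by have /submxP[w ->] := PV_sub; rewrite -mulmxA LT mulmx0. Qed.

Lemma PiPV : Pi *m PV = PV *m Pi.
Proof.
have [kK _ _ _] := cK; rewrite /Pi -(mmx_mulr kK mm)// -(mmx_mull kK mm)//.
apply: (mmx_eq mm) => [||h Kh]; last by rewrite PV_rho.
- by apply: ccontM; [exact: crho|exact: ccont_cst].
- by apply: ccontM; [exact: ccont_cst|exact: crho].
Qed.

Lemma kap_rho : exists2 d, 0 < d & forall z : 'rV[R]_n, `|z| < d -> `|z| < dl /\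
  forall l, K l -> kap (z *m rho l) = A l (kap z).
Proof.
have /near_normP[d d0 hd] : nbhs (0 : 'rV[R]_n) [set z | `|z| < dl /\ forall l, K l -> kap (tau (A l (kap z))) = A l (kap z)].
  by apply: filterI; [exact: nball_nbhs|exact: near_kap (stab_tube nbx')].
exists d => // z zd; have := hd z; rewrite subr0 => /(_ zd)[zl h]; split=> // l Kl.
by rewrite -h// tauK// tk.
Qed.

(** At a [K]-fixed vector the components of [P] along the Lie algebra of [K] vanish: they are zero
    at [x], and have zero derivative along the segment because the generators vanish at points fixed
    by [K]. The other components lie in the range of [Tx] since [om] is nondegenerate, and averaging
    over [K] replaces the preimage by one fixed by [K]. *)
Lemma pp_range : exists2 d, 0 < d & forall z : 'rV[R]_n, `|z| < d -> z *m Pi = z ->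
  exists u, pp z = u *m (Pi *m Tx).
Proof.
have [kK _ _ _] := cK.
have [d d0 hd] := kap_rho; exists d => // z zd zP; have [zl zK] := hd z zd.
have zr l : K l -> z *m rho l = z by move=> Kl; rewrite -zP -mulmxA (Pi_rho Kl).1.
have E0p : E0 *m (pp z)^T = 0.
  apply/row_matrixP => i; rewrite row_mul row0; set b := row i E0.
  have bL : b *m Lx = 0 by rewrite /b -row_mul E0L row0.
  pose xi := coord_vec (lone G) th gam b; have txi : lie_alg G xi := cv_tan lg b.
  have bE u : (b *m (pp u)^T) 0 0 = P (kap u) xi.
    by rewrite PE mxE; apply: eq_bigr => s _; rewrite !mxE.
  have small (s : R) : 0 <= s <= 1 -> `|s *: z| < d by move=> s01; exact: scale_ball.
  have [|s s01] := @CN_line R n ((fun y => P y xi) \o kap) 0 z.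
    move=> s /small; rewrite add0r => /hd[sl _].
    exact: (lcoord_CN lc sl (Csm_snear _ (P_Csm txi))).
  rewrite !add0r /= kx Px => E.
  have sd := small s s01; have [sl sK] := hd _ sd.
  have g0 : grad ((fun y => P y xi) \o kap) (s *: z) = 0.
    apply: pd_eq0 => //; first exact: Csm_snear (P_Csm txi).
    move=> v tv; have := hPom txi tv; rewrite /dform asboolT// => ->.
    have -> : infgen A xi (kap (s *: z)) = 0.
      by apply: infgen_fix => // l Kl; rewrite /stab /= -sK// -scalemxAl zr.
    have [lin _ _] := hom2.
    have t0 : tangent (X := mspace M) (kap (s *: z)) 0.
      have [tau1 [kap1 [e1 l1]]] := lcoord_chart (kap (s *: z)).
      by have := cv_tan l1 0; rewrite cv0.
    have := lin _ 1 0 0 v Logic.I t0 t0 tv; rewrite scaler0 addr0 mul1r => /eqP.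
    by rewrite -subr_eq0 opprD addNKr oppr_eq0 => /eqP.
  move: E; rewrite g0 mulmx0 mxE subr0 => E.
  by apply/rowP => j; rewrite ord1 bE E mxE.
have ppL : pp z = (Qx *m Dx *m (pp z)^T)^T *m Lx^T.
  rewrite -trmx_mul; apply: trmx_inj; rewrite trmxK !mulmxA.
  by move: E0p; rewrite /E0 mulmxBl mul1mx => /eqP; rewrite subr_eq0 => /eqP {1}->.
have TO : Lx^T = invmx (Omx^T) *m Tx.
  by rewrite Tx_E trmx_mul mulKmx// unitmx_tr Omx_unit.
set u := (Qx *m Dx *m (pp z)^T)^T *m invmx (Omx^T).
have ppu : pp z = u *m Tx by rewrite {1}ppL TO mulmxA.
exists u; rewrite mulmxA /Pi -(mmx_mull kK mm)//.
rewrite -(mmx_mulr kK mm); last by apply: ccontM; [exact: ccont_cst|exact: crho].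
rewrite -[LHS](mmx_cst kK mm); apply: (mmx_eq mm) => [||l Kl].
- exact: ccont_cst.
- by apply: ccontM; [apply: ccontM; [exact: ccont_cst|exact: crho]|exact: ccont_cst].
(* Matrix of the coadjoint action of [l]. The default 0 agrees with the value of a covector outside
   the Lie algebra. *)
pose be : 'M[R]_k := \matrix_(t, s) (if `[< lie_alg G (Ad (linv l) (ds s)) >] then tcrd th (Ad (linv l) (ds s)) 0 t else 0).
have hbe y s : P (A l y) (ds s) = \sum_t P y (ds t) * be t s.
  have [hP1 _ ->] := hP => //.
  have [ta|nta] := pselect (lie_alg G (Ad (linv l) (ds s))).
    rewrite {1}(tan_cv lg ta) PE; apply: eq_bigr => t _.
    by rewrite [be _ _]mxE asboolT// mulrC.
  by have [_ ->] := hP1 y => //; rewrite big1// => t _; rewrite mxE asboolF// mulr0.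
have Tbe : rho l *m Tx = Tx *m be.
  have p0N : CNv ((0 : 'rV[R]_n) *m rho l) pp by rewrite mul0mx; exact: pp_CN.
  have := jac_comp (CNv_mull (0 : 'rV[R]_n) (rho l)) p0N; rewrite jac_mull mul0mx -/Tx => <-.
  rewrite -(jac_mulr be (pp_CN n0l)); apply: jac_near.
  apply: filterS (nball_nbhs _ d0) => v /hd[_ hv]; apply/rowP => s.
  rewrite [LHS]mxE [RHS]mxE /= hv// hbe.
  by apply: eq_bigr => t _; rewrite [pp v 0 t]mxE.
rewrite -mulmxA Tbe mulmxA -ppu; apply/rowP => s; rewrite [RHS]mxE [LHS]mxE -{1}(zr l Kl) zK// hbe.
by apply: eq_bigr => t _; rewrite [pp z 0 t]mxE.
Qed.

Lemma Pi_fix (z : 'rV[R]_n) : z *m Pi = z -> forall l, K l -> z *m rho l = z.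
Proof. by move=> zP l Kl; rewrite -zP -mulmxA (Pi_rho Kl).1. Qed.

(** The gradient of an invariant function at a point fixed by [K] is invariant under [K], hence
    equal to its mean; it therefore kills the complement of the fixed vectors. *)
Lemma grad_Pi f : Csm (X := mspace M) f -> ginvariant A f -> exists2 d, 0 < d &
  forall e : 'rV[R]_n, `|e| < d -> e *m Pi = e -> Pi *m grad (f \o kap) e = grad (f \o kap) e.
Proof.
have [kK _ _ _] := cK => fs fi; have [d d0 hd] := kap_rho; exists d => // e ed eP.
have [el _] := hd e ed; have fN : CN e (f \o kap) := lcoord_CN lc el (Csm_snear _ fs).
rewrite /Pi -(mmx_mulr kK mm)// -[RHS](mmx_cst kK mm).
apply: (mmx_eq mm) => [||l Kl]; [by apply: ccontM; [exact: crho|exact: ccont_cst]|exact: ccont_cst|].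
have er := Pi_fix eP Kl; have fN' : CN (e *m rho l) (f \o kap) by rewrite er.
have := grad_comp (CNv_mull e (rho l)) fN'; rewrite jac_mull er => <-.
apply: grad_near; apply: filterS (nball_near ed) => u /hd[_ hu] /=.
by rewrite hu.
Qed.

(** The zero set contains [e + w *m rho h] for all [h] in [K]. Averaging the Taylor expansions of
    [pp] at these points removes the first order term, as the mean of [w *m rho h] is
    [w *m Pi = 0]. *)
Lemma pp_fix_bound : exists C d : R, [/\ 0 < C, 0 < d &
  forall e w : 'rV[R]_n, `|e| < d -> `|w| < d -> e *m Pi = e -> w *m Pi = 0 -> pp (e + w) = 0 ->
    `|pp e| <= C * `|w| ^+ 2].
Proof.
have [kK _ _ _] := cK.
have [d1 d10 h1] := kap_rho; have [B B0 hB] := rho_bound.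
have /choice[Cd hC] : forall s : 'I_k, exists q : R * R, [/\ 0 < q.1, 0 < q.2 &
  forall e w : 'rV[R]_n, `|e| < q.2 -> `|w| < q.2 ->
    `|crd pp s (e + w) - crd pp s e - (w *m grad (crd pp s) e) 0 0| <= q.1 * `|w| ^+ 2].
  by move=> s; have [C [d h]] := taylor2 (pp_CN n0l s); exists (C, d).
have [d2 d20 h2] : exists2 d2, 0 < d2 & forall i, d2 <= (Cd i).2.
  exists (\big[Num.min/1]_i (Cd i).2); last by move=> i; exact: bigmin_le_cond.
  by apply: lt_bigmin => // i _; have [] := hC i.
pose C := \sum_i (Cd i).1 + 1.
have C1 i : (Cd i).1 <= C.
  rewrite /C (bigD1 i)//= -addrA lerDl addr_ge0//.
  by apply: sumr_ge0 => j _; have [/ltW] := hC j.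
have C0 : 0 < C by rewrite ltr_wpDl//; apply: sumr_ge0 => j _; have [/ltW] := hC j.
(* [d1 / 2] keeps [e + w] where [kap] is equivariant; [d2 / B] keeps all the [w *m rho h] where
   Taylor's estimate holds. *)
pose d := Num.min (d1 / 2) (Num.min d2 (d2 / B)).
have dlt (u : 'rV[R]_n) : `|u| < d -> [/\ `|u| < d1 / 2, `|u| < d2 & B * `|u| < d2].
  by rewrite !lt_min => /and3P[a b c]; split=> //; rewrite mulrC -ltr_pdivlMr.
exists (C * B ^+ 2), d; split.
- by rewrite mulr_gt0// exprn_gt0.
- by rewrite /d !lt_min d20 !divr_gt0.
move=> e w ed wd eP wP p0; have [e1 e2 _] := dlt e ed; have [w1 w2 w3] := dlt w wd.
have ew1 : `|e + w| < d1 by rewrite (splitr d1) (le_lt_trans (ler_normD _ _))// ltrD.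
apply: rV_norm_le => [|s]; first by rewrite mulr_ge0 ?exprn_ge0// mulr_ge0 ?exprn_ge0// ltW.
have [q10 q20 hq] := hC s.
pose f h := crd pp s e + (w *m rho h *m grad (crd pp s) e) 0 0.
have fb h : K h -> `|f h| <= C * B ^+ 2 * `|w| ^+ 2.
  move=> Kh; have er := Pi_fix eP Kh.
  have p0' : pp (e + w *m rho h) = 0.
    by rewrite -{1}er -mulmxDl; apply/pp_eq0; rewrite (h1 _ ew1).2//; apply: P_inv; exact/pp_eq0.
  have wB : `|w *m rho h| < d2 := le_lt_trans (hB _ _ Kh) w3.
  have := hq e (w *m rho h) (lt_le_trans e2 (h2 s)) (lt_le_trans wB (h2 s)).
  rewrite {1}/crd p0' mxE sub0r -opprD normrN -/(f h) => h3; apply: (le_trans h3).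
  rewrite -mulrA -exprMn ler_pM ?exprn_ge0//; first exact: ltW.
  have hb := hB w h Kh; have Bw : 0 <= B * `|w| by rewrite mulr_ge0// ltW.
  by rewrite lerXn2r ?nnegrE.
have cg : ccont (fun h => w *m rho h *m grad (crd pp s) e).
  by apply: ccontM; [apply: ccontM; [exact: ccont_cst|exact: crho]|exact: ccont_cst].
have cf : continuous f.
  by move=> h; apply: (@continuousD _ _ _ (fun=> crd pp s e)); [exact: cst_continuous|exact: (cg 0 0 h)].
have [lin mono m1 _] := mm.
have mf : m f = crd pp s e.
  have c1 : continuous (fun _ : G => 1 : R) by exact: cst_continuous.
  have := lin (fun=> 1) (fun h => (w *m rho h *m grad (crd pp s) e) 0 0) (crd pp s e) c1 (cg 0 0).
  rewrite m1 !mulr1 => E; rewrite /f.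
  rewrite E (_ : m _ = mmx m (fun h => w *m rho h *m grad (crd pp s) e) 0 0); last by rewrite mxE.
  rewrite (mmx_mulr kK mm); last by apply: ccontM; [exact: ccont_cst|exact: crho].
  by rewrite (mmx_mull kK mm)// -/Pi wP mul0mx mxE addr0.
rewrite -[pp e 0 s]/(crd pp s e) -mf ler_norml; set b := C * _ * _ in fb *.
rewrite -{1}(mean_cst kK mm (- b)) -{2}(mean_cst kK mm b).
by apply/andP; split; apply: mono => //; try exact: cst_continuous; move=> h /fb; rewrite ler_norml => /andP[].
Qed.

(* On the slice fixed by [K], the zeros of the momentum map form a manifold. *)
Lemma zero_correction : exists C d : R, [/\ 0 < C, 0 < d &
  forall e : 'rV[R]_n, `|e| < d -> e *m Pi = e -> e *m Qx = 0 -> exists e',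
   [/\ e' *m Pi = e', e' *m Qx = 0, pp e' = 0 & `|e - e'| <= C * `|pp e|]].
Proof.
pose Zm := Pi *m Tx; pose a := \rank Zm; pose Zb := row_base Zm.
have [X XE] : exists X, Zb = X *m Zm by apply/submxP; rewrite /Zb eq_row_base.
pose N := pinvmx Zb; have ZN : Zb *m N = 1%:M by apply: mulmxVp; exact: row_base_free.
have ZbE p (u : 'M[R]_(p, n)) : exists v : 'M[R]_(p, a), u *m Zm = v *m Zb.
  by apply/submxP; rewrite /Zb eq_row_base submxMl.
move: Zb N XE ZN ZbE => Zb N XE ZN ZbE.
(* Correction directions: fixed by [K], tangent to the slice, and sent by [Tx] to a basis of the
   range of [Pi *m Tx]. Removing the orbit part does not change the image, since [PV *m Tx = 0]. *)
pose Rm := X *m Pi *m (1%:M - PV).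
have RT : Rm *m Tx = Zb.
  by rewrite /Rm -mulmxA mulmxBl mul1mx PVT subr0 -mulmxA XE.
have RP : Rm *m Pi = Rm.
  rewrite /Rm -mulmxA mulmxBl mul1mx -PiPV mulmxBr mulmxA.
  by rewrite -[X *m Pi *m Pi]mulmxA Pi2 mulmxBr mulmx1.
have RQ : Rm *m Qx = 0.
  apply/Q_eq0; rewrite /Rm -mulmxA mulmxBl mul1mx (PV_id PV_sub) subrr mulmx0 //.
pose ll (z : 'rV[R]_(a + n)) := rsubmx z + lsubmx z *m Rm.
have llN z : CNv z ll by apply: CNvD; [exact: CNv_rsubmx|apply: CNv_mulr; exact: CNv_lsubmx].
pose U := [set z : 'rV[R]_(a + n) | `|ll z| < dl].
have oU : open U.
  have cl : continuous ll by move=> z; exact: CNv_cont (llN z).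
  exact: (open_comp (fun z _ => cl z) (@open_nball0 R n dl)).
have ll0 : ll 0 = 0 by rewrite /ll !linear0 mul0mx addr0.
have U0 : U 0 by rewrite /U /= ll0 normr0.
pose H z := pp (ll z) *m N.
have HN z : U z -> CNv z H.
  by move=> Uz; apply: CNv_mulr; apply: (CNv_comp (llN z)); exact: pp_CN.
have pp0 : pp 0 = 0 by apply/pp_eq0; rewrite kx.
have H0 : H 0 = 0 by rewrite /H ll0 pp0 mul0mx.
have HJ : usubmx (jac H 0) = 1%:M.
  have U00 : U (row_mx 0 0) by rewrite row_mx0.
  rewrite -row_mx0 -(jac_usubmx (HN _ U00)).
  rewrite (_ : (fun u => _) = (fun u => (pp \o (fun u : 'rV[R]_a => u *m Rm)) u *m N)); last first.
    by apply/funext => u; rewrite /H /ll row_mxKl row_mxKr add0r.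
  have p0N : CNv ((0 : 'rV[R]_a) *m Rm) pp by rewrite mul0mx; exact: pp_CN.
  rewrite jac_mulr; last by apply: CNv_comp p0N; exact: CNv_mull.
  by rewrite (jac_comp (CNv_mull _ _) p0N) jac_mull mul0mx -/Tx RT ZN.
have [d1 [d2 [cc [g [[d10 d20 cc0 gs] [g0 gU gE _ gb]]]]]] := implicit_function oU U0 (CNv_Cinfv HN) H0 HJ.
have [d3 d30 h3] := pp_range.
have gN : CNv 0 g.
  by apply: (Cinfv_CNv (@open_nball0 R n d2) _ gs); rewrite /= normr0.
have cst : {for (0 : 'rV[R]_n), continuous (fun e : 'rV[R]_n => e + g e *m Rm)}.
  by apply: CNv_cont; apply: CNvD; [exact: CNv_id|exact: CNv_mulr].
have /near_normP[d4 d40 h4] : nbhs (0 : 'rV[R]_n) [set e | `|e + g e *m Rm| < d3].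
  by apply: (cst [set u | `|u| < d3]); rewrite g0 mul0mx addr0; exact: nball_nbhs.
have [c1 c10 hc1] := mulmx_bound Rm; have [c2 c20 hc2] := mulmx_bound N.
exists (c1 * (cc * c2)), (Num.min d2 d4); split.
- by rewrite !mulr_gt0.
- by rewrite lt_min d20.
move=> e; rewrite lt_min => /andP[ed2 ed4] eP eQ.
have E1 : (e + g e *m Rm) *m Pi = e + g e *m Rm by rewrite mulmxDl eP -mulmxA RP.
exists (e + g e *m Rm); split=> //.
- by rewrite mulmxDl eQ -mulmxA RQ mulmx0 addr0.
(* The equation that was solved is [pp e' *m N = 0]. By [pp_range] the row [pp e'] is a combination
   of the rows of [Zb], where [N] is injective. *)
- have [|u pu] := h3 (e + g e *m Rm) _ E1; first by apply: h4; rewrite subr0.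
  have [v vE] := ZbE _ u.
  have := gE _ ed2; rewrite /H /ll row_mxKl row_mxKr pu vE -mulmxA ZN mulmx1 => ->.
  by rewrite mul0mx.
- rewrite opprD addrA subrr add0r normrN -!mulrA; apply: (le_trans (hc1 _)).
  rewrite ler_pM2l//; apply: (le_trans (gb _ ed2)); rewrite ler_pM2l//.
  by rewrite /H /ll row_mxKl row_mxKr mul0mx addr0.
Qed.

(** The slice representative of [y] is [e + w] with [e] fixed by [K]. The gradient of [F] at [e]
    kills [w], so [F] changes by second order from [e] to [e + w]. It vanishes at the corrected zero
    [e'], whose distance to [e] is bounded by [|pp e|], again of second order in [w]. *)
Lemma vanishing_order F : Csm (X := mspace M) F -> ginvariant A F ->
  nbhs x [set y | P y = 0 -> wx y = 0 -> F y = 0] ->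
  exists2 C, 0 < C & nbhs x [set y | P y = 0 -> `|F y| <= C * `|wx y| ^+ 2].
Proof.
move=> Fs Fi F0.
have FN : CN 0 (F \o kap) := lcoord_CN lc n0l (Csm_snear _ Fs).
have [C1 [d1 [C10 d10 u1]]] := taylor2 FN.
have [C2 [d2 [C20 d20 u2]]] := CN_lipschitz FN.
have [C3 [d3 [C30 d30 u3]]] := pp_fix_bound.
have [C4 [d4 [C40 d40 u4]]] := zero_correction.
have [d5 d50 u5] := grad_Pi Fs Fi.
have near_w : nbhs (0 : 'rV[R]_n) [set e | (e *m Qx = 0 -> rr e = e) /\ (P (kap e) = 0 -> wx (kap e) = 0 -> F (kap e) = 0) /\ `|e| < dl].
  by apply: filterI => //; apply: filterI; [exact: (near_kap F0)|exact: nball_nbhs].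
have /near_normP[d6 d60 u6] := near_w.
pose dm := Num.min (Num.min d1 d2) (Num.min (Num.min d3 d4) (Num.min d5 d6)).
have dm0 : 0 < dm by rewrite !lt_min d10 d20 d30 d40 d50.
have dmE (u : 'rV[R]_n) : `|u| < dm -> [/\ `|u| < d1, `|u| < d2, `|u| < d3 & [/\ `|u| < d4, `|u| < d5 & `|u| < d6]].
  by rewrite !lt_min => /andP[/andP[-> ->] /andP[/andP[-> ->] /andP[-> ->]]].
have pp0 : pp 0 = 0 by apply/pp_eq0; rewrite kx.
have cP : {for (0 : 'rV[R]_n), continuous pp} := CNv_cont (pp_CN n0l).
have h0 : 0 < dm / (2 * C4) by rewrite divr_gt0// mulr_gt0.
have nz : nbhs x [set y | `|rr (tau y) *m Pi| < dm / 2 /\ (`|wx y| < dm /\ `|pp (rr (tau y) *m Pi)| < dm / (2 * C4))].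
  have near_z (Q : set 'rV[R]_n) : nbhs (0 : 'rV[R]_n) Q -> nbhs x [set y | Q (rr (tau y))].
    have crt : {for x, continuous (rr \o tau)}.
      by apply: continuous_comp; [exact: (tau_cont lc)|rewrite tx; exact: CNv_cont].
    by move=> hQ; apply: (crt Q); rewrite /= tx rr0.
  have lN q (B : 'M[R]_(n, q)) (e : R) : 0 < e -> nbhs (0 : 'rV[R]_n) [set z | `|z *m B| < e].
    move=> e0; have c := CNv_cont (CNv_mull (0 : 'rV[R]_n) B).
    by apply: (c [set u | `|u| < e]); rewrite mul0mx; exact: nball_nbhs.
  apply: filterI; first by apply: (near_z [set z | `|z *m Pi| < dm / 2]); apply: lN; rewrite divr_gt0.
  apply: filterI; first by apply: (near_z [set z | `|z *m (1%:M - Pi)| < dm]); exact: lN.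
  apply: (near_z [set z | `|pp (z *m Pi)| < dm / (2 * C4)]).
  have c := CNv_cont (CNv_mull (0 : 'rV[R]_n) Pi).
  apply: (c [set u | `|pp u| < dm / (2 * C4)]); rewrite mul0mx.
  by apply: (cP [set u | `|u| < dm / (2 * C4)]); rewrite pp0; exact: nball_nbhs.
(* Taylor's constant of [F], plus its Lipschitz constant times the constants of [zero_correction]
   and [pp_fix_bound]. *)
exists (C1 + C2 * (C4 * C3)); first by rewrite addr_gt0// !mulr_gt0.
apply: filterS2 rrx nz => y [zQ [g gy]] [e2 [w1 p1]] Py.
set z := rr (tau y) in zQ gy e2 p1 *; set e := z *m Pi in e2 p1 *.
rewrite -/(wx y) in w1; set w := wx y in w1 *.
have zE : z = e + w by rewrite /e /w /wx -/z mulmxBr mulmx1 addrC subrK.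
have e1 : `|e| < dm by apply: lt_trans e2 _; rewrite ltr_pdivrMr// ltr_pMr ?ltr1n.
have [ed1 ed2 ed3 [ed4 ed5 ed6]] := dmE e e1; have [wd1 wd2 wd3 _] := dmE w w1.
have eP : e *m Pi = e by rewrite /e -mulmxA Pi2.
have wP : w *m Pi = 0 by rewrite /w /wx -mulmxA mulmxBl mul1mx Pi2 subrr mulmx0.
have eQ : e *m Qx = 0.
  apply/Q_eq0; rewrite /e -mulmxA PiPV mulmxA.
  by have /Q_eq0 -> := zQ; rewrite mul0mx.
have pz : pp (e + w) = 0 by rewrite -zE; apply/pp_eq0; rewrite -gy; exact: P_inv.
have pe := u3 e w ed3 wd3 eP wP pz.
have [e' [e'P e'Q pe' ee']] := u4 e ed4 eP eQ.
have e'm : `|e'| < dm.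
  rewrite -(subrK e e') (le_lt_trans (ler_normD _ _))// [ltRHS]splitr ltrD// distrC.
  apply: (le_lt_trans ee'); rewrite -ltr_pdivlMl//.
  by move: p1; rewrite invfM mulrA mulrC.
have [e'1 e'2 e'3 [e'4 e'5 e'6]] := dmE e' e'm.
have [|rre [Fe' e'l]] := u6 e'; first by rewrite subr0.
have F0' : F (kap e') = 0.
  apply: Fe'; first exact/pp_eq0.
  by rewrite /wx tk// rre// mulmxBr mulmx1 e'P subrr.
have wg : (w *m grad (F \o kap) e) 0 0 = 0 by rewrite -(u5 e ed5 eP) mulmxA wP mul0mx mxE.
have FE : F y = (F \o kap) (e + w) by rewrite /= -zE -gy Fi.
have b1 := u1 e w ed1 wd1; rewrite wg subr0 in b1.
have b2 := u2 e e' ed2 e'2; rewrite [(F \o kap) e']F0' subr0 in b2.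
rewrite FE -(subrK ((F \o kap) e) ((F \o kap) (e + w))) (le_trans (ler_normD _ _))//.
rewrite mulrDl lerD//; apply: (le_trans b2); rewrite -!mulrA ler_pM2l//.
by apply: (le_trans ee'); rewrite ler_pM2l.
Qed.

End Slice.

Lemma haar_full (R : realType) (k : nat) (G : lieGroup R k) : exists I : (G -> R) -> R,
  [/\ forall (f1 f2 : G -> R) (a : R), Cc f1 -> Cc f2 -> I (fun h => a * f1 h + f2 h) = a * I f1 + I f2,
    forall f1 f2 : G -> R, Cc f1 -> Cc f2 -> (forall h, setT h -> f1 h <= f2 h) -> I f1 <= I f2,
    forall (f : G -> R) g, Cc f -> setT g -> I (fun h => f (lmul h g)) = I f &
    forall f : G -> R, Cc f -> (forall h, setT h -> 0 <= f h) -> 0 < f (lone G) -> 0 < I f].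
Proof. by apply: haar; split=> //; exact: closedT. Qed.

Section SlicePackage.
Variables (R : realType) (k n : nat) (G : lieGroup R k) (M : manifold R n).
Variable A : lieAction G M.
Hypothesis hproper : proper_action A.
Variables (om : M -> vec (mspace M) -> vec (mspace M) -> R) (P : M -> covec (mspace G)).
Hypotheses (hom2 : twoform (X := mspace M) om) (homnd : nondeg_form (X := mspace M) om)
  (hP : equivariant_map A P)
  (hPom : forall xi x w, lie_alg G xi -> tangent (X := mspace M) x w ->
     dform (X := mspace M) (fun y => P y xi) x w = om x (infgen A xi x) w).
Local Notation CsmM f := (Csm (X := mspace M) f).

Definition qf (S : 'M[R]_n) (u : 'rV[R]_n) : R := (u *m S *m u^T) 0 0.

(** Collects what is used of the slice afterwards, free of coordinates on [G] and of the choice of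
    [tau] and [rr]. The bound by [phi], rather than by its square root, is what makes the
    differential inequality linear. *)
Theorem slice_package (x : M) : P x = 0 -> exists (w : M -> 'rV[R]_n) (S : 'M[R]_n) (phi : M -> R) (c : R),
  [/\ [/\ CsmM phi, ginvariant A phi, 0 < c & forall u, c * `|u| ^+ 2 <= qf S u],
    [/\ forall j, snear x (fun y => w y 0 j), w x = 0 & \forall y \near x, phi y = qf S (w y)],
    nbhs x [set y | phi y = 0 -> orbit_type A (stab A x) y],
    forall F, CsmM F -> ginvariant A F -> nbhs x [set y | P y = 0 -> phi y = 0 -> F y = 0] ->
      exists2 C, 0 < C & nbhs x [set y | P y = 0 -> `|F y| <= C * phi y] &
    forall v, tangent (X := mspace M) x v -> (forall j, v (fun y => w y 0 j) = 0) ->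
      (forall F, CsmM F -> ginvariant A F -> v F = 0) -> orbit_dir A x v].
Proof.
move=> Px; have [m mm] := mean_exists (stab_compact hproper x).
have [rho [tau [kap [dl [lc crho rho1 rhoM tauK]]]]] := linear_coords hproper mm.
have [th [gam [dg lg]]] := lcoord_chart (lone G).
pose L := Lx A x tau gam; pose B := row_base L.
have [Dx DE] : exists D, B = D *m L by apply/submxP; rewrite /B eq_row_base.
have BV : B *m pinvmx B = 1%:M by apply: mulmxVp; exact: row_base_free.
have LB : L *m pinvmx B *m B = L by rewrite mulmxKpV// /B eq_row_base.
move: B (pinvmx B) DE BV LB => B B' DE BV LB.
have DL : Dx *m Lx A x tau gam = B by rewrite DE.
have [rr [Y [rrN rr0 rrJ [rrx rrQ] rrinv]]] := slice_map hproper mm lc crho rho1 rhoM tauK lg BV DL LB.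
have [I [Ilin Imono Itr Ipos]] := haar_full G.
have [phi [phis phii nphi]] := phi_exists hproper mm lc crho rhoM Ilin Imono Itr Ipos rrN rrinv.
have [c c0 hc] := quad_ge hproper mm crho rho1 rhoM.
have tx : tau x = 0 by case: lc => [[_ _ []]].
exists (wx m rho tau rr), (Sx m rho), phi, c; split.
- by split.
- split=> //; last by rewrite /wx tx rr0 mul0mx.
  by move=> j; exact: (rrtau_snear lc rrN (1%:M - Pi m rho) j).
- exact: (phi_orbit_type hproper mm lc crho rho1 rhoM tauK lg BV DL LB rrN rr0 rrx nphi).
- move=> F Fs Fi F0.
  have [|C C0 nC] := vanishing_order hproper mm lc crho rho1 rhoM tauK lg BV DL LB rrN rr0 rrx rrQ hom2 homnd hP hPom Px Fs Fi.
    apply: filterS2 F0 nphi => y h yq Py wy; apply: h => //.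
    by rewrite yq wy /quad !mul0mx mxE.
  exists (C / c); first by rewrite divr_gt0.
  apply: filterS2 nC nphi => y h yq Py; apply: (le_trans (h Py)).
  by rewrite -mulrA ler_pM2l// mulrC ler_pdivlMr// mulrC yq.
- move=> v tv vw vF.
  exact: (slice_tangent hproper mm lc crho rhoM lg Ilin Imono Itr Ipos rrN rrJ rrinv tv vw vF).
Qed.

End SlicePackage.

(** * Invariant functions on the quotient *)

Section Quotient.
Variables (R : realType) (k n : nat) (G : lieGroup R k) (M : manifold R n).
Variable A : lieAction G M.
Local Notation CsmM f := (Csm (X := mspace M) f).
Implicit Types (S : set M) (V : set (set M)).

Lemma gorbitP x y : gorbit A x = gorbit A y <-> exists g, A g x = y.
Proof.
split=> [E|[g <-]].
  have : gorbit A y y by exists (lone G); rewrite ?act1.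
  by rewrite -E => -[g _ <-]; exists g.
apply/seteqP; split=> [_ [h _ <-]|_ [h _ <-]].
  by exists (lmul h (linv g)) => //; rewrite -actM lmulgKV.
by exists (lmul h g) => //; rewrite actM.
Qed.

Lemma gorbitA g x : gorbit A (A g x) = gorbit A x.
Proof. by apply/esym/gorbitP; exists g. Qed.

(** Inverse of the pullback by [gorbit] on invariant functions; sets that are not orbits get the
    default 0. *)
Definition desc (f : M -> R) (p : set M) : R := xget 0 [set r | exists2 x, p = gorbit A x & r = f x].

Lemma descE f x : ginvariant A f -> desc f (gorbit A x) = f x.
Proof.
move=> fi; rewrite /desc; case: xgetP => [r _ [y /gorbitP[g <-] ->]|/(_ (f x))[]].
  by rewrite fi.
by exists x.
Qed.

Lemma orbit_typeA K g x : orbit_type A K x -> orbit_type A K (A g x).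
Proof.
move=> [h E]; exists (lmul g h); apply/seteqP; split=> [l /= hl|_ [l Kl <-] /=].
  have : [set h | A h x = x] (lmul (linv g) (lmul l g)).
    by rewrite /= !actM hl -actM lmulV act1.
  rewrite E => -[l' Kl' El]; exists l' => //.
  transitivity (lmul g (lmul (lmul (lmul h l') (linv h)) (linv g))); first by rewrite linvM !lmulA.
  by rewrite El !lmulA lmulgV lmul1 -lmulA lmulgV lmulg1.
have : [set h | A h x = x] (lmul (lmul h l) (linv h)) by rewrite E; exists l.
by move=> /= hx; rewrite -[in RHS]hx -!actM linvM !lmulA lmulgKV.
Qed.

Lemma qsmP S V f : fsmooth (f := qspace A S) V f <-> forall x, S x -> V (gorbit A x) ->
  exists g, snear x g /\ nbhs x [set y | S y -> V (gorbit A y) -> f (gorbit A y) = g y].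
Proof.
split=> h x Sx Vx.
  have [U [g [oU Ux gU E]]] := h x Sx Vx; have nU := open_nbhs_nbhs (conj oU Ux).
  exists g; split; first exact: msm_snear gU.
  by apply: filterS nU => y Uy Sy Vy; exact: E.
have [g [/smooth_atP[U [oU Ux gU]] ng]] := h x Sx Vx.
have : nbhs x (U `&` [set y | S y -> V (gorbit A y) -> f (gorbit A y) = g y]).
  by apply: filterI => //; exact: open_nbhs_nbhs.
rewrite nbhsE => -[W [oW Wx] WU]; exists W, g; split=> //.
  by move=> c ac; apply: Cinf_sub (gU c ac) => _ [z [z1 /WU[z2 _]] <-]; exists z.
by move=> y Sy Vy /WU[_]; apply.
Qed.

Lemma qsm_sub S V V' f : V' `<=` V -> fsmooth (f := qspace A S) V f -> fsmooth (f := qspace A S) V' f.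
Proof.
move=> sV /qsmP h; apply/qsmP => x Sx Vx; have [g [gs ng]] := h x Sx (sV _ Vx).
by exists g; split=> //; apply: filterS ng => y E Sy /sV; exact: E.
Qed.

Lemma qsm_cst S V c : fsmooth (f := qspace A S) V (fun=> c).
Proof. by apply/qsmP => x _ _; exists (fun=> c); split; [exact: snear_cst|exact: filterE]. Qed.

Lemma qsmD S V f g : fsmooth (f := qspace A S) V f -> fsmooth (f := qspace A S) V g ->
  fsmooth (f := qspace A S) V (fun p => f p + g p).
Proof.
move=> /qsmP h1 /qsmP h2; apply/qsmP => x Sx Vx.
have [f1 [s1 n1]] := h1 x Sx Vx; have [f2 [s2 n2]] := h2 x Sx Vx.
exists (fun y => f1 y + f2 y); split; first exact: snearD.
by apply: filterS2 n1 n2 => y e1 e2 Sy Vy; rewrite e1 ?e2.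
Qed.

Lemma qsmM S V f g : fsmooth (f := qspace A S) V f -> fsmooth (f := qspace A S) V g ->
  fsmooth (f := qspace A S) V (fun p => f p * g p).
Proof.
move=> /qsmP h1 /qsmP h2; apply/qsmP => x Sx Vx.
have [f1 [s1 n1]] := h1 x Sx Vx; have [f2 [s2 n2]] := h2 x Sx Vx.
exists (fun y => f1 y * f2 y); split; first exact: snearM.
by apply: filterS2 n1 n2 => y e1 e2 Sy Vy; rewrite e1 ?e2.
Qed.

Lemma qsm_sum S V (I : Type) (r : seq I) f : (forall i, fsmooth (f := qspace A S) V (f i)) ->
  fsmooth (f := qspace A S) V (fun p => \sum_(i <- r) f i p).
Proof.
move=> h; elim: r => [|i r IH]; first by under eq_fun do rewrite big_nil; exact: qsm_cst.
by under eq_fun do rewrite big_cons; exact: qsmD.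
Qed.

Lemma qsm_prod S V (I : Type) (r : seq I) f : (forall i, fsmooth (f := qspace A S) V (f i)) ->
  fsmooth (f := qspace A S) V (fun p => \prod_(i <- r) f i p).
Proof.
move=> h; elim: r => [|i r IH]; first by under eq_fun do rewrite big_nil; exact: qsm_cst.
by under eq_fun do rewrite big_cons; exact: qsmM.
Qed.

Lemma qsm_det S V m (B : set M -> 'M[R]_m) : (forall i j, fsmooth (f := qspace A S) V (fun p => B p i j)) ->
  fsmooth (f := qspace A S) V (fun p => \det (B p)).
Proof.
by move=> h; apply: qsm_sum => s; apply: qsmM; [exact: qsm_cst|exact: qsm_prod].
Qed.

Lemma qsm_adj S V m (B : set M -> 'M[R]_m) : (forall i j, fsmooth (f := qspace A S) V (fun p => B p i j)) ->
  forall i j, fsmooth (f := qspace A S) V (fun p => (\adj (B p)) i j).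
Proof.
move=> h i j; under eq_fun do rewrite mxE /cofactor; apply: qsmM; first exact: qsm_cst.
by apply: qsm_det => i' j'; under eq_fun do rewrite !mxE; exact: h.
Qed.

Lemma extends_sub S S' f f0 : S' `<=` S -> extends A S f f0 -> extends A S' f f0.
Proof. by move=> sS [h1 h2 h3]; split=> // x /sS; exact: h3. Qed.

Lemma extends_qfun S f f0 : extends A S f f0 -> qfun A S f0.
Proof.
move=> fe; have [fs fi E] := fe; split; last by exists f.
move=> U oU; exists (f @^-1` U); first by apply: open_comp => // y _; have := @Csm_cont _ _ _ _ fs; exact.
by move=> x Sx; rewrite /preimage/= E.
Qed.

Lemma qfun_sub S S' f0 : S' `<=` S -> qfun A S f0 -> qfun A S' f0.
Proof. by move=> sS [_ [f fe]]; exact: extends_qfun (extends_sub sS fe). Qed.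

Lemma desc_extends S f : CsmM f -> ginvariant A f -> extends A S f (desc f).
Proof. by move=> fs fi; split=> // x _; rewrite descE. Qed.

Lemma desc_qfun S f : CsmM f -> ginvariant A f -> qfun A S (desc f).
Proof. by move=> fs fi; exact: extends_qfun (desc_extends S fs fi). Qed.

Lemma qfun_qsm S V f0 : qfun A S f0 -> fsmooth (f := qspace A S) V f0.
Proof.
move=> [_ [f [fs fi E]]]; apply/qsmP => x Sx _; exists f; split; first exact: Csm_snear.
by apply: filterE => y Sy _; exact: E.
Qed.

Lemma smooth_at_q S V p f : fopen (f := qspace A S) V -> V p -> fsmooth (f := qspace A S) V f ->
  smooth_at (X := qspace A S) p f.
Proof. by move=> oV Vp fV; exists V. Qed.

Lemma qopenT S : fopen (f := qspace A S) setT.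
Proof. by exists setT => //; exact: openT. Qed.

Lemma qfun_smooth_at S p f0 : qfun A S f0 -> smooth_at (X := qspace A S) p f0.
Proof. by move=> h; apply: (smooth_at_q (qopenT S)) => //; exact: qfun_qsm. Qed.

Lemma open_saturation (U : set M) : open U -> open [set y | exists g, U (A g y)].
Proof.
move=> oU; have -> : [set y | exists g, U (A g y)] = \bigcup_(g in [set: G]) ((fun y => A g y) @^-1` U).
  by apply/seteqP; split=> [y [g Uy]|y [g _ Uy]]; exists g.
apply: bigcup_open => g _; apply: open_comp => // y _; exact: act_contr.
Qed.

Lemma qopen_image S (U : set M) : (forall g x, S x -> S (A g x)) -> open U ->
  fopen (f := qspace A S) (gorbit A @` (S `&` U)).
Proof.
move=> Sinv oU; exists [set y | exists g, U (A g y)]; first exact: open_saturation.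
move=> x Sx; split=> [[y [Sy Uy] /gorbitP[g <-]]|[g Ux]].
  by exists (linv g); rewrite -actM lmulV act1.
by exists (A g x); [split=> //; exact: Sinv|rewrite gorbitA].
Qed.

Lemma qopenI S V V' : fopen (f := qspace A S) V -> fopen (f := qspace A S) V' ->
  fopen (f := qspace A S) (V `&` V').
Proof.
move=> [U oU E] [U' oU' E']; exists (U `&` U'); first exact: openI.
by move=> x Sx; rewrite /preimage /= -(E x Sx) -(E' x Sx).
Qed.

Lemma qopen_near S V x : fopen (f := qspace A S) V -> S x -> V (gorbit A x) ->
  nbhs x [set y | S y -> V (gorbit A y)].
Proof.
move=> [U oU E] Sx Vx; have Ux : U x by apply/(E x Sx).
by apply: filterS (open_nbhs_nbhs (conj oU Ux)) => y Uy Sy; apply/(E y Sy).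
Qed.

End Quotient.

Section TangentFspace.
Variables (R : realType) (X : fspace R).
Implicit Types (x : pt X) (v w : vec X) (f : pt X -> R).

Lemma vec_sumE (I : Type) (r : seq I) (c : I -> R) (Z : I -> vec X) f :
  (\sum_(i <- r) c i *: Z i) f = \sum_(i <- r) c i * Z i f.
Proof. by elim: r => [|i r IH]; rewrite ?big_nil// !big_cons -IH. Qed.

Lemma tangent_lin x (a : R) v w : tangent x v -> tangent x w -> tangent x (a *: v + w).
Proof.
have E f : (a *: v + w) f = a * v f + w f by [].
move=> [v1 v2 v3 v4] [w1 w2 w3 w4]; split.
- by move=> b f g sf sg; rewrite !E v1 ?w1//; ring.
- by move=> f g sf sg; rewrite !E v2 ?w2//; ring.
- by move=> f g sf sg; rewrite !E (v3 _ g) ?(w3 _ g).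
- by move=> f sf; rewrite E v4 ?w4// mulr0 addr0.
Qed.

Lemma tangent0 x : tangent x (0 : vec X).
Proof. by split=> // *; rewrite ?mulr0 ?addr0. Qed.

Lemma tangent_sum x (I : Type) (r : seq I) (c : I -> R) (Z : I -> vec X) :
  (forall i, tangent x (Z i)) -> tangent x (\sum_(i <- r) c i *: Z i).
Proof.
move=> h; elim: r => [|i r IH]; first by rewrite big_nil; exact: tangent0.
by rewrite big_cons; exact: tangent_lin.
Qed.

Lemma dformE x v f : tangent x v -> dform f x v = v f.
Proof. by move=> h; rewrite /dform asboolT. Qed.

Lemma dform_cotangent x f : cotangent x (dform f x).
Proof.
split=> [a v w tv tw|v tv]; last by rewrite /dform asboolF.
by rewrite !dformE//; exact: tangent_lin.
Qed.

Lemma covec_sumE (I : Type) (r : seq I) (c : I -> R) (b : I -> covec X) v :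
  (\sum_(i <- r) c i *: b i) v = \sum_(i <- r) c i * b i v.
Proof. by elim: r => [|i r IH]; rewrite ?big_nil// !big_cons -IH. Qed.

Lemma cotangent_lin x (a : R) (b c : covec X) : cotangent x b -> cotangent x c -> cotangent x (a *: b + c).
Proof.
have E v : (a *: b + c) v = a * b v + c v by [].
move=> [b1 b2] [c1 c2]; split=> [r v w tv tw|v tv]; rewrite !E.
  by rewrite b1 ?c1//; ring.
by rewrite b2 ?c2// mulr0 addr0.
Qed.

Lemma cotangent_sum x (I : Type) (r : seq I) (c : I -> R) (b : I -> covec X) :
  (forall i, cotangent x (b i)) -> cotangent x (\sum_(i <- r) c i *: b i).
Proof.
move=> h; elim: r => [|i r IH]; last by rewrite big_cons; exact: cotangent_lin.
by rewrite big_nil; split=> // *; rewrite mulr0 addr0.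
Qed.

Lemma bundle_map_sum br (J : pt X -> covec X -> vec X) x (I : Type) (r : seq I) (c : I -> R) (b : I -> covec X) :
  bundle_map br J -> carrier x -> (forall i, cotangent x (b i)) ->
  J x (\sum_(i <- r) c i *: b i) = \sum_(i <- r) c i *: J x (b i).
Proof.
move=> hJ cx h; have [_ Jl _] := hJ x cx; elim: r => [|i r IH].
  have c0 : cotangent x (0 : covec X) by split=> // *; rewrite mulr0 addr0.
  by rewrite !big_nil; have := Jl (-1) _ _ c0 c0; rewrite scaler0 add0r => ->; rewrite scaleN1r addNr.
by rewrite !big_cons Jl ?IH//; exact: cotangent_sum.
Qed.

End TangentFspace.

(** Rows are added one at a time: as long as there are fewer than [m], some nonzero column is killed
    by all of them, and a [t] whose row does not kill it is independent of the previous ones. *)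
Lemma dual_family (F : fieldType) (T : Type) (Q : set T) m (e : T -> 'rV[F]_m) :
  (forall a : 'cV[F]_m, (forall t, Q t -> e t *m a = 0) -> a = 0) ->
  exists f : 'I_m -> T, (forall i, Q (f i)) /\ (\matrix_i e (f i)) \in unitmx.
Proof.
move=> h.
have H r : (r <= m)%N -> exists B : 'M[F]_(r, m), row_free B /\ forall i, exists2 t, Q t & row i B = e t.
  elim: r => [|r IH] rm; first by exists 0; split; [rewrite /row_free mxrank0|case].
  have [B [Bf Br]] := IH (ltnW rm).
  have [a a0 Ba] : exists2 a : 'cV[F]_m, a != 0 & B *m a = 0.
    have : kermx B^T != 0.
      by rewrite -mxrank_eq0 mxrank_ker mxrank_tr (eqP Bf) subn_eq0 -ltnNge.
    move=> /rowV0Pn[u /sub_kermxP uB u0]; exists u^T; first by rewrite trmx_eq0.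
    by apply: trmx_inj; rewrite trmx_mul trmxK uB trmx0.
  have [t Qt ta] : exists2 t, Q t & e t *m a != 0.
    apply: contrapT => nt; move/eqP: a0; apply; apply: h => t Qt.
    by apply: contrapT => /eqP ta; apply: nt; exists t.
  rewrite -addn1; exists (col_mx B (e t)); split.
    rewrite -kermx_eq0; apply/rowV0P => u /sub_kermxP.
    rewrite -[u]hsubmxK mul_row_col => E.
    have rs : rsubmx u = 0.
      have : rsubmx u *m (e t *m a) = 0; last first.
        rewrite [rsubmx u]mx11_scalar mul_scalar_mx => /eqP; rewrite scaler_eq0 (negPf ta) orbF => /eqP ->.
        by rewrite raddf0.
      by have := congr1 (mulmx^~ a) E; rewrite mulmxDl mul0mx -!mulmxA Ba mulmx0 add0r.
    move: E; rewrite rs mul0mx addr0 => lB.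
    by rewrite (row_free_inj Bf (etrans lB (esym (mul0mx _ B)))) row_mx0.
  move=> i; case: (split_ordP i) => j ->; first by rewrite rowKu.
  by rewrite rowKd; exists t => //; apply/matrixP => a' b; rewrite !mxE !ord1.
have [B [Bf Br]] := H m (leqnn m).
have /choice[f fP] : forall i, exists t, Q t /\ row i B = e t by move=> i; have [t] := Br i; exists t.
exists f; split=> [i|]; first by have [] := fP i.
rewrite -row_free_unit (_ : (\matrix_i e (f i)) = B)//.
by apply/row_matrixP => i; rewrite rowK; have [_ ->] := fP i.
Qed.

Section NearDerivatives.
Variable R : realType.
Implicit Types (f g : R -> R).

Lemma derive1_near f g (t : R) : {near t, f =1 g} ->
  (derivable g t 1 -> derivable f t 1) /\ derive1 f t = derive1 g t.
Proof.
move=> fg; have gf : {near t, g =1 f} by apply: filterS fg => s /= ->.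
split=> [dg|]; first exact: (near_eq_derivable gf dg).
by rewrite !derive1E; exact: (near_eq_derive _ fg).
Qed.

Lemma derive1n_near m f g (t : R) : {near t, f =1 g} -> {near t, derive1n m f =1 derive1n m g}.
Proof.
move=> fg; elim: m => [//|m IH]; rewrite !derive1nS.
by move/near_join: IH; apply: filterS => s /derive1_near[].
Qed.

Lemma Cinf1_near (I I' : set R) f g : (forall t, I' t -> I t /\ {near t, f =1 g}) -> Cinf1 I g -> Cinf1 I' f.
Proof.
move=> h gI m t /h[It /(derive1n_near m) E].
by have [d _] := derive1_near E; apply: d; exact: gI.
Qed.

(* On an interval of radius [1 / (2 C)] the mean value inequality gives
   [max u <= max u / 2]. *)
Lemma gronwall0 (u : R -> R) (t0 C : R) : 0 < C -> u t0 = 0 ->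
  (\forall t \near t0, [/\ 0 <= u t, derivable u t 1 & `|derive1 u t| <= C * u t]) ->
  \forall t \near t0, u t = 0.
Proof.
move=> C0 u0 /nbhs_ballP[d /= d0 hd].
pose r := Num.min (d / 2) ((2 * C)^-1).
have r0 : 0 < r by rewrite lt_min divr_gt0// invr_gt0 mulr_gt0.
have rd : r < d by rewrite gt_min; apply/orP; left; lra.
have rC : C * r <= 1 / 2.
  have : r <= (2 * C)^-1 by rewrite ge_min lexx orbT.
  by rewrite -(ler_pM2l C0) => /le_trans; apply; rewrite invfM mulrCA mulfV ?gt_eqF// mulr1 mul1r.
have hr t : t0 - r <= t <= t0 + r -> [/\ 0 <= u t, derivable u t 1 & `|derive1 u t| <= C * u t].
  move=> /andP[h1 h2]; apply: hd; rewrite /ball/= ltr_norml; apply/andP; split; lra.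
have uc : {within `[t0 - r, t0 + r], continuous u}.
  apply: derivable_within_continuous => t; rewrite in_itv/= => /hr[_ ? _] //.
have lr : t0 - r <= t0 + r by lra.
have [c + cmax] := EVT_max lr uc; rewrite in_itv/= => cr.
have uc0 : u c <= 0.
  have sub xi : Num.min t0 c <= xi <= Num.max t0 c -> t0 - r <= xi <= t0 + r.
    move: cr => /andP[c1 c2]; rewrite ge_min le_max => /andP[/orP[] h1 /orP[] h2]; apply/andP; split; lra.
  have [|xi /sub xir E] := @MVT_unordered _ u (derive1 u) t0 c.
    by move=> t /sub/hr[_ dt _]; rewrite derive1E; exact: derivableP.
  have [_ _ h1] := hr _ xir; have [h2 _ _] := hr _ cr.
  have h3 : `|c - t0| <= r by move: cr; rewrite ler_norml => /andP[? ?]; apply/andP; split; lra.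
  have h4 : u c <= C * u xi * r.
    rewrite -(subr0 (u c)) -[X in _ - X]u0 E; apply: (le_trans (ler_norm _)); rewrite normrM.
    by apply: ler_pM.
  have h5 : C * u xi * r <= C * r * u c by rewrite mulrAC ler_pM2l ?mulr_gt0//; apply: cmax; rewrite in_itv.
  have : C * r * u c <= 1 / 2 * u c by exact: ler_wpM2r.
  by move: h4 h5; lra.
near=> t; have tr : t0 - r <= t <= t0 + r.
  by apply/andP; split; apply: ltW; near: t; [apply: lt_nbhsr|apply: lt_nbhsl]; lra.
have [h1 _ _] := hr _ tr; apply/eqP; rewrite eq_le h1 andbT.
have ut : u t <= u c by have := cmax t; rewrite in_itv/=; exact.
exact: (le_trans ut uc0).
Unshelve. all: by end_near.
Qed.

End NearDerivatives.

Section InvariantGerms.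
Variables (R : realType) (k n : nat) (G : lieGroup R k) (M : manifold R n).
Variable A : lieAction G M.
Local Notation CsmM f := (Csm (X := mspace M) f).
Variable S : set M.
Hypothesis Sinv : forall g x, S x -> S (A g x).

Lemma ginvariantD f g : ginvariant A f -> ginvariant A g -> ginvariant A (fun y => f y + g y).
Proof. by move=> fi gi h y; rewrite fi gi. Qed.

Lemma ginvariantM f g : ginvariant A f -> ginvariant A g -> ginvariant A (fun y => f y * g y).
Proof. by move=> fi gi h y; rewrite fi gi. Qed.

Lemma CsmD f g : CsmM f -> CsmM g -> CsmM (fun y => f y + g y).
Proof. by move=> fs gs; apply: snear_Csm => y; apply: snearD; exact: Csm_snear. Qed.

Lemma Csm_mul f g : CsmM f -> CsmM g -> CsmM (fun y => f y * g y).
Proof. by move=> fs gs; apply: snear_Csm => y; apply: snearM; exact: Csm_snear. Qed.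

Lemma Csm_cst c : CsmM (fun=> c).
Proof. by apply: snear_Csm => y; exact: snear_cst. Qed.

Lemma Csm_sum (I : Type) (r : seq I) f : (forall i, CsmM (f i)) -> CsmM (fun y => \sum_(i <- r) f i y).
Proof. by move=> h; apply: snear_Csm => y; apply: snear_sum => i; exact: Csm_snear. Qed.

Definition inv_germ (V : set (set M)) (h : set M -> R) (x : M) (F : M -> R) :=
  [/\ CsmM F, ginvariant A F & nbhs x [set y | S y -> V (gorbit A y) -> h (gorbit A y) = F y]].

(** Trades functions on the quotient for global invariant functions near points of [S], so that the
    algebra of germs is done on [M]. The converse rests on the openness of the orbit map. *)
Lemma qfun_locP V h : qfun_loc A S V h <-> forall x, S x -> V (gorbit A x) -> exists F, inv_germ V h x F.
Proof.
split=> [H x Sx Vx|H _ [x Sx <-] Vx].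
  have [W [h1 [oW Wx [_ [F [Fs Fi FE]]] hW]]] := H (gorbit A x) (ex_intro2 _ _ x Sx erefl) Vx.
  exists F; split=> //; apply: filterS (qopen_near oW Sx Wx) => y Wy Sy Vy.
  by rewrite hW ?FE//; [exists y|exact: Wy].
have [F [Fs Fi]] := H x Sx Vx; rewrite nbhsE => -[U [oU Ux] hU].
exists (gorbit A @` (S `&` U)), (desc A F); split.
- exact: qopen_image.
- by exists x.
- exact: desc_qfun.
- by move=> _ _ [y [Sy Uy] <-] Vy; rewrite descE// hU.
Qed.

Lemma qfun_loc_cst V c : qfun_loc A S V (fun=> c).
Proof. by apply/qfun_locP => x _ _; exists (fun=> c); split=> //; [exact: Csm_cst|exact: filterE]. Qed.

Lemma qfun_locD V h1 h2 : qfun_loc A S V h1 -> qfun_loc A S V h2 -> qfun_loc A S V (fun p => h1 p + h2 p).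
Proof.
move=> /qfun_locP H1 /qfun_locP H2; apply/qfun_locP => x Sx Vx.
have [F1 [s1 i1 n1]] := H1 x Sx Vx; have [F2 [s2 i2 n2]] := H2 x Sx Vx.
exists (fun y => F1 y + F2 y); split; [exact: CsmD|exact: ginvariantD|].
by apply: filterS2 n1 n2 => y e1 e2 Sy Vy; rewrite e1 ?e2.
Qed.

Lemma qfun_locM V h1 h2 : qfun_loc A S V h1 -> qfun_loc A S V h2 -> qfun_loc A S V (fun p => h1 p * h2 p).
Proof.
move=> /qfun_locP H1 /qfun_locP H2; apply/qfun_locP => x Sx Vx.
have [F1 [s1 i1 n1]] := H1 x Sx Vx; have [F2 [s2 i2 n2]] := H2 x Sx Vx.
exists (fun y => F1 y * F2 y); split; [exact: Csm_mul|exact: ginvariantM|].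
by apply: filterS2 n1 n2 => y e1 e2 Sy Vy; rewrite e1 ?e2.
Qed.

Lemma qfun_loc_sum V (I : Type) (r : seq I) h : (forall i, qfun_loc A S V (h i)) ->
  qfun_loc A S V (fun p => \sum_(i <- r) h i p).
Proof.
move=> H; elim: r => [|i r IH]; first by under eq_fun do rewrite big_nil; exact: qfun_loc_cst.
by under eq_fun do rewrite big_cons; exact: qfun_locD.
Qed.

Lemma qfun_loc_prod V (I : Type) (r : seq I) h : (forall i, qfun_loc A S V (h i)) ->
  qfun_loc A S V (fun p => \prod_(i <- r) h i p).
Proof.
move=> H; elim: r => [|i r IH]; first by under eq_fun do rewrite big_nil; exact: qfun_loc_cst.
by under eq_fun do rewrite big_cons; exact: qfun_locM.
Qed.

Lemma qfun_loc_det V m (B : set M -> 'M[R]_m) : (forall i j, qfun_loc A S V (fun p => B p i j)) ->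
  qfun_loc A S V (fun p => \det (B p)).
Proof.
by move=> H; apply: qfun_loc_sum => s; apply: qfun_locM; [exact: qfun_loc_cst|exact: qfun_loc_prod].
Qed.

Lemma qfun_loc_adj V m (B : set M -> 'M[R]_m) : (forall i j, qfun_loc A S V (fun p => B p i j)) ->
  forall i j, qfun_loc A S V (fun p => (\adj (B p)) i j).
Proof.
move=> H i j; under eq_fun do rewrite mxE /cofactor; apply: qfun_locM; first exact: qfun_loc_cst.
by apply: qfun_loc_det => i' j'; under eq_fun do rewrite !mxE; exact: H.
Qed.

Lemma qfun_locV V h : qfun_loc A S V h -> (forall x, S x -> V (gorbit A x) -> h (gorbit A x) != 0) ->
  qfun_loc A S V (fun p => (h p)^-1).
Proof.
move=> /qfun_locP H h0; apply/qfun_locP => x Sx Vx; have [F [Fs Fi nF]] := H x Sx Vx.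
have Fx : F x != 0 by rewrite -(nbhs_singleton nF)// h0.
(* [F] may have either sign, so its inverse is written as [F] over its square, and [sinv] is applied
   to the square. *)
pose c := F x ^+ 2 / 2; have c0 : 0 < c by rewrite divr_gt0// exprn_even_gt0.
have F2s : CsmM (fun y => F y * F y) by exact: Csm_mul.
exists (fun y => F y * sinv c (F y * F y)); split.
- apply: Csm_mul => //; apply: snear_Csm => y; apply: (snear_sm1 (sm1_sinv c0)).
  exact: Csm_snear.
- by move=> g y; rewrite Fi.
- have : \forall y \near x, c <= F y * F y.
    have cx : c < F x * F x by rewrite /c -expr2 ltr_pdivrMr// ltr_pMr ?ltr1n// exprn_even_gt0.
    have /cvgrPdist_lt/(_ (F x * F x - c)) : {for x, continuous (fun y => F y * F y)} by have := @Csm_cont _ _ _ _ F2s; exact.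
    rewrite subr_gt0 => /(_ cx); apply: filterS => y; rewrite ltr_norml => /andP[_]; lra.
  apply: filterS2 nF => y E cy Sy Vy; rewrite E// sinvE// invfM mulrA.
  by rewrite divff ?mul1r// -E ?h0.
Qed.

Lemma qfun_loc_sub V V' h : V' `<=` V -> qfun_loc A S V h -> qfun_loc A S V' h.
Proof.
move=> sV /qfun_locP H; apply/qfun_locP => x Sx Vx; have [F [Fs Fi nF]] := H x Sx (sV _ Vx).
by exists F; split=> //; apply: filterS nF => y E Sy /sV; exact: E.
Qed.

Hypothesis hproper : proper_action A.

(** A smooth function on the quotient has a local extension [g] that is invariant along [S] only.
    Averaging makes it invariant, and on [S] the average of [b * g] is [f] times the average of [b],
    because [g] takes there the values of [f], constant on orbits. *)
Lemma qsm_inv_germ V f x : fopen (f := qspace A S) V -> fsmooth (f := qspace A S) V f -> S x ->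
  V (gorbit A x) -> exists F, inv_germ setT f x F.
Proof.
move=> oV /qsmP fV Sx Vx; have [g [gs ng]] := fV x Sx Vx.
have [I [Ilin Imono Itr Ipos]] := haar_full G.
have [U [oU Ux gU]] : exists U, [/\ open U, U x & fsmooth (f := mspace M) U g].
  by have /smooth_atP := gs.
have : nbhs x (U `&` [set y | S y -> V (gorbit A y) -> f (gorbit A y) = g y]).
  by apply: filterI => //; exact: open_nbhs_nbhs.
rewrite nbhsE => -[W [oW Wx] hW].
have [b [C [bs b0 b1 Cc [CW bC]]]] := bump (open_nbhs_nbhs (conj oW Wx)).
have gW : fsmooth (f := mspace M) W g.
  by move=> c ac; apply: Cinf_sub (gU c ac) => _ [z [z1 /hW[z2 _]] <-]; exists z.
have bc : Csc b by split=> //; exists C.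
have bgc : Csc (fun y => b y * g y).
  split; first exact: (Csm_bumpM bs Cc CW oW bC gW).
  by exists C => // y /bC ->; rewrite mul0r.
pose s := Av A I b x / 2.
have bx : 0 < Av A I b x.
  by apply: (Av_gt0 hproper Ipos bc b0); rewrite (nbhs_singleton b1) ltr01.
have s0 : 0 < s by rewrite divr_gt0.
exists (fun y => Av A I (fun y => b y * g y) y * sinv s (Av A I b y)); split.
- apply: Csm_mul; first exact: (Av_smooth hproper Ilin Imono).
  apply: snear_Csm => y; apply: (snear_sm1 (sm1_sinv s0)); apply: Csm_snear.
  exact: (Av_smooth hproper Ilin Imono).
- move=> h y; rewrite (Av_inv hproper Itr bc) (Av_inv hproper Itr bgc) //.
- have sx : \forall y \near x, s <= Av A I b y.
    have /cvgrPdist_lt/(_ s s0) : {for x, continuous (Av A I b)}.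
      by have := @Csm_cont _ _ _ _ (Av_smooth hproper Ilin Imono bc); exact.
    by apply: filterS => y; rewrite ltr_norml => /andP[_]; rewrite /s; lra.
  apply: filterS2 sx (qopen_near oV Sx Vx) => y sy Vy Sy _.
  have -> : Av A I (fun y => b y * g y) y = Av A I (fun z => f (gorbit A z) * b z) y.
    congr (I _); apply/funext => h; rewrite mulrC.
    have [Ch|/bC ->] := pselect (C (A h y)); last by rewrite !mulr0.
    have [_ ->] := hW _ (CW _ Ch) => //; first exact: Sinv.
    by rewrite gorbitA; exact: Vy.
  rewrite (AvM hproper Ilin (F := fun z => f (gorbit A z)) bc) => [|h]; last by rewrite gorbitA.
  by rewrite sinvE// mulfK// gt_eqF// (lt_le_trans s0 sy).
Qed.

End InvariantGerms.

Lemma cont_adj (R : realType) (T : topologicalType) a (F : T -> 'M[R]_a) t i j : mcont F t ->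
  {for t, continuous (fun h => (\adj (F h)) i j)}.
Proof.
move=> cF; have -> : (fun h => (\adj (F h)) i j) = (fun h => (-1) ^+ (j + i) * \det (row' j (col' i (F h)))).
  by apply/funext => h; rewrite mxE.
apply: continuousM; first exact: cst_continuous.
apply: cont_det => i' j'; have -> : (fun h => (row' j (col' i (F h))) i' j') = (fun h => F h (lift j i') (lift i j')).
  by apply/funext => h; rewrite !mxE.
exact: cF.
Qed.

Lemma bounded_near (R : realType) (T : topologicalType) (f : T -> R) t : {for t, continuous f} ->
  exists b, \forall s \near t, `|f s| <= b.
Proof.
move=> cf; exists (`|f t| + 1).
have /cvgrPdist_lt/(_ 1 ltr01) := cf; apply: filterS => s h.
have := ler_distD (f t) (f s) 0; rewrite !subr0 distrC => /le_trans; apply.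
by rewrite addrC lerD2l ltW.
Qed.

Lemma nonzero_near (R : realType) (T : topologicalType) (f : T -> R) t : {for t, continuous f} -> f t != 0 ->
  exists2 d, 0 < d & \forall s \near t, d <= `|f s|.
Proof.
move=> cf ft; exists (`|f t| / 2); first by rewrite divr_gt0// normr_gt0.
have d0 : 0 < `|f t| / 2 by rewrite divr_gt0// normr_gt0.
have /cvgrPdist_lt/(_ _ d0) := cf; apply: filterS => s h.
have := ler_distD (f s) (f t) 0; rewrite !subr0; move: h; lra.
Qed.

(** * The reduced systems *)

Section Reduced.
Variables (R : realType) (k n : nat) (G : lieGroup R k) (M : manifold R n).
Variable A : lieAction G M.
Variables (br : (M -> R) -> (M -> R) -> M -> R)
  (om : M -> vec (mspace M) -> vec (mspace M) -> R)
  (Delta : M -> set (vec (mspace M))) (H : M -> R) (P : M -> covec (mspace G)).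
Hypotheses (hom2 : twoform (X := mspace M) om) (homnd : nondeg_form (X := mspace M) om)
  (hproper : proper_action A) (hP : equivariant_map A P)
  (hPom : forall xi x w, lie_alg G xi -> tangent (X := mspace M) x w ->
     dform (X := mspace M) (fun y => P y xi) x w = om x (infgen A xi x) w)
  (hDV : forall x v, Delta x v -> orbit_dir A x v -> v = 0).
Variables (B0 : (set M -> R) -> (set M -> R) -> set M -> R) (H0 : set M -> R).
Hypothesis hsing : singular_reduced A br H P B0 H0.
Variables (BK : set G -> (set M -> R) -> (set M -> R) -> set M -> R)
  (JK : forall K : set G, set M -> covec (Qpiece A P K) -> vec (Qpiece A P K))
  (DK : forall K : set G, set M -> set (vec (Qpiece A P K)))
  (HK : set G -> set M -> R).
Arguments JK : clear implicits.
Arguments DK : clear implicits.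
Hypothesis hKred : forall K, compact_subgroup K ->
  regular_reduced br Delta H (BK K) (JK K) (DK K) (HK K).
Local Notation N := (zero_level P).
Local Notation CsmM f := (Csm (X := mspace M) f).
Local Notation gorb := (gorbit A).

Lemma N_inv g x : N x -> N (A g x).
Proof.
have [ct _ Pe] := hP; rewrite /zero_level/= => Px; apply/funext => xi.
have [hx|hx] := pselect (lie_alg G xi); first by rewrite Pe// Px.
by have [_ ->] := ct (A g x).
Qed.

Lemma piece_inv K g x : piece A P K x -> piece A P K (A g x).
Proof. by move=> [Nx Kx]; split; [exact: N_inv|exact: orbit_typeA]. Qed.

Lemma piece_N K : piece A P K `<=` N. Proof. by move=> x []. Qed.

Lemma stab_subgroup x : compact_subgroup (stab A x).
Proof.
have [h1 h2 h3 h4] : compact_subgroup (stab A x) by exact: stab_compact.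
by split.
Qed.

Lemma piece_stab x : N x -> piece A P (stab A x) x.
Proof.
move=> Nx; split=> //; exists (lone G); apply/seteqP; split=> [h hx|_ [h hx <-] /=].
  by exists h => //; rewrite lmul1 linv1 lmulg1.
by rewrite lmul1 linv1 lmulg1.
Qed.

Lemma orbit_type_trans K x y : orbit_type A K x -> orbit_type A (stab A x) y -> orbit_type A K y.
Proof.
move=> [g E] [h E']; exists (lmul h g); rewrite E'.
have Ex : stab A x = [set lmul (lmul g h) (linv g) | h in K] by [].
rewrite Ex; apply/seteqP; split=> [_ [_ [l Kl <-] <-]|_ [l Kl <-]].
  by exists l => //; rewrite linvM !lmulA.
by exists (lmul (lmul g l) (linv g)); [exists l|rewrite linvM !lmulA].
Qed.

Lemma orbit_type_sym K x : orbit_type A K x -> forall y, orbit_type A K y -> orbit_type A (stab A x) y.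
Proof.
move=> [g E] y [h E']; exists (lmul h (linv g)); rewrite E'.
have Ex : stab A x = [set lmul (lmul g h) (linv g) | h in K] by [].
rewrite Ex; apply/seteqP; split=> [_ [l Kl <-]|_ [_ [l Kl <-] <-]].
  exists (lmul (lmul g l) (linv g)); first by exists l.
  by rewrite linvM linvK !lmulA lmulgKV lmulgKV.
by exists l => //; rewrite linvM linvK !lmulA lmulgKV lmulgKV.
Qed.

Lemma carrier_piece K x : carrier (f := Qpiece A P K) (gorb x) <-> piece A P K x.
Proof.
split=> [[y py /gorbitP[g <-]]|px]; first exact: piece_inv.
by exists x.
Qed.

Definition frame_proj K U m (Z : 'I_m -> M -> vec (mspace M)) (Zb : 'I_m -> set M -> vec (Qpiece A P K)) :=
  forall j x, piece A P K x -> U x -> exists v, [/\ tangent (X := subspc (piece A P K)) x v,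
    Tincl x v = Z j x & Tmap (X := subspc (piece A P K)) (Y := Qpiece A P K) gorb x v = Zb j (gorb x)].

Lemma frame_proj_ext K U m Z Zb j x f F : @frame_proj K U m Z Zb -> piece A P K x -> U x ->
  extends A (piece A P K) F f -> Zb j (gorb x) f = Z j x F.
Proof.
move=> h px Ux fF; have qf : qfun A (piece A P K) f by exact: extends_qfun fF.
have [Fs Fi FE] := fF; have [v [[v1 v2 v3 v4] vZ vb]] := h j x px Ux.
rewrite -vZ -vb /Tincl /Tmap !asboolT; last 2 first.
- by apply/smooth_atP; exact: Csm_snear.
- exact: qfun_smooth_at.
have sF : smooth_at (X := subspc (piece A P K)) x F.
  exists setT; split=> //; first by exists setT => //; exact: openT.
  move=> y py _; exists setT, F; split=> //; exact: openT.
apply/esym/v3 => //; exists setT; split=> //; first by exists setT => //; exact: openT.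
by move=> y py _; rewrite /= FE.
Qed.

Lemma qfun_desc f0 : qfun A N f0 -> exists f, extends A N f f0.
Proof. by case. Qed.

Lemma frame_projE K U m Z Zh Zb j x f0 : @proj_frame R k n G M A Delta P U m Z Zh ->
  frame_proj (K := K) U Z Zb -> piece A P K x -> U x -> qfun A N f0 ->
  Zb j (gorb x) f0 = Zh j f0 (gorb x).
Proof.
move=> [_ _ _ _ pf] hZ px Ux qf; have [f fe] := qfun_desc qf.
rewrite (frame_proj_ext j hZ px Ux (extends_sub (@piece_N K) fe)).
by have [_ pe] := pf j; rewrite (pe f f0)//; exact: piece_N px.
Qed.

Lemma bracket_restricts K f0 h0 p : compact_subgroup K -> qfun A N f0 -> qfun A N h0 ->
  carrier (f := Qpiece A P K) p -> BK K f0 h0 p = B0 f0 h0 p.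
Proof.
move=> cK qf qh [x px <-]; have [[_ h1] _ _ _] := hKred cK; have [_ h2 _ _] := hsing.
have [f fe] := qfun_desc qf; have [h he] := qfun_desc qh.
have pN := @piece_N K.
rewrite (h1 f0 h0 f h (qfun_sub pN qf) (qfun_sub pN qh) (extends_sub pN fe) (extends_sub pN he) _ px).
by rewrite (h2 f0 h0 f h)//; exact: pN.
Qed.

Lemma hamiltonian_restricts K p : compact_subgroup K -> carrier (f := Qpiece A P K) p -> HK K p = H0 p.
Proof.
move=> cK [x px <-]; have [_ _ _ ->] := hKred cK => //; have [_ _ _ ->//] := hsing.
exact: piece_N px.
Qed.

Lemma Delta_hat_restrictsP K : compact_subgroup K -> Delta_hat_restricts Delta (DK K).
Proof.
move=> cK U m Z Zh pf; have [_ _ hZ _] := hKred cK.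
have [Zb [Zbv Zbp Zbd]] := hZ U m Z Zh pf.
exists (fun j f0 p => Zb j p f0), Zb; split=> //.
- move=> j; split.
  (* [Zh j] acts on functions on [M_0]; [f] is replaced by the one induced by its invariant
     extension [F], and the resulting local function on [M_0] is restricted to the piece. *)
  + move=> f [_ [F fF]] _ _ [x [px Ux] <-]; have [Fs Fi FE] := fF.
    have [oU _ _ _ pf'] := pf; have [[pl _ _ _] pe] := pf' j.
    have qd : qfun A N (desc A F) by exact: desc_qfun.
    have [W [h1 [oW Wx qh hW]]] := pl _ qd (gorb x) (ex_intro2 _ _ x (piece_N px) erefl)
       (ex_intro2 _ _ x (conj (piece_N px) Ux) erefl).
    exists W, h1; split=> //; last 2 first.
    * exact: qfun_sub (@piece_N K) qh.
    * move=> q _ Wq [y [py Uy] yq]; rewrite -yq in Wq *.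
      rewrite (frame_proj_ext j Zbp py Uy fF) -hW//.
      - by rewrite (pe F)//; [exact: desc_extends|exact: piece_N py].
      - by exists y => //; exact: piece_N py.
      - by exists y => //; split=> //; exact: piece_N py.
    by have [U' oU' E] := oW; exists U' => // y /piece_N; exact: E.
  + move=> r f g qf qg p cp Vp; have [+ _] := Zbv j => /(_ p cp Vp)[t1 _ _ _]; rewrite t1//; exact: qfun_smooth_at.
  + move=> f g qf qg p cp Vp; have [+ _] := Zbv j => /(_ p cp Vp)[_ t1 _ _]; rewrite t1//; exact: qfun_smooth_at.
  + move=> f g qf qg fg p cp Vp; have [+ _] := Zbv j => /(_ p cp Vp)[_ _ h _].
    apply: h; first exact: qfun_smooth_at.
    by exists setT; split=> [|//|q cq _]; [exact: qopenT|exact: fg].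
- move=> j f0 qf _ [x [px Ux] <-]; exact: (frame_projE j pf Zbp px Ux qf).
Qed.

(** The points [x] and [x'] of the orbit may differ by any group element, and the fibres of [Delta]
    there are not compared directly: both frames project to families spanning the same fibre of
    [DK]. *)
Lemma carrier_frame_dec U m Z Zh U' m' Z' Zh' x j : @proj_frame R k n G M A Delta P U m Z Zh ->
  @proj_frame R k n G M A Delta P U' m' Z' Zh' -> N x -> U x -> (gorb @` (N `&` U')) (gorb x) ->
  exists e : 'I_m' -> R, forall f0, qfun A N f0 -> Zh j f0 (gorb x) = \sum_l e l * Zh' l f0 (gorb x).
Proof.
move=> pf pf' Nx Ux [x' [Nx' Ux'] xx']; have cK := stab_subgroup x.
have [_ _ hZ _] := hKred cK; have px := piece_stab Nx.
have [Zb [_ Zbp Zbd]] := hZ U m Z Zh pf; have [Zb' [_ Zbp' Zbd']] := hZ U' m' Z' Zh' pf'.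
have px' : piece A P (stab A x) x' by apply/carrier_piece; rewrite xx'; exists x.
have D : DK (stab A x) (gorb x) (Zb j (gorb x)).
  apply/(Zbd (gorb x)); first by exists x.
  exists (fun i => (i == j)%:R); rewrite (bigD1 j)//= eqxx scale1r big1 ?addr0// => i /negPf ->.
  by rewrite scale0r.
have [|e E] := (Zbd' (gorb x) _ _).1 D; first by exists x'.
exists e => f0 qf; rewrite -(frame_projE j pf Zbp px Ux qf) E vec_sumE.
by apply: eq_bigr => l _; rewrite -xx' (frame_projE l pf' Zbp' px' Ux' qf).
Qed.

Lemma Delta_hat_dec U m Z Zh x E : @proj_frame R k n G M A Delta P U m Z Zh -> N x -> U x ->
  Delta_hat A Delta P E ->
  exists e : 'I_m -> R, forall f0, qfun A N f0 -> E f0 (gorb x) = \sum_l e l * Zh l f0 (gorb x).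
Proof.
move=> pf Nx Ux [_ hE]; have cx : carrier (f := qspace A N) (gorb x) by exists x.
have [U' [m' [Z' [Zh' [c [pf' xU' _ Ec]]]]]] := hE _ cx.
have [x' [Nx' Ux'] xx'] := xU'.
have h l : exists e : 'I_m -> R, forall f0, qfun A N f0 ->
    Zh' l f0 (gorb x) = \sum_l e l * Zh l f0 (gorb x).
  rewrite -xx'; apply: (carrier_frame_dec l pf' pf Nx' Ux'); rewrite xx'.
  by exists x.
have /choice[e eE] := h.
exists (fun i => \sum_l c l (gorb x) * e l i) => f0 qf; rewrite Ec//.
under eq_bigr do rewrite eE// mulr_sumr.
rewrite exchange_big; apply: eq_bigr => i _ /=; rewrite mulr_suml.
by apply: eq_bigr => l _; rewrite mulrA.
Qed.

(** The fields of a frame are tangent to the pieces, so their derivatives depend on germs along the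
    piece only. *)
Lemma frame_germ K U m Z Zb j x f g : @frame_proj K U m Z Zb -> piece A P K x -> U x ->
  snear x f -> snear x g -> nbhs x [set y | piece A P K y -> f y = g y] -> Z j x f = Z j x g.
Proof.
move=> h px Ux fs gs; rewrite nbhsE => -[W [oW Wx] hW].
have [v [[_ _ v3 _] vZ _]] := h j x px Ux.
have sub F : snear x F -> smooth_at (X := subspc (piece A P K)) x F.
  move=> /smooth_atP[V [oV Vx FV]]; exists V; split=> //; first by exists V.
  by move=> y py Vy; exists V, F.
rewrite -vZ /Tincl /Tmap !asboolT; [|by apply/smooth_atP..].
apply: v3; first exact: sub.
by exists W; split=> //; [exists W|move=> y py Wy; exact: hW].
Qed.

Lemma vfield_snear (U : set M) (Z : M -> vec (mspace M)) x f : open U ->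
  vfield (X := mspace M) U Z -> U x -> snear x f -> snear x (fun y => Z y f).
Proof.
move=> oU [_ hZ] Ux /smooth_atP[V [oV Vx fV]].
have oW : open (V `&` U) by exact: openI.
apply: (@msm_snear _ _ _ (V `&` U)); first exact: open_nbhs_nbhs.
apply: hZ => //.
by move=> c ac; apply: Cinf_sub (fV c ac) => _ [z [z1 [z2 _]] <-]; exists z.
Qed.

(** The invariance comes from the projection to [Zh i], whose values are locally functions on [M_0];
    commuting with the generators would give it along connected pieces of orbits only. *)
Lemma Zh_germ U m Z Zh i x f : @proj_frame R k n G M A Delta P U m Z Zh -> N x -> U x ->
  CsmM f -> ginvariant A f ->
  exists F, [/\ CsmM F, ginvariant A F & nbhs x [set y | N y -> Z i y f = F y]].
Proof.
move=> pf Nx Ux fs fi; have [oU _ _ _ pf'] := pf; have [[h1 _ _ _] h2] := pf' i.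
have qf : qfun A N (desc A f) by exact: desc_qfun.
have /(qfun_locP N_inv)/(_ x Nx)[] := h1 _ qf; first by exists x.
move=> F [Fs Fi nF]; exists F; split=> //.
apply: filterS2 nF (open_nbhs_nbhs (conj oU Ux)) => y E Uy Ny.
by rewrite -E//; [rewrite (h2 f)//; exact: desc_extends|exists y].
Qed.

Lemma near_snear (x : M) (f : M -> R) : snear x f -> \forall y \near x, snear y f.
Proof.
move=> /smooth_atP[V [oV Vx fV]]; apply: filterS (open_nbhs_nbhs (conj oV Vx)) => y Vy.
by apply/smooth_atP; exists V.
Qed.

Lemma qfE (S : 'M[R]_n) u : qf S u = \sum_j \sum_l S j l * (u 0 j * u 0 l).
Proof.
rewrite /qf mxE exchange_big; apply: eq_bigr => l _; rewrite !mxE mulr_suml.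
by apply: eq_bigr => j _; rewrite mulrA [S j l * _]mulrC.
Qed.

(* [Z phi] is invariant on [N] near [x], so a combination [v] killing the
   invariants kills it; but [v (Z phi)] is the Hessian of [phi] at [v]. Hence [v]
   kills [w] and is tangent to the orbit. *)
Lemma frame_independent U m Z Zh x (a : 'I_m -> R) : @proj_frame R k n G M A Delta P U m Z Zh ->
  N x -> U x -> (forall F, CsmM F -> ginvariant A F -> \sum_i a i * Z i x F = 0) -> forall i, a i = 0.
Proof.
move=> pf Nx Ux a0; have [oU Zv Zb _ pf'] := pf.
have cK := stab_subgroup x; have px := piece_stab Nx.
have [_ _ hZ _] := hKred cK; have [Zbar [_ Zbp _]] := hZ U m Z Zh pf.
pose V y : vec (mspace M) := \sum_i a i *: Z i y.
have VE y f : V y f = \sum_i a i * Z i y f by exact: vec_sumE.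
have tV y : U y -> tangent (X := mspace M) y (V y).
  by move=> Uy; apply: tangent_sum => i; have [+ _] := Zv i; exact.
have Vs f : snear x f -> snear x (fun y => V y f).
  move=> fs; under eq_fun do rewrite VE; apply: snear_sum => i.
  by apply: snearM; [exact: snear_cst|exact: vfield_snear oU (Zv i) Ux fs].
have [w [S [phi [c [[phis phii c0 hc] [ws wx nphi] _ _ tw]]]]] :=
  slice_package hproper hom2 homnd hP hPom Nx.
have /choice[F FP] := fun i => Zh_germ i pf Nx Ux phis phii.
pose psi y := \sum_i a i * F i y.
have psis : CsmM psi.
  by apply: Csm_sum => i; apply: Csm_mul; [exact: Csm_cst|have [] := FP i].
have psii : ginvariant A psi.
  by move=> g y; apply: eq_bigr => i _; have [_ -> _] := FP i.
have Vphi : V x (fun y => V y phi) = 0.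
  rewrite -[RHS](a0 _ psis psii) VE; apply: eq_bigr => i _; congr (_ * _).
  apply: (frame_germ (g := psi) i Zbp px Ux); first by apply: Vs; exact: Csm_snear.
    exact: Csm_snear.
  have : \forall y \near x, forall i, N y -> Z i y phi = F i y.
    by apply: filter_forall => l; have [] := FP l.
  by apply: filterS => y h [Ny _]; rewrite VE; apply: eq_bigr => l _; rewrite h.
have wsn : \forall y \near x, forall j, snear y (fun y => w y 0 j).
  by apply: filter_forall => j; exact: near_snear.
have E1 : \forall y \near x, V y phi =
    \sum_j \sum_l S j l * (w y 0 j * V y (fun y => w y 0 l) + w y 0 l * V y (fun y => w y 0 j)).
  move/near_join: nphi => nphi.
  apply: filterS3 nphi wsn (open_nbhs_nbhs (conj oU Ux)) => y E ys Uy.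
  have ty := tV y Uy.
  have Q : {near y, (fun y => \sum_j \sum_l S j l * (w y 0 j * w y 0 l)) =1 phi}.
    by apply: filterS E => z /= ->; rewrite qfE.
  rewrite -(tan_eq ty _ Q); last first.
    apply: snear_sum => j; apply: snear_sum => l; apply: snearM; first exact: snear_cst.
    exact: snearM.
  rewrite (tan_sum ty); last first.
    move=> j; apply: snear_sum => l; apply: snearM; first exact: snear_cst.
    exact: snearM.
  apply: eq_bigr => j _; rewrite (tan_sum ty); last first.
    by move=> l; apply: snearM; [exact: snear_cst|exact: snearM].
  apply: eq_bigr => l _; rewrite (tanZ ty); last exact: snearM.
  by rewrite (tanM ty).
pose u : 'rV[R]_n := \row_j V x (fun y => w y 0 j).
have tx := tV x Ux.
(* Since [w x = 0], only the products of two first derivatives of [w] remain, and each occurs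
   twice. *)
have E2 : V x (fun y => V y phi) = 2 * qf S u.
  have E1' : {near x, (fun y => \sum_j \sum_l S j l * (w y 0 j * V y (fun y => w y 0 l) + w y 0 l * V y (fun y => w y 0 j)))
      =1 (fun y => V y phi)} by apply: filterS E1 => y /= ->.
  have s1 j l : snear x (fun y => w y 0 j * V y (fun y => w y 0 l)).
    by apply: snearM => //; exact: Vs.
  rewrite -(tan_eq tx _ E1'); last first.
    apply: snear_sum => j; apply: snear_sum => l; apply: snearM; first exact: snear_cst.
    exact: snearD.
  rewrite (tan_sum tx); last first.
    move=> j; apply: snear_sum => l; apply: snearM; first exact: snear_cst.
    exact: snearD.
  rewrite qfE mulr_sumr; apply: eq_bigr => j _; rewrite mulr_sumr (tan_sum tx); last first.
    move=> l; apply: snearM; first exact: snear_cst.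
    exact: snearD.
  apply: eq_bigr => l _; rewrite (tanZ tx); last exact: snearD.
  rewrite (tanD tx)// !(tanM tx)//; [|exact: Vs..].
  by rewrite wx !mxE; ring.
have u0 : u = 0.
  have : c * `|u| ^+ 2 <= 0.
    by apply: (le_trans (hc u)); move: Vphi; rewrite E2; lra.
  rewrite pmulr_rle0// => h; apply/eqP; rewrite -normr_eq0 -sqrf_eq0.
  by rewrite eq_le h sqr_ge0.
have ov : orbit_dir A x (V x).
  apply: tw => // [j|f fs fi]; last by rewrite VE a0.
  by have := congr1 (fun v : 'rV[R]_n => v 0 j) u0; rewrite !mxE.
have [l1 l2] := Zb x Ux; apply: l2; apply: hDV ov.
by apply/l1; exists a.
Qed.

Lemma dual_invariants U m Z Zh x : @proj_frame R k n G M A Delta P U m Z Zh -> N x -> U x ->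
  exists f : 'I_m -> M -> R, (forall i, CsmM (f i) /\ ginvariant A (f i)) /\
    (\matrix_(i, j) Z j x (f i)) \in unitmx.
Proof.
move=> pf Nx Ux.
have [|f [f1 f2]] := @dual_family R (M -> R) [set F | CsmM F /\ ginvariant A F] m (fun F => \row_j Z j x F).
  move=> a h; apply/matrixP => i j; rewrite ord1 mxE.
  apply: (frame_independent (a := fun i => a i 0) pf Nx Ux) => F Fs Fi.
  have /(congr1 (fun B : 'M[R]_1 => B 0 0)) := h F (conj Fs Fi); rewrite !mxE => E.
  by rewrite -[RHS]E; apply: eq_bigr => l _; rewrite mxE mulrC.
exists f; split=> //; rewrite (_ : (\matrix_(i, j) _) = \matrix_i \row_j Z j x (f i))//.
by apply/matrixP => i j; rewrite !mxE.
Qed.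

Lemma proj_frame_sub U m Z Zh U' : @proj_frame R k n G M A Delta P U m Z Zh -> open U' -> U' `<=` U ->
  @proj_frame R k n G M A Delta P U' m Z Zh.
Proof.
move=> [oU Zv Zb Zl pf] oU' sU; split=> //.
- move=> j; have [h1 h2] := Zv j; split=> [x cx /sU|V f oV sV]; first exact: h1.
  by apply: h2 => // y /sV/sU.
- by move=> x /sU; exact: Zb.
- by move=> j xi x hx /sU; exact: Zl.
- move=> j; have [[h1 h2 h3 h4] h5] := pf j.
  have sV : gorb @` (N `&` U') `<=` gorb @` (N `&` U).
    by move=> _ [x [Nx /sU Ux] <-]; exists x.
  split; last by move=> f f0 qf fe x Nx /sU; exact: h5.
  split.
  + by move=> f qf; apply: (qfun_loc_sub N_inv sV); exact: h1.
  + by move=> r f g qf qg p cp /sV; exact: h2.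
  + by move=> f g qf qg p cp /sV; exact: h3.
  + by move=> f g qf qg fg p cp /sV; exact: h4.
Qed.

Lemma qfun_qfun_loc V f : qfun A N f -> qfun_loc A N V f.
Proof.
move=> [_ [F [Fs Fi FE]]]; apply/(qfun_locP N_inv) => x Nx _; exists F; split=> //.
by apply: filterE => y Ny _; exact: FE.
Qed.

Lemma frame_matrix_cont U m Z Zh (f : 'I_m -> M -> R) x : @proj_frame R k n G M A Delta P U m Z Zh ->
  U x -> (forall i, CsmM (f i)) -> mcont (fun y => \matrix_(i, j) Z j y (f i)) x.
Proof.
move=> [oU Zv _ _ _] Ux fs i j.
have -> : (fun y => (\matrix_(i, j) Z j y (f i)) i j) = (fun y => Z j y (f i)) by apply/funext => y; rewrite mxE.
by apply: snear_cont; apply: (vfield_snear oU (Zv j) Ux); apply: Csm_snear.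
Qed.

(* The frame field [Zh j] is cut off by the average of a bump function supported
   in [U]. Its coefficients in another frame are read off by Cramer's rule from
   its values on a dual family of invariants. *)
Lemma Delta_hat_frame U m Z Zh x j : @proj_frame R k n G M A Delta P U m Z Zh -> N x -> U x ->
  (exists E, Delta_hat A Delta P E) -> exists E r,
  [/\ Delta_hat A Delta P E, r != 0 & forall f0, qfun A N f0 -> E f0 (gorb x) = r * Zh j f0 (gorb x)].
Proof.
move=> pf Nx Ux [E0 [_ hE0]]; have [oU Zv _ _ pf'] := pf.
have [[l1 l2 l3 l4] pe] := pf' j.
have [I [Ilin Imono Itr Ipos]] := haar_full G.
have [b [C [bs b0 b1 Cc [CU bC]]]] := bump (open_nbhs_nbhs (conj oU Ux)).
have bc : Csc b by split=> //; exists C.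
pose beta := desc A (Av A I b).
have bE y : beta (gorb y) = Av A I b y by rewrite /beta descE//; exact: Av_inv.
have out q : carrier (f := qspace A N) q -> ~ (gorb @` (N `&` U)) q -> beta q = 0.
  move=> [y Ny <-] nU; rewrite bE -[RHS](Av0 hproper Ilin y); congr (I _); apply/funext => h.
  apply: bC => /CU Uh; apply: nU; exists (A h y); last exact: gorbitA.
  by split=> //; exact: N_inv.
pose E f0 q := beta q * Zh j f0 q.
have Eext f f0 : qfun A N f0 -> extends A N f f0 -> extends A N (Av A I (fun y => b y * Z j y f)) (E f0).
  move=> qf fe; have [fs fi _] := fe.
  have bfc : Csc (fun y => b y * Z j y f).
    split; last by exists C => // y /bC ->; rewrite mul0r.
    apply: (Csm_bumpM bs Cc CU oU bC); have [_ hv] := Zv j; apply: hv => //.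
    by apply: snear_msm => y _; exact: Csm_snear.
  split; [exact: (Av_smooth hproper Ilin Imono)|exact: (Av_inv hproper Itr)|move=> y Ny].
  rewrite /E bE mulrC -(AvM hproper Ilin (F := fun z => Zh j f0 (gorb z)) bc); last by move=> h; rewrite gorbitA.
  congr (I _); apply/funext => h.
  have [Ch|/bC ->] := pselect (C (A h y)); last by rewrite mulr0 mul0r.
  rewrite mulrC (pe f)//; [exact: N_inv|exact: CU].
have Eqf f0 : qfun A N f0 -> qfun A N (E f0).
  by move=> qf; have [_ [f fe]] := qf; exact: extends_qfun (Eext f f0 qf fe).
exists E, (beta (gorb x)); split=> //; last first.
  rewrite bE gt_eqF//; apply: (Av_gt0 hproper Ipos bc b0).
  by rewrite (nbhs_singleton b1) ltr01.
split.
  have cases q : carrier (f := qspace A N) q -> beta q = 0 \/ (gorb @` (N `&` U)) q.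
    by move=> cq; have [h|/(out q cq) h] := pselect ((gorb @` (N `&` U)) q); [right|left].
  split=> //.
  - move=> r f g qf qg q cq _; rewrite /E; have [->|Vq] := cases q cq; first by rewrite !mul0r mulr0 addr0.
    by rewrite l2//; ring.
  - move=> f g qf qg q cq _; rewrite /E; have [->|Vq] := cases q cq; first by rewrite !mul0r !mulr0 addr0.
    by rewrite l3//; ring.
  - move=> f g qf qg fg q cq _; rewrite /E; have [->|Vq] := cases q cq; first by rewrite !mul0r.
    by rewrite (l4 f g).
move=> _ [y Ny <-].
(* The given element of [Delta_hat] is used only for the frames that its definition provides near
   every point of [M_0]. *)
have [U' [m' [Z' [Zh' [_ [pf1 [y' [Ny' Uy'] yy'] _ _]]]]]] := hE0 (gorb y) (ex_intro2 _ _ y Ny erefl).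
have [f [fP fU]] := dual_invariants pf1 Ny' Uy'.
pose Am z := \matrix_(i, l) Z' l z (f i).
have Amc z : U' z -> mcont Am z.
  by move=> Uz; apply: (frame_matrix_cont pf1 Uz) => i; have [] := fP i.
pose U2 := [set z | U' z /\ \det (Am z) != 0].
have oU2 : open U2.
  rewrite openE => z [Uz dz]; rewrite /interior.
  have [d d0 nd] := nonzero_near (cont_det (Amc z Uz)) dz.
  have [oU' _ _ _ _] := pf1.
  apply: filterS2 nd (open_nbhs_nbhs (conj oU' Uz)) => z' h Uz'; split=> //.
  by rewrite -normr_gt0; exact: lt_le_trans h.
have U2y : U2 y' by split=> //; rewrite -unitfE -unitmxE.
have sU : U2 `<=` U' by move=> z [].
have pf2 := proj_frame_sub pf1 oU2 sU.
pose Aq q := \matrix_(i, l) Zh' l (desc A (f i)) q.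
have qf i : qfun A N (desc A (f i)) by have [fs fi] := fP i; exact: desc_qfun.
have AqE z : N z -> U2 z -> Aq (gorb z) = Am z.
  move=> Nz Uz; apply/matrixP => i l; rewrite !mxE; have [_ _ _ _ /(_ l)[_ pe']] := pf2.
  by rewrite (pe' (f i))//; have [fs fi] := fP i; exact: desc_extends.
pose c l q := (\det (Aq q))^-1 * \sum_i (\adj (Aq q)) l i * E (desc A (f i)) q.
exists U2, m', Z', Zh', c; split=> //.
- by exists y'.
- have Aloc i l : qfun_loc A N (gorb @` (N `&` U2)) (fun q => Aq q i l).
    under eq_fun do rewrite mxE; have [_ _ _ _ /(_ l)[[h1 _ _ _] _]] := pf2; exact: h1.
  move=> l; apply: (qfun_locM N_inv).
    apply: (qfun_locV N_inv); first exact: (qfun_loc_det N_inv).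
    by move=> z Nz [z' [Nz' Uz'] <-]; rewrite AqE//; case: Uz'.
  apply: (qfun_loc_sum N_inv) => i; apply: (qfun_locM N_inv); first exact: (qfun_loc_adj N_inv).
  exact: qfun_qfun_loc (Eqf _ (qf i)).
- move=> f0 qf0 _ [z [Nz Uz] <-].
  have [e eE] : exists e : 'I_m' -> R, forall f0, qfun A N f0 -> E f0 (gorb z) = \sum_l e l * Zh' l f0 (gorb z).
    (* Over the image of [U] the two frames are compared; elsewhere the cut-off [beta] is zero. *)
    have [[z' [Nz' Uz'] zz']|nU] := pselect ((gorb @` (N `&` U)) (gorb z)).
      have [|e eE] := carrier_frame_dec (U' := U2) j pf pf2 Nz' Uz'; first by rewrite zz'; exists z.
      exists (fun l => beta (gorb z) * e l) => g qg; rewrite /E -zz' eE// mulr_sumr.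
      by apply: eq_bigr => l _; rewrite mulrA.
    exists (fun=> 0) => g qg; rewrite /E out//; last by exists z.
    by rewrite mul0r big1// => l _; rewrite mul0r.
  rewrite eE//; apply: eq_bigr => l _; congr (_ * _).
  have dz : \det (Aq (gorb z)) != 0 by rewrite AqE//; case: Uz.
  have /(congr1 (fun B : 'cV[R]_m' => B l 0)) : \adj (Aq (gorb z)) *m (Aq (gorb z) *m \col_l e l) = \det (Aq (gorb z)) *: (\col_l e l).
    by rewrite mulmxA mul_adj_mx mul_scalar_mx.
  rewrite [RHS]mxE [(\col_l e l) l 0]mxE => El.
  apply: (mulfI dz); rewrite -El /c mulrA mulfV// mul1r mxE; apply: eq_bigr => i _.
  congr (_ * _); rewrite mxE eE//; apply: eq_bigr => l' _; rewrite !mxE mulrC//.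
Qed.

(** * Solutions of the singular reduced system *)

Section Curve.
Variable J : M -> covec (mspace M) -> vec (mspace M).
Hypotheses (hJ : bundle_map (X := mspace M) br J) (hH : CsmM H) (hHinv : ginvariant A H).
Variables (I : set R) (gam : R -> set M).
Hypotheses (oI : open I) (hsol : singular_solution A Delta P B0 H0 I gam).

(** The curve is not lifted to [M]: representatives are chosen for each time separately, so
    statements about them have to hold throughout a neighbourhood of [x0]. *)
Lemma near_rep x0 (Q : set M) t0 : I t0 -> N x0 -> gam t0 = gorb x0 -> nbhs x0 Q ->
  \forall t \near t0, I t /\ exists y, [/\ Q y, N y & gam t = gorb y].
Proof.
move=> It0 Nx0 g0; rewrite nbhsE => -[W [oW Wx] WQ]; have [[_ hc] _ _] := hsol.
have oV := hc _ (qopen_image N_inv oW).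
have Vt0 : (I `&` gam @^-1` (gorb @` (N `&` W))) t0 by split=> //; exists x0.
apply: filterS (open_nbhs_nbhs (conj oV Vt0)) => t [It [y [Ny Wy] gy]]; split=> //.
by exists y; split=> //; exact: WQ.
Qed.

Lemma curve_frame t : I t -> exists U m Z Zh x,
  [/\ @proj_frame R k n G M A Delta P U m Z Zh, N x, U x & gam t = gorb x].
Proof.
move=> It; have [[hcar _] _ [D _ /(_ t It)[_ [E [_ hE] _] _]]] := hsol.
have [U [m [Z [Zh [c [pf [x [Nx Ux] gx] _ _]]]]]] := hE _ (hcar t It).
by exists U, m, Z, Zh, x.
Qed.

(** The coefficients [e] belong to the single time [t], and nothing is said of their dependence on
    it; bounds on them are obtained afterwards from known rates. *)
Lemma curve_rate t U m Z Zh x : I t -> @proj_frame R k n G M A Delta P U m Z Zh -> N x -> U x ->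
  gam t = gorb x -> exists e : 'I_m -> R, forall f, CsmM f -> ginvariant A f ->
  derive1 (desc A f \o gam) t = B0 (desc A f) H0 (gorb x) + \sum_i e i * Z i x f.
Proof.
move=> It pf Nx Ux gx; have [_ _ [D _ /(_ t It)[h1 [E hE h2] _]]] := hsol.
have [e he] := Delta_hat_dec pf Nx Ux hE; exists e => f fs fi.
have qf : qfun A N (desc A f) by exact: desc_qfun.
rewrite h1//; have := h2 _ qf; rewrite gx he// => /eqP; rewrite subr_eq addrC => /eqP ->.
congr (_ + _); apply: eq_bigr => i _; have [_ _ _ _ pe] := pf; have [_ pi] := pe i.
by rewrite (pi f)//; exact: desc_extends.
Qed.

Lemma bracket_ext f : CsmM f -> ginvariant A f -> exists F, [/\ CsmM F, ginvariant A F,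
  forall x, N x -> B0 (desc A f) H0 (gorb x) = F x &
  forall x, N x -> F x = J x (dform (X := mspace M) H x) f].
Proof.
move=> fs fi; have [h1 h2 qH hHE] := hsing.
have qf : qfun A N (desc A f) by exact: desc_qfun.
have [_ [F [Fs Fi FE]]] := h1 _ _ qf qH; exists F; split=> // x Nx.
have HE : extends A N H H0 by split.
rewrite -FE// (h2 _ _ _ _ qf qH (desc_extends _ fs fi) HE)//.
have [J1 _ J3] := @hJ x Logic.I; rewrite -J3// dformE//.
by apply: J1; exact: dform_cotangent.
Qed.

(** At a zero of the nonnegative function [phi] every tangent vector kills it. So the bracket of
    [phi] with [H] and the derivatives of [phi] along the frame vanish where [phi] does, and the
    slice bounds them on [N] by multiples of [phi]. *)
Lemma orbit_type_near t0 x0 : I t0 -> N x0 -> gam t0 = gorb x0 ->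
  \forall t \near t0, carrier (f := Qpiece A P (stab A x0)) (gam t).
Proof.
move=> It0 Nx g0.
(* The frame supplied by the solution lives near some representative [x1] of the orbit, which
   replaces [x0]; the two have conjugate stabilizers. *)
have [U [m [Z [Zh [x1 [pf Nx1 Ux1 g1]]]]]] := curve_frame It0.
have st : orbit_type A (stab A x0) x1.
  have /gorbitP[g <-] : gorb x0 = gorb x1 by rewrite -g0.
  by apply: orbit_typeA; have [] := piece_stab Nx.
suff : \forall t \near t0, carrier (f := Qpiece A P (stab A x1)) (gam t).
  apply: filterS => t [y [Ny y1] <-]; exists y => //; split=> //.
  exact: orbit_type_trans st y1.
clear x0 Nx g0 st; move: x1 Nx1 Ux1 g1 => x Nx Ux g0.
have [oU Zv _ _ _] := pf.
have [w [S [phi [c [[phis phii c0 hc] [ws wx nphi] oty van _]]]]] :=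
  slice_package hproper hom2 homnd hP hPom Nx.
have px0 : phi x = 0.
  by rewrite (nbhs_singleton nphi) wx /qf !mul0mx mxE.
have phi0 : \forall y \near x, 0 <= phi y.
  apply: filterS nphi => y ->; apply: le_trans (hc _).
  by rewrite mulr_ge0 ?sqr_ge0// ltW.
have minz y v : (\forall z \near y, 0 <= phi z) -> tangent (X := mspace M) y v -> phi y = 0 -> v phi = 0.
  by move=> h tv; apply: (tan_min tv _ h); exact: Csm_snear.
have [FB [FBs FBi FBE FBJ]] := bracket_ext phis phii.
have nphi' := near_join phi0.
have [CB CB0 nFB] : exists2 C, 0 < C & nbhs x [set y | P y = 0 -> `|FB y| <= C * phi y].
  apply: van => //; apply: filterS nphi' => y h Py yq; rewrite FBJ//; apply: (minz y _ h) => //.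
  by have [J1 _ _] := @hJ y Logic.I; apply: J1; exact: dform_cotangent.
have /choice[FZ FZP] : forall i, exists C, 0 <= C /\ nbhs x [set y | N y -> `|Z i y phi| <= C * phi y].
  move=> i; have [F [Fs Fi FE]] := Zh_germ i pf Nx Ux phis phii.
  have [C C0 nC] : exists2 C, 0 < C & nbhs x [set y | P y = 0 -> `|F y| <= C * phi y].
    apply: van => //; apply: filterS3 nphi' FE (open_nbhs_nbhs (conj oU Ux)) => y h E Uy Py yq.
    by rewrite -E//; apply: (minz y _ h) => //; have [+ _] := Zv i; exact.
  exists C; split; first exact: ltW.
  by apply: filterS2 FE nC => y E h Ny; rewrite E// h.
have nFZ : \forall y \near x, forall i, N y -> `|Z i y phi| <= FZ i * phi y.
  by apply: filter_forall => i; have [] := FZP i.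
have [f [fP fU]] := dual_invariants pf Nx Ux.
pose Am y := \matrix_(i, j) Z j y (f i).
have Ac : mcont Am x.
  move=> i j; have -> : (fun y => Am y i j) = (fun y => Z j y (f i)) by apply/funext => y; rewrite mxE.
  apply: snear_cont; apply: (vfield_snear oU (Zv j) Ux); apply: Csm_snear.
  by have [] := fP i.
have [d d0 nd] : exists2 d, 0 < d & \forall y \near x, d <= `|\det (Am y)|.
  apply: nonzero_near; first exact: cont_det.
  by rewrite -unitfE -unitmxE.
have /choice[ba baP] : forall il : 'I_m * 'I_m, exists b, \forall y \near x, `|(\adj (Am y)) il.1 il.2| <= b.
  by move=> il; apply: bounded_near; exact: cont_adj.
have nba : \forall y \near x, forall il : 'I_m * 'I_m, `|(\adj (Am y)) il.1 il.2| <= ba il.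
  by apply: filter_forall.
have /choice[Fl FlP] := fun l => bracket_ext (fP l).1 (fP l).2.
have /choice[bl blP] : forall l, exists b, \forall y \near x, `|Fl l y| <= b.
  move=> l; apply: bounded_near; have [Fs _ _ _] := FlP l.
  by apply: snear_cont; exact: Csm_snear.
have nbl : \forall y \near x, forall l, `|Fl l y| <= bl l by apply: filter_forall.
have [_ hsm _] := hsol.
have /choice[dl dlP] : forall l, exists b, \forall t \near t0, `|derive1 (desc A (f l) \o gam) t| <= b.
  move=> l; apply: bounded_near; have [fs fi] := fP l.
  have := hsm _ (desc_qfun N fs fi) 1 t0 It0.
  by move=> /derivable1_diffP/differentiable_continuous.
have ndl : \forall t \near t0, forall l, `|derive1 (desc A (f l) \o gam) t| <= dl l.
  exact: (@filter_forall _ _ (fun l t => `|derive1 (desc A (f l) \o gam) t| <= dl l) (nbhs t0) _ dlP).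
(* Cramer's rule: [ba] bounds the adjugate, [d] the determinant from below, [dl] the rates of the
   dual invariants along the curve and [bl] their brackets with [H]. *)
pose ce i := \sum_l ba (i, l) * (dl l + bl l) / d.
pose C := CB + \sum_i ce i * FZ i + 1.
have HQ := filterI (filterI (filterI oty nFB) (filterI nFZ nd)) (filterI (filterI nba nbl) (filterI phi0 (open_nbhs_nbhs (conj oU Ux)))).
have FF : Filter (nbhs x) by exact: nbhs_filter.
have HT := near_rep It0 Nx g0 (HQ FF FF FF FF FF FF FF).
have key : \forall t \near t0, exists y, [/\ gam t = gorb y, N y, phi y = 0 -> orbit_type A (stab A x) y, 0 <= phi y &
    `|derive1 (desc A phi \o gam) t| <= C * phi y].
  apply: filterS2 HT ndl => t [It [y [[[[y1 y2] [y3 y4]] [[y5 y6] [y7 Uy]]] Ny gy]]] tl.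
  exists y; split=> //.
  have [e eE] := curve_rate It pf Ny Uy gy.
  have eb i : `|e i| <= ce i.
    pose b : 'cV[R]_m := \col_l (derive1 (desc A (f l) \o gam) t - Fl l y).
    have Aeb : Am y *m (\col_i e i) = b.
      apply/matrixP => l i'; rewrite !mxE (eE (f l) (fP l).1 (fP l).2).
      have [_ _ el _] := FlP l; rewrite el; last exact: Ny.
      rewrite addrC addKr.
      by apply: eq_bigr => j _; rewrite !mxE mulrC.
    have := congr1 (mulmx (\adj (Am y))) Aeb; rewrite mulmxA mul_adj_mx mul_scalar_mx.
    move/(congr1 (fun B : 'cV[R]_m => B i 0)); rewrite 3!mxE => E.
    have dy : \det (Am y) != 0 by rewrite -normr_gt0; exact: lt_le_trans y4.
    have -> : e i = (\sum_l (\adj (Am y)) i l * b l 0) / \det (Am y) by rewrite -E mulrAC divff// mul1r.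
    rewrite normrM normfV ler_pdivrMr ?normr_gt0//; apply: (le_trans (ler_norm_sum _ _ _)).
    rewrite mulr_suml; apply: ler_sum => l _; rewrite normrM [b l 0]mxE.
    have h1 : `|\adj (Am y) i l| * `|(desc A (f l) \o gam)^`()%classic t - Fl l y| <= ba (i, l) * (dl l + bl l).
      apply: ler_pM => //; first exact: (y5 (i, l)).
      by apply: (le_trans (ler_normB _ _)); apply: lerD; [exact: tl|exact: y6].
    apply: (le_trans h1); rewrite -[_ / d * _]mulrA.
    apply: ler_peMr; first by apply: le_trans h1; rewrite mulr_ge0.
    by rewrite mulrC ler_pdivlMr// mul1r.
  rewrite (eE phi)// FBE//; apply: (le_trans (ler_normD _ _)).
  rewrite /C -addrA [X in _ <= X]mulrDl; apply: lerD; first exact: y2.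
  apply: (@le_trans _ _ ((\sum_i ce i * FZ i) * phi y)); last first.
    by apply: ler_wpM2r => //; rewrite lerDl ler01.
  apply: (le_trans (ler_norm_sum _ _ _)); rewrite mulr_suml; apply: ler_sum => i _.
  rewrite normrM -mulrA; apply: ler_pM => //; exact: y3.
have u0 : \forall t \near t0, (desc A phi \o gam) t = 0.
  apply: (@gronwall0 _ _ _ C); last first.
  - apply: filterS2 key HT => t [y [gy Ny _ p0 h]] [It _]; split.
    + by rewrite /= gy descE.
    + exact: (hsm _ (desc_qfun N phis phii) 0 t It).
    + by rewrite /= gy descE.
  - by rewrite /= g0 descE.
  - rewrite /C ltr_wpDl// addr_ge0 ?(ltW CB0)//; apply: sumr_ge0 => i _; apply: mulr_ge0; last by have [] := FZP i.
    rewrite /ce; apply: sumr_ge0 => l _; rewrite divr_ge0 ?(ltW d0)// mulr_ge0//.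
      by apply: le_trans (normr_ge0 _) (nbhs_singleton nba (i, l)).
    by rewrite addr_ge0//; [exact: le_trans (normr_ge0 _) (nbhs_singleton ndl l)|exact: le_trans (normr_ge0 _) (nbhs_singleton nbl l)].
apply: filterS2 key u0 => t [y [gy Ny h _ _]] /=; rewrite gy descE// => /h oy.
by exists y.
Qed.

Lemma piece_preserved K : is_interval I -> I 0 -> carrier (f := Qpiece A P K) (gam 0) ->
  forall t, I t -> carrier (f := Qpiece A P K) (gam t).
Proof.
move=> iI I00 c0; have [[hcar _] _ _] := hsol.
pose T := [set t | carrier (f := Qpiece A P K) (gam t)].
have loc t0 : I t0 -> \forall t \near t0, I t /\ (carrier (f := Qpiece A P K) (gam t) <-> carrier (f := Qpiece A P K) (gam t0)).
  move=> It0; have [x0 Nx0 g0] := hcar t0 It0.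
  apply: filterS2 (orbit_type_near It0 Nx0 (esym g0)) (open_nbhs_nbhs (conj oI It0)) => t [y [Ny sy] gy] It.
  split=> //; rewrite -gy -g0; split=> /carrier_piece[_ h]; apply/carrier_piece; split=> //.
    exact: orbit_type_trans h (orbit_type_sym sy (piece_stab Nx0).2).
  exact: orbit_type_trans h sy.
have /connected_intervalP cI := iI.
have TI : I `&` T = I.
  apply: cI; first by exists 0.
  - exists [set t | I t /\ T t].
      rewrite openE => t [It Tt]; rewrite /interior; apply: filterS (loc t It) => s [Is [_ h]].
      by split=> //; exact: h.
    by apply/seteqP; split=> t [? ?] //; case: H1.
  - exists (~` [set t | I t /\ ~ T t]).
      rewrite closedC openE => t [It Tt]; rewrite /interior; apply: filterS (loc t It) => s [Is [h _]].
      by split=> // /h.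
    apply/seteqP; split=> t [It h]; split=> //; first by move=> [].
    by apply: contrapT => nT; apply: h.
by move=> t It; have [] : (I `&` T) t by rewrite TI.
Qed.

(** * Restriction of a solution to its piece *)

Section Solution.
Variable K : set G.
Hypotheses (cK : compact_subgroup K) (gK : forall t, I t -> carrier (f := Qpiece A P K) (gam t)).
Local Notation S := (piece A P K).
Local Notation Q := (Qpiece A P K).

Lemma qsm_local V f : (forall x, S x -> V (gorb x) -> exists V' g,
    [/\ fopen (f := Q) V', V' (gorb x), fsmooth (f := Q) V' g &
      forall y, S y -> V (gorb y) -> V' (gorb y) -> f (gorb y) = g (gorb y)]) -> fsmooth (f := Q) V f.
Proof.
move=> h; apply/qsmP => x Sx Vx; have [V' [g [oV' Vx' /qsmP gs E]]] := h x Sx Vx.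
have [F [Fs nF]] := gs x Sx Vx'; exists F; split=> //.
by apply: filterS2 nF (qopen_near oV' Sx Vx') => y e1 e2 Sy Vy; rewrite E ?e1//; exact: e2.
Qed.

Lemma curve_near t x f F : I t -> S x -> gam t = gorb x -> inv_germ A S setT f x F ->
  {near t, f \o gam =1 desc A F \o gam}.
Proof.
move=> It Sx gx [Fs Fi nF]; have := near_rep It (piece_N Sx) gx nF.
apply: filterS => s [Is [y [Ey Ny gy]]]; rewrite /= gy descE// Ey//.
by apply/carrier_piece; rewrite -gy; exact: gK.
Qed.

Lemma curve_piece_continuous : fcontinuous_curve (X := Q) I gam.
Proof.
split=> // V oV; rewrite openE => t [It Vt]; rewrite /interior.
have [x Sx gx] := gK It; have Vx : V (gorb x) by rewrite gx.
apply: filterS (near_rep It (piece_N Sx) (esym gx) (qopen_near oV Sx Vx)) => s [Is [y [Ey Ny gy]]].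
by split=> //; rewrite /preimage/= gy; apply: Ey; apply/carrier_piece; rewrite -gy; exact: gK.
Qed.

Lemma curve_piece_smooth V f : fopen (f := Q) V -> fsmooth (f := Q) V f ->
  Cinf1 (I `&` gam @^-1` V) (f \o gam).
Proof.
move=> oV fV m t [It Vt]; have [x Sx gx] := gK It; have Vx : V (gorb x) by rewrite gx.
have [F FP] := qsm_inv_germ (@piece_inv K) hproper oV fV Sx Vx; have [Fs Fi nF] := FP.
have [_ h _] := hsol; have := h _ (desc_qfun N Fs Fi) => hF.
apply: (Cinf1_near (I := I) (g := desc A F \o gam) (I' := [set t])) => // s ->.
by split=> //; exact: (curve_near It Sx (esym gx) FP).
Qed.

Lemma smooth_at_qfun p f x : gorb x = p -> S x -> smooth_at (X := Q) p f -> exists F, inv_germ A S setT f x F.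
Proof.
move=> <- Sx [V [oV Vx fV]]; exact: (qsm_inv_germ (@piece_inv K) hproper oV fV Sx Vx).
Qed.

Lemma tangent_desc x v f F : S x -> tangent (X := Q) (gorb x) v -> smooth_at (X := Q) (gorb x) f ->
  inv_germ A S setT f x F -> v f = v (desc A F).
Proof.
move=> Sx [_ _ v3 _] fs [Fs Fi]; rewrite nbhsE => -[W [oW Wx] hW]; apply: v3 => //.
exists (gorb @` (S `&` W)); split; [exact: qopen_image (@piece_inv K) oW|by exists x|].
by move=> _ _ [y [Sy Wy] <-]; rewrite descE// hW.
Qed.

Lemma JK_dform g h q : qfun A S g -> qfun A S h -> carrier (f := Q) q ->
  JK K q (dform (X := Q) h q) g = BK K g h q.
Proof.
move=> qg qh cq; have [_ hb _ _] := hKred cK; have [J1 _ J3] := hb q cq.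
by rewrite -J3 ?dformE//; [apply: J1; exact: dform_cotangent|exact: qfun_qsm..].
Qed.

Lemma BK_smooth V g h : qfun A S g -> qfun A S h -> fsmooth (f := Q) V (BK K g h).
Proof.
move=> qg qh; have [[[h1 _ _ _ _] _] _ _ _] := hKred cK.
by apply: (@qsm_sub _ _ _ _ _ _ _ setT) => //; apply: h1; exact: qfun_qsm.
Qed.

Lemma curve_dirac t : I t ->
  dirac_sections (X := Q) (JK K) (DK K) (gam t) (velocity (X := Q) gam t, dform (X := Q) (HK K) (gam t)).
Proof.
move=> It; have [U [m [Zf [Zh [x [pf Nx Ux gx]]]]]] := curve_frame It.
have Sx : S x by apply/carrier_piece; rewrite -gx; exact: gK.
have [_ hb hZ _] := hKred cK; have [Zb [Zbv Zbp Zbd]] := hZ U m Zf Zh pf.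
have [oU _ _ _ _] := pf; have [_ _ qH _] := hsing; have qHS := qfun_sub (@piece_N K) qH.
pose V := gorb @` (S `&` U).
have oV : fopen (f := Q) V by exact: qopen_image (@piece_inv K) oU.
have Vx : V (gorb x) by exists x.
have [f [fP fU]] := dual_invariants pf Nx Ux.
pose fq i := desc A (f i).
have qf i : qfun A S (fq i) by have [fs fi] := fP i; exact: desc_qfun.
pose Aq q := \matrix_(i, j) Zb j q (fq i).
have Ax : Aq (gorb x) = \matrix_(i, j) Zf j x (f i).
  apply/matrixP => i j; rewrite !mxE (frame_proj_ext j Zbp Sx Ux (F := f i))//.
  by have [fs fi] := fP i; exact: desc_extends.
have dx : \det (Aq (gorb x)) != 0 by rewrite Ax -unitfE -unitmxE.
have Zbs V' g j : fopen (f := Q) V' -> V' `<=` V -> qfun A S g -> fsmooth (f := Q) V' (fun q => Zb j q g).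
  by move=> oV' sV qg; have [_ h] := Zbv j; apply: h => //; exact: qfun_qsm.
have tZb j q : carrier (f := Q) q -> V q -> tangent (X := Q) q (Zb j q) by have [h _] := Zbv j; exact: h.
(* The condition on [H0] concerns globally defined derivations in [Delta_hat]; the local [Zh j] is
   reached through one that equals a nonzero multiple of it at [gorb x]. *)
have hHx j : Zb j (gorb x) H0 = 0.
  have [_ _ [D _ /(_ t It)[_ [E hE _] h3]]] := hsol.
  have [|E' [r [hE' r0 Er]]] := Delta_hat_frame j pf Nx Ux; first by exists E.
  rewrite (frame_projE j pf Zbp Sx Ux qH); apply: (mulfI r0).
  by rewrite -Er// mulr0 -gx h3.
have [e eE] := curve_rate It pf Nx Ux gx.
pose hr q := \row_j Zb j q H0.
pose bt q i := (hr q *m \adj (Aq q)) 0 i.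
(* The corrected form is Cramer's solution multiplied by the determinant, so that no inverse depends
   on [q]. The constant [c] normalizes it to the differential of [H0] at [gorb x], where [bt]
   vanishes. *)
pose c := (\det (Aq (gorb x)))^-1.
pose a q : covec Q := (c * \det (Aq q)) *: dform (X := Q) H0 q + \sum_i (- c * bt q i) *: dform (X := Q) (fq i) q.
have aE q v : tangent (X := Q) q v -> a q v = c * \det (Aq q) * v H0 + \sum_i (- c * bt q i) * v (fq i).
  move=> tv; have -> : a q v = c * \det (Aq q) * dform (X := Q) H0 q v + (\sum_i (- c * bt q i) *: dform (X := Q) (fq i) q : covec Q) v by [].
  by rewrite covec_sumE dformE//; congr (_ + _); apply: eq_bigr => i _; rewrite dformE.
have aco q : cotangent (X := Q) q (a q).
  by apply: cotangent_lin; [exact: dform_cotangent|apply: cotangent_sum => i; exact: dform_cotangent].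
have dets V' : fopen (f := Q) V' -> V' `<=` V -> fsmooth (f := Q) V' (fun q => c * \det (Aq q)).
  move=> oV' sV; apply: qsmM; first exact: qsm_cst.
  by apply: qsm_det => i j; under eq_fun do rewrite mxE; exact: Zbs.
have bts V' i : fopen (f := Q) V' -> V' `<=` V -> fsmooth (f := Q) V' (fun q => - c * bt q i).
  move=> oV' sV; apply: qsmM; first exact: qsm_cst.
  rewrite /bt; under eq_fun do rewrite mxE; apply: qsm_sum => j; apply: qsmM.
    by under eq_fun do rewrite mxE; exact: Zbs.
  by apply: qsm_adj => i' j'; under eq_fun do rewrite mxE; exact: Zbs.
have JE q g : carrier (f := Q) q -> qfun A S g ->
    JK K q (a q) g = c * \det (Aq q) * BK K g H0 q + \sum_i (- c * bt q i) * BK K g (fq i) q.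
  move=> cq qg; have [_ Jl _] := hb q cq.
  rewrite /a Jl; [|exact: dform_cotangent|by apply: cotangent_sum => i; exact: dform_cotangent].
  rewrite (bundle_map_sum _ _ hb cq); last by move=> i; exact: dform_cotangent.
  have -> : ((c * \det (Aq q)) *: JK K q (dform (X := Q) H0 q) + \sum_i (- c * bt q i) *: JK K q (dform (X := Q) (fq i) q) : vec Q) g =
    c * \det (Aq q) * JK K q (dform (X := Q) H0 q) g + (\sum_i (- c * bt q i) *: JK K q (dform (X := Q) (fq i) q) : vec Q) g by [].
  by rewrite vec_sumE JK_dform//; congr (_ + _); apply: eq_bigr => i _; rewrite JK_dform.
(* The coefficients [e] of the velocity at time [t] are kept constant: the section has to take the
   prescribed value at [gam t] only. *)
pose Z q : vec Q := 1 *: JK K q (a q) + \sum_j e j *: Zb j q.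
have ZE q g : Z q g = JK K q (a q) g + \sum_j e j * Zb j q g.
  have -> : Z q g = 1 * JK K q (a q) g + (\sum_j e j *: Zb j q : vec Q) g by [].
  by rewrite vec_sumE mul1r.
have tZ q : carrier (f := Q) q -> V q -> tangent (X := Q) q (Z q).
  move=> cq Vq; have [J1 _ _] := hb q cq; apply: tangent_lin; first exact: J1.
  by apply: tangent_sum => j; exact: tZb.
have ax : a (gorb x) = dform (X := Q) H0 (gorb x).
  rewrite /a mulVf// scale1r big1 ?addr0// => i _.
  have h0 : hr (gorb x) = 0 by apply/matrixP => u v; rewrite [LHS]mxE hHx mxE.
  by rewrite /bt h0 mul0mx mxE mulr0 scale0r.
exists V, Z, a; split=> //.
- by rewrite gx.
(* [g] is smooth over [V'] only; near each point it is replaced by the function induced by an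
   invariant extension, to which the formula for brackets applies. *)
- split=> // V' g oV' sV gs; apply: qsm_local => y Sy Vy.
  have [F [Fs Fi nF]] := qsm_inv_germ (@piece_inv K) hproper oV' gs Sy Vy.
  move: nF; rewrite nbhsE => -[W [oW Wy] hW].
  have oW' : fopen (f := Q) (gorb @` (S `&` W)) by exact: qopen_image (@piece_inv K) oW.
  pose V2 := V' `&` (gorb @` (S `&` W)).
  have oV2 : fopen (f := Q) V2 by exact: qopenI.
  have qF : qfun A S (desc A F) by exact: desc_qfun.
  have sV2 : V2 `<=` V by move=> q [/sV].
  exists V2, (fun q => (c * \det (Aq q) * BK K (desc A F) H0 q + \sum_i (- c * bt q i) * BK K (desc A F) (fq i) q)
     + \sum_j e j * Zb j q (desc A F)); split=> //.
  + by split=> //; exists y.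
  + apply: qsmD; first apply: qsmD.
    * by apply: qsmM; [exact: dets|exact: BK_smooth].
    * by apply: qsm_sum => i; apply: qsmM; [exact: bts|exact: BK_smooth].
    * by apply: qsm_sum => j; apply: qsmM; [exact: qsm_cst|exact: Zbs].
  + move=> z Sz Vz [_ [z' [Sz' Wz'] zz']]; have cz : carrier (f := Q) (gorb z) by exists z.
    have [_ _ t3 _] := tZ _ cz (sV _ Vz).
    rewrite (t3 _ (desc A F)); last 2 first.
    * by exists V'.
    * by exists (gorb @` (S `&` W)); split=> //; [exists z'|move=> _ _ [u [Su Wu] <-]; rewrite descE// hW].
    by rewrite ZE JE.
- split=> // V' W oV' sV hW; apply: qsm_local => y Sy Vy.
  exists V', (fun q => c * \det (Aq q) * W q H0 + \sum_i (- c * bt q i) * W q (fq i)); split=> //.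
  + have [_ hs] := hW; apply: qsmD.
      by apply: qsmM; [exact: dets|apply: hs => //; exact: qfun_qsm].
    by apply: qsm_sum => i; apply: qsmM; [exact: bts|apply: hs => //; exact: qfun_qsm].
  + move=> z Sz Vz _; apply: aE; have [h _] := hW; apply: h => //; by exists z.
- split=> [q cq Vq|]; first split.
  + apply/(Zbd q Vq); exists e; rewrite /Z scale1r addrC addrA [- _ + _]addrC subrr add0r//.
  + move=> w /(Zbd q Vq)[d wd].
    have tw : tangent (X := Q) q w by rewrite wd; apply: tangent_sum => j; exact: tZb.
    rewrite aE//; pose dc : 'cV[R]_m := \col_j d j.
    have wH : w H0 = (hr q *m dc) 0 0.
      by rewrite wd vec_sumE mxE; apply: eq_bigr => j _; rewrite !mxE mulrC.
    have wf i : w (fq i) = (Aq q *m dc) i 0.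
      by rewrite wd vec_sumE mxE; apply: eq_bigr => j _; rewrite !mxE mulrC.
    have -> : \sum_i - c * bt q i * w (fq i) = - c * (hr q *m \adj (Aq q) *m (Aq q *m dc)) 0 0.
      by rewrite mxE mulr_sumr; apply: eq_bigr => i _; rewrite wf mulrA.
    (* The adjugate identity makes the correction cancel the differential of [H0] on every
       combination of the projected fields. *)
    have -> : hr q *m \adj (Aq q) *m (Aq q *m dc) = \det (Aq q) *: (hr q *m dc).
      by rewrite -mulmxA [\adj _ *m _]mulmxA mul_adj_mx mul_scalar_mx scalemxAr.
    by rewrite [X in _ + _ * X]mxE wH; ring.
  + congr (_, _).
    (* Both functionals are evaluated on an invariant extension of the germ of [g], where
       [curve_rate] applies. *)
    * apply/funext => g; rewrite /velocity gx.
      have cx : carrier (f := Q) (gorb x) by exists x.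
      have tx := tZ _ cx Vx.
      case: asboolP => [sg|ng]; last by have [_ _ _ ->] := tx.
      have [F FP] := smooth_at_qfun erefl Sx sg; have [Fs Fi nF] := FP.
      rewrite (tangent_desc Sx tx sg FP).
      have [_ ->] := derive1_near (curve_near It Sx gx FP).
      have qF : qfun A S (desc A F) by exact: desc_qfun.
      rewrite eE// ZE ax JK_dform// bracket_restricts//; last exact: desc_qfun.
      congr (_ + _); apply: eq_bigr => j _; congr (_ * _).
      by rewrite (frame_proj_ext j Zbp Sx Ux (F := F))//; exact: desc_extends.
    * rewrite gx ax; apply/funext => v; rewrite /dform; case: asboolP => // -[_ _ v3 _].
      apply/esym/v3; first exact: qfun_smooth_at.
      exists setT; split=> [|//|q cq _]; first exact: qopenT.
      by rewrite (hamiltonian_restricts cK).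
Qed.

End Solution.

End Curve.

End Reduced.

Unset Implicit Arguments.
Set Strict Implicit.
Set Printing Implicit Defensive.

Theorem proposition29 (R : realType) (k n : nat) (G : lieGroup R k)
  (M : manifold R n) (A : lieAction G M)
  (br : (M -> R) -> (M -> R) -> M -> R)
  (J : M -> covec (mspace M) -> vec (mspace M))
  (om : M -> vec (mspace M) -> vec (mspace M) -> R)
  (Delta : M -> set (vec (mspace M)))
  (H : M -> R) (P : M -> covec (mspace G))
  (* the bracket, its bundle map and the two-form *)
  (hbr : gen_poisson (X := mspace M) br)
  (hJ : bundle_map (X := mspace M) br J)
  (hom2 : twoform (X := mspace M) om)
  (homnd : nondeg_form (X := mspace M) om)
  (hJom : forall x a w, cotangent (X := mspace M) x a ->
     tangent (X := mspace M) x w -> om x (J x a) w = a w)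
  (hDelta : subbundle (X := mspace M) Delta)
  (hH : Csm (X := mspace M) H)
  (* the symmetry group *)
  (hproper : proper_action A)
  (hHinv : ginvariant A H)
  (hJinv : forall xi, lie_alg G xi ->
     lie_bundle_map_eq0 (X := mspace M) (infgen A xi) J)
  (hDinv : forall xi (U : set M) Z, lie_alg G xi -> open U ->
     vfield (X := mspace M) U Z -> (forall x, U x -> Delta x (Z x)) ->
     forall x, U x -> Delta x (lie (X := mspace M) (infgen A xi) Z x))
  (* the momentum map *)
  (hP : equivariant_map A P)
  (hPom : forall xi x w, lie_alg G xi -> tangent (X := mspace M) x w ->
     dform (X := mspace M) (fun y => P y xi) x w
     = om x (infgen A xi x) w)
  (hPDelta : forall xi x, lie_alg G xi ->
     annihilator (X := mspace M) (Delta x)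
       (dform (X := mspace M) (fun y => P y xi) x))
  (* the regularity assumptions *)
  (hDV : forall x v, Delta x v -> orbit_dir A x v -> v = 0)
  (hDVsub : subbundle (X := mspace M)
     (vsum (X := mspace M) (orbit_dir A) Delta))
  (hreg : forall K, compact_subgroup K ->
     regular_conditions A J Delta (piece A P K))
  (* the singular reduced system *)
  (B0 : (set M -> R) -> (set M -> R) -> set M -> R) (H0 : set M -> R)
  (hsing : singular_reduced A br H P B0 H0)
  (* the regular reduced systems *)
  (BK : set G -> (set M -> R) -> (set M -> R) -> set M -> R)
  (JK : forall K : set G,
     set M -> covec (Qpiece A P K) -> vec (Qpiece A P K))
  (DK : forall K : set G, set M -> set (vec (Qpiece A P K)))
  (HK : set G -> set M -> R)
  (hKred : forall K, compact_subgroup K ->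
     regular_reduced br Delta H (BK K) (JK K) (DK K) (HK K)) :
  forall K, compact_subgroup K ->
  (* (1) *)
  ([/\ forall f0 h0, qfun A (zero_level P) f0 -> qfun A (zero_level P) h0 ->
         forall p, carrier (f := Qpiece A P K) p ->
         BK K f0 h0 p = B0 f0 h0 p,
       Delta_hat_restricts Delta (DK K) &
       forall p, carrier (f := Qpiece A P K) p -> HK K p = H0 p]) /\
  (* (2) *)
  (forall (I : set R) (gam : R -> set M),
     open I -> is_interval I -> I 0 ->
     singular_solution A Delta P B0 H0 I gam ->
     carrier (f := Qpiece A P K) (gam 0) ->
     (forall t, I t -> carrier (f := Qpiece A P K) (gam t)) /\
     solution (X := Qpiece A P K)
       (dirac_sections (X := Qpiece A P K) (JK K) (DK K)) (HK K) I gam).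
Proof.
move=> K cK; split.
  split; [|exact: Delta_hat_restrictsP hKred _ cK|].
  - by move=> f0 h0 qf qh p cp; exact: (bracket_restricts hsing hKred cK qf qh cp).
  - by move=> p cp; exact: (hamiltonian_restricts hsing hKred cK cp).
move=> I gam oI iI I00 hsol c0.
have gK := piece_preserved hom2 homnd hproper hP hPom hDV hsing hKred hJ hH hHinv oI hsol iI I00 c0.
split=> //; split.
- exact: (curve_piece_continuous hP hsol gK).
- move=> V f; exact: (curve_piece_smooth hproper hP hsol gK).
- move=> t; exact: (curve_dirac hom2 homnd hproper hP hPom hDV hsing hKred hsol cK gK).
Qed.
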